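(* (Weak Pontryagin Maximum Principle) Assume there exists $N\in\mathbb N$ such that $L_K\cdot(t_2-t_1)\le N\log(d\rho^{-1})$, where $d\rho:=[\rho_\varepsilon]$. If $v\in\mathring{\mathcal A}$ solves the optimal control problem, i.e. there exist $r'\in\widetilde{\mathbb R}_{>0}$ and $n\in\mathbb N$ such that $I[v]\le I[u]$ for all $u\in\mathcal A$ with $\|u-v\|_n<r'$, then $(q^v,v,p^v)$ is a solution $(q,v,p)$ on $[t_1,t_2]$ of the system $$\text{(WPS)}\qquad\begin{cases}\dot q=\dfrac{\partial\mathcal H}{\partial p}(t,q,v,p)\\[4pt]\dot p=-\dfrac{\partial\mathcal H}{\partial q}(t,q,v,p)\\[4pt]\dfrac{\partial\mathcal H}{\partial u}(t,q,v,p)=0\\[4pt](q(t_1),p(t_2))=(q_1,0).\end{cases}$$ Moreover, if $q\in\mathcal Q$, $u\in\mathcal A$, $p\in\mathcal{GC}^\infty([t_1,t_2],\widetilde{\mathbb R}^d)$ are such that $(q,u,p)$ solves (WPS) (with $u$ in place of $v$), then necessarily $(q,p)=(q^u,p^u)$.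
   Context: Ring of scalars. Fix a net $\rho=(\rho_\varepsilon)_{\varepsilon\in(0,1]}$ in $(0,1]$ with $\rho_\varepsilon\to0$ as $\varepsilon\to0^+$. ''For $\varepsilon$ small'' means: for all $\varepsilon\in(0,\varepsilon_0]$, for some $\varepsilon_0\in(0,1]$. A net $(x_\varepsilon)\in\mathbb R^{(0,1]}$ is moderate if there is $N\in\mathbb N$ with $|x_\varepsilon|\le\rho_\varepsilon^{-N}$ for $\varepsilon$ small; $(x_\varepsilon)\sim(y_\varepsilon)$ if for all $n\in\mathbb N$, $|x_\varepsilon-y_\varepsilon|\le\rho_\varepsilon^n$ for $\varepsilon$ small. $\widetilde{\mathbb R}$ is the ring of moderate nets modulo $\sim$ with pointwise operations; classes are written $[x_\varepsilon]$, similarly for $\widetilde{\mathbb R}^n$. Order: $x\le y$ iff there are representatives $x=[x_\varepsilon]$, $y=[y_\varepsilon]$ with $x_\varepsilon\le y_\varepsilon$ for all $\varepsilon$; $x<y$ means $x\le y$ and $y-x$ is invertible; $\widetilde{\mathbb R}_{>0}=\{x: x>0\}$. $[a,b]=\{x\in\widetilde{\mathbb R}: a\le x\le b\}$, $(a,b)=\{x: a<x<b\}$, $|[x_\varepsilon]|=[|x_\varepsilon|]$, $B_r(c)=\{x\in\widetilde{\mathbb R}^n:|x-c|<r\}$ for $r\in\widetilde{\mathbb R}_{>0}$, with closure $\overline{B_r(c)}=\{x:|x-c|\le r\}$. The sharp topology on $\widetilde{\mathbb R}^n$ has these balls as a base; all topological notions refer to it. Functions of generalized numbers such as $\log(d\rho^{-1})=[\log(\rho_\varepsilon^{-1})]$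 are defined $\varepsilon$-wise. Generalized smooth functions (GSF). For $\Omega_\varepsilon\subseteq\mathbb R^n$, $\langle\Omega_\varepsilon\rangle$ is the set of $[x_\varepsilon]\in\widetilde{\mathbb R}^n$ such that for every representative $(x'_\varepsilon)$ one has $x'_\varepsilon\in\Omega_\varepsilon$ for $\varepsilon$ small. For $X\subseteq\widetilde{\mathbb R}^n$, $Y\subseteq\widetilde{\mathbb R}^k$, a map $f:X\to Y$ is a GSF, $f\in\mathcal{GC}^\infty(X,Y)$, if there is a net $f_\varepsilon\in C^\infty(\Omega_\varepsilon,\mathbb R^k)$, $\Omega_\varepsilon\subseteq\mathbb R^n$ open, with $X\subseteq\langle\Omega_\varepsilon\rangle$, $f([x_\varepsilon])=[f_\varepsilon(x_\varepsilon)]\in Y$ and $(\partial^\alpha f_\varepsilon(x_\varepsilon))$ moderate for all $[x_\varepsilon]\in X$ and all multi-indices $\alpha$ (one may always choose $\Omega_\varepsilon=\mathbb R^n$). Derivatives at sharply interior points are $\partial^\alpha f([x_\varepsilon])=[\partial^\alpha f_\varepsilon(x_\varepsilon)]$ (independent of choices), and at boundary points of a set which is the closure of its interior they are the sharp limits from interior points. $\int_c^e f=[\int_{c_\varepsilon}^{e_\varepsilon}f_\varepsilon]$ for $f\in\mathcal{GC}^\infty([a,b],\widetilde{\mathbb R})$, $c,e\in[a,b]$. Functionally compact sets and norms. $K\subseteq\widetilde{\mathbb R}^n$ is functionally compact if $K=[K_\varepsilon]:=\{[x_\varepsilon]: x_\varepsilon\in K_\varepsilon\text{ for }\varepsilon\text{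 small}\}$ for compact sets $K_\varepsilon\subseteq\mathbb R^n$ and $K\subseteq B_R(0)$ for some $R\in\widetilde{\mathbb R}_{>0}$; it is solid if it is the closure of its sharp interior. $[t_1,t_2]$ with $t_1<t_2$ is solid functionally compact. Continuous generalized functions attain maxima on nonempty functionally compact sets. For $v\in\mathcal{GC}^\infty([t_1,t_2],\widetilde{\mathbb R}^k)$ defined by $(v_\varepsilon)$ and $n\in\mathbb N$: $\|v\|_n=[\max_{j\le n,\,1\le i\le k}\max_{t\in[t_{1\varepsilon},t_{2\varepsilon}]}|(v^i_\varepsilon)^{(j)}(t)|]$. Control setting (standing assumptions). $t_1<t_2$ in $\widetilde{\mathbb R}$; $H\subseteq\widetilde{\mathbb R}^d$, $K\subseteq\widetilde{\mathbb R}^l$ solid functionally compact; $L\in\mathcal{GC}^\infty([t_1,t_2]\times H\times K,\widetilde{\mathbb R})$, $\varphi\in\mathcal{GC}^\infty([t_1,t_2]\times H\times K,\widetilde{\mathbb R}^d)$; $q_1\in\widetilde{\mathbb R}^d$, $r\in\widetilde{\mathbb R}_{>0}$ with $\overline{B_r(q_1)}\subseteq H$. $M_K:=\max|\varphi(t,q,k)|$ and $L_K:=\max|\partial_q\varphi(t,q,k)|$ (operator norm), both over $t_1\le t\le t_2$, $|q-q_1|\le r$, $k\in K$. It is assumed that $(t_2-t_1)M_K\le r$ and $\lim_{n\to+\infty}(t_2-t_1)^nL_K^n=0$ in the sharp topology. $\mathcal Q:=\{q\in\mathcal{GC}^\infty([t_1,t_2],H):\|q-q_1\|_0\le r\}$,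 $\mathcal A:=\mathcal{GC}^\infty([t_1,t_2],K)$. Under these assumptions, for each $u\in\mathcal A$ there is a unique $q^u\in\mathcal Q$ with $\dot q^u(t)=\varphi(t,q^u(t),u(t))$ for all $t\in[t_1,t_2]$ and $q^u(t_1)=q_1$. Set $I[u]:=\int_{t_1}^{t_2}L(t,q^u(t),u(t))\,dt$. $\mathring{\mathcal A}$ is the set of $u\in\mathcal A$ for which there is $r'\in\widetilde{\mathbb R}_{>0}$ such that every $v\in\mathcal{GC}^\infty([t_1,t_2],\widetilde{\mathbb R}^l)$ with $\max_{t_1\le t\le t_2}|v(t)-u(t)|<r'$ lies in $\mathcal A$. Hamiltonian: $\mathcal H:[t_1,t_2]\times H\times K\times\widetilde{\mathbb R}^d\to\widetilde{\mathbb R}$, $\mathcal H(t,q,u,p)=L(t,q,u)+p\cdot\varphi(t,q,u)$. For $u\in\mathcal A$, $p^u\in\mathcal{GC}^\infty([t_1,t_2],\widetilde{\mathbb R}^d)$ is the unique GSF solution of $\dot p^u=-\frac{\partial\mathcal H}{\partial q}(t,q^u,u,p^u)=-\frac{\partial L}{\partial q}(t,q^u,u)-\left(\frac{\partial\varphi}{\partial q}(t,q^u,u)\right)^{\mathrm T}p^u$, $p^u(t_2)=0$. *)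

(* Defs.v *)
From HB Require Import structures.
From mathcomp Require Import all_boot all_order all_algebra.
From mathcomp Require Import generic_quotient ring_quotient.
From mathcomp Require Import all_classical all_reals all_analysis.
Set Implicit Arguments.
Unset Strict Implicit.
Unset Printing Implicit Defensive.
Import Order.TTheory GRing.Theory Num.Theory.
Import numFieldNormedType.Exports.
Local Open Scope classical_set_scope.
Local Open Scope ring_scope.
Local Open Scope quotient_scope.

(* Nets are functions R -> R of which only the values on (0,1] are used;
   "for e small" is "\forall e \near 0^'+". *)
Record gauge (R : realType) := Gauge {
  gauge_fun :> R -> R;
  gauge_itv : forall e, 0 < e <= 1 -> 0 < gauge_fun e <= 1;
  gauge_cvg : gauge_fun e @[e --> 0^'+] --> (0 : R) }.

Lemma gauge_near (R : realType) (rho : gauge R) :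
  \forall e \near (0 : R)^'+, 0 < rho e <= 1.
Proof.
near=> e; apply: gauge_itv; apply/andP; split; first by [].
by near: e; apply: nbhs_right_le.
Unshelve. all: by end_near. Qed.

Lemma gauge_small (R : realType) (rho : gauge R) (c : R) : 0 < c ->
  \forall e \near (0 : R)^'+, rho e < c.
Proof.
by move=> c0; have := @gauge_cvg _ rho; move/cvgr_lt; apply.
Qed.

Definition moderate (R : realType) (rho : gauge R) : {pred R -> R} :=
  fun x => `[< exists N : nat, \forall e \near (0 : R)^'+, `|x e| <= rho e ^- N >].

Lemma moderate_subring (R : realType) (rho : gauge R) :
  subring_closed (moderate rho).
Proof.
have mono e (a b : nat) : 0 < rho e <= 1 -> (a <= b)%N -> rho e ^- a <= rho e ^- b.
  move=> /andP[r0 r1] ab.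
  by rewrite lef_pV2 ?posrE ?exprn_gt0// ler_wiXn2l// ltW.
split.
- apply/asboolP; exists 0%N; near=> e.
  by rewrite expr0 invr1 normr1.
- move=> x y /asboolP[a xa] /asboolP[b yb]; apply/asboolP.
  exists (maxn a b).+1; near=> e.
  have r01 : 0 < rho e <= 1 by near: e; apply: gauge_near.
  have r2 : rho e < 2^-1 by near: e; apply: gauge_small; rewrite invr_gt0.
  have hx : `|x e| <= rho e ^- maxn a b.
    apply: (@le_trans _ _ (rho e ^- a)); first by near: e.
    by apply: mono => //; rewrite leq_maxl.
  have hy : `|y e| <= rho e ^- maxn a b.
    apply: (@le_trans _ _ (rho e ^- b)); first by near: e.
    by apply: mono => //; rewrite leq_maxr.
  have /andP[r0 _] := r01.
  apply: (le_trans (ler_normB _ _)); apply: (le_trans (lerD hx hy)).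
  rewrite exprS invfM -mulr2n -[leLHS]mulr_natl ler_wpM2r//.
    by rewrite invr_ge0 exprn_ge0// ltW.
  by rewrite -[leLHS]invrK lef_pV2 ?posrE ?invr_gt0// ltW.
- move=> x y /asboolP[a xa] /asboolP[b yb]; apply/asboolP.
  exists (a + b)%N; near=> e.
  rewrite exprD invfM normrM ler_pM//; first by near: e.
  by near: e.
Unshelve. all: by end_near. Qed.

HB.instance Definition _ (R : realType) (rho : gauge R) :=
  GRing.isSubringClosed.Build (R -> R) (moderate rho) (moderate_subring rho).

Record mnet (R : realType) (rho : gauge R) :=
  MNet { mnet_val :> R -> R; _ : mnet_val \in moderate rho }.
HB.instance Definition _ (R : realType) (rho : gauge R) :=
  [isSub for @mnet_val R rho].
HB.instance Definition _ (R : realType) (rho : gauge R) :=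
  [Choice of mnet rho by <:].
HB.instance Definition _ (R : realType) (rho : gauge R) :=
  [SubChoice_isSubComNzRing of mnet rho by <:].

Definition negligible (R : realType) (rho : gauge R) : {pred mnet rho} :=
  fun x => `[< forall n : nat, \forall e \near (0 : R)^'+, `|x e| <= rho e ^+ n >].

Lemma negligible_ideal (R : realType) (rho : gauge R) :
  idealr_closed (@negligible R rho).
Proof.
split.
- apply/asboolP => n; near=> e.
  have /andP[r0 _] : 0 < rho e <= 1 by near: e; apply: gauge_near.
  by rewrite /= normr0 exprn_ge0// ltW.
- apply/negP => /asboolP/(_ 1%N) h.
  suff : \forall e \near (0 : R)^'+, False by move/filter_ex => -[].
  near=> e.
  have : (1 : R) <= rho e by rewrite -[leLHS]normr1 -[rho e]expr1; near: e.
  by apply/negP; rewrite -ltNge; near: e; apply: gauge_small.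
- move=> a x y /asboolP hx /asboolP hy; apply/asboolP => n.
  have /asboolP[N aN] := valP a.
  near=> e.
  have r01 : 0 < rho e <= 1 by near: e; apply: gauge_near.
  have /andP[r0 r1] := r01.
  have r2 : rho e < 2^-1 by near: e; apply: gauge_small; rewrite invr_gt0.
  have ha : `|a e| <= rho e ^- N by near: e.
  have hxe : `|x e| <= rho e ^+ (N + n.+1) by near: e; apply: hx.
  have hye : `|y e| <= rho e ^+ n.+1 by near: e; apply: hy.
  have hax : `|a e * x e| <= rho e ^+ n.+1.
    rewrite normrM; apply: (le_trans (ler_pM _ _ ha hxe)) => //.
    by rewrite exprD mulKf// expf_neq0// gt_eqF.
  apply: (le_trans (ler_normD _ _)); apply: (le_trans (lerD hax hye)).
  rewrite exprS -mulr2n -[leLHS]mulr_natl mulrA ler_piMl ?exprn_ge0 ?ltW//.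
  by rewrite -[ltRHS](@divff _ 2)// ltr_pM2l.
Unshelve. all: by end_near. Qed.

HB.instance Definition _ (R : realType) (rho : gauge R) :=
  isIdealr.Build (mnet rho) (@negligible R rho) (negligible_ideal rho).

Definition rcnum (R : realType) (rho : gauge R) :=
  {ideal_quot (@negligible R rho)}.
HB.instance Definition _ (R : realType) (rho : gauge R) :=
  GRing.ComNzRing.on (rcnum rho).
HB.instance Definition _ (R : realType) (rho : gauge R) :=
  Quotient.on (rcnum rho).

Definition represents (R : realType) (rho : gauge R) (xe : R -> R)
    (x : rcnum rho) : Prop :=
  exists2 m : mnet rho, val m = xe & \pi_(rcnum rho) m = x.

(* [x_e]; the junk value 0 is returned when x_e is not moderate *)
Definition rcclass (R : realType) (rho : gauge R) (xe : R -> R) : rcnum rho :=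
  \pi_(rcnum rho) (insubd 0 xe).

(* a chosen representative; used only in constructions which do not depend on
   the choice *)
Definition rcnet (R : realType) (rho : gauge R) (x : rcnum rho) : R -> R :=
  val (repr x).

Definition gle (R : realType) (rho : gauge R) (x y : rcnum rho) : Prop :=
  exists xe ye : R -> R, [/\ represents xe x, represents ye y &
    forall e, 0 < e <= 1 -> xe e <= ye e].

Notation "x <=~ y" := (gle x y) (at level 70, no associativity).

Definition glt (R : realType) (rho : gauge R) (x y : rcnum rho) : Prop :=
  x <=~ y /\ exists z, (y - x) * z = 1.

Notation "x <~ y" := (glt x y) (at level 70, no associativity).

Definition gitv (R : realType) (rho : gauge R) (a b : rcnum rho) :
    set (rcnum rho) :=
  [set x | a <=~ x /\ x <=~ b].

Definition log_drhoV (R : realType) (rho : gauge R) : rcnum rho :=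
  rcclass rho (fun e => ln (rho e)^-1).

Definition is_gmax (R : realType) (rho : gauge R) (A : set (rcnum rho))
    (m : rcnum rho) : Prop :=
  A m /\ forall x, A x -> x <=~ m.

(* Maxima, derivatives, norms, integrals and solutions below are the elements
   singled out by their defining property (xget), with junk value 0 when there
   is none. *)
Definition gmax (R : realType) (rho : gauge R) (A : set (rcnum rho)) :
    rcnum rho :=
  xget 0 (is_gmax A).

(* Classes of moderate nets in R^n are identified with n-tuples of classes. *)
Definition vrepresents (R : realType) (rho : gauge R) (n : nat)
    (xe : R -> 'rV[R]_n) (x : 'rV[rcnum rho]_n) : Prop :=
  forall i, represents (fun e => xe e 0 i) (x 0 i).

(* The library norm on 'rV[R]_n is the maximum norm, not the Euclidean one. *)
Definition enorm (R : realType) (n : nat) (x : 'rV[R]_n) : R :=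
  Num.sqrt (\sum_i x 0 i ^+ 2).

(* A acts on row vectors from the right, as the library's Jacobian does *)
Definition opnorm (R : realType) (m n : nat) (A : 'M[R]_(m, n)) : R :=
  sup [set enorm (x *m A) | x in [set x : 'rV[R]_m | enorm x <= 1]].

Definition gnorm (R : realType) (rho : gauge R) (n : nat)
    (x : 'rV[rcnum rho]_n) : rcnum rho :=
  rcclass rho (fun e => enorm (\row_i rcnet (x 0 i) e)).

Definition gopnorm (R : realType) (rho : gauge R) (m n : nat)
    (A : 'M[rcnum rho]_(m, n)) : rcnum rho :=
  rcclass rho (fun e => opnorm (\matrix_(i, j) rcnet (A i j) e)).

Definition gball (R : realType) (rho : gauge R) (n : nat)
    (c : 'rV[rcnum rho]_n) (r : rcnum rho) : set 'rV[rcnum rho]_n :=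
  [set x | gnorm (x - c) <~ r].

Definition gcball (R : realType) (rho : gauge R) (n : nat)
    (c : 'rV[rcnum rho]_n) (r : rcnum rho) : set 'rV[rcnum rho]_n :=
  [set x | gnorm (x - c) <=~ r].

Definition sharp_nbhs (R : realType) (rho : gauge R) (n : nat)
    (c : 'rV[rcnum rho]_n) : set_system 'rV[rcnum rho]_n :=
  filter_from [set r | 0 <~ r] (gball c).

Definition sharp_interior (R : realType) (rho : gauge R) (n : nat)
    (X : set 'rV[rcnum rho]_n) : set 'rV[rcnum rho]_n :=
  [set x | sharp_nbhs x X].

Definition sharp_closure (R : realType) (rho : gauge R) (n : nat)
    (X : set 'rV[rcnum rho]_n) : set 'rV[rcnum rho]_n :=
  [set x | forall U, sharp_nbhs x U -> X `&` U !=set0].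

(* [K_e] *)
Definition internal (R : realType) (rho : gauge R) (n : nat)
    (Ke : R -> set 'rV[R]_n) : set 'rV[rcnum rho]_n :=
  [set x | exists2 xe, vrepresents xe x &
    \forall e \near (0 : R)^'+, Ke e (xe e)].

(* <Omega_e> *)
Definition strongly_internal (R : realType) (rho : gauge R) (n : nat)
    (Om : R -> set 'rV[R]_n) : set 'rV[rcnum rho]_n :=
  [set x | forall xe, vrepresents xe x ->
    \forall e \near (0 : R)^'+, Om e (xe e)].

Definition functionally_compact (R : realType) (rho : gauge R) (n : nat)
    (K : set 'rV[rcnum rho]_n) : Prop :=
  (exists Ke : R -> set 'rV[R]_n,
     (forall e, 0 < e <= 1 -> compact (Ke e)) /\ K = internal Ke) /\
  (exists2 r, 0 <~ r & K `<=` gball 0 r).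

Definition solid (R : realType) (rho : gauge R) (n : nat)
    (K : set 'rV[rcnum rho]_n) : Prop :=
  K = sharp_closure (sharp_interior K).

(* Multi-indices are encoded as sequences of coordinate directions. *)
Definition pderive (R : realType) (n : nat) (s : seq 'I_n)
    (g : 'rV[R]_n -> R) : 'rV[R]_n -> R :=
  foldr (fun i h => fun x => 'D_(delta_mx 0 i) h x) g s.

Definition vcomp (R : realType) (n k : nat) (g : 'rV[R]_n -> 'rV[R]_k)
    (j : 'I_k) : 'rV[R]_n -> R :=
  fun x => g x 0 j.

Definition smooth_on (R : realType) (n k : nat) (Om : set 'rV[R]_n)
    (g : 'rV[R]_n -> 'rV[R]_k) : Prop :=
  forall (j : 'I_k) (s : seq 'I_n) x, Om x ->
    {for x, continuous (pderive s (vcomp g j))} /\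
    forall i, derivable (pderive s (vcomp g j)) x (delta_mx 0 i).

Definition gsf_net (R : realType) (rho : gauge R) (n k : nat)
    (X : set 'rV[rcnum rho]_n) (f : 'rV[rcnum rho]_n -> 'rV[rcnum rho]_k)
    (Om : R -> set 'rV[R]_n) (fe : R -> 'rV[R]_n -> 'rV[R]_k) : Prop :=
  [/\ forall e, 0 < e <= 1 -> open (Om e) /\ smooth_on (Om e) (fe e),
      X `<=` strongly_internal Om,
      forall x xe, X x -> vrepresents xe x ->
        vrepresents (fun e => fe e (xe e)) (f x) &
      forall x xe, X x -> vrepresents xe x -> forall (j : 'I_k) (s : seq 'I_n),
        (fun e => pderive s (vcomp (fe e) j) (xe e)) \in moderate rho].

(* Only the values on X of the total function f matter. *)
Definition gsf (R : realType) (rho : gauge R) (n k : nat)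
    (X : set 'rV[rcnum rho]_n) (Y : set 'rV[rcnum rho]_k)
    (f : 'rV[rcnum rho]_n -> 'rV[rcnum rho]_k) : Prop :=
  (forall x, X x -> Y (f x)) /\ exists Om fe, gsf_net X f Om fe.

Definition gderiv_int (R : realType) (rho : gauge R) (n k : nat)
    (X : set 'rV[rcnum rho]_n) (f : 'rV[rcnum rho]_n -> 'rV[rcnum rho]_k)
    (s : seq 'I_n) (x : 'rV[rcnum rho]_n) : 'rV[rcnum rho]_k :=
  xget 0 [set y : 'rV[rcnum rho]_k | exists Om fe xe,
    [/\ gsf_net X f Om fe, vrepresents xe x &
      forall j, represents (fun e => pderive s (vcomp (fe e) j) (xe e)) (y 0 j)]].

(* At points of X outside its sharp interior the derivative is the sharp limit
   from the interior. *)
Definition gderiv (R : realType) (rho : gauge R) (n k : nat)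
    (X : set 'rV[rcnum rho]_n) (f : 'rV[rcnum rho]_n -> 'rV[rcnum rho]_k)
    (s : seq 'I_n) (x : 'rV[rcnum rho]_n) : 'rV[rcnum rho]_k :=
  if x \in sharp_interior X then gderiv_int X f s x
  else xget 0 [set y : 'rV[rcnum rho]_k |
    gderiv_int X f s @ within (sharp_interior X) (sharp_nbhs x)
      `=>` sharp_nbhs y].

Definition spderiv (R : realType) (rho : gauge R) (n : nat)
    (X : set 'rV[rcnum rho]_n) (f : 'rV[rcnum rho]_n -> rcnum rho)
    (i : 'I_n) (x : 'rV[rcnum rho]_n) : rcnum rho :=
  gderiv X (fun y => const_mx (f y) : 'rV_1) [:: i] x 0 0.

(* [t1,t2] as a subset of 'rV_1, and curves as functions on 'rV_1 *)
Definition titv (R : realType) (rho : gauge R) (t1 t2 : rcnum rho) :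
    set 'rV[rcnum rho]_1 :=
  [set x | gitv t1 t2 (x 0 0)].

Definition oncurve (R : realType) (rho : gauge R) (k : nat)
    (f : rcnum rho -> 'rV[rcnum rho]_k) : 'rV[rcnum rho]_1 -> 'rV[rcnum rho]_k :=
  fun x => f (x 0 0).

Definition gcurve (R : realType) (rho : gauge R) (k : nat) (t1 t2 : rcnum rho)
    (Y : set 'rV[rcnum rho]_k) (f : rcnum rho -> 'rV[rcnum rho]_k) : Prop :=
  gsf (titv t1 t2) Y (oncurve f).

Definition gdot (R : realType) (rho : gauge R) (k : nat) (t1 t2 : rcnum rho)
    (f : rcnum rho -> 'rV[rcnum rho]_k) (t : rcnum rho) : 'rV[rcnum rho]_k :=
  gderiv (titv t1 t2) (oncurve f) [:: ord0] (const_mx t).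

(* ||f||_n *)
Definition gcnorm (R : realType) (rho : gauge R) (k : nat) (t1 t2 : rcnum rho)
    (n : nat) (f : rcnum rho -> 'rV[rcnum rho]_k) : rcnum rho :=
  xget 0 [set y | exists Om fe t1e t2e,
    [/\ gsf_net (titv t1 t2) (oncurve f) Om fe,
        represents t1e t1, represents t2e t2 &
        represents (fun e : R => sup [set z : R | exists j (i : 'I_k) (t : R),
          [/\ (j <= n)%N, t1e e <= t <= t2e e &
            z = `|pderive (nseq j ord0) (vcomp (fe e) i) (const_mx t)|] ]) y]].

(* the integral from t1 to t2, for t1 <~ t2 *)
Definition gint (R : realType) (rho : gauge R) (t1 t2 : rcnum rho)
    (f : rcnum rho -> rcnum rho) : rcnum rho :=
  xget 0 [set y | exists Om fe t1e t2e,
    [/\ gsf_net (titv t1 t2) (oncurve (fun t => const_mx (f t) : 'rV_1)) Om fe,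
        represents t1e t1, represents t2e t2 &
        represents (fun e : R => \int[lebesgue_measure]_(t in `[t1e e, t2e e])
          fe e (const_mx t) 0 0) y]].

Record control_data (R : realType) (rho : gauge R) (d l : nat) := ControlData {
  ct1 : rcnum rho;
  ct2 : rcnum rho;
  cH : set 'rV[rcnum rho]_d;
  cK : set 'rV[rcnum rho]_l;
  cL : rcnum rho -> 'rV[rcnum rho]_d -> 'rV[rcnum rho]_l -> rcnum rho;
  cphi : rcnum rho -> 'rV[rcnum rho]_d -> 'rV[rcnum rho]_l -> 'rV[rcnum rho]_d;
  cq1 : 'rV[rcnum rho]_d;
  cr : rcnum rho }.

(* (t,q,k) as a point of 'rV_(1 + d + l) and (t,q,k,p) as a point of
   'rV_(1 + d + l + d) *)
Definition pack3 (T : Type) (d l : nat) (t : T) (q : 'rV[T]_d) (k : 'rV[T]_l) :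
    'rV[T]_(1 + d + l) :=
  row_mx (row_mx (const_mx t) q) k.

Definition unc3 (T S : Type) (d l : nat)
    (f : T -> 'rV[T]_d -> 'rV[T]_l -> S) (x : 'rV[T]_(1 + d + l)) : S :=
  f (lsubmx (lsubmx x) 0 0) (rsubmx (lsubmx x)) (rsubmx x).

Definition pack4 (T : Type) (d l : nat) (t : T) (q : 'rV[T]_d) (k : 'rV[T]_l)
    (p : 'rV[T]_d) : 'rV[T]_(1 + d + l + d) :=
  row_mx (pack3 t q k) p.

Definition unc4 (T S : Type) (d l : nat)
    (f : T -> 'rV[T]_d -> 'rV[T]_l -> 'rV[T]_d -> S)
    (x : 'rV[T]_(1 + d + l + d)) : S :=
  unc3 f (lsubmx x) (rsubmx x).

Definition dom3 (R : realType) (rho : gauge R) (d l : nat)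
    (P : control_data rho d l) : set 'rV[rcnum rho]_(1 + d + l) :=
  [set x | unc3 (fun t q k => [/\ gitv (ct1 P) (ct2 P) t, cH P q & cK P k]) x].

Definition dom4 (R : realType) (rho : gauge R) (d l : nat)
    (P : control_data rho d l) : set 'rV[rcnum rho]_(1 + d + l + d) :=
  [set x | dom3 P (lsubmx x)].

(* row i is the partial derivative of phi with respect to q_i, so that this is
   the transpose of the usual matrix *)
Definition dphi_dq (R : realType) (rho : gauge R) (d l : nat)
    (P : control_data rho d l) t q k : 'M[rcnum rho]_d :=
  \matrix_(i, j) gderiv (dom3 P) (unc3 (cphi P)) [:: lshift l (rshift 1 i)]
    (pack3 t q k) 0 j.

Definition M_K (R : realType) (rho : gauge R) (d l : nat)
    (P : control_data rho d l) : rcnum rho :=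
  gmax [set y | exists t q k, [/\ gitv (ct1 P) (ct2 P) t,
    gcball (cq1 P) (cr P) q, cK P k & y = gnorm (cphi P t q k)]].

Definition L_K (R : realType) (rho : gauge R) (d l : nat)
    (P : control_data rho d l) : rcnum rho :=
  gmax [set y | exists t q k, [/\ gitv (ct1 P) (ct2 P) t,
    gcball (cq1 P) (cr P) q, cK P k & y = gopnorm (dphi_dq P t q k)]].

Record standing (R : realType) (rho : gauge R) (d l : nat)
    (P : control_data rho d l) : Prop := Standing {
  st_time : ct1 P <~ ct2 P;
  st_H : functionally_compact (cH P) /\ solid (cH P);
  st_K : functionally_compact (cK P) /\ solid (cK P);
  st_L : gsf (dom3 P) setT (fun x => const_mx (unc3 (cL P) x) : 'rV_1);
  st_phi : gsf (dom3 P) setT (unc3 (cphi P));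
  st_r : 0 <~ cr P;
  st_ball : gcball (cq1 P) (cr P) `<=` cH P;
  st_MK : (ct2 P - ct1 P) * M_K P <=~ cr P;
  st_LK : (const_mx ((ct2 P - ct1 P) ^+ n * L_K P ^+ n) : 'rV_1) @[n \oo]
            `=>` sharp_nbhs (0 : 'rV[rcnum rho]_1) }.

Definition trajectory (R : realType) (rho : gauge R) (d l : nat)
    (P : control_data rho d l) (q : rcnum rho -> 'rV[rcnum rho]_d) : Prop :=
  gcurve (ct1 P) (ct2 P) (cH P) q /\
  gcnorm (ct1 P) (ct2 P) 0 (fun t => q t - cq1 P) <=~ cr P.

Definition control (R : realType) (rho : gauge R) (d l : nat)
    (P : control_data rho d l) (u : rcnum rho -> 'rV[rcnum rho]_l) : Prop :=
  gcurve (ct1 P) (ct2 P) (cK P) u.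

Definition inner_control (R : realType) (rho : gauge R) (d l : nat)
    (P : control_data rho d l) (u : rcnum rho -> 'rV[rcnum rho]_l) : Prop :=
  control P u /\ exists2 r', 0 <~ r' & forall v,
    gcurve (ct1 P) (ct2 P) setT v ->
    gmax [set gnorm (v t - u t) | t in gitv (ct1 P) (ct2 P)] <~ r' ->
    control P v.

Definition state_solution (R : realType) (rho : gauge R) (d l : nat)
    (P : control_data rho d l) (u : rcnum rho -> 'rV[rcnum rho]_l)
    (q : rcnum rho -> 'rV[rcnum rho]_d) : Prop :=
  [/\ trajectory P q,
      forall t, gitv (ct1 P) (ct2 P) t ->
        gdot (ct1 P) (ct2 P) q t = cphi P t (q t) (u t) &
      q (ct1 P) = cq1 P].

(* q^u; only its values on [t1,t2] are determined, as for costate below *)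
Definition state (R : realType) (rho : gauge R) (d l : nat)
    (P : control_data rho d l) (u : rcnum rho -> 'rV[rcnum rho]_l) :
    rcnum rho -> 'rV[rcnum rho]_d :=
  xget (fun _ => 0) (state_solution P u).

Definition cost (R : realType) (rho : gauge R) (d l : nat)
    (P : control_data rho d l) (u : rcnum rho -> 'rV[rcnum rho]_l) :
    rcnum rho :=
  gint (ct1 P) (ct2 P) (fun t => cL P t (state P u t) (u t)).

Definition hamiltonian (R : realType) (rho : gauge R) (d l : nat)
    (P : control_data rho d l) t q u (p : 'rV[rcnum rho]_d) : rcnum rho :=
  cL P t q u + (p *m (cphi P t q u)^T) 0 0.

Definition dH_dq (R : realType) (rho : gauge R) (d l : nat)
    (P : control_data rho d l) t q u p : 'rV[rcnum rho]_d :=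
  \row_j spderiv (dom4 P) (unc4 (hamiltonian P))
    (lshift d (lshift l (rshift 1 j))) (pack4 t q u p).

Definition dH_du (R : realType) (rho : gauge R) (d l : nat)
    (P : control_data rho d l) t q u p : 'rV[rcnum rho]_l :=
  \row_j spderiv (dom4 P) (unc4 (hamiltonian P))
    (lshift d (rshift (1 + d) j)) (pack4 t q u p).

Definition dH_dp (R : realType) (rho : gauge R) (d l : nat)
    (P : control_data rho d l) t q u p : 'rV[rcnum rho]_d :=
  \row_j spderiv (dom4 P) (unc4 (hamiltonian P))
    (rshift (1 + d + l) j) (pack4 t q u p).

Definition adjoint_solution (R : realType) (rho : gauge R) (d l : nat)
    (P : control_data rho d l) (u : rcnum rho -> 'rV[rcnum rho]_l)
    (p : rcnum rho -> 'rV[rcnum rho]_d) : Prop :=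
  [/\ gcurve (ct1 P) (ct2 P) setT p,
      forall t, gitv (ct1 P) (ct2 P) t ->
        gdot (ct1 P) (ct2 P) p t = - dH_dq P t (state P u t) (u t) (p t) &
      p (ct2 P) = 0].

(* p^u *)
Definition costate (R : realType) (rho : gauge R) (d l : nat)
    (P : control_data rho d l) (u : rcnum rho -> 'rV[rcnum rho]_l) :
    rcnum rho -> 'rV[rcnum rho]_d :=
  xget (fun _ => 0) (adjoint_solution P u).

Definition optimal (R : realType) (rho : gauge R) (d l : nat)
    (P : control_data rho d l) (v : rcnum rho -> 'rV[rcnum rho]_l) : Prop :=
  exists r' n, 0 <~ r' /\ forall u, control P u ->
    gcnorm (ct1 P) (ct2 P) n (fun t => u t - v t) <~ r' ->
    cost P v <=~ cost P u.

Definition solves_WPS (R : realType) (rho : gauge R) (d l : nat)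
    (P : control_data rho d l) (q : rcnum rho -> 'rV[rcnum rho]_d)
    (u : rcnum rho -> 'rV[rcnum rho]_l)
    (p : rcnum rho -> 'rV[rcnum rho]_d) : Prop :=
  (forall t, gitv (ct1 P) (ct2 P) t ->
    [/\ gdot (ct1 P) (ct2 P) q t = dH_dp P t (q t) (u t) (p t),
        gdot (ct1 P) (ct2 P) p t = - dH_dq P t (q t) (u t) (p t) &
        dH_du P t (q t) (u t) (p t) = 0]) /\
  q (ct1 P) = cq1 P /\ p (ct2 P) = 0.

(* Main.v *)
Require Import Defs.
From mathcomp Require Import all_boot all_order all_algebra.
From mathcomp Require Import generic_quotient ring_quotient.
From mathcomp Require Import all_classical all_reals all_analysis.
From mathcomp Require Import ring lra zify.
Require Import Defs.
Import Order.TTheory GRing.Theory Num.Theory.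
Import numFieldNormedType.Exports.
Set Implicit Arguments.
Unset Strict Implicit.
Unset Printing Implicit Defensive.
Local Open Scope classical_set_scope.
Local Open Scope ring_scope.
Local Open Scope quotient_scope.

(** Everything is reduced to nets.  A class is handled through arbitrary
    representatives ([gleP], [gltP], [vrepresents_negl]), and a property of all
    classes in a bounded internal set becomes, for small e, a property of all
    points of one set K e: a net that selects a counterexample whenever there is
    one would represent a class that violates the property ([near0_unif],
    [near0_unif_nbhd]).  In this way pointwise moderateness becomes a bound
    rho^-N near K e, and a domain of definition contains a neighbourhood of K e
    whose radius is a power of rho.  On sets in the closure of their interior
    all nets of a generalized smooth function have the same derivatives up to
    negligible errors, at boundary points too ([pderive_unique], [gderivE]).

    The powers of (t2 - t1) L_K tend sharply to 0, so one of them is below rho;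
    for small e the number (t2 - t1) |phi_q| is therefore below any given real
    constant on the core [t1, t2] x ball x K, and also on a tube around it whose
    width is a power of rho ([phi_LK], [tube_dom]).  Hence both the state and the
    adjoint equation are contractions over the whole time interval.  Solutions
    are produced by Picard iteration for each e on an interval that is longer by
    a power of rho, so that the result is a smooth net on a neighbourhood of
    [t1, t2] ([ode_solve], [ode_smooth]).  Bounds, uniqueness and dependence on the
    control come from a first exit estimate ([barrier], [state_bound],
    [state_close], [adjoint_unique]).

    For the maximum principle let v be optimal with state q and adjoint state p,
    and let D = - H_u(t, q, v, p).  The control v + rho^k D is admissible and
    close to v for large k, because v is interior.  If q' is its state, the
    adjoint equation cancels the terms of first order in q' - q in the derivative
    of

      cost of (q', v + rho^k D) up to t  -  cost of (q, v) up to t  +  p . (q' - q),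

    which by Taylor's formula for the Hamiltonian is - rho^k |D|^2 up to an error
    of second order ([ham_taylor], [cost_descent]).  At the end points the last
    term is negligible, so optimality makes the total change nonnegative up to
    negligible errors.  A point with |D| > rho^m has around it an interval of
    polynomial length with |D| >= rho^m / 2, as D is Lipschitz with a moderate
    constant; for k large the decrease there exceeds the errors ([stationary]).
    Hence |D| is below every power of rho, that is, H_u = 0.

    The remaining equations say that H_p = phi ([dH_dp_phi]) and that p solves
    the adjoint equation; uniqueness of q and p is the uniqueness of solutions of
    the two differential equations. *)

(** * Moderate and negligible nets *)

Notation "'\near0' e , P" := (\forall e \near (0 : Real.sort _)^'+, P)
  (at level 200, e name, P at level 200).

Section Scalars.
Context {R : realType} (rho : gauge R).
Implicit Types (x y c : R -> R).

Lemma near0_itv : \near0 e, (0 : R) < e <= 1.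
Proof.
near=> e; apply/andP; split; first by [].
by near: e; apply: nbhs_right_le.
Unshelve. all: by end_near. Qed.

Lemma near0_ex (P : R -> Prop) : (\near0 e, P e) -> exists e, P e.
Proof. by move=> h; exact: (@filter_ex _ (0 : R)^'+ _ P h). Qed.

Lemma rho_expM e m n : 0 < rho e <= 1 -> (m <= n)%N -> rho e ^+ n <= rho e ^+ m.
Proof. by move=> /andP[r0 r1] mn; rewrite ler_wiXn2l// ltW. Qed.

Lemma rho_exp_gt0 e n : 0 < rho e <= 1 -> 0 < rho e ^+ n.
Proof. by move=> /andP[r0 _]; rewrite exprn_gt0. Qed.

Lemma rho_exp_ge0 e n : 0 < rho e <= 1 -> 0 <= rho e ^+ n.
Proof. by move=> r; apply/ltW/rho_exp_gt0. Qed.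

Lemma rho_expVM e m n : 0 < rho e <= 1 -> (m <= n)%N -> rho e ^- m <= rho e ^- n.
Proof.
by move=> r mn; rewrite lef_pV2 ?posrE ?rho_exp_gt0//; apply: rho_expM.
Qed.

Lemma rho_expVMX e m n : 0 < rho e <= 1 -> rho e ^- m * rho e ^+ (m + n) = rho e ^+ n.
Proof. by move=> /andP[r0 _]; rewrite exprD mulKf// expf_neq0// gt_eqF. Qed.

Lemma near_rhoM (a : R) : \near0 e, a * rho e <= 1.
Proof.
near=> e; have /andP[r0 r1] : 0 < rho e <= 1 by near: e; apply: gauge_near.
have h : rho e < (`|a| + 1)^-1 by near: e; apply: gauge_small; rewrite invr_gt0 ltr_wpDl.
have a1 : 0 < `|a| + 1 by rewrite ltr_wpDl.
have h' : (`|a| + 1) * rho e < 1 by rewrite -ltr_pdivlMl// mulr1.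
have := ler_norm a; nra.
Unshelve. all: by end_near. Qed.

(** Constants are absorbed by one more power of rho; all the estimates below
    rest on this. *)
Lemma near_rhoX (a : R) n : \near0 e, a * rho e ^+ n.+1 <= rho e ^+ n.
Proof.
near=> e; have re : 0 < rho e <= 1 by near: e; apply: gauge_near.
rewrite exprS mulrA ler_piMl//; first exact/ltW/rho_exp_gt0.
by near: e; apply: near_rhoM.
Unshelve. all: by end_near. Qed.

(** Moderateness and negligibility of plain functions, so that they combine
    without the subtype of moderate nets. *)
Definition mod_net x := exists N : nat, \near0 e, `|x e| <= rho e ^- N.
Definition negl x := forall n : nat, \near0 e, `|x e| <= rho e ^+ n.

Lemma moderateP x : (x \in moderate rho) <-> mod_net x.
Proof. by split => [/asboolP|h]; last exact/asboolP. Qed.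

Lemma mod_netD x y : mod_net x -> mod_net y -> mod_net (fun e => x e + y e).
Proof. by move=> /moderateP hx /moderateP hy; apply/moderateP; apply: (rpredD hx hy). Qed.

Lemma mod_netB x y : mod_net x -> mod_net y -> mod_net (fun e => x e - y e).
Proof. by move=> /moderateP hx /moderateP hy; apply/moderateP; apply: (rpredB hx hy). Qed.

Lemma mod_netM x y : mod_net x -> mod_net y -> mod_net (fun e => x e * y e).
Proof. by move=> /moderateP hx /moderateP hy; apply/moderateP; apply: (rpredM hx hy). Qed.

Lemma mod_net_le x y : mod_net y -> (\near0 e, `|x e| <= `|y e|) -> mod_net x.
Proof.
move=> [N hN] xy; exists N; near=> e.
by apply: (@le_trans _ _ `|y e|); near: e.
Unshelve. all: by end_near. Qed.

Lemma mod_net_cst (a : R) : mod_net (fun=> a).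
Proof.
exists 1%N; near=> e; have re : 0 < rho e <= 1 by near: e; apply: gauge_near.
have /andP[r0 r1] := re.
rewrite -[leRHS]mul1r ler_pdivlMr ?expr1//.
by near: e; apply: near_rhoM.
Unshelve. all: by end_near. Qed.

Lemma mod_net_sum (I : Type) (s : seq I) (F : I -> R -> R) :
  (forall i, mod_net (F i)) -> mod_net (fun e => \sum_(i <- s) F i e).
Proof.
move=> h; elim: s => [|i s ih].
  by under eq_fun do rewrite big_nil; apply: mod_net_cst.
by under eq_fun do rewrite big_cons; apply: mod_netD.
Qed.

Lemma mod_net_norm x : mod_net x -> mod_net (fun e => `|x e|).
Proof. by move=> h; apply: mod_net_le h _; near=> e; rewrite normr_id.
Unshelve. all: by end_near. Qed.

Lemma mod_net_rho N : mod_net (fun e => rho e ^- N).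
Proof.
exists N; near=> e; have re : 0 < rho e <= 1 by near: e; apply: gauge_near.
by rewrite ger0_norm ?invr_ge0 ?rho_exp_ge0.
Unshelve. all: by end_near. Qed.

Lemma mod_net_rhoX N : mod_net (fun e => rho e ^+ N).
Proof.
exists 0%N; near=> e; have re : 0 < rho e <= 1 by near: e; apply: gauge_near.
by rewrite ger0_norm ?rho_exp_ge0// expr0 invr1 -(expr0 (rho e)) rho_expM.
Unshelve. all: by end_near. Qed.

Lemma mod_net_absorb c n : mod_net c ->
  exists m0, forall m, (m0 <= m)%N -> \near0 e, `|c e| * rho e ^+ m <= rho e ^+ n.
Proof.
move=> [N hN]; exists (N + n)%N => m le_m; near=> e.
have re : 0 < rho e <= 1 by near: e; apply: gauge_near.
apply: (@le_trans _ _ (rho e ^- N * rho e ^+ (N + n))); last by rewrite rho_expVMX.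
apply: ler_pM; rewrite ?normr_ge0 ?rho_exp_ge0 ?rho_expM//.
by near: e.
Unshelve. all: by end_near. Qed.

Lemma negl_le x y : negl y -> (\near0 e, `|x e| <= `|y e|) -> negl x.
Proof.
move=> hy xy n; near=> e.
by apply: (@le_trans _ _ `|y e|); near: e; [|apply: hy].
Unshelve. all: by end_near. Qed.

Lemma neglM c x : mod_net c -> negl x -> negl (fun e => c e * x e).
Proof.
move=> /(mod_net_absorb) hc hx n; have [m0 /(_ m0 (leqnn _)) hm] := hc n.
near=> e; rewrite normrM; apply: (@le_trans _ _ (`|c e| * rho e ^+ m0)); last by near: e.
by rewrite ler_wpM2l//; near: e; apply: hx.
Unshelve. all: by end_near. Qed.

Lemma negl0 : negl (fun=> 0).
Proof.
move=> n; near=> e; rewrite normr0 rho_exp_ge0//; near: e; exact: gauge_near.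
Unshelve. all: by end_near. Qed.

Lemma neglD x y : negl x -> negl y -> negl (fun e => x e + y e).
Proof.
move=> hx hy n; near=> e; apply: (le_trans (ler_normD _ _)).
apply: (@le_trans _ _ (2 * rho e ^+ n.+1)); last by near: e; apply: near_rhoX.
by rewrite mulr2n mulrDl mul1r lerD//; near: e; [apply: hx|apply: hy].
Unshelve. all: by end_near. Qed.

Lemma neglN x : negl x -> negl (fun e => - x e).
Proof. by move=> hx; apply: negl_le hx _; near=> e; rewrite normrN.
Unshelve. all: by end_near. Qed.

Lemma neglB x y : negl x -> negl y -> negl (fun e => x e - y e).
Proof. by move=> hx hy; apply: neglD => //; apply: neglN. Qed.

Lemma negl_norm x : negl x -> negl (fun e => `|x e|).
Proof. by move=> h; apply: negl_le h _; near=> e; rewrite normr_id.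
Unshelve. all: by end_near. Qed.

Lemma negl_sum (I : Type) (s : seq I) (F : I -> R -> R) :
  (forall i, negl (F i)) -> negl (fun e => \sum_(i <- s) F i e).
Proof.
move=> h; elim: s => [|i s ih].
  by under eq_fun do rewrite big_nil; apply: negl0.
by under eq_fun do rewrite big_cons; apply: neglD.
Qed.

Lemma negl_mod x : negl x -> mod_net x.
Proof.
move=> /(_ 0%N) h; apply: (mod_net_le (mod_net_cst 1)).
by near=> e; rewrite normr1 -(expr0 (rho e)); near: e.
Unshelve. all: by end_near. Qed.

(** * Representatives of classes *)

Lemma represents_mod x (a : rcnum rho) : represents x a -> mod_net x.
Proof. by move=> [m <- _]; apply/moderateP/(valP m). Qed.

Lemma represents_rcclass x : mod_net x -> represents x (rcclass rho x).
Proof.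
move=> /moderateP mx; exists (MNet mx) => //; rewrite /rcclass; congr (\pi _).
by apply: val_inj; rewrite val_insubd mx.
Qed.

Lemma represents_rcnet (a : rcnum rho) : represents (rcnet a) a.
Proof. by exists (repr a) => //; rewrite reprK. Qed.

Lemma represents_eq x y (a b : rcnum rho) : represents x a -> represents y b ->
  (a = b <-> negl (fun e => x e - y e)).
Proof.
move=> [m <- <-] [p <- <-].
have E : (\pi_(rcnum rho) m = \pi_(rcnum rho) p) <-> (m - p \in @Defs.negligible R rho).
  by rewrite Quotient.idealrBE; split=> /eqP.
rewrite E; split => [/asboolP|h]; last exact/asboolP.
by [].
Qed.

Lemma represents_congr x y (a : rcnum rho) : represents x a ->
  negl (fun e => y e - x e) -> represents y a.
Proof.
move=> rx nyx.
have my : mod_net y.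
  apply: (mod_net_le (mod_netD (represents_mod rx) (negl_mod nyx))).
  by near=> e; rewrite addrC subrK.
have ry := represents_rcclass my.
by have <- : rcclass rho y = a by apply/(represents_eq ry rx).
Unshelve. all: by end_near. Qed.

Lemma represents_inj x (a b : rcnum rho) : represents x a -> represents x b -> a = b.
Proof.
move=> ha hb; apply/(represents_eq ha hb).
by under eq_fun do rewrite subrr; apply: negl0.
Qed.

Lemma represents_negl x y (a : rcnum rho) : represents x a -> represents y a ->
  negl (fun e => x e - y e).
Proof. by move=> hx hy; apply/(represents_eq hx hy). Qed.

Lemma represents0 : represents (fun=> 0) (0 : rcnum rho).
Proof. by exists 0 => //; rewrite raddf0. Qed.

Lemma represents1 : represents (fun=> 1) (1 : rcnum rho).
Proof. by exists 1 => //; rewrite rmorph1. Qed.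

Lemma representsD x y (a b : rcnum rho) : represents x a -> represents y b ->
  represents (fun e => x e + y e) (a + b).
Proof. by move=> [m <- <-] [p <- <-]; exists (m + p) => //; rewrite rmorphD. Qed.

Lemma representsN x (a : rcnum rho) : represents x a ->
  represents (fun e => - x e) (- a).
Proof. by move=> [m <- <-]; exists (- m) => //; rewrite rmorphN. Qed.

Lemma representsB x y (a b : rcnum rho) : represents x a -> represents y b ->
  represents (fun e => x e - y e) (a - b).
Proof. by move=> ha hb; apply: representsD => //; apply: representsN. Qed.

Lemma representsM x y (a b : rcnum rho) : represents x a -> represents y b ->
  represents (fun e => x e * y e) (a * b).
Proof. by move=> [m <- <-] [p <- <-]; exists (m * p) => //; rewrite rmorphM. Qed.

Lemma representsX x (a : rcnum rho) n : represents x a ->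
  represents (fun e => x e ^+ n) (a ^+ n).
Proof.
move=> ha; elim: n => [|n ih].
  by under eq_fun do rewrite expr0; rewrite expr0; apply: represents1.
by under eq_fun do rewrite exprS; rewrite exprS; apply: representsM.
Qed.

Lemma represents_sum (I : Type) (s : seq I) (F : I -> R -> R) (G : I -> rcnum rho) :
  (forall i, represents (F i) (G i)) ->
  represents (fun e => \sum_(i <- s) F i e) (\sum_(i <- s) G i).
Proof.
move=> h; elim: s => [|i s ih].
  by under eq_fun do rewrite big_nil; rewrite big_nil; apply: represents0.
by under eq_fun do rewrite big_cons; rewrite big_cons; apply: representsD.
Qed.

(** The order is defined by one well-chosen pair of representatives; any other
    pair differs from it by negligible nets, and conversely adding the
    negligible excess to y produces such a pair. *)
Lemma gleP x y (a b : rcnum rho) : represents x a -> represents y b ->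
  a <=~ b <-> forall n, \near0 e, x e <= y e + rho e ^+ n.
Proof.
move=> ra rb; split.
  move=> [x' [y' [ra' rb' le']]] n.
  have nx := represents_negl ra ra'; have ny := represents_negl rb' rb.
  have nn := neglD nx ny.
  near=> e.
  have h1 : x' e <= y' e by apply: le'; near: e; apply: near0_itv.
  have : `|x e - x' e + (y' e - y e)| <= rho e ^+ n by near: e; apply: nn.
  by move=> /ler_normlP[]; lra.
move=> h; exists x, (fun e => Num.max (x e) (y e)); split => //.
  apply: (represents_congr rb) => n; near=> e.
  have xy : x e <= y e + rho e ^+ n by near: e; apply: h.
  have re : 0 < rho e <= 1 by near: e; apply: gauge_near.
  have r0 := rho_exp_gt0 n re.
  by rewrite ler_norml; case: (leP (x e) (y e)) => xye; apply/andP; split; lra.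
by move=> e _; rewrite le_max lexx.
Unshelve. all: by end_near. Qed.

(** An inverse of b - a is moderate, which bounds b - a below by a power of rho;
    conversely a net bounded below by such a power is inverted pointwise. *)
Lemma gltP x y (a b : rcnum rho) : represents x a -> represents y b ->
  a <~ b <-> exists N, \near0 e, x e + rho e ^+ N <= y e.
Proof.
move=> ra rb; split.
  move=> [/(gleP ra rb) le_ab [z zE]].
  have rz := represents_rcnet z.
  have := representsM (representsB rb ra) rz; rewrite zE => r1.
  have n1 := represents_negl r1 represents1.
  have [N hN] := represents_mod rz.
  exists N.+1; near=> e.
  have re : 0 < rho e <= 1 by near: e; apply: gauge_near.
  have r0 := rho_exp_gt0 N.+1 re.
  have h1 : `|(y e - x e) * rcnet z e - 1| <= rho e ^+ 1 by near: e; apply: n1.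
  have h2 : `|rcnet z e| <= rho e ^- N by near: e.
  have h3 : rho e < 4^-1 by near: e; apply: gauge_small; rewrite invr_gt0.
  have h4 : 4 * rho e ^+ N.+1 <= rho e ^+ N by near: e; apply: near_rhoX.
  have h5 : x e <= y e + rho e ^+ N.+1 by near: e; apply: le_ab.
  have h6 : `|y e - x e| * rho e ^- N >= 2^-1.
    apply: (@le_trans _ _ (`|y e - x e| * `|rcnet z e|)); last by rewrite ler_wpM2l.
    rewrite -normrM; move: h1; rewrite expr1 => /ler_normlP[h1 h1'].
    by apply: le_trans (ler_norm _); lra.
  have h7 : `|y e - x e| >= 2^-1 * rho e ^+ N by rewrite -ler_pdivlMr ?rho_exp_gt0.
  move: h7; rewrite ler_normr => /orP[]; lra.
move=> [N hN]; split.
  apply/(gleP ra rb) => n; near=> e.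
  have re : 0 < rho e <= 1 by near: e; apply: gauge_near.
  have r0 := rho_exp_gt0 N re; have rn := rho_exp_gt0 n re.
  have : x e + rho e ^+ N <= y e by near: e.
  by lra.
pose z e := (y e - x e)^-1.
have mz : mod_net z.
  exists N; near=> e.
  have re : 0 < rho e <= 1 by near: e; apply: gauge_near.
  have r0 := rho_exp_gt0 N re.
  have h : x e + rho e ^+ N <= y e by near: e.
  by rewrite normfV lef_pV2 ?posrE// ?ger0_norm ?normr_gt0; lra.
exists (rcclass rho z).
have rz := representsM (representsB rb ra) (represents_rcclass mz).
apply/(represents_eq rz represents1).
apply: (negl_le negl0); near=> e.
have re : 0 < rho e <= 1 by near: e; apply: gauge_near.
have r0 := rho_exp_gt0 N re.
have h : x e + rho e ^+ N <= y e by near: e.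
rewrite /z mulfV ?subrr//; lra.
Unshelve. all: by end_near. Qed.

Lemma glt_gle (a b : rcnum rho) : a <~ b -> a <=~ b.
Proof. by case. Qed.

Lemma represents_rhoX n : represents (fun e => rho e ^+ n) (rcclass rho (fun e => rho e ^+ n)).
Proof. exact/represents_rcclass/mod_net_rhoX. Qed.

Lemma gle_glt_trans (x y z : rcnum rho) : x <=~ y -> y <~ z -> x <~ z.
Proof.
have hx := represents_rcnet x; have hy := represents_rcnet y; have hz := represents_rcnet z.
move=> /(gleP hx hy) xy /(gltP hy hz)[N hN]; apply/(gltP hx hz); exists N.+1; near=> e.
have re : 0 < rho e <= 1 by near: e; apply: gauge_near.
have k1 : rcnet x e <= rcnet y e + rho e ^+ N.+1 by near: e.
have k2 : rcnet y e + rho e ^+ N <= rcnet z e by near: e.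
have k3 : 2 * rho e ^+ N.+1 <= rho e ^+ N by near: e; apply: near_rhoX.
by lra.
Unshelve. all: by end_near. Qed.

Lemma rho_small (z : rcnum rho) : 0 <~ z -> exists M, rcclass rho (fun e => rho e ^+ M) <~ z.
Proof.
have hz := represents_rcnet z; move=> /(gltP represents0 hz)[N hN]; exists N.+1.
apply/(gltP (represents_rhoX N.+1) hz); exists N.+1; near=> e.
have k2 : 0 + rho e ^+ N <= rcnet z e by near: e.
have k3 : 2 * rho e ^+ N.+1 <= rho e ^+ N by near: e; apply: near_rhoX.
by lra.
Unshelve. all: by end_near. Qed.

(** * Uniformity over internal sets *)

Lemma notnear_ex (P : R -> Prop) (d : R) : 0 < d -> ~ (\near0 e, ~ P e) ->
  exists e, 0 < e < d /\ P e.
Proof.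
move=> d0 h; apply: contrapT => h'; apply: h; near=> e => Pe; apply: h'.
exists e; split=> //; apply/andP; split; first by [].
by near: e; apply: nbhs_right_lt.
Unshelve. all: by end_near. Qed.

(** If each level N is bad for e arbitrarily close to 0, a bad e below
    1 / (N + 1) is picked for it; along the selected e the levels tend to
    infinity. *)
Lemma diagonal_selection (Z : Type) (z0 : Z) (Bad : nat -> R -> Z -> Prop) :
  (forall N, ~ \near0 e, ~ exists z, Bad N e z) ->
  exists (S : set R) (nn : R -> nat) (zz : R -> Z),
    [/\ forall e, S e -> Bad (nn e) e (zz e),
        forall N, \near0 e, S e -> (N <= nn e)%N &
        ~ \near0 e, ~ S e].
Proof.
move=> h.
have /choice[ez ezP] : forall N, exists p : R * Z, 0 < p.1 < N.+1%:R^-1 /\ Bad N p.1 p.2.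
  move=> N; have [e [e01 [z bz]]] := notnear_ex (d := N.+1%:R^-1) (ltac:(by rewrite invr_gt0)) (h N).
  by exists (e, z).
pose S := [set e | exists N, (ez N).1 = e].
pose nn e := xget 0%N [set N | (ez N).1 = e].
have nnP e : S e -> (ez (nn e)).1 = e.
  by move=> [N NE]; apply: (@xgetPex _ 0%N [set N | (ez N).1 = e]); exists N.
exists S, nn, (fun e => (ez (nn e)).2); split.
- move=> e Se; have := (ezP (nn e)).2; by rewrite nnP.
- elim=> [|N ih]; first by near=> e.
  have e0 : 0 < (ez N).1 by case: (ezP N) => /andP[].
  near=> e => Se; rewrite ltn_neqAle; apply/andP; split.
    apply/eqP => NE; have := nnP _ Se; rewrite -NE => eE.
    have : e < (ez N).1 by near: e; apply: nbhs_right_lt.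
    by rewrite eE ltxx.
  by move: Se; near: e.
- move=> [d /= d0 dP].
  have [N hN] : exists N : nat, N.+1%:R^-1 < d.
    exists (Num.truncn d^-1); rewrite invf_plt ?posrE//.
    exact: truncnS_gt.
  have [/andP[e0 eN] _] := ezP N.
  apply: (dP (ez N).1) => //=; last by exists N.
  by rewrite sub0r normrN gtr0_norm// (lt_trans eN).
Unshelve. all: by end_near. Qed.

(** A net that selects a counterexample in K e whenever there is one is itself
    a net in K, so it can select one only for e away from 0. *)
Lemma near0_unif (Z : Type) (K : R -> set Z) (P : R -> Z -> Prop) :
  (\near0 e, K e !=set0) ->
  (forall z, (\near0 e, K e (z e)) -> \near0 e, P e (z e)) ->
  \near0 e, forall z, K e z -> P e z.
Proof.
move=> K0 h.
have [z0 _] : exists z0 : Z, True by have [e [z _]] := near0_ex K0; exists z.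
have /choice[g gP] : forall e, exists z, (K e !=set0 -> K e z) /\
   ((exists z, K e z /\ ~ P e z) -> ~ P e z).
  move=> e; have [[z [Kz nPz]]|nb] := pselect (exists z, K e z /\ ~ P e z).
    by exists z.
  have [[z Kz]|nK] := pselect (K e !=set0); first by exists z.
  by exists z0.
have hg : \near0 e, P e (g e).
  by apply: h; near=> e; apply: (gP e).1; near: e.
near=> e => z Kz; apply: contrapT => nPz.
by apply: (gP e).2; [exists z|near: e].
Unshelve. all: by end_near. Qed.

(** If each net in K, even after a negligible displacement, eventually
    satisfies P N for some N, then one N works on a whole rho^N-neighbourhood
    of K: otherwise points violating P N within rho^N of K, for a sequence of
    e tending to 0 and N tending to infinity, would assemble into a
    negligible displacement of a net in K. *)
Lemma near0_unif_nbhd n (K : R -> set 'rV[R]_n) (P : nat -> R -> 'rV[R]_n -> Prop) :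
  (\near0 e, K e !=set0) ->
  (forall N M e (y : 'rV[R]_n), 0 < rho e <= 1 -> (N <= M)%N -> P N e y -> P M e y) ->
  (forall x y : R -> 'rV[R]_n, (\near0 e, K e (x e)) -> negl (fun e => `|y e - x e|) ->
     exists N, \near0 e, P N e (y e)) ->
  exists N, \near0 e, forall x y : 'rV[R]_n, K e x -> `|y - x| <= rho e ^+ N -> P N e y.
Proof.
move=> K0 Pmono h; apply: contrapT => nuni.
pose Bad N e (z : 'rV[R]_n * 'rV[R]_n) :=
  [/\ K e z.1, `|z.2 - z.1| <= rho e ^+ N & ~ P N e z.2].
have nb N : ~ \near0 e, ~ exists z, Bad N e z.
  move=> hn; apply: nuni; exists N; near=> e => x y Kx yx; apply: contrapT => nP.
  have : ~ exists z, Bad N e z by near: e.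
  by apply; exists (x, y).
have [S [nn [zz [SB Snn nS]]]] := diagonal_selection (0, 0) nb.
have /choice[g gP] : forall e, exists z, K e !=set0 -> K e z.
  move=> e; have [[z Kz]|nK] := pselect (K e !=set0); first by exists z.
  by exists 0.
pose x e := if `[< S e >] then (zz e).1 else g e.
pose y e := if `[< S e >] then (zz e).2 else g e.
have [N hN] : exists N, \near0 e, P N e (y e).
  apply: (h x).
    near=> e; rewrite /x; case: asboolP => [/SB[]//|_].
    by apply: gP; near: e.
  move=> n0; near=> e; rewrite normr_id /x /y.
  have re : 0 < rho e <= 1 by near: e; apply: gauge_near.
  case: asboolP => [Se|_]; last by rewrite subrr normr0 rho_exp_ge0.
  have [_ zle _] := SB _ Se; apply: (le_trans zle); apply: rho_expM => //.
  by move: Se; near: e; apply: Snn.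
apply: nS; near=> e => Se.
have [_ _ nP] := SB _ Se; apply: nP.
have : P N e (y e) by near: e.
rewrite /y; case: asboolP => // _; apply: Pmono; first by near: e; apply: gauge_near.
by move: Se; near: e; apply: Snn.
Unshelve. all: by end_near. Qed.

Lemma near0_choice (Z : Type) (z0 : Z) (P : R -> Z -> Prop) :
  (\near0 e, exists z, P e z) -> exists z, \near0 e, P e (z e).
Proof.
move=> h; have /choice[g gP] : forall e, exists z, (exists z, P e z) -> P e z.
  move=> e; have [[z Pz]|n] := pselect (exists z, P e z); first by exists z.
  by exists z0.
by exists g; near=> e; apply: gP; near: e.
Unshelve. all: by end_near. Qed.

End Scalars.

(** * Euclidean norms *)

Section Norms.
Context {R : realType}.

Definition dotp n (x y : 'rV[R]_n) : R := \sum_i x 0 i * y 0 i.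

Lemma enorm_ge0 n (x : 'rV[R]_n) : 0 <= enorm x.
Proof. exact: sqrtr_ge0. Qed.

Lemma enorm_sqr n (x : 'rV[R]_n) : enorm x ^+ 2 = dotp x x.
Proof.
rewrite sqr_sqrtr; last by apply: sumr_ge0 => i _; rewrite sqr_ge0.
by apply: eq_bigr => i _; rewrite expr2.
Qed.

Lemma enorm0 n : enorm (0 : 'rV[R]_n) = 0.
Proof. by rewrite /enorm big1 ?sqrtr0// => i _; rewrite mxE expr0n. Qed.

Lemma coord_le_enorm n (x : 'rV[R]_n) i : `|x 0 i| <= enorm x.
Proof.
rewrite -(ler_sqr (normr_ge0 _) (enorm_ge0 x)) sqr_sqrtr; last first.
  by apply: sumr_ge0 => j _; rewrite sqr_ge0.
rewrite real_normK ?num_real// (bigD1 i)//= lerDl.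
by apply: sumr_ge0 => j _; rewrite sqr_ge0.
Qed.

Lemma enorm_le_sum n (x : 'rV[R]_n) : enorm x <= \sum_i `|x 0 i|.
Proof.
have s0 : 0 <= \sum_i `|x 0 i| by apply: sumr_ge0.
rewrite -(ler_sqr (enorm_ge0 x) s0) enorm_sqr expr2 mulr_suml.
apply: ler_sum => i _; rewrite -[leLHS]ger0_norm -?expr2 ?sqr_ge0// normrX expr2.
by rewrite ler_wpM2l// (bigD1 i)//= lerDl sumr_ge0.
Qed.

Lemma dotp_le n (x y : 'rV[R]_n) : dotp x y <= enorm x * enorm y.
Proof.
have [x0|x0] := eqVneq (enorm x) 0.
  rewrite x0 mul0r /dotp big1// => i _.
  have : `|x 0 i| <= 0 by rewrite -x0 coord_le_enorm.
  by rewrite normr_le0 => /eqP->; rewrite mul0r.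
have [y0|y0] := eqVneq (enorm y) 0.
  rewrite y0 mulr0 /dotp big1// => i _.
  have : `|y 0 i| <= 0 by rewrite -y0 coord_le_enorm.
  by rewrite normr_le0 => /eqP->; rewrite mulr0.
have a0 : 0 < enorm x by rewrite lt_def x0 enorm_ge0.
have b0 : 0 < enorm y by rewrite lt_def y0 enorm_ge0.
set a := enorm x in a0 *; set b := enorm y in b0 *.
have : 0 <= \sum_i (x 0 i * b - y 0 i * a) ^+ 2.
  by apply: sumr_ge0 => i _; rewrite sqr_ge0.
have -> : \sum_i (x 0 i * b - y 0 i * a) ^+ 2 =
    b ^+ 2 * dotp x x - 2 * a * b * dotp x y + a ^+ 2 * dotp y y.
  rewrite /dotp !mulr_sumr -sumrB -big_split/=; apply: eq_bigr => i _; ring.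
rewrite -!enorm_sqr -/a -/b => h.
have ab : 0 < a * b by rewrite mulr_gt0.
rewrite -(ler_pM2l ab); nra.
Qed.

Lemma dotpDl n (x y z : 'rV[R]_n) : dotp (x + y) z = dotp x z + dotp y z.
Proof. by rewrite -big_split/=; apply: eq_bigr => i _; rewrite mxE mulrDl. Qed.

Lemma dotpC n (x y : 'rV[R]_n) : dotp x y = dotp y x.
Proof. by apply: eq_bigr => i _; rewrite mulrC. Qed.

(** Vector estimates are tested in every direction, which reduces them to the
    scalar mean value theorem. *)
Lemma enorm_dual n (z : 'rV[R]_n) c : 0 <= c ->
  (forall w, dotp z w <= c * enorm w) -> enorm z <= c.
Proof.
move=> c0 /(_ z); rewrite -enorm_sqr expr2.
have [->//|z0] := eqVneq (enorm z) 0.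
by rewrite ler_pM2r// lt_def z0 enorm_ge0.
Qed.

Lemma enormD n (x y : 'rV[R]_n) : enorm (x + y) <= enorm x + enorm y.
Proof.
apply: enorm_dual => [|w]; first by rewrite addr_ge0 ?enorm_ge0.
by rewrite dotpDl mulrDl lerD ?dotp_le.
Qed.

Lemma enormZ n (a : R) (x : 'rV[R]_n) : enorm (a *: x) = `|a| * enorm x.
Proof.
rewrite /enorm -sqrtr_sqr -sqrtrM ?sqr_ge0// mulr_sumr; congr Num.sqrt.
by apply: eq_bigr => i _; rewrite mxE exprMn.
Qed.

Lemma enormN n (x : 'rV[R]_n) : enorm (- x) = enorm x.
Proof. by rewrite -scaleN1r enormZ normrN1 mul1r. Qed.

Lemma enormB n (x y : 'rV[R]_n) : enorm (x - y) = enorm (y - x).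
Proof. by rewrite -enormN opprB. Qed.

Lemma enormBD n (x y z : 'rV[R]_n) : enorm (x - z) <= enorm (x - y) + enorm (y - z).
Proof. by rewrite -(subrKA y x); apply: enormD. Qed.

Lemma enorm_dist n (x y : 'rV[R]_n) : `|enorm x - enorm y| <= enorm (x - y).
Proof.
rewrite ler_norml; apply/andP; split.
  by rewrite lerNl opprB lerBlDr enormB -{1}(subrK x y) enormD.
by rewrite lerBlDr -{1}(subrK y x) enormD.
Qed.

Lemma enorm_eq0 n (x : 'rV[R]_n) : enorm x <= 0 -> x = 0.
Proof.
move=> x0; apply/rowP => i; rewrite mxE; apply/eqP; rewrite -normr_le0.
exact: le_trans (coord_le_enorm _ _) x0.
Qed.

Lemma coord_le_norm n (x : 'rV[R]_n) i : `|x 0 i| <= `|x|.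
Proof. by rewrite [leRHS]mx_normrE; apply/bigmax_geP; right => /=; exists (0, i). Qed.

Lemma norm_le_coord n (x : 'rV[R]_n) c : 0 <= c ->
  (forall i, `|x 0 i| <= c) -> `|x| <= c.
Proof.
move=> c0 h; rewrite [leLHS]mx_normrE; apply/bigmax_leP; split => // -[i j] _ /=.
by rewrite ord1.
Qed.

Lemma norm_le_enorm n (x : 'rV[R]_n) : `|x| <= enorm x.
Proof. by apply: norm_le_coord; [exact: enorm_ge0|exact: coord_le_enorm]. Qed.

Lemma sum_le_norm n (x : 'rV[R]_n) : \sum_i `|x 0 i| <= n%:R * `|x|.
Proof.
apply: (@le_trans _ _ (\sum_(i < n) `|x|)).
  by apply: ler_sum => i _; apply: coord_le_norm.
by rewrite sumr_const card_ord mulr_natl.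
Qed.

Lemma enorm_le_norm n (x : 'rV[R]_n) : enorm x <= n%:R * `|x|.
Proof. exact: le_trans (enorm_le_sum x) (sum_le_norm x). Qed.

Lemma norm_row_mx n m (x : 'rV[R]_n) (y : 'rV[R]_m) c :
  `|x| <= c -> `|y| <= c -> `|row_mx x y| <= c.
Proof.
move=> xc yc; apply: norm_le_coord => [|i]; first exact: le_trans xc.
rewrite mxE; case: splitP => j _; [apply: le_trans xc|apply: le_trans yc];
  exact: coord_le_norm.
Qed.

(** * Operator norm *)

Definition msum m n (A : 'M[R]_(m, n)) : R := \sum_i \sum_j `|A i j|.

Lemma msum_ge0 m n (A : 'M[R]_(m, n)) : 0 <= msum A.
Proof. by do 2!apply: sumr_ge0 => ? _. Qed.

Lemma enorm_mul_le m n (x : 'rV[R]_m) (A : 'M[R]_(m, n)) :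
  enorm (x *m A) <= msum A * enorm x.
Proof.
apply: (le_trans (enorm_le_sum _)); rewrite /msum exchange_big/= mulr_suml.
apply: ler_sum => j _; rewrite mxE; apply: (le_trans (ler_norm_sum _ _ _)).
rewrite mulr_suml; apply: ler_sum => i _.
by rewrite normrM mulrC ler_wpM2l// coord_le_enorm.
Qed.

Lemma opnorm_has_sup m n (A : 'M[R]_(m, n)) :
  has_sup [set enorm (x *m A) | x in [set x : 'rV[R]_m | enorm x <= 1]].
Proof.
split; first by exists (enorm (0 *m A)), 0; rewrite //= enorm0.
exists (msum A) => _ [x /= x1 <-]; apply: (le_trans (enorm_mul_le _ _)).
by rewrite ler_piMr// msum_ge0.
Qed.

Lemma opnorm_ge0 m n (A : 'M[R]_(m, n)) : 0 <= opnorm A.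
Proof.
apply: (@le_trans _ _ (enorm (0 *m A))); first exact: enorm_ge0.
by apply: (ub_le_sup (opnorm_has_sup A).2); exists 0; rewrite //= enorm0.
Qed.

Lemma enorm_opnorm m n (x : 'rV[R]_m) (A : 'M[R]_(m, n)) :
  enorm (x *m A) <= opnorm A * enorm x.
Proof.
have [x0|x0] := eqVneq (enorm x) 0.
  have -> : x = 0 by apply: enorm_eq0; rewrite x0.
  by rewrite mul0mx !enorm0 mulr0.
have a0 : 0 < enorm x by rewrite lt_def x0 enorm_ge0.
rewrite -ler_pdivrMr// mulrC -[X in X * _]ger0_norm ?invr_ge0 ?enorm_ge0//.
rewrite -enormZ scalemxAl; apply: (ub_le_sup (opnorm_has_sup A).2).
exists ((enorm x)^-1 *: x) => //=.
by rewrite enormZ ger0_norm ?invr_ge0 ?enorm_ge0// mulVf.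
Qed.

Lemma opnorm_le m n (A : 'M[R]_(m, n)) c :
  (forall x, enorm x <= 1 -> enorm (x *m A) <= c) -> opnorm A <= c.
Proof.
move=> h; apply: ge_sup; first exact: (opnorm_has_sup A).1.
by move=> _ [x /= x1 <-]; apply: h.
Qed.

Lemma opnorm_dist m n (A B : 'M[R]_(m, n)) : opnorm A <= opnorm B + msum (A - B).
Proof.
apply: opnorm_le => x x1.
have -> : x *m A = x *m B + x *m (A - B) by rewrite -mulmxDr addrC subrK.
apply: (le_trans (enormD _ _)); apply: lerD.
  by apply: (le_trans (enorm_opnorm _ _)); rewrite ler_piMr ?opnorm_ge0.
by apply: (le_trans (enorm_mul_le _ _)); rewrite ler_piMr// msum_ge0.
Qed.

(** By duality a matrix and its transpose have the same operator norm; the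
    adjoint equation is therefore as contracting as the state equation. *)
Lemma enorm_opnorm_tr n (x : 'rV[R]_n) (A : 'M[R]_n) :
  enorm (x *m A^T) <= opnorm A * enorm x.
Proof.
apply: enorm_dual => [|w]; first by rewrite mulr_ge0 ?opnorm_ge0 ?enorm_ge0.
have -> : dotp (x *m A^T) w = dotp (w *m A) x.
  rewrite /dotp; under eq_bigr do rewrite mxE mulr_suml.
  under [RHS]eq_bigr do rewrite mxE mulr_suml.
  rewrite exchange_big/=; apply: eq_bigr => i _; apply: eq_bigr => j _.
  by rewrite mxE; ring.
apply: (le_trans (dotp_le _ _)).
rewrite mulrAC; apply: ler_wpM2r; [exact: enorm_ge0|exact: enorm_opnorm].
Qed.

Lemma dotp_norm n (x y : 'rV[R]_n) : `|dotp x y| <= enorm x * enorm y.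
Proof.
rewrite ler_norml dotp_le andbT lerNl -[enorm x]enormN.
suff -> : - dotp x y = dotp (- x) y by exact: dotp_le.
by rewrite /dotp -sumrN; apply: eq_bigr => i _; rewrite mxE mulNr.
Qed.

(** The derivative of cost difference plus pairing with the adjoint state,
    arranged as Taylor remainder of the Hamiltonian, first order terms, and
    defects of the differential equations. *)
Lemma slope_identity n (L' L : R) (f' f dq' dq z adj dp p : 'rV[R]_n) (HH : R) :
  L' - L + (dotp dp z + dotp p (dq' - dq)) =
  (L' + dotp p f' - (L + dotp p f) - (- dotp adj z - HH)) + (- dotp adj z - HH) +
  (dotp adj z + dotp (dp - adj) z) + (dotp p (dq' - f') - dotp p (dq - f)).
Proof.
have dB (x y w : 'rV[R]_n) : dotp x (y - w) = dotp x y - dotp x w.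
  by rewrite /dotp -sumrB; apply: eq_bigr => i _; rewrite !mxE mulrBr.
have dBl (x y w : 'rV[R]_n) : dotp (y - w) x = dotp y x - dotp w x by rewrite dotpC dB ![dotp x _]dotpC.
by rewrite !dB dBl; ring.
Qed.

Lemma convex_comb_enorm n (q q' c : 'rV[R]_n) (s M : R) : 0 <= s <= 1 ->
  enorm (q - c) <= M -> enorm (q' - c) <= M -> enorm (q + s *: (q' - q) - c) <= M.
Proof.
move=> /andP[s0 s1] h h'.
have -> : q + s *: (q' - q) - c = (1 - s) *: (q - c) + s *: (q' - c).
  by apply/rowP => i; rewrite !mxE; ring.
apply: (le_trans (enormD _ _)); rewrite !enormZ !ger0_norm ?subr_ge0//.
have s10 : 0 <= 1 - s by rewrite subr_ge0.
have := ler_wpM2l s10 h; have := ler_wpM2l s0 h'; lra.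
Qed.

(** The radial projection onto the ball. *)
Lemma retract_ball n (q0 q : 'rV[R]_n) r : 0 <= r ->
  exists q', enorm (q' - q0) <= r /\ enorm (q - q') <= Num.max 0 (enorm (q - q0) - r).
Proof.
move=> r0; have [qr|qr] := leP (enorm (q - q0)) r.
  by exists q; rewrite subrr enorm0 le_max lexx.
have n0 : 0 < enorm (q - q0) := le_lt_trans r0 qr.
pose s := r / enorm (q - q0).
have s0 : 0 <= s by rewrite divr_ge0 ?enorm_ge0.
have s1 : s <= 1 by rewrite ler_pdivrMr// mul1r ltW.
exists (q0 + s *: (q - q0)); split.
  by rewrite addrAC subrr add0r enormZ ger0_norm// /s mulfVK ?gt_eqF.
have -> : q - (q0 + s *: (q - q0)) = (1 - s) *: (q - q0).
  by rewrite opprD addrA scalerBl scale1r.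
rewrite enormZ ger0_norm ?subr_ge0// mulrBl mul1r /s mulfVK ?gt_eqF//.
by rewrite le_max lexx orbT.
Qed.

End Norms.

(** * Mean values, chain rule and Taylor estimates *)

Section Calculus.
Context {R : realType}.

Lemma is_derive_cvgP (V : normedModType R) (f : V -> R) (x v : V) (d : R) :
  is_derive x v f d <-> h^-1 * (f (h *: v + x) - f x) @[h --> (0 : R)^'] --> d.
Proof.
split => [[df <-]|h]; first exact: df.
apply: DeriveDef; first by apply/cvg_ex; exists d.
by apply: cvg_lim => //; apply: h.
Qed.

Lemma is_derive_line (V : normedModType R) (f : V -> R) (x v : V) (t d : R) :
  is_derive (x + t *: v) v f d -> is_derive t 1 (fun s : R => f (x + s *: v)) d.
Proof.
move=> /is_derive_cvgP h; apply/is_derive_cvgP; move: h.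
set g := fun _ => _; set k := fun _ => _; suff -> : g = k by [].
apply/funext => h; rewrite /g /k; congr (_ * (f _ - _)).
by rewrite scalerDl -[h *: 1]/(h * 1) mulr1 addrCA.
Qed.

Lemma is_derive_cts (f : R -> R) (t d : R) : is_derive t 1 f d -> {for t, continuous f}.
Proof. by move=> [df _]; apply/differentiable_continuous/derivable1_diffP. Qed.

Lemma within_itv_cts (f : R -> R) (a b : R) :
  (forall t, a <= t <= b -> {for t, continuous f}) -> {within `[a, b], continuous f}.
Proof.
move=> h; apply: continuous_in_subspaceT => t; rewrite inE/= in_itv/= => tab.
exact: h.
Qed.

Lemma MVT_any (f df : R -> R) (a b : R) :
  (forall t, Num.min a b <= t <= Num.max a b -> is_derive t 1 f (df t)) ->
  exists2 c, Num.min a b <= c <= Num.max a b & f b - f a = df c * (b - a).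
Proof.
wlog ab : a b / a <= b => [H|].
  case/orP: (le_total a b) => [|ba] h; first exact: H.
  have [|c ch cE] := H b a ba; first by move=> t; rewrite minC maxC; apply: h.
  exists c; first by rewrite minC maxC.
  by rewrite -opprB cE; ring.
rewrite (min_idPl ab) (max_idPr ab) => h.
have [t|t|c ch cE] := @MVT_segment R f df a b ab.
- by rewrite in_itv/= => /andP[at' tb]; apply: h; rewrite !ltW.
- by apply: within_itv_cts => {}t /h /is_derive_cts.
- by exists c => //; move: ch; rewrite in_itv.
Qed.

Lemma MVT_le (f df : R -> R) (a b M : R) : a <= b ->
  (forall t, a <= t <= b -> is_derive t 1 f (df t)) ->
  (forall t, a < t < b -> df t <= M) -> f b - f a <= M * (b - a).
Proof.
rewrite le_eqVlt => /predU1P[->|ab] h hM; first by rewrite !subrr mulr0.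
have [t|t|c] := @MVT R f df a b ab.
- by rewrite in_itv/= => /andP[at' tb]; apply: h; rewrite !ltW.
- by apply: within_itv_cts => {}t /h /is_derive_cts.
- by rewrite in_itv/= => /hM cM ->; rewrite ler_wpM2r// subr_ge0 ltW.
Qed.

Lemma is_deriveZl (f : R -> R) (t d c : R) :
  is_derive t 1 f d -> is_derive t 1 (fun s => c * f s) (c * d).
Proof. by move=> h; apply: is_deriveZ. Qed.

Lemma is_derive_sumr (V : normedModType R) n (f : 'I_n -> V -> R) (x v : V) (d : 'I_n -> R) :
  (forall i, is_derive x v (f i) (d i)) ->
  is_derive x v (fun s => \sum_i f i s) (\sum_i d i).
Proof. by move=> h; have := is_derive_sum h; rewrite fct_sumE. Qed.

(** Pairing with the increment reduces the vector-valued mean value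
    inequality to the scalar one. *)
Lemma MVT_enorm n (x dx : R -> 'rV[R]_n) (a b M : R) : a <= b ->
  (forall t, a <= t <= b -> forall j, is_derive t 1 (fun s => x s 0 j) (dx t 0 j)) ->
  (forall t, a < t < b -> enorm (dx t) <= M) ->
  enorm (x b - x a) <= M * (b - a).
Proof.
rewrite le_eqVlt => /predU1P[->|ab] h hM; first by rewrite !subrr mulr0 enorm0.
set w := x b - x a.
have M0 : 0 <= M.
  apply: le_trans (hM ((a + b) / 2) _); first exact: enorm_ge0.
  by rewrite midf_lt//= midf_lt.
have : \sum_j w 0 j * x b 0 j - \sum_j w 0 j * x a 0 j <= M * enorm w * (b - a).
  apply: (@MVT_le (fun t => \sum_j w 0 j * x t 0 j) (fun t => \sum_j w 0 j * dx t 0 j)).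
  - exact: ltW.
  - by move=> t tab; apply: is_derive_sumr => j; apply: is_deriveZl; apply: h.
  - move=> t tab; apply: (le_trans (dotp_le _ _)).
    by rewrite mulrC ler_wpM2r ?enorm_ge0// hM.
have -> : \sum_j w 0 j * x b 0 j - \sum_j w 0 j * x a 0 j = enorm w ^+ 2.
  rewrite enorm_sqr -sumrB; apply: eq_bigr => j _.
  by rewrite -mulrBr; congr (_ * _); rewrite !mxE.
rewrite expr2 mulrAC.
have [->|w0] := eqVneq (enorm w) 0; first by rewrite mulr_ge0// subr_ge0 ltW.
by rewrite ler_pM2r// lt_def w0 enorm_ge0.
Qed.

Lemma MVT_enorm_any n (x dx : R -> 'rV[R]_n) (a b s t M : R) :
  (forall t, a <= t <= b -> forall j, is_derive t 1 (fun s => x s 0 j) (dx t 0 j)) ->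
  (forall t, a <= t <= b -> enorm (dx t) <= M) ->
  a <= s <= b -> a <= t <= b ->
  enorm (x t - x s) <= M * `|t - s|.
Proof.
move=> h hM; wlog st : s t / s <= t => [H|].
  have [st sab tab|/ltW ts sab tab] := leP s t; first exact: H.
  by rewrite enormB distrC; apply: H.
move=> /andP[as' sb] /andP[at' tb].
rewrite ger0_norm ?subr_ge0//.
apply: (@MVT_enorm _ x dx) => // u /andP[su ut].
  by apply: h; rewrite (le_trans as')//= (le_trans ut).
by apply: hM; rewrite (le_trans as' (ltW su))//= (le_trans (ltW ut)).
Qed.

Lemma cvg_sumr (T : Type) (F : set_system T) (FF : Filter F) (I : Type) (r : seq I)
    (f : I -> T -> R) (l : I -> R) :
  (forall i, f i x @[x --> F] --> l i) ->
  \sum_(i <- r) f i x @[x --> F] --> \sum_(i <- r) l i.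
Proof.
move=> h; elim: r => [|i r ih].
  by under eq_fun do rewrite big_nil; rewrite big_nil; apply: cvg_cst.
under eq_fun do rewrite big_cons; rewrite big_cons; exact: cvgD.
Qed.

Lemma enorm_continuous (T : topologicalType) n (x : T -> 'rV[R]_n) (t : T) :
  (forall j, {for t, continuous (fun s => x s 0 j)}) ->
  {for t, continuous (fun s => enorm (x s))}.
Proof.
move=> h; apply: (@continuous_comp _ _ _ (fun s => \sum_j x s 0 j ^+ 2) Num.sqrt).
  apply: cvg_sumr => j; rewrite /= expr2.
  by under eq_fun do rewrite expr2; apply: cvgM; apply: h.
exact: sqrt_continuous.
Qed.

(** A barrier (first exit) estimate: while |x| stays below r + dl its speed
    is too small to reach that level within the interval. *)
Lemma barrier n (x dx : R -> 'rV[R]_n) (a b r dl A B : R) : a < b ->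
  (forall t, a <= t <= b -> forall j, is_derive t 1 (fun s => x s 0 j) (dx t 0 j)) ->
  enorm (x a) <= A -> 0 <= r -> 0 <= B ->
  (forall t, a <= t <= b -> enorm (x t) <= r + dl ->
    (b - a) * enorm (dx t) <= r + Num.max 0 (enorm (x t) - r) / 2 + B) ->
  2 * (A + B) < dl ->
  forall t, a <= t <= b -> enorm (x t) <= r + 2 * (A + B).
Proof.
move=> ab dxE xA r0 B0 hb hdl s /andP[as' sb]; rewrite leNgt; apply/negP => hs.
have A0 : 0 <= A by apply: le_trans xA; exact: enorm_ge0.
pose l := Num.min (enorm (x s)) (r + dl).
have rl : r + 2 * (A + B) < l by rewrite lt_min hs ltrD2l.
pose S := [set t | a <= t <= s /\ l <= enorm (x t)].
have Ss : S s by split; [rewrite as' lexx|rewrite ge_min lexx].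
have lbS : has_inf S by split; [exists s|exists a => t [/andP[]]].
pose tau := inf S.
have atau : a <= tau by apply: lb_le_inf; [exists s|move=> t [/andP[]]].
have taus : tau <= s by apply: ge_inf => //; case: lbS.
have xcts t : a <= t <= b -> {for t, continuous (fun s => enorm (x s))}.
  by move=> tab; apply: enorm_continuous => j; apply: (is_derive_cts (dxE t tab j)).
have ltl t : a <= t < tau -> enorm (x t) < l.
  move=> /andP[at' ttau]; rewrite ltNge; apply/negP => lx.
  have : tau <= t by apply: ge_inf; [case: lbS|split=> //; rewrite at' (le_trans (ltW ttau))].
  by rewrite leNgt ttau.
have ltau : l <= enorm (x tau).
  rewrite leNgt; apply/negP => xl.
  have [] : a <= tau <= b by rewrite atau (le_trans taus).
  have atb : a <= tau <= b by rewrite atau (le_trans taus).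
  have := cvgr_lt (enorm (x tau)) (xcts _ atb) l xl => -[e /= e0 he].
  have [t [tS lt] te] := inf_adherent e0 lbS.
  have taut : tau <= t by apply: ge_inf => //; case: lbS.
  have : enorm (x t) < l.
    by apply: he => /=; rewrite distrC ger0_norm ?subr_ge0// ltrBlDl.
  by rewrite ltNge lt.
have ltau0 : 0 < l - r by rewrite subr_gt0; lra.
have : enorm (x tau - x a) <= (r + (l - r) / 2 + B) / (b - a) * (tau - a).
  apply: (@MVT_enorm _ x dx) => //.
    move=> t /andP[at' tt]; apply: dxE; rewrite at'/=.
    by rewrite (le_trans tt)// (le_trans taus).
  move=> t /andP[at' tt]; rewrite ler_pdivlMr ?subr_gt0// mulrC.
  have xl : enorm (x t) < l by apply: ltl; rewrite (ltW at').
  have tab : a <= t <= b by rewrite (ltW at')/= (le_trans (ltW tt))// (le_trans taus).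
  apply: (le_trans (hb t tab _)).
    by apply: (le_trans (ltW xl)); rewrite ge_min lexx orbT.
  rewrite lerD2r lerD2l ler_pM2r ?invr_gt0// ge_max (ltW ltau0)/= lerD2r; exact: ltW.
have -> : (r + (l - r) / 2 + B) / (b - a) * (tau - a) = (r + (l - r) / 2 + B) * ((tau - a) / (b - a)).
  by rewrite mulrAC mulrA.
have q1 : (tau - a) / (b - a) <= 1.
  by rewrite ler_pdivrMr ?subr_gt0// mul1r lerD2r (le_trans taus).
have c0 : 0 <= r + (l - r) / 2 + B by lra.
have c1 := ler_wpM2l c0 q1.
have := enorm_dist (x tau) (x a); rewrite ler_norml => /andP[_].
lra.
Qed.

(** Differentiation along coordinates with continuous partials: the increment
    is the sum of the partials at intermediate points, one for each step of a
    path that changes the coordinates one after the other. *)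
Lemma partial_increment n (f : 'rV[R]_n -> R) (D : 'I_n -> 'rV[R]_n -> R)
    (y : 'rV[R]_n) (r : R) :
  (forall z i, `|z - y| < r -> is_derive z (delta_mx 0 i) f (D i z)) ->
  forall h : 'rV[R]_n, `|h| < r -> exists xi : 'I_n -> 'rV[R]_n,
    (forall i, `|xi i - y| <= `|h|) /\
    f (y + h) - f y = \sum_i h 0 i * D i (xi i).
Proof.
move=> fD h hr.
pose p (k : nat) : 'rV[R]_n := \row_i (if (i < k)%N then h 0 i else 0).
have p0 : p 0%N = 0 by apply/rowP => i; rewrite !mxE.
have pn : p n = h by apply/rowP => i; rewrite !mxE ltn_ord.
have step (i : 'I_n) : exists z : 'rV[R]_n, `|z - y| <= `|h| /\
    f (y + p i.+1) - f (y + p i) = h 0 i * D i z.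
  pose c (t : R) : 'rV[R]_n := y + p i + t *: delta_mx 0 i.
  have ch (t : R) : Num.min 0 (h 0 i) <= t <= Num.max 0 (h 0 i) -> `|c t - y| <= `|h|.
    move=> tb; apply: norm_le_coord => // j.
    have -> : (c t - y) 0 j = (if (j < i)%N then h 0 j else 0) + t * (j == i)%:R.
      by rewrite /c !mxE /=; ring.
    have [->|ji] := eqVneq j i.
      rewrite ltnn add0r mulr1.
      apply: le_trans (coord_le_norm h i); move: tb.
      have ha := ler_norm (h 0 i); have hb := ler_norm (- h 0 i); rewrite normrN in hb.
      have [h0|h0] := lerP 0 (h 0 i) => /andP[t1 t2]; rewrite ler_norml; apply/andP; split; lra.
    rewrite mulr0 addr0; case: ifP => _; last by rewrite normr0.
    exact: coord_le_norm.
  have [t tb|t tb tE] := @MVT_any (fun t => f (c t)) (fun t => D i (c t)) 0 (h 0 i).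
    by apply: is_derive_line; apply: fD; apply: le_lt_trans hr; apply: ch.
  exists (c t); split; first exact: ch.
  have <- : c (h 0 i) = y + p i.+1.
    rewrite /c -addrA; congr (_ + _); apply/rowP => j; rewrite !mxE /= ltnS [(j <= i)%N]leq_eqVlt.
    rewrite -[(j == i :> nat)]/(j == i); have [->|ji] := eqVneq j i; first by rewrite ltnn add0r mulr1.
    by rewrite mulr0 addr0.
  have <- : c 0 = y + p i by rewrite /c scale0r addr0.
  by rewrite tE subr0 mulrC.
have /choice[xi xiP] := step; exists xi; split; first by move=> i; exact: (xiP i).1.
rewrite -{1}pn -{2}[y]addr0 -p0 -(telescope_sumr (fun k => f (y + p k)) (leq0n n)).
by rewrite big_mkord; apply: eq_bigr => i _; rewrite (xiP i).2.
Qed.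

(** Continuity of the partials suffices: the increment is a sum of partials at
    intermediate points that converge to c x. *)
Lemma is_derive_chain n (V : normedModType R) (f : 'rV[R]_n -> R)
    (D : 'I_n -> 'rV[R]_n -> R) (A : set 'rV[R]_n)
    (c : V -> 'rV[R]_n) (x v : V) (c' : 'I_n -> R) :
  open A -> A (c x) ->
  (forall z i, A z -> is_derive z (delta_mx 0 i) f (D i z)) ->
  (forall i, {for c x, continuous (D i)}) ->
  (forall i, is_derive x v (fun s => c s 0 i) (c' i)) ->
  is_derive x v (fun s => f (c s)) (\sum_i D i (c x) * c' i).
Proof.
move=> oA Ac fD Dc cc.
have /nbhs_ballP[r /= r0 rA] : nbhs (c x) A by apply: open_nbhs_nbhs.
have fD' z i : `|z - c x| < r -> is_derive z (delta_mx 0 i) f (D i z).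
  by move=> zr; apply: fD; apply: rA; rewrite -ball_normE /= distrC.
have /choice[xi xiP] : forall h : 'rV[R]_n, exists xi : 'I_n -> 'rV[R]_n,
    `|h| < r -> (forall i, `|xi i - c x| <= `|h|) /\
      f (c x + h) - f (c x) = \sum_i h 0 i * D i (xi i).
  move=> h; have [hr|hr] := ltP `|h| r; last by exists (fun=> c x).
  by have [xi] := partial_increment fD' hr; exists xi.
pose k (h : R) := c (h *: v + x) - c x.
have kq i : h^-1 * k h 0 i @[h --> (0 : R)^'] --> c' i.
  have /is_derive_cvgP := cc i; rewrite /k; set a := fun _ => _; set b := fun _ => _.
  by suff -> : a = b by []; apply/funext => h; rewrite /a /b !mxE.
have ki i : k h 0 i @[h --> (0 : R)^'] --> 0.
  have h0 : h @[h --> (0 : R)^'] --> (0 : R) by exact: (@nbhs_dnbhs R).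
  have hk : h * (h^-1 * k h 0 i) @[h --> (0 : R)^'] --> 0.
    by rewrite -[X in _ --> X](mul0r (c' i)); exact: cvgM h0 (kq i).
  apply: (cvg_trans _ hk); apply: near_eq_cvg.
  near=> h; rewrite /= mulrA mulfV ?mul1r//; near: h; exact: nbhs_dnbhs_neq.
have k0 : `|k h| @[h --> (0 : R)^'] --> 0.
  have k1 : \sum_i `|k h 0 i| @[h --> (0 : R)^'] --> 0.
    have E : (0 : R) = \sum_(i < n) 0 by rewrite big1.
    rewrite [X in _ --> X]E.
    apply: (@cvg_sumr _ _ _ _ _ (fun i h => `|k h 0 i|) (fun=> 0)) => i.
    by apply/norm_cvg0P; exact: ki.
  apply: (squeeze_cvgr _ (cvg_cst 0) k1); near=> h; rewrite normr_ge0/=.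
  exact: le_trans (norm_le_enorm _) (enorm_le_sum _).
have kr : \forall h \near (0 : R)^', `|k h| < r by apply: (cvgr_lt 0 k0).
have xic i : xi (k h) i @[h --> (0 : R)^'] --> c x.
  apply/cvgrPdist_lt => e e0; near=> h.
  have h1 : `|k h| < r by near: h.
  have [h2 _] := xiP _ h1.
  rewrite distrC; apply: le_lt_trans (h2 i) _; near: h.
  exact: (cvgr_lt 0 k0).
apply/is_derive_cvgP.
have hk : \sum_i D i (xi (k h) i) * (h^-1 * k h 0 i) @[h --> (0 : R)^'] --> \sum_i D i (c x) * c' i.
  apply: cvg_sumr => i; apply: cvgM; last exact: kq.
  by apply: (cvg_comp _ (D i) (xic i)); exact: Dc.
apply: (cvg_trans _ hk); apply: near_eq_cvg; near=> h.
have h1 : `|k h| < r by near: h.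
have [_ h2] := xiP _ h1.
have -> : c (h *: v + x) = c x + k h by rewrite /k subrKC.
rewrite h2 mulr_sumr; apply: eq_bigr => i _; ring.
Unshelve. all: by end_near. Qed.

Lemma segment_increment n (f : 'rV[R]_n -> R) (D : 'I_n -> 'rV[R]_n -> R)
    (A : set 'rV[R]_n) (x y : 'rV[R]_n) :
  open A -> (forall t : R, 0 <= t <= 1 -> A (x + t *: (y - x))) ->
  (forall z i, A z -> is_derive z (delta_mx 0 i) f (D i z)) ->
  (forall z i, A z -> {for z, continuous (D i)}) ->
  forall t : R, 0 <= t <= 1 ->
  is_derive t 1 (fun t : R => f (x + t *: (y - x)))
    (\sum_i D i (x + t *: (y - x)) * (y - x) 0 i).
Proof.
move=> oA hA fD Dc t t01.
apply: (@is_derive_chain n R f D A (fun t => x + t *: (y - x)) t 1 ((y - x) 0)) => //.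
- exact: hA.
- by move=> i; apply: Dc; apply: hA.
- move=> i.
  rewrite (_ : (fun _ => _) = cst (x 0 i) + (y - x) 0 i \*: id); last first.
    by apply/funext => s; rewrite !mxE /= mulrC.
  by apply: is_derive_eq; rewrite add0r -[X in X = _]/(_ * 1) mulr1.
Qed.

Lemma segment_lipschitz n (f : 'rV[R]_n -> R) (D : 'I_n -> 'rV[R]_n -> R)
    (A : set 'rV[R]_n) (x y : 'rV[R]_n) (C : R) :
  open A -> (forall t : R, 0 <= t <= 1 -> A (x + t *: (y - x))) ->
  (forall z i, A z -> is_derive z (delta_mx 0 i) f (D i z)) ->
  (forall z i, A z -> {for z, continuous (D i)}) ->
  (forall (t : R) i, 0 <= t <= 1 -> `|D i (x + t *: (y - x))| <= C) ->
  `|f y - f x| <= C * (n%:R * `|y - x|).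
Proof.
move=> oA hA fD Dc hC; have hS := segment_increment oA hA fD Dc.
have [t|t] := @MVT_any (fun t => f (x + t *: (y - x)))
    (fun t => \sum_i D i (x + t *: (y - x)) * (y - x) 0 i) 0 1.
  by rewrite (min_idPl ler01) (max_idPr ler01); apply: hS.
rewrite (min_idPl ler01) (max_idPr ler01) scale1r scale0r addr0 subrKC subr0 mulr1.
move=> t01 ->; apply: (le_trans (ler_norm_sum _ _ _)).
have C0 : n%:R * `|y - x| = 0 \/ 0 <= C.
  case: n f D A x y oA hA fD Dc hC hS t01 => [|n] f D A x y oA hA fD Dc hC hS t01.
    by left; rewrite mul0r.
  by right; apply: le_trans (hC 0 ord0 _); rewrite ?lexx ?ler01.
have : \sum_i `|D i (x + t *: (y - x)) * (y - x) 0 i| <= C * \sum_i `|(y - x) 0 i|.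
  rewrite mulr_sumr; apply: ler_sum => i _; rewrite normrM ler_wpM2r//; exact: hC.
move=> /le_trans; apply.
case: C0 => [z0|C0]; last by rewrite ler_wpM2l// sum_le_norm.
have s0 : \sum_i `|(y - x) 0 i| = 0.
  apply/eqP; rewrite eq_le; apply/andP; split; last exact: sumr_ge0.
  by rewrite -[X in _ <= X]z0 sum_le_norm.
by rewrite s0 z0.
Qed.

(** The mean value theorem along the segment, first for f and then for its
    partials. *)
Lemma segment_taylor2 n (f : 'rV[R]_n -> R) (D : 'I_n -> 'rV[R]_n -> R)
    (DD : 'I_n -> 'I_n -> 'rV[R]_n -> R) (A : set 'rV[R]_n) (x y : 'rV[R]_n) (C : R) :
  open A -> (forall t : R, 0 <= t <= 1 -> A (x + t *: (y - x))) ->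
  (forall z i, A z -> is_derive z (delta_mx 0 i) f (D i z)) ->
  (forall z i j, A z -> is_derive z (delta_mx 0 j) (D i) (DD i j z)) ->
  (forall z i, A z -> {for z, continuous (D i)}) ->
  (forall z i j, A z -> {for z, continuous (DD i j)}) ->
  (forall (t : R) i j, 0 <= t <= 1 -> `|DD i j (x + t *: (y - x))| <= C) ->
  `|f y - f x - \sum_i D i x * (y - x) 0 i| <= C * (n%:R * `|y - x|) ^+ 2.
Proof.
move=> oA hA fD DDD Dc DDc hC; have hS := segment_increment oA hA fD Dc.
have [t|t] := @MVT_any (fun t => f (x + t *: (y - x)))
    (fun t => \sum_i D i (x + t *: (y - x)) * (y - x) 0 i) 0 1.
  by rewrite (min_idPl ler01) (max_idPr ler01); apply: hS.
rewrite (min_idPl ler01) (max_idPr ler01) scale1r scale0r addr0 subrKC subr0 mulr1.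
move=> t01 ->; rewrite -sumrB.
pose z := x + t *: (y - x).
have /andP[t0 t1] := t01.
have zx : z - x = t *: (y - x) by rewrite /z addrC addKr.
have hD i : `|D i z - D i x| <= C * (n%:R * `|y - x|).
  have C0 : 0 <= C by apply: le_trans (hC 0 i i _); rewrite ?lexx ?ler01.
  apply: (@le_trans _ _ (C * (n%:R * `|z - x|))).
    apply: (@segment_lipschitz n (D i) (DD i) A) => //.
    - move=> s /andP[s0 s1]; rewrite zx scalerA; apply: hA.
      by rewrite mulr_ge0//= mulr_ile1.
    - by move=> w j; apply: DDc.
    - move=> s j /andP[s0 s1]; rewrite zx scalerA; apply: hC.
      by rewrite mulr_ge0//= mulr_ile1.
  rewrite ler_wpM2l// ler_wpM2l// zx mx_normZ ger0_norm// ler_piMl//.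
apply: (le_trans (ler_norm_sum _ _ _)).
apply: (@le_trans _ _ (\sum_i C * (n%:R * `|y - x|) * `|(y - x) 0 i|)).
  by apply: ler_sum => i _; rewrite -mulrBl normrM ler_wpM2r//; exact: hD.
have [n0|n0] := posnP n.
  by subst n; rewrite big_ord0 !mul0r expr0n mulr0.
have C0 : 0 <= C by apply: le_trans (hC 0 (Ordinal n0) (Ordinal n0) _); rewrite ?lexx ?ler01.
rewrite -mulr_sumr.
have -> : C * (n%:R * `|y - x|) ^+ 2 = C * (n%:R * `|y - x|) * (n%:R * `|y - x|) by ring.
rewrite ler_wpM2l ?sum_le_norm//.
by rewrite !mulr_ge0.
Qed.

(** * Primitives and Picard iteration *)

(** The fundamental theorem of calculus on a larger interval, in which a and b
    are interior points. *)
Lemma antiderivative (g : R -> R) (a b : R) : continuous g ->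
  exists G : R -> R, forall t, a <= t <= b -> is_derive t 1 G (g t).
Proof.
move=> cg; pose mu := @lebesgue_measure R.
exists (fun x => (\int[mu]_(t in `[a - 1, x]) g t)%R) => t /andP[at' tb].
have int : mu.-integrable `[a - 1, b + 1] (EFin \o g).
  apply: continuous_compact_integrable; first exact: segment_compact.
  exact: continuous_subspaceT.
have [||dG GE] := @continuous_FTC1_closed R g (a - 1) t (b + 1) _ int _ (cg t).
- by rewrite (le_lt_trans tb)// ltrDl.
- by rewrite (lt_le_trans _ at')// ltrBlDr ltrDl.
by apply: (DeriveDef dG); rewrite -derive1E; exact: GE.
Qed.

Lemma Rintegral_antiderivative (f F : R -> R) (a b : R) : a < b ->
  (forall t, a <= t <= b -> {for t, continuous f}) ->
  (forall t, a <= t <= b -> is_derive t 1 F (f t)) ->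
  (\int[@lebesgue_measure R]_(t in `[a, b]) f t)%R = F b - F a.
Proof.
move=> ab fc dF; rewrite /Rintegral (@continuous_FTC2 R f F a b)//.
- exact: within_itv_cts.
- split => [t||].
  + by rewrite in_itv/= => /andP[at' tb]; have [] := dF t; rewrite ?ltW.
  + by apply: cvg_at_right_filter; apply: (is_derive_cts (dF _ _)); rewrite lexx ltW.
  + by apply: cvg_at_left_filter; apply: (is_derive_cts (dF _ _)); rewrite lexx ltW.
- move=> t; rewrite in_itv/= => /andP[at' tb]; rewrite derive1E.
  by have [] := dF t; rewrite ?ltW.
Qed.

(** The retraction of the line onto [a, b], which extends functions from [a, b]
    continuously. *)
Definition clamp (a b t : R) : R := Num.max a (Num.min b t).

Lemma clamp_itv a b t : a <= b -> a <= clamp a b t <= b.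
Proof. by move=> ab; rewrite /clamp le_max lexx/= ge_max ab ge_min lexx. Qed.

Lemma clamp_id a b t : a <= t <= b -> clamp a b t = t.
Proof. by move=> /andP[at' tb]; rewrite /clamp (min_idPr tb) (max_idPr at'). Qed.

Lemma clamp_dist a b s t : a <= b -> `|clamp a b t - clamp a b s| <= `|t - s|.
Proof.
move=> ab; rewrite /clamp.
have := ler_norm (t - s); have := ler_norm (- (t - s)); rewrite normrN.
by case: (leP b t); case: (leP b s); case: (leP a t); case: (leP a s) => *;
  do ?[rewrite (max_idPr _)//]; do ?[rewrite (max_idPl _)//];
  rewrite ler_norml; apply/andP; split; rewrite /Num.max; repeat case: ifP => ?; lra.
Qed.

Lemma lipschitz_continuous1 (f : R -> R) (M : R) :
  (forall s t, `|f t - f s| <= M * `|t - s|) -> continuous f.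
Proof.
move=> h t; apply/cvgrPdist_lt => e e0; near=> s.
apply: le_lt_trans (h _ _) _.
have M0 : 0 < `|M| + 1 by rewrite ltr_wpDl.
apply: (@le_lt_trans _ _ ((`|M| + 1) * `|t - s|)).
  by rewrite ler_wpM2r// (le_trans (ler_norm M))// lerDl.
rewrite -ltr_pdivlMl//; near: s.
by exists ((`|M| + 1)^-1 * e) => //=; rewrite mulr_gt0 ?invr_gt0.
Unshelve. all: by end_near. Qed.

Lemma clamp_continuous a b : a <= b -> continuous (clamp a b).
Proof.
by move=> ab; apply: (@lipschitz_continuous1 _ 1) => s t; rewrite mul1r clamp_dist.
Qed.

Lemma clampP (a b t : R) : a <= b ->
  [\/ t <= a /\ clamp a b t = a, b <= t /\ clamp a b t = b |
      a <= t <= b /\ clamp a b t = t].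
Proof.
move=> ab; have [tb|bt] := leP t b; last first.
  by constructor 2; split; [exact: ltW|rewrite /clamp (min_idPl (ltW bt)) (max_idPr ab)].
have [ta|ta] := leP t a.
  by constructor 1; split => //; rewrite /clamp (min_idPr tb) (max_idPl ta).
by constructor 3; rewrite clamp_id ?(ltW ta)//.
Qed.

Lemma clamp_wide (x y n t : R) : x <= y -> x - n <= t <= y + n -> 0 <= n -> `|t - clamp x y t| <= n.
Proof.
move=> xy /andP[h1 h2] n0; rewrite ler_norml; apply/andP.
by case: (clampP t xy) => -[h ->]; split; lra.
Qed.

Lemma geometric_limit (u : nat -> R) (C : R) : 0 <= C ->
  (forall n, `|u n.+1 - u n| <= C / 2 ^+ n) ->
  exists l, forall n, `|l - u n| <= 2 * C / 2 ^+ n.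
Proof.
move=> C0 h.
have p2 (n : nat) : (0 : R) < 2 ^+ n by rewrite exprn_gt0.
have hm n k : `|u (n + k)%N - u n| <= 2 * C / 2 ^+ n - 2 * C / 2 ^+ (n + k).
  elim: k => [|k ih]; first by rewrite addn0 !subrr normr0.
  have -> : 2 * C / 2 ^+ n - 2 * C / 2 ^+ (n + k.+1) =
      C / 2 ^+ (n + k) + (2 * C / 2 ^+ n - 2 * C / 2 ^+ (n + k)).
    by rewrite addnS exprS; field; rewrite !expf_neq0.
  rewrite -(subrKA (u (n + k)%N)); apply: (le_trans (ler_normD _ _)).
  by rewrite lerD// addnS h.
have geo0 : 2 * C / 2 ^+ n @[n --> \oo] --> (0 : R).
  have := @cvg_geometric R (2 * C) 2^-1; rewrite ger0_norm ?invr_ge0//.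
  rewrite invf_lt1// ltr1n => /(_ isT).
  by apply: cvg_trans; apply: near_eq_cvg; near=> n; rewrite /geometric/= exprVn.
have cu : cvgn u.
  apply/cauchy_cvgP/cauchyP => e e0.
  have [N _ hN] : \forall n \near \oo, 2 * C / 2 ^+ n < e / 2.
    by apply: (cvgr_lt 0 geo0); rewrite divr_gt0.
  have hB k : (N <= k)%N -> `|u k - u N| < e / 2.
    move=> /subnKC <-; apply: le_lt_trans (hm _ _) _.
    apply: le_lt_trans _ (hN N (leqnn _)); rewrite lerBlDr lerDl.
    by rewrite !mulr_ge0// invr_ge0 ltW.
  exists (u N); exists N => // k /= Nk; rewrite -ball_normE /= distrC.
  by apply: lt_trans (hB k Nk) _; rewrite ltr_pdivrMr// ltr_pMr// ltr1n.
exists (lim (u n @[n --> \oo])) => n; rewrite ler_norml; apply/andP; split.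
  rewrite lerBrDr; apply: limr_ge => //; exists n => // k /= /subnKC <-.
  have := hm n (k - n)%N; rewrite ler_norml => /andP[+ _].
  have : 0 <= 2 * C / 2 ^+ (n + (k - n)) by rewrite !mulr_ge0// invr_ge0 ltW.
  lra.
rewrite lerBlDr; apply: limr_le => //; exists n => // k /= /subnKC <-.
have := hm n (k - n)%N; rewrite ler_norml => /andP[_ +].
have : 0 <= 2 * C / 2 ^+ (n + (k - n)) by rewrite !mulr_ge0// invr_ge0 ltW.
lra.
Unshelve. all: by end_near. Qed.

(** Picard iteration on [a, b] inside the ball of radius s about q0.  The time
    is clamped to [a, b] so that every iterate is defined and continuous on the
    whole line; the factor 1/2 makes the increments decrease geometrically. *)
Lemma picard n (F : R -> 'rV[R]_n -> 'rV[R]_n) (a b t0 M s : R) (q0 : 'rV[R]_n) :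
  a < b -> a <= t0 <= b -> 0 <= M -> (b - a) * M <= s ->
  (forall x : R -> 'rV[R]_n, (forall j, continuous (fun t => x t 0 j)) ->
    (forall t, enorm (x t - q0) <= s) ->
    forall j, continuous (fun t => F (clamp a b t) (x (clamp a b t)) 0 j)) ->
  (forall t q, a <= t <= b -> enorm (q - q0) <= s -> enorm (F t q) <= M) ->
  (forall t q q', a <= t <= b -> enorm (q - q0) <= s -> enorm (q' - q0) <= s ->
    (b - a) * enorm (F t q - F t q') <= enorm (q - q') / 2) ->
  exists q : R -> 'rV[R]_n, [/\ q t0 = q0, forall t, enorm (q t - q0) <= s,
    forall t t', enorm (q t - q t') <= M * `|t - t'| &
    forall t, a < t < b -> forall j, is_derive t 1 (fun u => q u 0 j) (F t (q t) 0 j)].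
Proof.
move=> ab t0ab M0 Ms Fc FM FL.
have abW := ltW ab.
have ab0 : 0 < b - a by rewrite subr_gt0.
pose good (x : R -> 'rV[R]_n) := (forall t, enorm (x t - q0) <= s) /\
  (forall t t', enorm (x t - x t') <= M * `|t - t'|).
have goodc x : good x -> forall j, continuous (fun t => x t 0 j).
  move=> [_ xL] j; apply: (@lipschitz_continuous1 _ M) => u v.
  apply: le_trans (xL v u); apply: le_trans (coord_le_enorm (x v - x u) j).
  by rewrite !mxE.
pose next (x y : R -> 'rV[R]_n) := exists Y : R -> 'rV[R]_n,
  [/\ forall t j, a <= t <= b -> is_derive t 1 (fun u => Y u 0 j) (F t (x t) 0 j),
      forall t, y t = Y (clamp a b t) & Y t0 = q0].
have step x : good x -> exists y, good y /\ next x y.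
  move=> gx; have [xs xL] := gx.
  pose g t := F (clamp a b t) (x (clamp a b t)).
  have /choice[G GE] : forall j, exists G : R -> R, forall t, a <= t <= b -> is_derive t 1 G (g t 0 j).
    by move=> j; apply: antiderivative; apply: Fc => //; apply: goodc.
  pose Y t := \row_j (G j t - G j t0 + q0 0 j).
  have YE t j : a <= t <= b -> is_derive t 1 (fun u => Y u 0 j) (F t (x t) 0 j).
    move=> tab; rewrite (_ : (fun _ => _) = G j + cst (- G j t0 + q0 0 j)); last first.
      by apply/funext => u; rewrite /Y mxE -addrA.
    have := GE j t tab; rewrite /g clamp_id// => h.
    by apply: is_derive_eq; rewrite addr0.
  have Y0 : Y t0 = q0 by apply/rowP => j; rewrite mxE subrr add0r.
  have YL t t' : a <= t <= b -> a <= t' <= b -> enorm (Y t - Y t') <= M * `|t - t'|.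
    move=> tab t'ab; apply: (@MVT_enorm_any n Y (fun u => F u (x u)) a b) => //.
    - by move=> u uab j; apply: YE.
    - by move=> u uab; apply: FM.
  exists (fun t => Y (clamp a b t)); split; last by exists Y.
  split=> [t|t t'].
    rewrite -{1}Y0; apply: (le_trans (YL _ _ (clamp_itv _ abW) t0ab)).
    apply: le_trans Ms; rewrite mulrC ler_wpM2r//.
    have /andP[c1 c2] := clamp_itv t abW; have /andP[c3 c4] := t0ab.
    by rewrite ler_norml; apply/andP; split; lra.
  apply: (le_trans (YL _ _ (clamp_itv _ abW) (clamp_itv _ abW))).
  by rewrite ler_wpM2l// clamp_dist.
have contr x y x' y' d : good x -> good x' -> next x y -> next x' y' ->
    (forall t, enorm (x t - x' t) <= d) -> forall t, enorm (y t - y' t) <= d / 2.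
  move=> [xs _] [x's _] [Y [YE yY Y0]] [Y' [Y'E y'Y' Y'0]] hd t.
  rewrite yY y'Y'; set u := clamp a b t.
  have uab : a <= u <= b by apply: clamp_itv.
  have := @MVT_enorm_any n (Y - Y') (fun u => F u (x u) - F u (x' u)) a b t0 u (d / 2 / (b - a)).
  rewrite !fctE Y0 Y'0 subrr subr0 => h.
  have d0 : 0 <= d by apply: le_trans (hd 0); apply: enorm_ge0.
  apply: (le_trans (h _ _ t0ab uab)).
  - move=> v vab j; rewrite (_ : (fun _ => _) = (fun u => Y u 0 j) - (fun u => Y' u 0 j)); last first.
      by apply/funext => w; rewrite !mxE.
    by have := is_deriveB (YE v j vab) (Y'E v j vab); rewrite !mxE.
  - move=> v vab; rewrite ler_pdivlMr// mulrC.
    by apply: (le_trans (FL _ _ _ vab (xs v) (x's v))); rewrite ler_pM2r ?invr_gt0.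
  - rewrite mulrAC ler_pdivrMr// ler_wpM2l ?divr_ge0//.
    have /andP[c1 c2] := uab; have /andP[c3 c4] := t0ab.
    by rewrite ler_norml; apply/andP; split; lra.
have s0 : 0 <= s by apply: le_trans Ms; rewrite mulr_ge0// ltW.
have [f fP] : exists f : (R -> 'rV[R]_n) -> (R -> 'rV[R]_n), forall x, good x -> good (f x) /\ next x (f x).
  have /choice[f fP] : forall x, exists y, good x -> good y /\ next x y.
    by move=> x; have [/step[y yP]|n'] := pselect (good x); [exists y|exists x].
  by exists f.
pose u k := iter k f (fun=> q0).
have gu k : good (u k).
  elim: k => [|k /fP[]//]; split => [t|t t']; rewrite subrr enorm0//.
  by rewrite mulr_ge0.
have nu k : next (u k) (u k.+1) by have [] := fP _ (gu k).
have du k t : enorm (u k.+1 t - u k t) <= 2 * s / 2 ^+ k.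
  elim: k t => [|k ih] t.
    apply: (le_trans (enormBD _ q0 _)); rewrite expr0 divr1 mulr2n mulrDl mul1r lerD//.
      by case: (gu 1%N).
    by rewrite enormB; case: (gu 0%N).
  have := contr _ _ _ _ _ (gu k.+1) (gu k) (nu k.+1) (nu k) ih t.
  by rewrite [2 ^+ k.+1]exprSr invfM [2 * s * (_ * _)]mulrA.
have /choice[q qP] : forall t, exists l : 'rV[R]_n, forall j k, `|l 0 j - u k t 0 j| <= 2 * (2 * s) / 2 ^+ k.
  move=> t; have /choice[l lP] : forall j, exists l, forall k, `|l - u k t 0 j| <= 2 * (2 * s) / 2 ^+ k.
    move=> j; apply: geometric_limit; first by rewrite mulr_ge0.
    move=> k; apply: le_trans (du k t).
    by apply: le_trans (coord_le_enorm (u k.+1 t - u k t) j); rewrite !mxE.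
  by exists (\row_j l j) => j k; rewrite mxE.
pose err k : R := n%:R * (2 * (2 * s) / 2 ^+ k).
have qu k t : enorm (q t - u k t) <= err k.
  apply: (le_trans (enorm_le_sum _)); rewrite /err mulr_natl -[n in _ *+ n]card_ord -sumr_const.
  by apply: ler_sum => j _; have := qP t j k; rewrite !mxE.
have err0 e : 0 < e -> exists k, err k < e.
  move=> e0; pose c := n%:R * (2 * (2 * s)) / e.
  have [k hk] : exists k : nat, c < 2 ^+ k.
    exists (Num.truncn c).+1; apply: (lt_trans (truncnS_gt _)).
    by rewrite -natrX ltr_nat ltn_expl.
  exists k; rewrite /err mulrA ltr_pdivrMr ?exprn_gt0//.
  by move: hk; rewrite /c ltr_pdivrMr// [_ ^+ _ * _]mulrC.
have gq : good q.
  split=> [t|t t']; apply/ler_addgt0Pr => e e0.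
    have [k hk] := err0 e e0; apply: (le_trans (enormBD _ (u k t) _)).
    by rewrite addrC lerD//; [case: (gu k)|apply: (le_trans (qu k t)); apply: ltW].
  have [|k hk] := err0 (e / 2); first by rewrite divr_gt0.
  apply: (le_trans (enormBD _ (u k t) _)); rewrite [leRHS]addrC [e]splitr -addrA lerD//.
    by apply: (le_trans (qu k t)); apply: ltW.
  apply: (le_trans (enormBD _ (u k t') _)); rewrite addrC lerD//.
    by case: (gu k).
  by rewrite enormB; apply: (le_trans (qu k t')); apply: ltW.
have [y [gy ny]] := step q gq.
have yq t : y t = q t.
  apply/eqP; rewrite -subr_eq0; apply/eqP/enorm_eq0/ler_addgt0Pr => e e0; rewrite add0r.
  have [|k hk] := err0 (e / 2); first by rewrite divr_gt0.
  apply: (le_trans (enormBD _ (u k.+1 t) _)); rewrite [e]splitr lerD//.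
    apply: (le_trans (contr _ _ _ _ _ gq (gu k) ny (nu k) (qu k) t)).
    apply: (le_trans _ (ltW hk)); rewrite ler_pdivrMr// ler_peMr ?ler1n//.
    by apply: le_trans (qu k t); apply: enorm_ge0.
  rewrite enormB; apply: (le_trans (qu _ _)); apply: (le_trans _ (ltW hk)).
  rewrite /err exprS invfM ler_wpM2l// mulrCA ler_piMl//.
    by rewrite !mulr_ge0// invr_ge0 exprn_ge0.
  by rewrite invf_le1// ler1n.
have [Y [YE yY Y0]] := ny.
have [qs qL] := gq.
exists q; split => //.
  by rewrite -yq yY clamp_id.
move=> t /andP[at' tb] j.
have tab : a <= t <= b by rewrite !ltW.
have := YE t j tab; apply: near_eq_is_derive; near=> v.
rewrite -yq yY clamp_id//; apply/andP; split; near: v.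
  by apply: (@filterS _ _ _ [set v | a < v]) => [v /= /ltW//|]; exact: lt_nbhsr.
by apply: (@filterS _ _ _ [set v | v < b]) => [v /= /ltW//|]; exact: lt_nbhsl.
Unshelve. all: by end_near. Qed.

Lemma is_derive_reflect (c : R) (f : R -> R) t df : is_derive (c - t) 1 f df ->
  is_derive t 1 (fun s => f (c - s)) (- df).
Proof.
move=> h.
have h1 : is_derive t 1 (fun s : R => c - s) (- 1).
  by have := is_deriveB (is_derive_cst c t 1) (is_derive_id t 1); rewrite sub0r.
apply: (is_derive_eq (@is_derive1_comp R f (fun s => c - s) t _ _ h h1)).
by rewrite mulrC mulN1r.
Qed.

Lemma is_derive_dotp n (x y dx dy : R -> 'rV[R]_n) (t : R) :
  (forall j, is_derive t 1 (fun s => x s 0 j) (dx t 0 j)) ->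
  (forall j, is_derive t 1 (fun s => y s 0 j) (dy t 0 j)) ->
  is_derive t 1 (fun s => dotp (x s) (y s)) (dotp (dx t) (y t) + dotp (x t) (dy t)).
Proof.
move=> hx hy; rewrite addrC /dotp -big_split/=; apply: is_derive_sumr => j.
apply: (is_derive_eq (is_deriveM (hx j) (hy j))).
by congr (_ + _); rewrite mulrC.
Qed.

(** The mean value inequality on the three pieces cut by s1 and s2. *)
Lemma mean_descent (G dG : R -> R) (x s1 s2 y eta c : R) : x <= s1 -> s1 <= s2 -> s2 <= y ->
  (forall t, x <= t <= y -> is_derive t 1 G (dG t)) ->
  (forall t, x <= t <= y -> dG t <= eta) -> (forall t, s1 <= t <= s2 -> dG t <= eta - c) ->
  G y - G x <= (y - x) * eta - (s2 - s1) * c.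
Proof.
move=> x1 x2 x3 dE d1 d2.
have e1 : G s1 - G x <= eta * (s1 - x).
  by apply: (MVT_le x1) => t /andP[h1 h2]; [apply: dE|apply: d1]; apply/andP; split; lra.
have e2 : G s2 - G s1 <= (eta - c) * (s2 - s1).
  by apply: (MVT_le x2) => t /andP[h1 h2]; [apply: dE|apply: d2]; apply/andP; split; lra.
have e3 : G y - G s2 <= eta * (y - s2).
  by apply: (MVT_le x3) => t /andP[h1 h2]; [apply: dE|apply: d1]; apply/andP; split; lra.
lra.
Qed.

Lemma minmax_itv (x y t lo hi : R) : lo <= x <= hi -> lo <= y <= hi ->
  Num.min x y <= t <= Num.max x y -> lo <= t <= hi.
Proof.
move=> /andP[x1 x2] /andP[y1 y2] /andP[m1 m2]; apply/andP; split.
  by apply: le_trans m1; rewrite le_min x1.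
by apply: (le_trans m2); rewrite ge_max x2.
Qed.

Lemma subinterval (x y t del : R) : x <= t <= y -> 2 * del <= y - x -> 0 < del ->
  exists s, [/\ x <= s, s + del <= y & s <= t <= s + del].
Proof.
move=> /andP[h1 h2] h3 h4; have [h|h] := leP (t + del) y.
  by exists t; split => //; apply/andP; split; lra.
by exists (t - del); split; [lra|lra|apply/andP; split; lra].
Qed.

Lemma dist_le_itv (s t s' del : R) : s <= t <= s + del -> s <= s' <= s + del -> `|t - s'| <= del.
Proof. by move=> /andP[? ?] /andP[? ?]; rewrite ler_norml; apply/andP; split; lra. Qed.

End Calculus.

(** * Linear arithmetic *)

(** The last steps of the estimates below, where only linear arithmetic is left:
    T stands for the length of the time interval, F and D for values and
    increments of the right-hand side, and the letters that occur with a numeric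
    factor for powers of rho. *)
Section LinearArithmetic.
Context {R : realType}.

Lemma arith_tube (T ox oy ms D c s : R) : T * ox <= T * (oy + ms) ->
  T * ms <= T * (D * c) -> D * (T * c) <= D * s -> T * oy <= 16^-1 ->
  16 * D * s <= 1 -> T * ox <= 8^-1.
Proof. lra. Qed.

Lemma arith_bound (T X Y qq L r' m1 m dq' D F p mx : R) :
  T * X <= qq / 8 + L -> T * Y <= r' + m1 -> L <= m1 -> T * dq' <= T * (D + F) ->
  T * F <= T * (X + Y) -> T * D <= T * p -> 0 <= mx -> qq <= mx -> 3 * m1 <= m -> T * p <= m1 ->
  T * dq' <= r' + mx / 2 + m.
Proof. lra. Qed.

Lemma arith_close (T X qq L Mc m1 m dq' D D' F p : R) :
  T * X <= qq / 8 + L -> L <= Mc -> T * dq' <= T * (D' + F) ->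
  T * F <= T * (X + D) -> T * D <= T * p -> T * D' <= T * p -> 0 <= qq ->
  2 * m1 <= m -> T * p <= m1 -> T * dq' <= qq / 2 + (Mc + m).
Proof. lra. Qed.

Lemma arith_sum2 (x y z w : R) : x <= z -> y <= z -> 2 * z <= w -> x + y <= w.
Proof. lra. Qed.

Lemma arith_lt (x w z : R) : 5 * x <= w -> w <= z -> 0 < x -> 2 * (x + x) < z.
Proof. lra. Qed.

Lemma arith_le (x w z r' : R) : 5 * x <= w -> w <= z -> 0 < x -> r' + 2 * (x + x) <= r' + z.
Proof. lra. Qed.

Lemma arith_final (x w z y : R) : 4 * x <= w -> w <= z -> 2 * (x + (y + x)) <= 2 * y + z.
Proof. lra. Qed.

Lemma itv_widen (x y z n : R) : x <= y <= z -> 0 < n -> x - n <= y <= z + n.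
Proof. by move=> /andP[h1 h2] n0; apply/andP; split; lra. Qed.

Lemma arith_rhs (T F F0 D L r' dN m : R) : T * F <= T * (D + F0) -> T * F0 <= r' + m ->
  T * D <= dN / 8 + L -> L <= 2 * m -> T * F <= r' + dN / 8 + 3 * m.
Proof. lra. Qed.

Lemma arith_rhs2 (T F r' dN m p : R) : T * F <= r' + dN / 8 + 3 * m -> 2 * p * F <= m -> 8 * m <= dN -> 0 <= m ->
  (T + 2 * p) * F <= r' + dN.
Proof. lra. Qed.

Lemma arith_r4 (x y z : R) : 8 * z <= y -> y <= 1 -> x + y / 8 + 3 * z <= x + 4.
Proof. lra. Qed.

Lemma arith_rhs3 (T D q p : R) : T * D <= q / 8 -> 0 <= D -> 2 * p <= T -> 0 <= q -> (T + 2 * p) * D <= q / 2.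
Proof. by move=> h1 h2 h3 h4; have := ler_wpM2r h2 h3; lra. Qed.

Lemma arith_uniq (T x y z o w m m1 s A : R) : T * A <= T * (x + y + z) -> T * z <= T * (o * w) ->
  T * x <= m1 -> T * y <= m1 -> T * o * w <= 2^-1 * w -> 2 * m1 <= m -> T * A <= w / 2 + m.
Proof. lra. Qed.

Lemma arith_fin2 (x y z : R) : 4 * x <= y -> y <= z -> 2 * (x + x) <= z.
Proof. lra. Qed.

Lemma arith_wide (y z w r' A B : R) : y <= r' + A -> z <= w + y -> w <= A -> 2 * A <= B -> z <= r' + B.
Proof. lra. Qed.

Lemma arith_adj (T x y o z h s w : R) : T * x <= w -> T * y <= T * z -> T * o * h <= 2^-1 * s ->
  T * z = T * o * h -> 2 * w <= s -> T * (x + y) <= s.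
Proof. lra. Qed.

Lemma arith_slope (dG Rem S E1 E2 E3 HH x y z : R) : dG = Rem + (- S - HH) + (S + E1) + (E2 - E3) ->
  Rem <= x -> E1 <= y -> E2 <= y -> - y <= E3 -> x + 3 * y <= z -> dG <= - HH + z.
Proof. lra. Qed.

Lemma arith_ends (A B A' B' p1 p2 m n : R) : B - A <= B' - A' + m -> - m <= p2 -> p1 <= m -> 3 * m <= n ->
  - n <= B' - B + p2 - (A' - A + p1).
Proof. lra. Qed.

Lemma arith_half (x y z w m : R) : x < y -> z <= m -> y <= z + w -> 2 * m <= x -> x / 2 <= w.
Proof. lra. Qed.

Lemma arith_contra (x y z E G : R) : - x <= G -> y <= z -> x <= z -> 16 * z <= E -> 0 < E ->
  y - E / 4 < G.
Proof. lra. Qed.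

End LinearArithmetic.

(** * Vectors of generalized numbers *)

Lemma row_continuous {R : realType} (T : topologicalType) n (F : T -> 'rV[R]_n) (t : T) :
  (forall i, {for t, continuous (fun s => F s 0 i)}) -> {for t, continuous F}.
Proof.
move=> h; apply/cvgrPdist_lt => e e0.
have h0 : \sum_i `|F t 0 i - F s 0 i| @[s --> t] --> \sum_(i < n) (0 : R).
  apply: cvg_sumr => i; have := cvg_norm (cvgB (cvg_cst (F t 0 i)) (h i)).
  by rewrite subrr normr0; apply.
rewrite big1// in h0; near=> s.
apply: (@le_lt_trans _ _ (\sum_i `|F t 0 i - F s 0 i|)).
  apply: (le_trans (norm_le_enorm _)); apply: (le_trans (enorm_le_sum _)).
  by apply: ler_sum => i _; rewrite !mxE.
near: s; exact: (cvgr_lt 0 h0).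
Unshelve. all: by end_near. Qed.

Section Vectors.
Context {R : realType} (rho : gauge R).
Notation rc := (rcnum rho).

Definition vnet n (x : 'rV[rc]_n) : R -> 'rV[R]_n := fun e => \row_i rcnet (x 0 i) e.

Lemma vrepresents_vnet n (x : 'rV[rc]_n) : vrepresents (vnet x) x.
Proof. by move=> i; under eq_fun do rewrite mxE; apply: represents_rcnet. Qed.

Lemma negl_normP n (x : R -> 'rV[R]_n) :
  negl rho (fun e => `|x e|) <-> forall i, negl rho (fun e => x e 0 i).
Proof.
split=> [h i|h].
  apply: (negl_le h); near=> e; rewrite normr_id; exact: coord_le_norm.
apply: (negl_le (negl_sum (index_enum 'I_n) (F := fun i e => `|x e 0 i|) _)).
  by move=> i; apply: negl_norm.
near=> e; rewrite normr_id; apply: le_trans (ler_norm _).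
exact: le_trans (norm_le_enorm _) (enorm_le_sum _).
Unshelve. all: by end_near. Qed.

Lemma mod_normP n (x : R -> 'rV[R]_n) :
  mod_net rho (fun e => `|x e|) <-> forall i, mod_net rho (fun e => x e 0 i).
Proof.
split=> [h i|h].
  apply: (mod_net_le h); near=> e; rewrite normr_id; exact: coord_le_norm.
apply: (mod_net_le (mod_net_sum (index_enum 'I_n) (F := fun i e => `|x e 0 i|) _)).
  by move=> i; apply: mod_net_norm.
near=> e; rewrite normr_id; apply: le_trans (ler_norm _).
exact: le_trans (norm_le_enorm _) (enorm_le_sum _).
Unshelve. all: by end_near. Qed.

Lemma vrepresents_negl n (x y : R -> 'rV[R]_n) (a : 'rV[rc]_n) :
  vrepresents x a -> vrepresents y a -> negl rho (fun e => `|x e - y e|).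
Proof.
move=> hx hy; apply/negl_normP => i.
have := represents_negl (hx i) (hy i); set f := fun _ => _; set g := fun _ => _.
by suff -> : f = g by []; apply/funext => e; rewrite /f /g !mxE.
Qed.

Lemma vrepresents_congr n (x y : R -> 'rV[R]_n) (a : 'rV[rc]_n) :
  vrepresents x a -> negl rho (fun e => `|y e - x e|) -> vrepresents y a.
Proof.
move=> hx /negl_normP h i; apply: (represents_congr (hx i)).
have := h i; set f := fun _ => _; set g := fun _ => _.
by suff -> : f = g by []; apply/funext => e; rewrite /f /g !mxE.
Qed.

Lemma vrepresents_mod n (x : R -> 'rV[R]_n) (a : 'rV[rc]_n) :
  vrepresents x a -> mod_net rho (fun e => `|x e|).
Proof. by move=> h; apply/mod_normP => i; apply: represents_mod (h i). Qed.

Lemma mod_vrepresents n (x : R -> 'rV[R]_n) :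
  mod_net rho (fun e => `|x e|) -> exists a : 'rV[rc]_n, vrepresents x a.
Proof.
move=> /mod_normP h; exists (\row_i rcclass rho (fun e => x e 0 i)) => i.
by rewrite mxE; apply: represents_rcclass.
Qed.

Lemma vrepresents_inj n (x : R -> 'rV[R]_n) (a b : 'rV[rc]_n) :
  vrepresents x a -> vrepresents x b -> a = b.
Proof. by move=> ha hb; apply/rowP => i; apply: represents_inj (ha i) (hb i). Qed.

Lemma vrepresentsB n (x y : R -> 'rV[R]_n) (a b : 'rV[rc]_n) :
  vrepresents x a -> vrepresents y b -> vrepresents (fun e => x e - y e) (a - b).
Proof.
move=> ha hb i; rewrite !mxE; under eq_fun do rewrite !mxE.
exact: representsB.
Qed.

Lemma vrepresents_row_mx n m (x : R -> 'rV[R]_n) (y : R -> 'rV[R]_m)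
    (a : 'rV[rc]_n) (b : 'rV[rc]_m) :
  vrepresents x a -> vrepresents y b ->
  vrepresents (fun e => row_mx (x e) (y e)) (row_mx a b).
Proof.
move=> ha hb i; rewrite mxE; under eq_fun do rewrite mxE.
by case: splitP => j _; [apply: ha|apply: hb].
Qed.

Lemma vrepresents_lsubmx n m (x : R -> 'rV[R]_(n + m)) (a : 'rV[rc]_(n + m)) :
  vrepresents x a -> vrepresents (fun e => lsubmx (x e)) (lsubmx a).
Proof. by move=> ha i; rewrite mxE; under eq_fun do rewrite mxE; apply: ha. Qed.

Lemma vrepresents_rsubmx n m (x : R -> 'rV[R]_(n + m)) (a : 'rV[rc]_(n + m)) :
  vrepresents x a -> vrepresents (fun e => rsubmx (x e)) (rsubmx a).
Proof. by move=> ha i; rewrite mxE; under eq_fun do rewrite mxE; apply: ha. Qed.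

Lemma vrepresents_const_mx (x : R -> R) (a : rc) :
  represents x a -> vrepresents (fun e => const_mx (x e) : 'rV_1) (const_mx a).
Proof. by move=> ha i; rewrite mxE; under eq_fun do rewrite mxE. Qed.

Lemma represents_gnorm n (x : R -> 'rV[R]_n) (a : 'rV[rc]_n) :
  vrepresents x a -> represents (fun e => enorm (x e)) (gnorm a).
Proof.
move=> ha; have hv := vrepresents_vnet a.
have mv : mod_net rho (fun e => enorm (vnet a e)).
  apply: (mod_net_le (mod_netM (mod_net_cst _ n%:R) (vrepresents_mod hv))).
  near=> e; rewrite ger0_norm ?enorm_ge0//; apply: le_trans (ler_norm _).
  exact: enorm_le_norm.
apply: (represents_congr (represents_rcclass mv)).
apply: (negl_le (neglM (mod_net_cst _ n%:R) (vrepresents_negl ha hv))).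
near=> e; apply: le_trans (ler_norm _).
exact: le_trans (enorm_dist _ _) (enorm_le_norm _).
Unshelve. all: by end_near. Qed.

(** * Sharp interior and closure in terms of nets *)

Lemma sharp_interior_net n (X : set 'rV[rc]_n) x xe :
  sharp_interior X x -> vrepresents xe x ->
  exists m, forall y ye, vrepresents ye y ->
    (\near0 e, `|ye e - xe e| <= rho e ^+ m) -> X y.
Proof.
move=> [r /= r0 rX] hx.
have hr := represents_rcnet r.
have [N hN] := (gltP (represents0 rho) hr).1 r0.
exists N.+1 => y ye hy yx; apply: rX.
apply/(gltP (represents_gnorm (vrepresentsB hy hx)) hr).
exists N.+1; near=> e.
have re : 0 < rho e <= 1 by near: e; apply: gauge_near.
have h1 : 0 + rho e ^+ N <= rcnet r e by near: e.
have h2 : (n%:R + 1) * rho e ^+ N.+1 <= rho e ^+ N by near: e; apply: near_rhoX.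
have h3 : `|ye e - xe e| <= rho e ^+ N.+1 by near: e.
have h4 := enorm_le_norm (ye e - xe e).
have h5 : n%:R * `|ye e - xe e| <= n%:R * rho e ^+ N.+1 by rewrite ler_wpM2l.
lra.
Unshelve. all: by end_near. Qed.

Lemma sharp_nbhs_net n (x : 'rV[rc]_n) xe m : vrepresents xe x ->
  sharp_nbhs x [set y | forall ye, vrepresents ye y ->
     \near0 e, `|ye e - xe e| <= rho e ^+ m].
Proof.
move=> hx; exists (rcclass rho (fun e => rho e ^+ m)) => /=.
  apply/(gltP (represents0 rho) (represents_rhoX rho m)); exists m; near=> e.
  by rewrite add0r.
move=> y /= yx ye hy.
have [N hN] := (gltP (represents_gnorm (vrepresentsB hy hx)) (represents_rhoX rho m)).1 yx.
near=> e; apply: (le_trans (norm_le_enorm _)).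
have h : enorm (ye e - xe e) + rho e ^+ N <= rho e ^+ m by near: e.
have re : 0 < rho e <= 1 by near: e; apply: gauge_near.
have := rho_exp_gt0 N re; lra.
Unshelve. all: by end_near. Qed.

Lemma sharp_nbhsP n (x : 'rV[rc]_n) xe (U : set 'rV[rc]_n) : vrepresents xe x ->
  sharp_nbhs x U <-> exists m, forall y ye, vrepresents ye y ->
    (\near0 e, `|ye e - xe e| <= rho e ^+ m) -> U y.
Proof.
move=> hx; split=> [|[m hm]]; first by move=> h; apply: (@sharp_interior_net _ U x).
have [r r0 rU] := @sharp_nbhs_net n x xe m hx.
exists r => // y /rU /= h; apply: (hm y (vnet y)); first exact: vrepresents_vnet.
exact/h/vrepresents_vnet.
Qed.

Lemma sharp_nbhsI n (x : 'rV[rc]_n) (U V : set 'rV[rc]_n) :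
  sharp_nbhs x U -> sharp_nbhs x V -> sharp_nbhs x (U `&` V).
Proof.
have hx := vrepresents_vnet x.
move=> /(sharp_nbhsP _ hx)[m hm] /(sharp_nbhsP _ hx)[p hp]; apply/(sharp_nbhsP _ hx).
exists (m + p)%N => y ye hy yx; split; [apply: (hm y ye)|apply: (hp y ye)] => //; near=> e;
  (have re : 0 < rho e <= 1 by near: e; apply: gauge_near);
  (have h : `|ye e - vnet x e| <= rho e ^+ (m + p) by near: e);
  by apply: (le_trans h); apply: rho_expM => //; rewrite ?leq_addr ?leq_addl.
Unshelve. all: by end_near. Qed.

(** The consequence of solidity that makes derivatives at boundary points
    unique. *)
Definition fat n (X : set 'rV[rc]_n) := X `<=` sharp_closure (sharp_interior X).

Lemma sharp_closureP n (x : 'rV[rc]_n) xe (X : set 'rV[rc]_n) : vrepresents xe x ->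
  sharp_closure X x <-> forall m, exists z ze, [/\ X z, vrepresents ze z &
    \near0 e, `|ze e - xe e| <= rho e ^+ m].
Proof.
move=> hx; split=> [h m|h U /(sharp_nbhsP _ hx)[m hm]].
  have [z [Xz hz]] := h _ (sharp_nbhs_net m hx).
  exists z, (vnet z); split => //; first exact: vrepresents_vnet.
  exact/hz/vrepresents_vnet.
have [z [ze [Xz hz zx]]] := h m; exists z; split => //; exact: hm zx.
Qed.

(** Uniformity over X is expressed by such families: what holds along every net
    of points of X holds on all of K e, for e small. *)
Definition nets_in n (K : R -> set 'rV[R]_n) (X : set 'rV[rc]_n) :=
  (\near0 e, K e !=set0) /\
  forall xe, (\near0 e, K e (xe e)) -> exists2 x, X x & vrepresents xe x.

Lemma nets_in1 n (X : set 'rV[rc]_n) x xe : X x -> vrepresents xe x ->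
  nets_in (fun e => [set xe e]) X.
Proof.
move=> Xx hx; split; first by near=> e; exists (xe e).
move=> ye hy; exists x => //; apply: (vrepresents_congr hx).
apply: (negl_le (negl0 rho)); near=> e; have -> : ye e = xe e by near: e.
by rewrite subrr !normr0.
Unshelve. all: by end_near. Qed.

Definition mod_on n (X : set 'rV[rc]_n) (g : R -> 'rV[R]_n -> R) :=
  forall x xe, X x -> vrepresents xe x -> mod_net rho (fun e => g e (xe e)).

Definition netdom n (X : set 'rV[rc]_n) (Om : R -> set 'rV[R]_n) :=
  (forall e, 0 < e <= 1 -> open (Om e)) /\ X `<=` strongly_internal Om.

Lemma netdomI n (X : set 'rV[rc]_n) Om Om' : netdom X Om -> netdom X Om' ->
  netdom X (fun e => Om e `&` Om' e).
Proof.
move=> [oO hO] [oU hU]; split=> [e e01|x Xx xe hx]; first exact: openI (oO _ e01) (oU _ e01).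
by near=> e; split; near: e; [apply: hO Xx _ hx|apply: hU Xx _ hx].
Unshelve. all: by end_near. Qed.

Lemma unif_dom n (X : set 'rV[rc]_n) Om K : X `<=` strongly_internal Om -> nets_in K X ->
  exists N, \near0 e, forall x y : 'rV[R]_n, K e x -> `|y - x| <= rho e ^+ N -> Om e y.
Proof.
move=> XO [K0 KX].
apply: (@near0_unif_nbhd R rho n K (fun _ => Om)) => // x y /KX[a Xa hx] yx.
exists 0%N; apply: XO Xa _ _; exact: vrepresents_congr hx yx.
Qed.

(** If the bounds rho^-N failed within rho^N of K for every N, they would fail
    along one net that represents a point of X. *)
Lemma unif_bound n (X : set 'rV[rc]_n) g K : mod_on X g -> nets_in K X ->
  exists N, \near0 e, forall x y : 'rV[R]_n, K e x -> `|y - x| <= rho e ^+ N ->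
    `|g e y| <= rho e ^- N.
Proof.
move=> mg [K0 KX].
apply: (@near0_unif_nbhd R rho n K (fun N e y => `|g e y| <= rho e ^- N)) => //.
  by move=> N M e y re NM /le_trans; apply; apply: rho_expVM.
by move=> x y /KX[a Xa hx] yx; apply: (mg a) => //; apply: vrepresents_congr hx yx.
Qed.

(** Nets of class C^k whose derivatives are moderate on X.  The partials are
    given as data, so that sums, products and compositions are treated by
    induction on k without computing iterated directional derivatives. *)
Fixpoint Cnet n (X : set 'rV[rc]_n) (Om : R -> set 'rV[R]_n) (k : nat)
    (g : R -> 'rV[R]_n -> R) : Prop :=
  [/\ forall e x, 0 < e <= 1 -> Om e x -> {for x, continuous (g e)},
      mod_on X g &
      if k is k'.+1 then exists D : 'I_n -> R -> 'rV[R]_n -> R,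
        (forall i, Cnet X Om k' (D i)) /\
        forall i e x, 0 < e <= 1 -> Om e x -> is_derive x (delta_mx 0 i) (g e) (D i e x)
      else True].

Definition Snet n (X : set 'rV[rc]_n) Om g := forall k, @Cnet n X Om k g.

Lemma CnetP n (X : set 'rV[rc]_n) Om k g : Cnet X Om k g <->
  [/\ forall e x, 0 < e <= 1 -> Om e x -> {for x, continuous (g e)},
      mod_on X g &
      if k is k'.+1 then exists D : 'I_n -> R -> 'rV[R]_n -> R,
        (forall i, Cnet X Om k' (D i)) /\
        forall i e x, 0 < e <= 1 -> Om e x -> is_derive x (delta_mx 0 i) (g e) (D i e x)
      else True].
Proof. by case: k. Qed.

Lemma Cnet_cts n (X : set 'rV[rc]_n) Om k g : Cnet X Om k g ->
  forall e x, 0 < e <= 1 -> Om e x -> {for x, continuous (g e)}.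
Proof. by case: k => [|k] []. Qed.

Lemma Cnet_mod n (X : set 'rV[rc]_n) Om k g : Cnet X Om k g -> mod_on X g.
Proof. by case: k => [|k] []. Qed.

Lemma Cnet_le n (X : set 'rV[rc]_n) Om k g : Cnet X Om k.+1 g -> Cnet X Om k g.
Proof.
elim: k g => [|k ih] g /CnetP[gc gm [D [DC gD]]]; apply/CnetP; split => //.
by exists D; split => // i; apply: ih.
Qed.

Lemma Cnet_ext n (X : set 'rV[rc]_n) Om k g g' : netdom X Om ->
  (forall e x, 0 < e <= 1 -> Om e x -> g e x = g' e x) ->
  Cnet X Om k g -> Cnet X Om k g'.
Proof.
move=> [oO XO] gg' Cg.
have nE e x : 0 < e <= 1 -> Om e x -> \near x, g e x = g' e x.
  move=> e01 Ox; have : nbhs x (Om e) by apply: open_nbhs_nbhs; split=> //; apply: oO.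
  by apply: filterS => z; apply: gg'.
have gc' e x : 0 < e <= 1 -> Om e x -> {for x, continuous (g' e)}.
  move=> e01 Ox; rewrite /prop_for /continuous_at -(gg' e x e01 Ox).
  apply: (cvg_trans _ (Cnet_cts Cg e01 Ox)).
  exact: (@near_eq_cvg _ _ (nbhs x) _ (g e) (g' e) (nE e x e01 Ox)).
have gm' : mod_on X g'.
  move=> x xe Xx hx; apply: (mod_net_le (Cnet_mod Cg Xx hx)); near=> e.
  rewrite gg'//; near: e; [exact: near0_itv|exact: XO Xx _ hx].
case: k Cg => [|k] /CnetP[gc gm gD]; apply/CnetP; split => //.
have [D [DC gDD]] := gD; exists D; split => // i e x e01 Ox.
by apply: near_eq_is_derive (gDD i e x e01 Ox); apply: nE.
Unshelve. all: by end_near. Qed.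

Lemma Cnet_cst n (X : set 'rV[rc]_n) Om k (c : R -> R) : mod_net rho c ->
  Cnet X Om k (fun e _ => c e).
Proof.
have cc e : continuous (fun _ : 'rV[R]_n => c e) by exact: cst_continuous.
move=> mc; elim: k c mc cc => [|k ih] c mc cc; apply/CnetP; split => //.
- by move=> e x _ _; exact: cc.
- by move=> e x _ _; exact: cc.
exists (fun _ _ _ => 0 : R); split => [i|i e x _ _]; last exact: is_derive_cst.
by apply: ih => [|e x]; [exact: mod_net_cst|exact: cst_continuous].
Qed.

Lemma CnetD n (X : set 'rV[rc]_n) Om k f g : Cnet X Om k f -> Cnet X Om k g ->
  Cnet X Om k (fun e x => f e x + g e x).
Proof.
elim: k f g => [|k ih] f g Cf Cg; (apply/CnetP; split;
    [by move=> e x e01 Ox; apply: continuousD (Cnet_cts Cf e01 Ox) (Cnet_cts Cg e01 Ox)|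
     by move=> x xe Xx hx; apply: mod_netD; [apply: (Cnet_mod Cf Xx hx)|apply: (Cnet_mod Cg Xx hx)]|]) => //.
have /CnetP[_ _ [D [DC fD]]] := Cf; have /CnetP[_ _ [E [EC gE]]] := Cg.
exists (fun i e x => D i e x + E i e x); split => [i|i e x e01 Ox]; first exact: ih.
exact: is_deriveD (fD i e x e01 Ox) (gE i e x e01 Ox).
Qed.

Lemma CnetM n (X : set 'rV[rc]_n) Om k f g : Cnet X Om k f -> Cnet X Om k g ->
  Cnet X Om k (fun e x => f e x * g e x).
Proof.
elim: k f g => [|k ih] f g Cf Cg; (apply/CnetP; split;
    [by move=> e x e01 Ox; apply: continuousM (Cnet_cts Cf e01 Ox) (Cnet_cts Cg e01 Ox)|
     by move=> x xe Xx hx; apply: mod_netM; [apply: (Cnet_mod Cf Xx hx)|apply: (Cnet_mod Cg Xx hx)]|]) => //.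
have /CnetP[_ _ [D [DC fD]]] := Cf; have /CnetP[_ _ [E [EC gE]]] := Cg.
exists (fun i e x => f e x * E i e x + g e x * D i e x); split => [i|i e x e01 Ox].
  by apply: CnetD; apply: ih => //; apply: Cnet_le.
exact: is_deriveM (fD i e x e01 Ox) (gE i e x e01 Ox).
Qed.

Lemma Cnet_sum n (X : set 'rV[rc]_n) Om k (I : Type) (s : seq I) f :
  (forall i, Cnet X Om k (f i)) -> Cnet X Om k (fun e x => \sum_(i <- s) f i e x).
Proof.
move=> h; elim: s => [|i s ih].
  under eq_fun do under eq_fun do rewrite big_nil.
  exact/Cnet_cst/mod_net_cst.
by under eq_fun do under eq_fun do rewrite big_cons; apply: CnetD.
Qed.

Lemma is_derive_coord n (x v : 'rV[R]_n) i :
  is_derive x v (fun y : 'rV[R]_n => y 0 i) (v 0 i).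
Proof.
apply/is_derive_cvgP; apply: cvg_near_cst; near=> h; apply/eqP.
rewrite !mxE addrK mulrA mulVf ?mul1r//; near: h; exact: nbhs_dnbhs_neq.
Unshelve. all: by end_near. Qed.

Lemma Cnet_coord n (X : set 'rV[rc]_n) Om k i : Cnet X Om k (fun _ x => x 0 i).
Proof.
case: k => [|k]; (apply/CnetP; split;
  [by move=> e x _ _; exact: coord_continuous|
   by move=> x xe _ hx; apply: represents_mod (hx i)|]) => //.
exists (fun j _ _ => (delta_mx 0 j : 'rV[R]_n) 0 i); split => [j|j e x _ _].
  exact/Cnet_cst/mod_net_cst.
exact: is_derive_coord.
Qed.

Lemma Cnet_comp n m (X : set 'rV[rc]_n) Om (Y : set 'rV[rc]_m) Om' k
    (f : R -> 'rV[R]_m -> R) (G : R -> 'rV[R]_n -> 'rV[R]_m) :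
  netdom Y Om' ->
  (forall e x, 0 < e <= 1 -> Om e x -> Om' e (G e x)) ->
  (forall x xe, X x -> vrepresents xe x ->
     exists2 y, Y y & vrepresents (fun e => G e (xe e)) y) ->
  Cnet Y Om' k f -> (forall i, Cnet X Om k (fun e x => G e x 0 i)) ->
  Cnet X Om k (fun e x => f e (G e x)).
Proof.
move=> [oO' YO'] GO GY; elim: k f => [|k ih] f Cf CG; (apply/CnetP; split;
  [|by move=> x xe Xx hx; have [y Yy hy] := GY _ _ Xx hx; apply: (Cnet_mod Cf Yy hy)|]) => //.
- move=> e x e01 Ox; apply: (@continuous_comp _ _ _ (G e) (f e)).
    by apply: row_continuous => i; apply: (Cnet_cts (CG i)).
  exact: (Cnet_cts Cf e01 (GO _ _ e01 Ox)).
- move=> e x e01 Ox; apply: (@continuous_comp _ _ _ (G e) (f e)).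
    by apply: row_continuous => i; apply: (Cnet_cts (CG i)).
  exact: (Cnet_cts Cf e01 (GO _ _ e01 Ox)).
have /CnetP[_ _ [D [DC fD]]] := Cf.
have /choice[E EP] : forall i, exists E : 'I_n -> R -> 'rV[R]_n -> R,
   (forall j, Cnet X Om k (E j)) /\ forall j e x, 0 < e <= 1 -> Om e x ->
     is_derive x (delta_mx 0 j) (fun x => G e x 0 i) (E j e x).
  by move=> i; have /CnetP[_ _ [E EP]] := CG i; exists E.
exists (fun j e x => \sum_i D i e (G e x) * E i j e x); split => [j|j e x e01 Ox].
  apply: Cnet_sum => i; apply: CnetM; last exact: (EP i).1.
  by apply: ih => // i'; apply: Cnet_le.
apply: (@is_derive_chain R m _ (f e) (fun i => D i e) (Om' e) (G e)) => //.
- exact: oO'.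
- exact: GO.
- by move=> z i Oz; apply: fD.
- by move=> i; apply: (Cnet_cts (DC i)) => //; apply: GO.
- by move=> i; apply: (EP i).2.
Qed.

Lemma Snet_D n (X : set 'rV[rc]_n) Om g : netdom X Om -> Snet X Om g ->
  forall i, Snet X Om (fun e x => 'D_(delta_mx 0 i) (g e) x) /\
    forall e x, 0 < e <= 1 -> Om e x ->
      is_derive x (delta_mx 0 i) (g e) ('D_(delta_mx 0 i) (g e) x).
Proof.
move=> dX Sg i; split=> [k|e x e01 Ox].
  have /CnetP[_ _ [D [DC gD]]] := Sg k.+1.
  apply: (Cnet_ext dX _ (DC i)) => e x e01 Ox.
  by have [_ ->] := gD i e x e01 Ox.
have /CnetP[_ _ [D [DC gD]]] := Sg 1%N.
by have [dg _] := gD i e x e01 Ox; apply: derivableP.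
Qed.

Lemma Snet_pderive n (X : set 'rV[rc]_n) Om g s : netdom X Om -> Snet X Om g ->
  Snet X Om (fun e => pderive s (g e)).
Proof.
by move=> dX Sg; elim: s => [|i s ih]//; exact: (Snet_D dX ih i).1.
Qed.

Lemma gsf_net_dom n m (X : set 'rV[rc]_n) (f : 'rV[rc]_n -> 'rV[rc]_m) Om fe :
  gsf_net X f Om fe -> netdom X Om.
Proof. by move=> [h XO _ _]; split=> // e e01; case: (h e e01). Qed.

Lemma gsf_net_val n m (X : set 'rV[rc]_n) (f : 'rV[rc]_n -> 'rV[rc]_m) Om fe :
  gsf_net X f Om fe -> forall x xe, X x -> vrepresents xe x ->
  vrepresents (fun e => fe e (xe e)) (f x).
Proof. by case. Qed.

Lemma gsf_net_Snet n m (X : set 'rV[rc]_n) (f : 'rV[rc]_n -> 'rV[rc]_m) Om fe :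
  gsf_net X f Om fe -> forall s j, Snet X Om (fun e => pderive s (vcomp (fe e) j)).
Proof.
move=> [h XO _ hm] s j k; elim: k s => [|k ih] s; apply/CnetP; split => //.
- by move=> e x e01 Ox; have [_ sm] := h e e01; have [] := sm j s x Ox.
- by move=> x xe Xx hx; apply/moderateP; apply: hm Xx hx _ _.
- by move=> e x e01 Ox; have [_ sm] := h e e01; have [] := sm j s x Ox.
- by move=> x xe Xx hx; apply/moderateP; apply: hm Xx hx _ _.
exists (fun i e => pderive (i :: s) (vcomp (fe e) j)); split => // i e x e01 Ox.
by apply: derivableP; have [_ sm] := h e e01; have [_] := sm j s x Ox.
Qed.

Lemma Snet_gsf_net n m (X : set 'rV[rc]_n) (f : 'rV[rc]_n -> 'rV[rc]_m) Om fe :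
  netdom X Om -> (forall j, Snet X Om (fun e => vcomp (fe e) j)) ->
  (forall x xe, X x -> vrepresents xe x -> vrepresents (fun e => fe e (xe e)) (f x)) ->
  gsf_net X f Om fe.
Proof.
move=> dX Snet_phi fv; have [oO XO] := dX.
have Sp j s := Snet_pderive s dX (Snet_phi j).
split => //.
- move=> e e01; split; first exact: oO.
  move=> j s x Ox; split; first exact: (Cnet_cts (Sp j s 0%N) e01 Ox).
  by move=> i; have [_ /(_ e x e01 Ox)[]] := Snet_D dX (Sp j s) i.
- by move=> x xe Xx hx j s; apply/moderateP; apply: (Cnet_mod (Sp j s 0%N) Xx hx).
Qed.

Lemma ball_segment n (x y z : 'rV[R]_n) r : `|y - x| <= r -> `|z - x| <= r ->
  forall t : R, 0 <= t <= 1 -> `|y + t *: (z - y) - x| <= r.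
Proof.
move=> yr zr t /andP[t0 t1].
have -> : y + t *: (z - y) - x = (1 - t) *: (y - x) + t *: (z - x).
  by apply/rowP => i; rewrite !mxE; ring.
apply: (le_trans (ler_normD _ _)); rewrite !mx_normZ !ger0_norm ?subr_ge0//.
have t10 : 0 <= 1 - t by rewrite subr_ge0.
have := ler_wpM2l t10 yr; have := ler_wpM2l t0 zr; lra.
Qed.

(** The partials are bounded by a power of rho near K, and the balls of radius
    rho^N are convex. *)
Lemma unif_lipschitz n (X : set 'rV[rc]_n) Om g K : netdom X Om -> Cnet X Om 1 g ->
  nets_in K X -> exists N, \near0 e, forall x y z : 'rV[R]_n, K e x ->
    `|y - x| <= rho e ^+ N -> `|z - x| <= rho e ^+ N ->
    `|g e z - g e y| <= rho e ^- N * `|z - y|.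
Proof.
move=> [oO XO] /CnetP[_ _ [D [DC gD]]] hK.
have [N1 hN1] := unif_dom XO hK.
have /choice[N2 hN2] : forall i, exists N, \near0 e, forall x y : 'rV[R]_n, K e x ->
    `|y - x| <= rho e ^+ N -> `|D i e y| <= rho e ^- N.
  by move=> i; apply: unif_bound hK; apply: Cnet_mod (DC i).
pose N := (maxn N1 (\max_i N2 i)); exists N.+1.
have hN2' : \near0 e, forall i (x y : 'rV[R]_n), K e x -> `|y - x| <= rho e ^+ N2 i ->
   `|D i e y| <= rho e ^- N2 i.
  by apply: filter_forall => i; exact: hN2.
near=> e => x y z Kx yx zx.
have re : 0 < rho e <= 1 by near: e; apply: gauge_near.
have h1 : forall x y : 'rV[R]_n, K e x -> `|y - x| <= rho e ^+ N1 -> Om e y by near: e.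
have h2 : forall i (x y : 'rV[R]_n), K e x -> `|y - x| <= rho e ^+ N2 i ->
   `|D i e y| <= rho e ^- N2 i by near: e.
have e01 : 0 < e <= 1 by near: e; apply: near0_itv.
have hseg := ball_segment yx zx.
have le1 : (N1 <= N.+1)%N by rewrite ltnW// ltnS leq_maxl.
have le2 i : (N2 i <= N)%N by apply: leq_trans (leq_maxr _ _); apply: leq_bigmax.
have := @segment_lipschitz R n (g e) (fun i => D i e) (Om e) y z (rho e ^- N).
move=> /(_ (oO e e01)) h; apply: (le_trans (h _ _ _ _)).
- move=> t t01; apply: (h1 x) => //; apply: (le_trans (hseg t t01)).
  exact: rho_expM.
- by move=> w i Ow; apply: gD.
- by move=> w i Ow; apply: (Cnet_cts (DC i)).
- move=> t i t01; apply: (le_trans (h2 i x _ Kx _)); last exact: rho_expVM.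
  by apply: (le_trans (hseg t t01)); apply: rho_expM => //; apply: (leq_trans (le2 i)).
rewrite mulrA ler_wpM2r//.
have h3 : n%:R * rho e ^+ N.+1 <= rho e ^+ N by near: e; apply: near_rhoX.
rewrite mulrC ler_pdivrMr ?rho_exp_gt0// mulrC ler_pdivlMr ?rho_exp_gt0//.
Unshelve. all: by end_near. Qed.

Lemma Cnet_negl n (X : set 'rV[rc]_n) Om g x xe ye : netdom X Om -> Cnet X Om 1 g ->
  X x -> vrepresents xe x -> vrepresents ye x -> negl rho (fun e => g e (ye e) - g e (xe e)).
Proof.
move=> dX Cg Xx hx hy.
have [N hN] := unif_lipschitz dX Cg (nets_in1 Xx hx).
have hd := vrepresents_negl hy hx.
apply: (negl_le (neglM (mod_net_rho rho N) hd)); near=> e.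
apply: le_trans (ler_norm _).
have h : forall x y z : 'rV[R]_n, [set xe e] x ->
    `|y - x| <= rho e ^+ N -> `|z - x| <= rho e ^+ N ->
    `|g e z - g e y| <= rho e ^- N * `|z - y| by near: e.
apply: (h (xe e)) => //.
  rewrite subrr normr0 rho_exp_ge0//; near: e; exact: gauge_near.
by rewrite -normr_id; near: e; apply: hd.
Unshelve. all: by end_near. Qed.

(** * Derivatives of nets of the same function agree *)

(** A net that is negligible on X has negligible partials there: at interior
    points difference quotients with step rho^n, n large, are negligible and
    differ from the partial by O(rho^n) only. *)
Lemma partial_negl_int n (X : set 'rV[rc]_n) Om g D i x xe : netdom X Om ->
  Cnet X Om 1 (D i) ->
  (forall e x, 0 < e <= 1 -> Om e x -> is_derive x (delta_mx 0 i) (g e) (D i e x)) ->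
  (forall x xe, X x -> vrepresents xe x -> negl rho (fun e => g e (xe e))) ->
  X x -> sharp_interior X x -> vrepresents xe x -> negl rho (fun e => D i e (xe e)).
Proof.
move=> dX DC gD gn Xx intx hx n0; have [oO XO] := dX.
have [m hm] := sharp_interior_net intx hx.
have [N1 hN1] := unif_dom XO (nets_in1 Xx hx).
have [N hN] := unif_lipschitz dX DC (nets_in1 Xx hx).
pose p := (m + N1 + N + n0).+2.
have [pm pN1 pN pNn] : [/\ (m <= p)%N, (N1 <= p)%N, (N <= p)%N & (N + n0.+1 <= p)%N].
  by rewrite /p; split; lia.
pose ye e := xe e + rho e ^+ p *: (delta_mx 0 i : 'rV[R]_n).
have yx e : 0 < rho e <= 1 -> `|ye e - xe e| <= rho e ^+ p.
  move=> re; rewrite /ye addrAC subrr add0r mx_normZ ger0_norm ?rho_exp_ge0//.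
  rewrite ler_piMr ?rho_exp_ge0//; apply: norm_le_coord => // j; rewrite mxE /=.
  by case: eqP => _; rewrite ?normr1 ?normr0.
have [y hy] : exists y : 'rV[rc]_n, vrepresents ye y.
  apply: mod_vrepresents.
  apply: (mod_net_le (mod_netD (vrepresents_mod hx) (mod_net_cst rho 1))).
  near=> e; rewrite normr_id; apply: le_trans (ler_norm _).
  have re : 0 < rho e <= 1 by near: e; apply: gauge_near.
  rewrite -(subrK (xe e) (ye e)) addrC; apply: (le_trans (ler_normD _ _)).
  by rewrite lerD2l (le_trans (yx e re))// -(expr0 (rho e)) rho_expM.
have Xy : X y.
  apply: (hm y ye hy); near=> e.
  have re : 0 < rho e <= 1 by near: e; apply: gauge_near.
  by apply: (le_trans (yx e re)); apply: rho_expM.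
have nd := neglB (gn _ _ Xy hy) (gn _ _ Xx hx).
near=> e.
have re : 0 < rho e <= 1 by near: e; apply: gauge_near.
have e01 : 0 < e <= 1 by near: e; apply: near0_itv.
have h1 : forall x y : 'rV[R]_n, [set xe e] x -> `|y - x| <= rho e ^+ N1 -> Om e y by near: e.
have h2 : forall x y z : 'rV[R]_n, [set xe e] x ->
    `|y - x| <= rho e ^+ N -> `|z - x| <= rho e ^+ N ->
    `|D i e z - D i e y| <= rho e ^- N * `|z - y| by near: e.
pose c (t : R) := xe e + t *: (delta_mx 0 i : 'rV[R]_n).
have cx t : 0 <= t <= rho e ^+ p -> `|c t - xe e| <= rho e ^+ p.
  move=> /andP[t0 tp]; rewrite /c addrAC subrr add0r mx_normZ ger0_norm//.
  apply: le_trans tp; rewrite ler_piMr//; apply: norm_le_coord => // j; rewrite mxE /=.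
  by case: eqP => _; rewrite ?normr1 ?normr0.
have rp := rho_exp_gt0 p re.
have [t|t] := @MVT_any R (fun t => g e (c t)) (fun t => D i e (c t)) 0 (rho e ^+ p).
  rewrite (min_idPl (ltW rp)) (max_idPr (ltW rp)) => tb.
  apply: is_derive_line; apply: gD => //; apply: (h1 (xe e)) => //.
  by apply: (le_trans (cx t tb)); apply: rho_expM.
rewrite (min_idPl (ltW rp)) (max_idPr (ltW rp)) => tb.
rewrite [c 0]/c scale0r addr0 subr0 -[c (rho e ^+ p)]/(ye e) => tE.
have h3 : `|g e (ye e) - g e (xe e)| <= rho e ^+ (p + n0.+1) by near: e; apply: nd.
have h4 : `|D i e (c t)| <= rho e ^+ n0.+1.
  move: h3; rewrite tE normrM [X in _ * X]ger0_norm ?(ltW rp)// exprD mulrC ler_pM2l//.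
have h5 : `|D i e (c t) - D i e (xe e)| <= rho e ^+ n0.+1.
  apply: (le_trans (h2 (xe e) (xe e) (c t) _ _ _)) => //.
  - by rewrite subrr normr0 rho_exp_ge0.
  - by apply: (le_trans (cx t tb)); apply: rho_expM.
  apply: (@le_trans _ _ (rho e ^- N * rho e ^+ (N + n0.+1))); last by rewrite rho_expVMX.
  rewrite ler_wpM2l ?invr_ge0 ?rho_exp_ge0//; apply: (le_trans (cx t tb)).
  by apply: rho_expM.
have h6 : 2 * rho e ^+ n0.+1 <= rho e ^+ n0 by near: e; apply: near_rhoX.
have := ler_normB (D i e (c t)) (D i e (c t) - D i e (xe e)).
rewrite opprB addrCA subrr addr0; lra.
Unshelve. all: by end_near. Qed.

(** Interior points approximate x to every order, and the partial is Lipschitz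
    with a moderate constant. *)
Lemma partial_negl n (X : set 'rV[rc]_n) Om g D i : netdom X Om -> fat X ->
  Cnet X Om 1 (D i) ->
  (forall e x, 0 < e <= 1 -> Om e x -> is_derive x (delta_mx 0 i) (g e) (D i e x)) ->
  (forall x xe, X x -> vrepresents xe x -> negl rho (fun e => g e (xe e))) ->
  forall x xe, X x -> vrepresents xe x -> negl rho (fun e => D i e (xe e)).
Proof.
move=> dX fX DC gD gn x xe Xx hx n0.
have [N hN] := unif_lipschitz dX DC (nets_in1 Xx hx).
have [z [ze [intz hz zx]]] := (sharp_closureP _ hx).1 (fX x Xx) (N + n0.+1)%N.
have Xz : X z.
  by have [m hm] := sharp_interior_net intz hz; apply: (hm z ze hz);
    near=> e; rewrite subrr normr0 rho_exp_ge0//; near: e; apply: gauge_near.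
have nz := partial_negl_int dX DC gD gn Xz intz hz.
near=> e.
have re : 0 < rho e <= 1 by near: e; apply: gauge_near.
have h2 : forall x y z : 'rV[R]_n, [set xe e] x ->
    `|y - x| <= rho e ^+ N -> `|z - x| <= rho e ^+ N ->
    `|D i e z - D i e y| <= rho e ^- N * `|z - y| by near: e.
have h1 : `|ze e - xe e| <= rho e ^+ (N + n0.+1) by near: e.
have h4 : `|D i e (ze e)| <= rho e ^+ n0.+1 by near: e; apply: nz.
have h5 : `|D i e (ze e) - D i e (xe e)| <= rho e ^+ n0.+1.
  apply: (le_trans (h2 (xe e) (xe e) (ze e) _ _ _)) => //.
  - by rewrite subrr normr0 rho_exp_ge0.
  - by apply: (le_trans h1); apply: rho_expM => //; lia.
  apply: (@le_trans _ _ (rho e ^- N * rho e ^+ (N + n0.+1))); last by rewrite rho_expVMX.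
  by rewrite ler_wpM2l ?invr_ge0 ?rho_exp_ge0.
have h6 : 2 * rho e ^+ n0.+1 <= rho e ^+ n0 by near: e; apply: near_rhoX.
have := ler_normB (D i e (ze e)) (D i e (ze e) - D i e (xe e)).
rewrite opprB addrCA subrr addr0; lra.
Unshelve. all: by end_near. Qed.

Lemma Snet_sub n (X : set 'rV[rc]_n) Om Om' k g : netdom X Om' ->
  (forall e, Om' e `<=` Om e) -> Cnet X Om k g -> Cnet X Om' k g.
Proof.
move=> dX OO; elim: k g => [|k ih] g /CnetP[gc gm gD]; apply/CnetP; split => //.
- by move=> e x e01 /OO; apply: gc.
- by move=> e x e01 /OO; apply: gc.
have [D [DC gDD]] := gD; exists D; split => [i|i e x e01 /OO]; last exact: gDD.
exact: ih.
Qed.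

(** By induction on the order: the difference of two nets of f is negligible on
    X, hence so are its partials. *)
Lemma pderive_unique n m (X : set 'rV[rc]_n) (f : 'rV[rc]_n -> 'rV[rc]_m) Om fe Om' fe' :
  fat X -> gsf_net X f Om fe -> gsf_net X f Om' fe' ->
  forall s j x xe, X x -> vrepresents xe x ->
  negl rho (fun e => pderive s (vcomp (fe e) j) (xe e) - pderive s (vcomp (fe' e) j) (xe e)).
Proof.
move=> fX hf hf' s j.
pose O e := Om e `&` Om' e.
have dX : netdom X O := netdomI (gsf_net_dom hf) (gsf_net_dom hf').
have S1 s' : Snet X O (fun e => pderive s' (vcomp (fe e) j)).
  by move=> k; apply: Snet_sub dX _ (gsf_net_Snet hf s' j k) => e x [].
have S2 s' : Snet X O (fun e => pderive s' (vcomp (fe' e) j)).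
  by move=> k; apply: Snet_sub dX _ (gsf_net_Snet hf' s' j k) => e x [].
elim: s => [|i s ih] x xe Xx hx.
  exact: represents_negl (gsf_net_val hf Xx hx j) (gsf_net_val hf' Xx hx j).
have /= [d1 d1E] := Snet_D dX (S1 s) i; have /= [d2 d2E] := Snet_D dX (S2 s) i.
pose g e x := pderive s (vcomp (fe e) j) x - pderive s (vcomp (fe' e) j) x.
pose D (_ : 'I_n) e x := pderive (i :: s) (vcomp (fe e) j) x + (-1) * pderive (i :: s) (vcomp (fe' e) j) x.
have DC : Cnet X O 1 (D i).
  apply: CnetD (d1 1%N) (CnetM _ (d2 1%N)).
  by apply: (@Cnet_cst n X O 1 (fun=> -1)); apply: mod_net_cst.
have gD e y : 0 < e <= 1 -> O e y -> is_derive y (delta_mx 0 i) (g e) (D i e y).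
  move=> e01 Oy; rewrite /D mulN1r.
  exact: is_deriveB (d1E e y e01 Oy) (d2E e y e01 Oy).
have := partial_negl dX fX DC gD ih Xx hx.
set a := fun _ => _; set b := fun _ => _; suff -> : a = b by [].
by apply/funext => e; rewrite /a /b /D mulN1r.
Qed.

(** On a set that lies in the closure of its interior the derivative of a
    generalized smooth function is computed by any net, boundary points
    included: the derivative of a net is sharply continuous on X. *)
Lemma gderivE n m (X : set 'rV[rc]_n) (f : 'rV[rc]_n -> 'rV[rc]_m) Om fe s x xe j :
  fat X -> gsf_net X f Om fe -> X x -> vrepresents xe x ->
  represents (fun e => pderive s (vcomp (fe e) j) (xe e)) (gderiv X f s x 0 j).
Proof.
move=> fX hf Xx hx; have dX := gsf_net_dom hf.
have intE z ze : X z -> vrepresents ze z ->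
    forall j, represents (fun e => pderive s (vcomp (fe e) j) (ze e)) (gderiv_int X f s z 0 j).
  move=> Xz hz; rewrite /gderiv_int; set S := (X in xget _ X).
  have Sy : S (\row_j rcclass rho (fun e => pderive s (vcomp (fe e) j) (ze e))).
    exists Om, fe, ze; split => // j'; rewrite mxE; apply: represents_rcclass.
    exact: (Cnet_mod (gsf_net_Snet hf s j' 0) Xz hz).
  have [Om' [fe' [ze' [hf' hz' hS]]]] : S (xget 0 S) by apply: xgetPex; eexists; apply: Sy.
  move=> j'; apply: (represents_congr (hS j')).
  have n1 := pderive_unique fX hf hf' s j' Xz hz.
  have n2 := Cnet_negl (gsf_net_dom hf') (gsf_net_Snet hf' s j' 1) Xz hz' hz.
  apply: (negl_le (neglD n1 n2)); near=> e.
  by rewrite addrA subrK.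
rewrite /gderiv; case: ifPn => [|nint]; first by move=> _; apply: intE.
set S := (X in xget _ X).
pose y0 : 'rV[rc]_m := \row_j rcclass rho (fun e => pderive s (vcomp (fe e) j) (xe e)).
have hy0 : vrepresents (fun e => \row_j pderive s (vcomp (fe e) j) (xe e)) y0.
  move=> j'; rewrite mxE; under eq_fun do rewrite mxE; apply: represents_rcclass.
  exact: (Cnet_mod (gsf_net_Snet hf s j' 0) Xx hx).
have Xint z : sharp_interior X z -> X z.
  move=> intz; have hz := vrepresents_vnet z; have [p hp] := sharp_interior_net intz hz.
  by apply: (hp z _ hz); near=> e; rewrite subrr normr0 rho_exp_ge0//; near: e; apply: gauge_near.
have near_y0 p : exists q, forall z ze, sharp_interior X z -> vrepresents ze z ->
    (\near0 e, `|ze e - xe e| <= rho e ^+ q) ->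
    \near0 e, `|(\row_j pderive s (vcomp (fe e) j) (ze e)) - \row_j pderive s (vcomp (fe e) j) (xe e)| <= rho e ^+ p.
  have /choice[N hN] : forall j', exists N, \near0 e, forall x y z : 'rV[R]_n, [set xe e] x ->
    `|y - x| <= rho e ^+ N -> `|z - x| <= rho e ^+ N ->
    `|pderive s (vcomp (fe e) j') z - pderive s (vcomp (fe e) j') y| <= rho e ^- N * `|z - y|.
    by move=> j'; apply: unif_lipschitz dX (gsf_net_Snet hf s j' 1) (nets_in1 Xx hx).
  have hN' : \near0 e, forall j' (x y z : 'rV[R]_n), [set xe e] x ->
    `|y - x| <= rho e ^+ N j' -> `|z - x| <= rho e ^+ N j' ->
    `|pderive s (vcomp (fe e) j') z - pderive s (vcomp (fe e) j') y| <= rho e ^- N j' * `|z - y|.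
    by apply: filter_forall => j'; exact: hN.
  exists (\max_j' N j' + p)%N => z ze intz hz zx; near=> e.
  have re : 0 < rho e <= 1 by near: e; apply: gauge_near.
  have h : forall j' (x y z : 'rV[R]_n), [set xe e] x ->
    `|y - x| <= rho e ^+ N j' -> `|z - x| <= rho e ^+ N j' ->
    `|pderive s (vcomp (fe e) j') z - pderive s (vcomp (fe e) j') y| <= rho e ^- N j' * `|z - y| by near: e.
  have h1 : `|ze e - xe e| <= rho e ^+ (\max_j' N j' + p) by near: e.
  apply: norm_le_coord => [|j']; first exact: rho_exp_ge0.
  have le_N : (N j' <= \max_j' N j')%N by apply: leq_bigmax.
  rewrite !mxE; apply: (le_trans (h j' (xe e) (xe e) (ze e) _ _ _)) => //.
  - by rewrite subrr normr0 rho_exp_ge0.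
  - by apply: (le_trans h1); apply: rho_expM => //; lia.
  apply: (@le_trans _ _ (rho e ^- N j' * rho e ^+ (N j' + p))); last by rewrite rho_expVMX.
  rewrite ler_wpM2l ?invr_ge0 ?rho_exp_ge0//; apply: (le_trans h1).
  by apply: rho_expM => //; lia.
have Sy0 : S y0.
  move=> U /(sharp_nbhsP _ hy0)[p hp].
  have [q hq] := near_y0 p.
  apply/(sharp_nbhsP _ hx); exists q => z ze hz zx intz.
  change (U (gderiv_int X f s z)).
  apply: (hp (gderiv_int X f s z) (fun e => \row_j pderive s (vcomp (fe e) j) (ze e))); last exact: hq z ze intz hz zx.
  move=> j'; under eq_fun do rewrite mxE; apply: intE => //; exact: Xint.
have : S (xget 0 S) by apply: xgetPex; exists y0.
set y := xget 0 S => Sy; have hy := vrepresents_vnet y.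
suff -> : y = y0 by have := hy0 j; under eq_fun do rewrite mxE.
apply: (@vrepresents_inj _ (vnet y)) => //; apply: (vrepresents_congr hy0).
move=> p.
have [q hq] := near_y0 p.+1.
have hW : sharp_nbhs x [set z | sharp_interior X z -> forall ye,
    vrepresents ye (gderiv_int X f s z) -> \near0 e, `|ye e - vnet y e| <= rho e ^+ p.+1].
  exact: (Sy _ (sharp_nbhs_net p.+1 hy)).
have [z [intz [hz1 hz2]]] := fX x Xx _ (sharp_nbhsI hW (sharp_nbhs_net q hx)).
have hz := vrepresents_vnet z.
have hgz : vrepresents (fun e => \row_j pderive s (vcomp (fe e) j) (vnet z e)) (gderiv_int X f s z).
  move=> j'; under eq_fun do rewrite mxE; apply: intE => //; exact: Xint.
have k1 := hz1 intz _ hgz; have k2 := hq z _ intz hz (hz2 _ hz).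
near=> e; rewrite normr_id.
have h1 : `|(\row_j pderive s (vcomp (fe e) j) (vnet z e)) - vnet y e| <= rho e ^+ p.+1 by near: e.
have h2 : `|(\row_j pderive s (vcomp (fe e) j) (vnet z e)) - \row_j pderive s (vcomp (fe e) j) (xe e)| <= rho e ^+ p.+1 by near: e.
have h6 : 2 * rho e ^+ p.+1 <= rho e ^+ p by near: e; apply: near_rhoX.
rewrite -(subrKA (\row_j pderive s (vcomp (fe e) j) (vnet z e))).
apply: (le_trans (ler_normD _ _)); rewrite distrC; lra.
Unshelve. all: by end_near. Qed.

(** Partials of the scaled function agree with the scaled partials on an open
    set, so the induction can differentiate the identity once more. *)
Lemma pderiveZ n (X : set 'rV[rc]_n) Om g (c : R -> R) : netdom X Om -> Snet X Om g ->
  forall s e x, 0 < e <= 1 -> Om e x ->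
  pderive s (fun x => c e * g e x) x = c e * pderive s (g e) x.
Proof.
move=> dX Sg; elim=> [//|i s ih] e x e01 Ox /=; apply/derive_val.
have h := is_deriveZ (c e) ((Snet_D dX (Snet_pderive s dX Sg) i).2 e x e01 Ox).
apply: near_eq_is_derive h; have oO : nbhs x (Om e) by apply: open_nbhs_nbhs; split => //; apply: dX.1.
by near=> y; rewrite ih//; near: y.
Unshelve. all: by end_near. Qed.

Lemma is_derive_lsub n m (g : 'rV[R]_n -> R) (x : 'rV[R]_(n + m)) i dg :
  is_derive (lsubmx x) (delta_mx 0 i) g dg ->
  is_derive x (delta_mx 0 (lshift m i)) (fun y : 'rV[R]_(n + m) => g (lsubmx y)) dg.
Proof.
move/is_derive_cvgP => h; apply/is_derive_cvgP; move: h.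
set u := fun _ => _; set v := fun _ => _; suff -> : u = v by [].
apply/funext => h; rewrite /u /v; congr (_ * (g _ - _)).
by apply/rowP => j; rewrite !mxE eq_lshift.
Qed.

Lemma is_derive_lsub0 n m (g : 'rV[R]_n -> R) (x : 'rV[R]_(n + m)) i :
  is_derive x (delta_mx 0 (rshift n i)) (fun y : 'rV[R]_(n + m) => g (lsubmx y)) 0.
Proof.
apply/is_derive_cvgP.
rewrite (_ : (fun h => _) = fun=> 0); first exact: cvg_cst.
apply/funext => h.
have -> : lsubmx (h *: delta_mx 0 (rshift n i) + x) = lsubmx x.
  by apply/rowP => j; rewrite !mxE eq_lrshift mulr0 add0r.
by rewrite subrr mulr0.
Qed.

End Vectors.

(** * Products and preimages of domains *)

Lemma near0_forall_exp {R : realType} (rho : gauge R) (I : finType) (P : nat -> R -> I -> Prop) :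
  (forall N M e i, 0 < rho e <= 1 -> (N <= M)%N -> P N e i -> P M e i) ->
  (forall i, exists N, \near0 e, P N e i) -> exists N, \near0 e, forall i, P N e i.
Proof.
move=> Pm /choice[N hN]; exists (\max_i N i)%N.
have : \near0 e, forall i, P (N i) e i by apply: filter_forall => i; exact: hN.
move=> h; near=> e => i.
have re : 0 < rho e <= 1 by near: e; apply: gauge_near.
apply: (Pm (N i)) => //; first exact: leq_bigmax.
by move: i; near: e.
Unshelve. all: by end_near. Qed.

Section Products.
Context {R : realType} (rho : gauge R).
Notation rc := (rcnum rho).

Definition setprod n m (X : set 'rV[rc]_n) (Y : set 'rV[rc]_m) : set 'rV[rc]_(n + m) :=
  [set x | X (lsubmx x) /\ Y (rsubmx x)].

Lemma norm_lsubmx n m (x : 'rV[R]_(n + m)) : `|lsubmx x| <= `|x|.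
Proof. by apply: norm_le_coord => // i; rewrite mxE; apply: coord_le_norm. Qed.

Lemma norm_rsubmx n m (x : 'rV[R]_(n + m)) : `|rsubmx x| <= `|x|.
Proof. by apply: norm_le_coord => // i; rewrite mxE; apply: coord_le_norm. Qed.

Lemma fat_setprod n m (X : set 'rV[rc]_n) (Y : set 'rV[rc]_m) :
  fat X -> fat Y -> fat (setprod X Y).
Proof.
move=> fX fY x [Xx Yx]; have hx := vrepresents_vnet x.
apply/(sharp_closureP _ hx) => p.
have [y [ye [iy hy yx]]] := (sharp_closureP _ (vrepresents_lsubmx hx)).1 (fX _ Xx) p.
have [z [ze [iz hz zx]]] := (sharp_closureP _ (vrepresents_rsubmx hx)).1 (fY _ Yx) p.
have hyz := vrepresents_row_mx hy hz.
exists (row_mx y z), (fun e => row_mx (ye e) (ze e)); split => //.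
  have [m1 h1] := sharp_interior_net iy hy; have [m2 h2] := sharp_interior_net iz hz.
  apply/(sharp_nbhsP _ hyz); exists (m1 + m2)%N => w we hw wyz; split.
    apply: (h1 _ _ (vrepresents_lsubmx hw)); near=> e.
    have re : 0 < rho e <= 1 by near: e; apply: gauge_near.
    have h : `|we e - row_mx (ye e) (ze e)| <= rho e ^+ (m1 + m2) by near: e.
    rewrite -[ye e](row_mxKl _ (ze e)) -linearB/=; apply: (le_trans (norm_lsubmx _)).
    by apply: (le_trans h); apply: rho_expM => //; rewrite leq_addr.
  apply: (h2 _ _ (vrepresents_rsubmx hw)); near=> e.
  have re : 0 < rho e <= 1 by near: e; apply: gauge_near.
  have h : `|we e - row_mx (ye e) (ze e)| <= rho e ^+ (m1 + m2) by near: e.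
  rewrite -[ze e](row_mxKr (ye e)) -linearB/=; apply: (le_trans (norm_rsubmx _)).
  by apply: (le_trans h); apply: rho_expM => //; rewrite leq_addl.
near=> e; rewrite -[vnet x e]hsubmxK opp_row_mx add_row_mx; apply: norm_row_mx; near: e; [exact: yx|exact: zx].
Unshelve. all: by end_near. Qed.

Lemma fat_setT n : fat [set: 'rV[rc]_n].
Proof.
move=> x _; have hx := vrepresents_vnet x; apply/(sharp_closureP _ hx) => p.
exists x, (vnet x); split => //.
  by apply/(sharp_nbhsP _ hx); exists 0%N.
near=> e; rewrite subrr normr0 rho_exp_ge0//; near: e; exact: gauge_near.
Unshelve. all: by end_near. Qed.

Lemma fat_solid n (X : set 'rV[rc]_n) : solid X -> fat X.
Proof. by move=> sX x; rewrite {1}sX. Qed.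

(** * Generalized smooth functions from nets *)

Lemma Snet_gsf n m (X : set 'rV[rc]_n) Om (c : 'I_m -> R -> 'rV[R]_n -> R) :
  netdom X Om -> (forall j, Snet X Om (c j)) ->
  gsf_net X (fun x => \row_j rcclass rho (fun e => c j e (vnet x e))) Om
    (fun e x => \row_j c j e x).
Proof.
move=> dX Sc; apply: Snet_gsf_net => // [j|x xe Xx hx j].
  move=> k; apply: (Cnet_ext dX _ (Sc j k)) => e x _ _.
  by rewrite /vcomp mxE.
rewrite mxE; under eq_fun do rewrite mxE.
have hv := vrepresents_vnet x.
apply: (represents_congr (represents_rcclass _)).
  exact: (Cnet_mod (Sc j 0%N) Xx hv).
exact: Cnet_negl dX (Sc j 1%N) Xx hv hx.
Qed.

Lemma netdom_preimage n m (X : set 'rV[rc]_n) Om (Y : set 'rV[rc]_m) Om'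
    (G : R -> 'rV[R]_n -> 'rV[R]_m) : netdom X Om -> netdom Y Om' ->
  (forall i, Cnet X Om 0 (fun e x => G e x 0 i)) ->
  (forall x xe, X x -> vrepresents xe x ->
     exists2 y, Y y & vrepresents (fun e => G e (xe e)) y) ->
  netdom X (fun e => [set x | Om e x /\ Om' e (G e x)]).
Proof.
move=> [oO XO] [oO' YO'] CG GY; split=> [e e01|x Xx xe hx]; last first.
  have [y Yy hy] := GY _ _ Xx hx; near=> e; split; near: e.
    exact: XO Xx _ hx.
  exact: YO' Yy _ hy.
rewrite openE => x /= [Ox Ox'].
have h1 : nbhs x (Om e) by apply: open_nbhs_nbhs; split => //; apply: oO.
have h2 : nbhs (G e x) (Om' e) by apply: open_nbhs_nbhs; split => //; apply: oO'.
have Gc : {for x, continuous (G e)}.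
  by apply: row_continuous => i; apply: (Cnet_cts (CG i)).
exact: filterI h1 (Gc _ h2).
Unshelve. all: by end_near. Qed.

End Products.

(** * Generalized curves *)

Section Curves.
Context {R : realType} (rho : gauge R).
Notation rc := (rcnum rho).
Variables (t1 t2 : rc) (a b : R -> R).
Hypotheses (t12 : t1 <~ t2) (ha : represents a t1) (hb : represents b t2).

Lemma time_gap : exists N, \near0 e, a e + rho e ^+ N <= b e.
Proof. exact: (gltP ha hb).1. Qed.

Lemma near_time : \near0 e, a e < b e.
Proof.
have [N hN] := time_gap; near=> e.
have re : 0 < rho e <= 1 by near: e; apply: gauge_near.
have : a e + rho e ^+ N <= b e by near: e.
have := rho_exp_gt0 N re; lra.
Unshelve. all: by end_near. Qed.

Lemma gitv_rep t te : represents te t -> (\near0 e, a e <= te e <= b e) -> gitv t1 t2 t.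
Proof.
move=> ht tab; split; [apply/(gleP ha ht)|apply/(gleP ht hb)] => n; near=> e;
  (have re : 0 < rho e <= 1 by near: e; apply: gauge_near);
  (have /andP[h1 h2] : a e <= te e <= b e by near: e);
  have := rho_exp_gt0 n re; lra.
Unshelve. all: by end_near. Qed.

Lemma gitv_clamp t te : gitv t1 t2 t -> represents te t ->
  represents (fun e => clamp (a e) (b e) (te e)) t.
Proof.
move=> [h1 h2] ht; apply: (represents_congr ht) => n; near=> e.
have k1 : a e <= te e + rho e ^+ n by near: e; apply: ((gleP ha ht).1 h1).
have k2 : te e <= b e + rho e ^+ n by near: e; apply: ((gleP ht hb).1 h2).
have re : 0 < rho e <= 1 by near: e; apply: gauge_near.
have rn := rho_exp_gt0 n re.
have ab : a e < b e by near: e; apply: near_time.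
rewrite ler_norml; apply/andP.
by case: (clampP (te e) (ltW ab)) => -[k3 ->]; split; lra.
Unshelve. all: by end_near. Qed.

Lemma near_clamp te : \near0 e, a e <= clamp (a e) (b e) (te e) <= b e.
Proof. by near=> e; apply: clamp_itv; apply: ltW; near: e; apply: near_time.
Unshelve. all: by end_near. Qed.

Lemma itv_mod te : (\near0 e, a e <= te e <= b e) -> mod_net rho te.
Proof.
move=> tab; apply: (mod_net_le (mod_netD (mod_net_norm (represents_mod ha)) (mod_net_norm (represents_mod hb)))).
near=> e; rewrite [leRHS]ger0_norm ?addr_ge0//.
have /andP[h1 h2] : a e <= te e <= b e by near: e.
have := ler_norm (a e); have := ler_norm (b e); have := ler_norm (- a e); have := ler_norm (- b e).
rewrite !normrN; rewrite ler_norml => *; apply/andP; split; lra.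
Unshelve. all: by end_near. Qed.

Lemma itv_rep te : (\near0 e, a e <= te e <= b e) ->
  exists2 t, gitv t1 t2 t & represents te t.
Proof.
move=> tab; have ht := represents_rcclass (itv_mod tab).
by exists (rcclass rho te) => //; apply: gitv_rep ht tab.
Qed.

Definition tset e : set 'rV[R]_1 := [set x | a e <= x 0 0 <= b e].

Lemma nets_in_tset : nets_in tset (titv t1 t2).
Proof.
split=> [|xe hxe].
  near=> e; exists (const_mx (a e)); rewrite /tset /= mxE lexx ltW//; near: e; exact: near_time.
have [t tt ht] := itv_rep hxe; exists (const_mx t); first by rewrite /titv /= mxE.
by move=> i; rewrite !mxE ord1.
Unshelve. all: by end_near. Qed.

Lemma curve_unif (P : R -> R -> Prop) :
  (forall t te, gitv t1 t2 t -> represents te t -> (\near0 e, a e <= te e <= b e) ->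
     \near0 e, P e (te e)) ->
  \near0 e, forall t, a e <= t <= b e -> P e t.
Proof.
move=> h; apply: (@near0_unif R R (fun e => [set t | a e <= t <= b e])).
  near=> e; exists (a e); rewrite /= lexx ltW//; near: e; exact: near_time.
by move=> te tab; have [t tt ht] := itv_rep tab; apply: h ht tab.
Unshelve. all: by end_near. Qed.

(** Points are moved inside by a power of rho, for which t2 - t1 leaves room. *)
Lemma fat_titv : fat (titv t1 t2).
Proof.
move=> x tx; have hx := vrepresents_vnet x; apply/(sharp_closureP _ hx) => p.
have [N hN] := time_gap.
pose q := (p + N).+2.
pose te e := clamp (a e + rho e ^+ q) (b e - rho e ^+ q) (clamp (a e) (b e) (vnet x e 0 0)).
have hc := gitv_clamp tx (hx 0).
have tb : \near0 e, a e + rho e ^+ q <= te e <= b e - rho e ^+ q.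
  near=> e; apply: clamp_itv.
  have re : 0 < rho e <= 1 by near: e; apply: gauge_near.
  have k1 : a e + rho e ^+ N <= b e by near: e.
  have k2 : 2 * rho e ^+ q <= rho e ^+ (p + N).+1 by near: e; apply: near_rhoX.
  have k3 : rho e ^+ (p + N).+1 <= rho e ^+ N by apply: rho_expM => //; lia.
  lra.
have tab : \near0 e, a e <= te e <= b e.
  near=> e; have /andP[k1 k2] : a e + rho e ^+ q <= te e <= b e - rho e ^+ q by near: e.
  have re : 0 < rho e <= 1 by near: e; apply: gauge_near.
  have rq := rho_exp_gt0 q re; apply/andP; split; lra.
have [t tt ht] := itv_rep tab.
have htm := vrepresents_const_mx ht.
exists (const_mx t), (fun e => const_mx (te e)); split => //.
  apply/(sharp_nbhsP _ htm); exists q => y ye hy yt.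
  apply: (gitv_rep (hy 0)); near=> e.
  have /andP[k1 k2] : a e + rho e ^+ q <= te e <= b e - rho e ^+ q by near: e.
  have k3 : `|ye e - const_mx (te e)| <= rho e ^+ q by near: e.
  have := le_trans (coord_le_norm _ 0) k3; rewrite !mxE ler_norml => /andP[k4 k5].
  by apply/andP; split; lra.
have hd := represents_negl hc (hx 0).
near=> e.
have re : 0 < rho e <= 1 by near: e; apply: gauge_near.
apply: norm_le_coord => [|i]; first exact: rho_exp_ge0.
rewrite (_ : i = 0) ?ord1//.
have -> : (const_mx (te e) - vnet x e) 0 0 = te e - vnet x e 0 0 by rewrite !mxE.
have k0 : a e < b e by near: e; apply: near_time.
have k1 : `|clamp (a e) (b e) (vnet x e 0 0) - vnet x e 0 0| <= rho e ^+ p.+1 by near: e; apply: hd.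
have k2 : 2 * rho e ^+ p.+1 <= rho e ^+ p by near: e; apply: near_rhoX.
have k3 : rho e ^+ q <= rho e ^+ p.+1 by apply: rho_expM => //; rewrite /q; lia.
have k4 := clamp_itv (vnet x e 0 0) (ltW k0).
have rq := rho_exp_gt0 q re.
have k5 : a e + rho e ^+ q <= b e - rho e ^+ q.
  have /andP[] : a e + rho e ^+ q <= te e <= b e - rho e ^+ q by near: e.
  exact: le_trans.
move: k1 k4; rewrite /te; set c := clamp (a e) (b e) _; set z := vnet x e 0 0.
rewrite !ler_norml => /andP[c1 c2] /andP[c3 c4]; apply/andP.
by case: (clampP c k5) => -[c5 ->]; split; lra.
Unshelve. all: by end_near. Qed.

Lemma row1E (x : 'rV[R]_1) : x = const_mx (x 0 0).
Proof. by apply/rowP => i; rewrite mxE ord1. Qed.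

Lemma is_derive_time (g : 'rV[R]_1 -> R) (t d : R) (i : 'I_1) :
  is_derive (const_mx t) (delta_mx 0 i) g d <-> is_derive t 1 (fun s : R => g (const_mx s)) d.
Proof.
rewrite !is_derive_cvgP (ord1 i); set u := fun _ => _; set v := fun _ => _.
suff -> : u = v by [].
apply/funext => h; rewrite /u /v; congr (_ * (g _ - _)).
by apply/rowP => j; rewrite !mxE (ord1 j) eqxx.
Qed.

Lemma tset_near N : \near0 e, forall t, a e - rho e ^+ N <= t <= b e + rho e ^+ N ->
  tset e (const_mx (clamp (a e) (b e) t)) /\
  `|(const_mx t : 'rV[R]_1) - const_mx (clamp (a e) (b e) t)| <= rho e ^+ N.
Proof.
near=> e => t /andP[t1' t2'].
have ab : a e < b e by near: e; apply: near_time.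
have re : 0 < rho e <= 1 by near: e; apply: gauge_near.
have rN := rho_exp_gt0 N re.
split; first by rewrite /tset /= mxE clamp_itv// ltW.
apply: norm_le_coord => [|i]; first exact: ltW.
rewrite !mxE ler_norml; apply/andP.
by case: (clampP t (ltW ab)) => -[h ->]; split; lra.
Unshelve. all: by end_near. Qed.

Lemma time_dom Om : netdom (titv t1 t2) Om -> exists N, \near0 e, forall t,
  a e - rho e ^+ N <= t <= b e + rho e ^+ N -> Om e (const_mx t).
Proof.
move=> [_ XO]; have [N hN] := unif_dom XO nets_in_tset.
exists N; near=> e => t tb.
have h : forall x y : 'rV[R]_1, tset e x -> `|y - x| <= rho e ^+ N -> Om e y by near: e.
have k : forall t, a e - rho e ^+ N <= t <= b e + rho e ^+ N ->
  tset e (const_mx (clamp (a e) (b e) t)) /\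
  `|(const_mx t : 'rV[R]_1) - const_mx (clamp (a e) (b e) t)| <= rho e ^+ N.
  by near: e; apply: tset_near.
by have [k1 k2] := k t tb; apply: h k1 k2.
Unshelve. all: by end_near. Qed.

Lemma time_bound (g : R -> 'rV[R]_1 -> R) : mod_on (titv t1 t2) g -> exists N, \near0 e, forall t,
  a e - rho e ^+ N <= t <= b e + rho e ^+ N -> `|g e (const_mx t)| <= rho e ^- N.
Proof.
move=> mg; have [N hN] := unif_bound mg nets_in_tset.
exists N; near=> e => t tb.
have h : forall x y : 'rV[R]_1, tset e x -> `|y - x| <= rho e ^+ N -> `|g e y| <= rho e ^- N by near: e.
have k : forall t, a e - rho e ^+ N <= t <= b e + rho e ^+ N ->
  tset e (const_mx (clamp (a e) (b e) t)) /\
  `|(const_mx t : 'rV[R]_1) - const_mx (clamp (a e) (b e) t)| <= rho e ^+ N.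
  by near: e; apply: tset_near.
by have [k1 k2] := k t tb; apply: h k1 k2.
Unshelve. all: by end_near. Qed.

(** The net dc of the derivatives is carried along with c and tied to it by
    derivatives of functions of one real variable, so that directional
    derivatives on 'rV_1 need not be computed. *)
Definition curvenet k (f : rc -> 'rV[rc]_k) Om (c dc : R -> R -> 'rV[R]_k) :=
  [/\ netdom (titv t1 t2) Om,
      forall j, Snet (titv t1 t2) Om (fun e x => c e (x 0 0) 0 j),
      forall j, Snet (titv t1 t2) Om (fun e x => dc e (x 0 0) 0 j),
      forall t te, gitv t1 t2 t -> represents te t -> vrepresents (fun e => c e (te e)) (f t) &
      forall e t j, 0 < e <= 1 -> Om e (const_mx t) ->
        is_derive t 1 (fun s => c e s 0 j) (dc e t 0 j)].

Lemma curvenet_gsf k (f : rc -> 'rV[rc]_k) Om c dc : curvenet f Om c dc ->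
  gsf_net (titv t1 t2) (oncurve f) Om (fun e x => c e (x 0 0)).
Proof.
move=> [dX Sc _ cv _]; apply: Snet_gsf_net => //.
by move=> x xe Xx hx; apply: cv => //; apply: hx.
Qed.

Lemma curvenet_gcurve k (f : rc -> 'rV[rc]_k) Om c dc Y : curvenet f Om c dc ->
  (forall t, gitv t1 t2 t -> Y (f t)) -> gcurve t1 t2 Y f.
Proof.
move=> h fY; split; first by move=> x; apply: fY.
by exists Om, (fun e x => c e (x 0 0)); apply: curvenet_gsf h.
Qed.

Lemma gcurve_curvenet k (f : rc -> 'rV[rc]_k) Y : gcurve t1 t2 Y f ->
  exists Om c dc, curvenet f Om c dc.
Proof.
move=> [_ [Om [fe hf]]]; have dX := gsf_net_dom hf.
exists Om, (fun e t => fe e (const_mx t)),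
  (fun e t => \row_j pderive [:: ord0] (vcomp (fe e) j) (const_mx t)).
have S0 j : Snet (titv t1 t2) Om (fun e => vcomp (fe e) j) := gsf_net_Snet hf [::] j.
split => //.
- by move=> j k'; apply: (Cnet_ext dX _ (S0 j k')) => e x _ _; rewrite -row1E.
- move=> j k'; apply: (Cnet_ext dX _ (gsf_net_Snet hf [:: ord0] j k')) => e x _ _.
  by rewrite mxE -row1E.
- move=> t te tt ht; have := gsf_net_val hf (x := const_mx t) (xe := fun e => const_mx (te e)).
  rewrite /oncurve mxE; apply; first by rewrite /titv /= mxE.
  exact: vrepresents_const_mx.
- move=> e t j e01 Ot; rewrite mxE; apply/(is_derive_time (vcomp (fe e) j) t _ ord0).
  exact: (Snet_D dX (S0 j) ord0).2.
Qed.

Lemma curvenet_gdot k (f : rc -> 'rV[rc]_k) Om c dc : curvenet f Om c dc ->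
  forall t te, gitv t1 t2 t -> represents te t ->
  vrepresents (fun e => dc e (te e)) (gdot t1 t2 f t).
Proof.
move=> hc t te tt ht j; have hf := curvenet_gsf hc; have [[_ XO] _ _ _ cd] := hc.
have ttm : titv t1 t2 (const_mx t) by rewrite /titv /= mxE.
have htm := vrepresents_const_mx ht.
apply: (represents_congr (gderivE [:: ord0] j fat_titv hf ttm htm)).
apply: (negl_le (negl0 rho)); near=> e; rewrite normr0 normr_le0 subr_eq0; apply/eqP.
have Ot : Om e (const_mx (te e)) by near: e; apply: XO ttm _ htm.
have e01 : 0 < e <= 1 by near: e; apply: near0_itv.
have h1 : is_derive (te e) 1 (fun s => vcomp (fun x : 'rV[R]_1 => c e (x 0 0)) j (const_mx s)) (dc e (te e) 0 j).
  rewrite (_ : (fun _ => _) = fun s => c e s 0 j); last by apply/funext => s; rewrite /vcomp mxE.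
  exact: cd.
by have [_ <-] := (is_derive_time _ _ _ ord0).2 h1.
Unshelve. all: by end_near. Qed.

Lemma curvenet_bound k (f : rc -> 'rV[rc]_k) Om c dc : curvenet f Om c dc ->
  exists N, \near0 e, forall t, a e - rho e ^+ N <= t <= b e + rho e ^+ N ->
  [/\ Om e (const_mx t), `|c e t| <= rho e ^- N & `|dc e t| <= rho e ^- N].
Proof.
move=> [dX Sc Sd _ _].
have [N0 h0] := time_dom dX.
have mono N M e t : 0 < rho e <= 1 -> (N <= M)%N ->
    a e - rho e ^+ M <= t <= b e + rho e ^+ M -> a e - rho e ^+ N <= t <= b e + rho e ^+ N.
  move=> re NM /andP[h1 h2]; have := rho_expM re NM => h3; apply/andP; split; lra.
have [N1 h1] : exists N, \near0 e, forall (j : 'I_k), forall t, a e - rho e ^+ N <= t <= b e + rho e ^+ N ->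
    `|c e t 0 j| <= rho e ^- N /\ `|dc e t 0 j| <= rho e ^- N.
  apply: (@near0_forall_exp R rho) => [N M e j re NM h t tb|j].
    have [h1 h2] := h t (mono _ _ _ _ re NM tb); have h3 := rho_expVM re NM.
    by split; [apply: le_trans h1 h3|apply: le_trans h2 h3].
  have [N1 h1] := time_bound (Cnet_mod (Sc j 0%N)); have [N2 h2] := time_bound (Cnet_mod (Sd j 0%N)).
  exists (N1 + N2)%N; near=> e => t tb.
  have re : 0 < rho e <= 1 by near: e; apply: gauge_near.
  have k1 : forall t, a e - rho e ^+ N1 <= t <= b e + rho e ^+ N1 -> `|c e ((const_mx t : 'rV_1) 0 0) 0 j| <= rho e ^- N1 by near: e.
  have k2 : forall t, a e - rho e ^+ N2 <= t <= b e + rho e ^+ N2 -> `|dc e ((const_mx t : 'rV_1) 0 0) 0 j| <= rho e ^- N2 by near: e.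
  have := k1 t (mono _ _ _ _ re (leq_addr _ _) tb); have := k2 t (mono _ _ _ _ re (leq_addl _ _) tb).
  rewrite !mxE => l2 l1; split.
    by apply: (le_trans l1); apply: rho_expVM => //; rewrite leq_addr.
  by apply: (le_trans l2); apply: rho_expVM => //; rewrite leq_addl.
exists (N0 + N1)%N; near=> e => t tb.
have re : 0 < rho e <= 1 by near: e; apply: gauge_near.
have k0 : forall t, a e - rho e ^+ N0 <= t <= b e + rho e ^+ N0 -> Om e (const_mx t) by near: e.
have k1 : forall (j : 'I_k), forall t, a e - rho e ^+ N1 <= t <= b e + rho e ^+ N1 ->
    `|c e t 0 j| <= rho e ^- N1 /\ `|dc e t 0 j| <= rho e ^- N1 by near: e.
have r0 : 0 <= rho e ^- (N0 + N1) by rewrite invr_ge0 rho_exp_ge0.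
have r1 := rho_expVM re (leq_addl N0 N1).
have tb1 := mono _ _ _ _ re (leq_addl N0 N1) tb.
split; first exact: k0 (mono _ _ _ _ re (leq_addr _ _) tb).
  by apply: norm_le_coord => // j; apply: le_trans (k1 j t tb1).1 r1.
by apply: norm_le_coord => // j; apply: le_trans (k1 j t tb1).2 r1.
Unshelve. all: by end_near. Qed.

Lemma Snet_curvenet k Om (c dc : R -> R -> 'rV[R]_k) : netdom (titv t1 t2) Om ->
  (forall j, Snet (titv t1 t2) Om (fun e x => c e (x 0 0) 0 j)) ->
  (forall e t j, 0 < e <= 1 -> Om e (const_mx t) -> is_derive t 1 (fun s => c e s 0 j) (dc e t 0 j)) ->
  exists f, curvenet f Om c dc.
Proof.
move=> dX Sc cd.
have := Snet_gsf dX Sc; set f := fun x => _ => hf.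
exists (fun t => f (const_mx t)); split => //.
  move=> j k'; have [h1 h2] := Snet_D dX (Sc j) ord0.
  apply: (Cnet_ext dX _ (h1 k')) => e x e01 Ox.
  have cdx : is_derive (x 0 0) 1 (fun s => c e s 0 j) (dc e (x 0 0) 0 j).
    by apply: cd => //; rewrite -row1E.
  have [|_ <-] := (is_derive_time (fun x => c e (x 0 0) 0 j) (x 0 0) (dc e (x 0 0) 0 j) ord0).2.
    rewrite (_ : (fun _ => _) = fun s => c e s 0 j)//.
    by apply/funext => s; rewrite mxE.
  by rewrite -row1E.
move=> t te tt ht j.
have ttm : titv t1 t2 (const_mx t) by rewrite /titv /= mxE.
have := gsf_net_val hf ttm (vrepresents_const_mx ht) j.
by under eq_fun do rewrite !mxE.
Qed.

Lemma Snet_curve k (c : R -> R -> 'rV[R]_k) Om : netdom (titv t1 t2) Om ->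
  (forall j, Snet (titv t1 t2) Om (fun e x => c e (x 0 0) 0 j)) -> exists f dc, curvenet f Om c dc.
Proof.
move=> dX Sc.
pose dc e t : 'rV[R]_k := \row_j 'D_(delta_mx 0 0) (fun x : 'rV[R]_1 => c e (x 0 0) 0 j) (const_mx t).
have [e t j e01 Ot|f hf'] := Snet_curvenet dX Sc (dc := dc); last by exists f, dc.
have := (is_derive_time (fun x : 'rV[R]_1 => c e (x 0 0) 0 j) t (dc e t 0 j) 0).1.
rewrite (_ : (fun s => _) = fun s => c e s 0 j); last by apply/funext => s; rewrite mxE.
apply; rewrite mxE; exact: (Snet_D dX (Sc j) 0).2.
Qed.

End Curves.

(** * Maxima over internal sets *)

Section Maxima.
Context {R : realType} (rho : gauge R).
Notation rc := (rcnum rho).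

Lemma represents_gopnorm m n (A : R -> 'M[R]_(m, n)) (B : 'M[rc]_(m, n)) :
  (forall i j, represents (fun e => A e i j) (B i j)) ->
  represents (fun e => opnorm (A e)) (gopnorm B).
Proof.
move=> hA; pose A' e := \matrix_(i, j) rcnet (B i j) e.
have hd : negl rho (fun e => msum (A e - A' e)).
  apply: negl_sum => i; apply: negl_sum => j; apply: negl_norm.
  have := represents_negl (hA i j) (represents_rcnet (B i j)).
  set f := fun _ => _; set g := fun _ => _; suff -> : f = g by [].
  by apply/funext => e; rewrite /f /g /A' !mxE.
have mA : mod_net rho (fun e => opnorm (A' e)).
  apply: (@mod_net_le _ _ _ (fun e => msum (A' e))).
    apply: mod_net_sum => i; apply: mod_net_sum => j; apply: mod_net_norm.
    by under eq_fun do rewrite /A' mxE; apply: represents_mod (represents_rcnet _).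
  near=> e; rewrite ger0_norm ?opnorm_ge0// ger0_norm ?msum_ge0//.
  apply: opnorm_le => x x1; apply: (le_trans (enorm_mul_le _ _)).
  by rewrite ler_piMr// msum_ge0.
apply: (represents_congr (represents_rcclass mA)); apply: (negl_le hd).
near=> e; rewrite [leRHS]ger0_norm ?msum_ge0// ler_norml; apply/andP; split.
  rewrite lerNl opprB lerBlDr addrC.
  have -> : msum (A e - A' e) = msum (A' e - A e).
    by apply: eq_bigr => i _; apply: eq_bigr => j _; rewrite !mxE distrC.
  exact: opnorm_dist.
by rewrite lerBlDr addrC; exact: opnorm_dist.
Unshelve. all: by end_near. Qed.

(** Every class of a bounded internal set is represented by a net of points of
    one family of bounded sets, and every net of points of the family represents
    a class of the set; intersecting with balls makes the nets moderate. *)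
Lemma functionally_compact_nets n (K : set 'rV[rc]_n) : functionally_compact K ->
  exists Kc : R -> set 'rV[R]_n,
    (forall x, K x -> exists2 xe, vrepresents xe x & \near0 e, Kc e (xe e)) /\
    (forall xe, (\near0 e, Kc e (xe e)) -> exists2 x, K x & vrepresents xe x).
Proof.
move=> [[Ke [_ KE]] [r r0 Kr]].
pose Kc e := Ke e `&` [set x | enorm x <= rcnet r e].
exists Kc; split=> [x Kx|xe hxe].
  move: (Kx); rewrite {1}KE => -[xe hx hxe]; exists xe => //.
  have hr := represents_rcnet r.
  have hx0 : vrepresents (fun e => xe e - 0) (x - 0).
    apply: vrepresentsB => // i; rewrite !mxE; exact: represents0.
  have [N hN] := (gltP (represents_gnorm hx0) hr).1 (Kr _ Kx).
  near=> e; split; first by near: e.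
  have h : enorm (xe e - 0) + rho e ^+ N <= rcnet r e by near: e.
  have re : 0 < rho e <= 1 by near: e; apply: gauge_near.
  have := rho_exp_gt0 N re; rewrite subr0 in h => /=; lra.
have mx : mod_net rho (fun e => `|xe e|).
  apply: (mod_net_le (represents_mod (represents_rcnet r))); near=> e.
  rewrite normr_id; apply: (le_trans (norm_le_enorm _)); apply: le_trans (ler_norm _).
  have [_] : Kc e (xe e) by near: e.
  by [].
have [x hx] := mod_vrepresents mx; exists x => //; rewrite KE; exists xe => //.
by near=> e; have [] : Kc e (xe e) by near: e.
Unshelve. all: by end_near. Qed.

(** The supremum is approached up to rho^m with m the integer part of 1 / e; for
    small e this is below every fixed power of rho. *)
Lemma near_max n K (X : set 'rV[rc]_n) g : nets_in K X -> mod_on X g ->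
  exists xe, (\near0 e, K e (xe e)) /\
    forall p, \near0 e, forall y, K e y -> g e y <= g e (xe e) + rho e ^+ p.
Proof.
move=> hK mg; have [K0 _] := hK; have [N hN] := unif_bound mg hK.
pose m (e : R) := Num.truncn e^-1.
have : \near0 e, exists x, K e x /\ forall y, K e y -> g e y <= g e x + rho e ^+ m e.
  near=> e.
  have re : 0 < rho e <= 1 by near: e; apply: gauge_near.
  have [x0 Kx0] : K e !=set0 by near: e.
  have hb : forall x y : 'rV[R]_n, K e x -> `|y - x| <= rho e ^+ N -> `|g e y| <= rho e ^- N by near: e.
  have hs : has_sup [set g e x | x in K e].
    split; first by exists (g e x0), x0.
    exists (rho e ^- N) => _ [x Kx <-]; apply: (le_trans (ler_norm _)); apply: (hb x) => //.
    by rewrite subrr normr0 rho_exp_ge0.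
  have [_ [x Kx <-] hx] := sup_adherent (rho_exp_gt0 (m e) re) hs.
  exists x; split=> // y Ky; rewrite -lerBlDr; apply: (le_trans _ (ltW hx)).
  by rewrite lerD2r; apply: (ub_le_sup hs.2); exists y.
move=> /(near0_choice 0)[xe hxe]; exists xe; split=> [|p].
  by near=> e; have [] : K e (xe e) /\ forall y, K e y -> g e y <= g e (xe e) + rho e ^+ m e by near: e.
near=> e => y Ky.
have re : 0 < rho e <= 1 by near: e; apply: gauge_near.
have [_ h] : K e (xe e) /\ forall y, K e y -> g e y <= g e (xe e) + rho e ^+ m e by near: e.
apply: (le_trans (h y Ky)); rewrite lerD2l; apply: rho_expM => //.
have e0 : 0 < e by [].
have ep : e < p.+1%:R^-1 by near: e; apply: nbhs_right_lt; rewrite invr_gt0.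
rewrite /m; have := truncnS_gt e^-1.
have : p.+1%:R < e^-1 by rewrite -[p.+1%:R]invrK ltf_pV2 ?posrE ?invr_gt0.
by move=> h1 h2; have := lt_trans h1 h2; rewrite ltr_nat ltnS => /ltnW.
Unshelve. all: by end_near. Qed.

(** A maximizing net represents a point of X, so the maximum exists and its
    representatives bound g from above up to negligible errors. *)
Lemma gmax_attained n K (X : set 'rV[rc]_n) g (G : 'rV[rc]_n -> rc) (A : set rc) :
  nets_in K X -> (forall x, X x -> exists2 xe, vrepresents xe x & \near0 e, K e (xe e)) ->
  (forall x xe, X x -> vrepresents xe x -> represents (fun e => g e (xe e)) (G x)) ->
  (forall y, A y <-> exists2 x, X x & y = G x) ->
  forall M, represents M (gmax A) ->
  forall p, \near0 e, forall y, K e y -> g e y <= M e + rho e ^+ p.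
Proof.
move=> hK XK gG hA M hM.
have mg : mod_on X g by move=> x xe Xx hx; apply: represents_mod (gG x xe Xx hx).
have [xe [Kxe hxe]] := near_max hK mg.
have [x Xx hx] := hK.2 _ Kxe.
have [_ Amax] : is_gmax A (gmax A).
  apply: (@xgetPex _ 0 (is_gmax A)); exists (G x); split; first by apply/hA; exists x.
  move=> _ /hA[y Xy ->]; have [ye hy Kye] := XK y Xy.
  apply/(gleP (gG y ye Xy hy) (gG x xe Xx hx)) => p; near=> e.
  have h : forall y, K e y -> g e y <= g e (xe e) + rho e ^+ p by near: e; apply: hxe.
  by apply: h; near: e.
move=> p; apply: near0_unif => [|ye Kye]; first exact: hK.1.
have [y Xy hy] := hK.2 _ Kye.
by apply: ((gleP (gG y ye Xy hy) hM).1 _ p); apply: Amax; apply/hA; exists y.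
Unshelve. all: by end_near. Qed.

End Maxima.

(** * Points (t, q, k) and (t, q, k, p) *)

Section Packing.
Context {T : Type} {d l : nat}.

Lemma unc3_pack3 S (f : T -> 'rV[T]_d -> 'rV[T]_l -> S) t q k :
  unc3 f (pack3 t q k) = f t q k.
Proof. by rewrite /unc3 /pack3 !row_mxKl !row_mxKr mxE. Qed.

Lemma pack3_unc3 (x : 'rV[T]_(1 + d + l)) :
  x = pack3 (lsubmx (lsubmx x) 0 0) (rsubmx (lsubmx x)) (rsubmx x).
Proof.
rewrite /pack3 -[LHS]hsubmxK -[lsubmx x in LHS]hsubmxK; congr (row_mx (row_mx _ _) _).
by apply/rowP => i; rewrite [RHS]mxE (ord1 i).
Qed.

End Packing.

Section PackedNets.
Context {R : realType} (rho : gauge R) {d l : nat}.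
Notation rc := (rcnum rho).

Lemma vrepresents_pack3 (te : R -> R) (qe : R -> 'rV[R]_d) (ke : R -> 'rV[R]_l)
    (t : rc) (q : 'rV[rc]_d) (k : 'rV[rc]_l) :
  represents te t -> vrepresents qe q -> vrepresents ke k ->
  vrepresents (fun e => pack3 (te e) (qe e) (ke e)) (pack3 t q k).
Proof.
move=> ht hq hk; apply: vrepresents_row_mx hk; apply: vrepresents_row_mx hq.
exact: vrepresents_const_mx.
Qed.

Lemma pack3B (t t' : R) (q q' : 'rV[R]_d) (k k' : 'rV[R]_l) :
  pack3 t q k - pack3 t' q' k' = pack3 (t - t') (q - q') (k - k').
Proof.
rewrite /pack3 !opp_row_mx !add_row_mx; congr (row_mx (row_mx _ _) _).
by apply/rowP => i; rewrite !mxE.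
Qed.

Lemma pack3D (t t' : R) (q q' : 'rV[R]_d) (k k' : 'rV[R]_l) :
  pack3 t q k + pack3 t' q' k' = pack3 (t + t') (q + q') (k + k').
Proof.
rewrite /pack3 !add_row_mx; congr (row_mx (row_mx _ _) _).
by apply/rowP => i; rewrite !mxE.
Qed.

Lemma pack3Z (s t : R) (q : 'rV[R]_d) (k : 'rV[R]_l) :
  s *: pack3 t q k = pack3 (s * t) (s *: q) (s *: k).
Proof.
rewrite /pack3 !scale_row_mx; congr (row_mx (row_mx _ _) _).
by apply/rowP => i; rewrite !mxE.
Qed.

Lemma norm_pack3 (t : R) (q : 'rV[R]_d) (k : 'rV[R]_l) c :
  `|t| <= c -> `|q| <= c -> `|k| <= c -> `|pack3 t q k| <= c.
Proof.
move=> tc qc kc; apply: norm_row_mx => //; apply: norm_row_mx => //.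
by apply: norm_le_coord => [|i]; rewrite ?mxE//; apply: le_trans tc.
Qed.

Lemma pack4B (t t' : R) (q q' : 'rV[R]_d) (k k' : 'rV[R]_l) (p p' : 'rV[R]_d) :
  pack4 t q k p - pack4 t' q' k' p' = pack4 (t - t') (q - q') (k - k') (p - p').
Proof. by rewrite /pack4 opp_row_mx add_row_mx pack3B. Qed.

Definition dir_t : 'I_(1 + d + l) := lshift l (lshift d 0).
Definition dir_q (i : 'I_d) : 'I_(1 + d + l) := lshift l (rshift 1 i).
Definition dir_u (i : 'I_l) : 'I_(1 + d + l) := rshift (1 + d) i.

Lemma sum_pack3 (F : 'I_(1 + d + l) -> R) :
  \sum_i F i = F dir_t + \sum_i F (dir_q i) + \sum_i F (dir_u i).
Proof. by rewrite big_split_ord big_split_ord/= big_ord_recl big_ord0 addr0. Qed.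

Lemma pack3_t (t : R) (q : 'rV[R]_d) (k : 'rV[R]_l) : pack3 t q k 0 dir_t = t.
Proof. by rewrite /pack3 !row_mxEl mxE. Qed.

Lemma pack3_q (t : R) (q : 'rV[R]_d) (k : 'rV[R]_l) i : pack3 t q k 0 (dir_q i) = q 0 i.
Proof. by rewrite /pack3 row_mxEl row_mxEr. Qed.

Lemma pack3_u (t : R) (q : 'rV[R]_d) (k : 'rV[R]_l) i : pack3 t q k 0 (dir_u i) = k 0 i.
Proof. by rewrite /pack3 row_mxEr. Qed.

End PackedNets.

(** * Norms of curves and nets of curves *)

Section CurveNorm.
Context {R : realType} (rho : gauge R).
Notation rc := (rcnum rho).

(** When no net computes the norm its value is 0, hence the condition that the
    bound be nonnegative. *)
Lemma gcnorm_le k (t1 t2 : rc) n (f : rc -> 'rV[rc]_k) (B : rc) (Be : R -> R) :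
  t1 <~ t2 -> represents Be B -> (\near0 e, 0 <= Be e) ->
  (forall Om fe, gsf_net (titv t1 t2) (oncurve f) Om fe ->
    forall (j : nat) (i : 'I_k) t te, (j <= n)%N -> gitv t1 t2 t -> represents te t ->
    forall p, \near0 e, `|pderive (nseq j ord0) (vcomp (fe e) i) (const_mx (te e))| <= Be e + rho e ^+ p) ->
  gcnorm t1 t2 n f <=~ B.
Proof.
move=> t12 hB B0 h; rewrite /gcnorm; set S := (X in xget _ X).
have [[y Sy]|nS] := pselect (exists y, S y); last first.
  (* no net computes the norm, which then has its default value 0 *)
  rewrite xgetPN; last by move=> y Sy; apply: nS; exists y.
  apply/(gleP (represents0 rho) hB) => p; near=> e.
  have re : 0 < rho e <= 1 by near: e; apply: gauge_near.
  by rewrite addr_ge0 ?rho_exp_ge0//; near: e.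
have {y Sy} : S (xget 0 S) by apply: xgetPex; exists y.
move=> [Om [fe [a [b [hf ha hb hy]]]]].
apply/(gleP hy hB) => p.
have hu : \near0 e, forall (ji : 'I_n.+1 * 'I_k), forall t, a e <= t <= b e ->
    `|pderive (nseq ji.1 ord0) (vcomp (fe e) ji.2) (const_mx t)| <= Be e + rho e ^+ p.
  apply: filter_forall => -[j i]; apply: (curve_unif t12 ha hb) => t te tt ht _.
  by apply: h hf _ _ _ _ _ tt ht p; rewrite /= -ltnS.
near=> e.
have re : 0 < rho e <= 1 by near: e; apply: gauge_near.
have hB0 : 0 <= Be e by near: e.
set A := [set z : R | _].
have Ale z : A z -> z <= Be e + rho e ^+ p.
  move=> [j [i [t [jn tab ->]]]].
  have hh : forall (ji : 'I_n.+1 * 'I_k), forall t, a e <= t <= b e ->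
    `|pderive (nseq ji.1 ord0) (vcomp (fe e) ji.2) (const_mx t)| <= Be e + rho e ^+ p by near: e.
  have jn' : (j < n.+1)%N by rewrite ltnS.
  exact: (hh (Ordinal jn', i) t tab).
have [[z Az]|nA] := pselect (exists z, A z).
  by apply: ge_sup => //; exists z.
have -> : A = set0 by apply/seteqP; split => // z Az; apply: nA; exists z.
by rewrite sup0 addr_ge0 ?rho_exp_ge0.
Unshelve. all: by end_near. Qed.

Lemma Cnet_row_mx n m1 m2 (X : set 'rV[rc]_n) Om k (A : R -> 'rV[R]_n -> 'rV[R]_m1)
    (B : R -> 'rV[R]_n -> 'rV[R]_m2) :
  (forall i, Cnet X Om k (fun e x => A e x 0 i)) ->
  (forall i, Cnet X Om k (fun e x => B e x 0 i)) ->
  forall i, Cnet X Om k (fun e x => row_mx (A e x) (B e x) 0 i).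
Proof.
move=> hA hB i; case: (split_ordP i) => j ->.
  by under eq_fun do under eq_fun do rewrite row_mxEl.
by under eq_fun do under eq_fun do rewrite row_mxEr.
Qed.

Lemma Cnet_pack3 n d l (X : set 'rV[rc]_n) Om k (T : R -> 'rV[R]_n -> R)
    (Q : R -> 'rV[R]_n -> 'rV[R]_d) (U : R -> 'rV[R]_n -> 'rV[R]_l) :
  Cnet X Om k T -> (forall i, Cnet X Om k (fun e x => Q e x 0 i)) ->
  (forall i, Cnet X Om k (fun e x => U e x 0 i)) ->
  forall i, Cnet X Om k (fun e x => pack3 (T e x) (Q e x) (U e x) 0 i).
Proof.
move=> hT hQ hU; apply: Cnet_row_mx => //; apply: Cnet_row_mx => // i.
by under eq_fun do under eq_fun do rewrite mxE.
Qed.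

Lemma pack3_continuous (S : topologicalType) d l (T : S -> R) (Q : S -> 'rV[R]_d)
    (U : S -> 'rV[R]_l) (s : S) :
  {for s, continuous T} -> (forall i, {for s, continuous (fun s => Q s 0 i)}) ->
  (forall i, {for s, continuous (fun s => U s 0 i)}) ->
  {for s, continuous (fun s => pack3 (T s) (Q s) (U s))}.
Proof.
move=> hT hQ hU; apply: row_continuous => i.
case: (split_ordP i) => j ->.
  case: (split_ordP j) => j' ->; rewrite /pack3.
    rewrite (_ : (fun s => row_mx (row_mx (const_mx (T s)) (Q s)) (U s) 0 (lshift l (lshift d j'))) = T)//.
    by apply/funext => s'; rewrite !row_mxEl mxE.
  rewrite (_ : (fun s => row_mx (row_mx (const_mx (T s)) (Q s)) (U s) 0 (lshift l (rshift 1 j'))) =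
    fun s => Q s 0 j')//.
  by apply/funext => s'; rewrite row_mxEl row_mxEr.
rewrite (_ : (fun s => pack3 (T s) (Q s) (U s) 0 (rshift (1 + d) j)) = fun s => U s 0 j)//.
by apply/funext => s'; rewrite /pack3 row_mxEr.
Qed.

Lemma time_interval_dom (t1 t2 : rc) (a b : R -> R) p (good : R -> Prop) :
  t1 <~ t2 -> represents a t1 -> represents b t2 -> (\near0 e, good e) ->
  netdom (titv t1 t2) (fun e => [set x | good e /\ a e - rho e ^+ p < x 0 0 < b e + rho e ^+ p]).
Proof.
move=> t12 ha hb hg; split=> [e e01|x [h1 h2] xe hx].
  rewrite openE => x /= [ge /andP[x1 x2]].
  have cx : {for x, continuous (fun y : 'rV[R]_1 => y 0 0)} by exact: coord_continuous.
  have n1 : \forall y \near nbhs x, a e - rho e ^+ p < (y : 'rV[R]_1) 0 0 by apply: (cvgr_gt (x 0 0) cx).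
  have n2 : \forall y \near nbhs x, (y : 'rV[R]_1) 0 0 < b e + rho e ^+ p by apply: (cvgr_lt (x 0 0) cx).
  by apply: filterS2 n1 n2 => y y1 y2; split => //; apply/andP.
near=> e; split; first by near: e.
have re : 0 < rho e <= 1 by near: e; apply: gauge_near.
have rp := rho_exp_gt0 p.+1 re.
have k1 : a e <= xe e 0 0 + rho e ^+ p.+1 by near: e; apply: ((gleP ha (hx 0)).1 h1).
have k2 : xe e 0 0 <= b e + rho e ^+ p.+1 by near: e; apply: ((gleP (hx 0) hb).1 h2).
have k3 : 2 * rho e ^+ p.+1 <= rho e ^+ p by near: e; apply: near_rhoX.
by apply/andP; split; lra.
Unshelve. all: by end_near. Qed.

Lemma curvenet_lipschitz k (t1 t2 : rc) (a b : R -> R) (f : rc -> 'rV[rc]_k) Om c dc :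
  t1 <~ t2 -> represents a t1 -> represents b t2 -> curvenet t1 t2 f Om c dc ->
  exists N, \near0 e, forall s t, a e - rho e ^+ N <= s <= b e + rho e ^+ N ->
    a e - rho e ^+ N <= t <= b e + rho e ^+ N -> enorm (c e t - c e s) <= rho e ^- N * `|t - s|.
Proof.
move=> t12 ha hb hc; have [N hN] := curvenet_bound t12 ha hb hc; have [_ _ _ _ cd] := hc.
exists N.+1; near=> e => s t sab tab.
have e01 : 0 < e <= 1 by near: e; apply: near0_itv.
have re : 0 < rho e <= 1 by near: e; apply: gauge_near.
have h : forall t, a e - rho e ^+ N <= t <= b e + rho e ^+ N ->
  [/\ Om e (const_mx t), `|c e t| <= rho e ^- N & `|dc e t| <= rho e ^- N] by near: e.
have hk : k%:R * rho e <= 1 by near: e; apply: near_rhoM.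
have rN := rho_expM re (leqnSn N).
have sub u : a e - rho e ^+ N.+1 <= u <= b e + rho e ^+ N.+1 -> a e - rho e ^+ N <= u <= b e + rho e ^+ N.
  by move=> /andP[u1 u2]; apply/andP; split; lra.
apply: (@MVT_enorm_any R k (c e) (dc e) (a e - rho e ^+ N.+1) (b e + rho e ^+ N.+1)) => //.
- by move=> u /sub/h[Ou _ _] j; apply: cd.
- move=> u /sub/h[_ _ du]; apply: (le_trans (enorm_le_norm _)).
  apply: (@le_trans _ _ (k%:R * rho e ^- N)); first by rewrite ler_wpM2l.
  have r0 : 0 < rho e by case/andP: re.
  by rewrite exprS invfM ler_wpM2r ?invr_ge0 ?rho_exp_ge0// -[leRHS]mul1r ler_pdivlMr.
Unshelve. all: by end_near. Qed.

End CurveNorm.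

(** * Ordinary differential equations and integrals over nets *)

Section CurveSolutions.
Context {R : realType} (rho : gauge R).
Notation rc := (rcnum rho).
Variables (t1 t2 : rc) (a b : R -> R).
Hypotheses (t12 : t1 <~ t2) (ha : represents a t1) (hb : represents b t2).

(** The solution lives on an interval that exceeds [t1, t2] by rho^p on both
    sides, as the domain of a net for a curve on [t1, t2] must. *)
Lemma ode_solve n p (F : R -> R -> 'rV[R]_n -> 'rV[R]_n) (t0 s : R -> R) (q0 : R -> 'rV[R]_n) :
  (\near0 e, 0 <= s e /\ a e <= t0 e <= b e) ->
  (\near0 e, forall x : R -> 'rV[R]_n, (forall j, continuous (fun t => x t 0 j)) ->
    (forall t, enorm (x t - q0 e) <= s e) -> forall (c : R -> R), continuous c ->
    (forall t, a e - rho e ^+ p <= c t <= b e + rho e ^+ p) ->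
    forall j, continuous (fun t => F e (c t) (x (c t)) 0 j)) ->
  (\near0 e, forall t q, a e - rho e ^+ p <= t <= b e + rho e ^+ p -> enorm (q - q0 e) <= s e ->
    (b e - a e + 2 * rho e ^+ p) * enorm (F e t q) <= s e) ->
  (\near0 e, forall t q q', a e - rho e ^+ p <= t <= b e + rho e ^+ p ->
    enorm (q - q0 e) <= s e -> enorm (q' - q0 e) <= s e ->
    (b e - a e + 2 * rho e ^+ p) * enorm (F e t q - F e t q') <= enorm (q - q') / 2) ->
  exists q : R -> R -> 'rV[R]_n, \near0 e, [/\ q e (t0 e) = q0 e,
    forall t, enorm (q e t - q0 e) <= s e,
    forall t t', (b e - a e) * enorm (q e t - q e t') <= s e * `|t - t'| &
    forall t, a e - rho e ^+ p < t < b e + rho e ^+ p ->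
      forall j, is_derive t 1 (fun u => q e u 0 j) (F e t (q e t) 0 j)].
Proof.
move=> hs Fc FM FL; pose good e (q : R -> 'rV[R]_n) := [/\ q (t0 e) = q0 e,
    forall t, enorm (q t - q0 e) <= s e,
    forall t t', (b e - a e) * enorm (q t - q t') <= s e * `|t - t'| &
    forall t, a e - rho e ^+ p < t < b e + rho e ^+ p ->
      forall j, is_derive t 1 (fun u => q u 0 j) (F e t (q t) 0 j)].
apply: (near0_choice (P := good) (fun=> 0)).
near=> e.
have re : 0 < rho e <= 1 by near: e; apply: gauge_near.
have rp := rho_exp_gt0 p re.
have ab : a e < b e by near: e; apply: near_time t12 ha hb.
have [s0 /andP[at0 tb0]] : 0 <= s e /\ a e <= t0 e <= b e by near: e.
pose a' := a e - rho e ^+ p; pose b' := b e + rho e ^+ p; pose T := b e - a e + 2 * rho e ^+ p.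
have TE : b' - a' = T by rewrite /a' /b' /T; ring.
have ab' : a' < b' by rewrite /a' /b'; lra.
have T0 : 0 < T by rewrite -TE subr_gt0.
have tab : a' <= t0 e <= b' by rewrite /a' /b'; apply/andP; split; lra.
have [|//|t q tab' qs|t q q' tab' qs qs'|q [h1 h2 h3 h4]] :=
    @picard R n (F e) a' b' (t0 e) (s e / T) (s e) (q0 e) ab' tab (divr_ge0 s0 (ltW T0)) _ _ _ _.
- by rewrite TE mulrC mulfVK// gt_eqF.
- move=> x xc xs; have h : forall x : R -> 'rV[R]_n, (forall j, continuous (fun t => x t 0 j)) ->
    (forall t, enorm (x t - q0 e) <= s e) -> forall (c : R -> R), continuous c ->
    (forall t, a e - rho e ^+ p <= c t <= b e + rho e ^+ p) ->
    forall j, continuous (fun t => F e (c t) (x (c t)) 0 j) by near: e.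
  by apply: h => //; [apply: clamp_continuous; apply: ltW|move=> t; apply: clamp_itv; apply: ltW].
- have h : forall t q, a e - rho e ^+ p <= t <= b e + rho e ^+ p -> enorm (q - q0 e) <= s e ->
    (b e - a e + 2 * rho e ^+ p) * enorm (F e t q) <= s e by near: e; exact: FM.
  by rewrite ler_pdivlMr// mulrC; apply: h.
- have h : forall t q q', a e - rho e ^+ p <= t <= b e + rho e ^+ p ->
    enorm (q - q0 e) <= s e -> enorm (q' - q0 e) <= s e ->
    (b e - a e + 2 * rho e ^+ p) * enorm (F e t q - F e t q') <= enorm (q - q') / 2 by near: e; exact: FL.
  by rewrite TE; apply: h.
exists q; split => // t t'.
have := h3 t t'; rewrite -ler_pdivlMl ?subr_gt0// => h; apply: (le_trans h).
rewrite [leLHS]mulrAC [leRHS]mulrC ler_wpM2l ?mulr_ge0//.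
by rewrite lef_pV2 ?posrE ?subr_gt0// /T; lra.
Unshelve. all: by end_near. Qed.

(** Solutions are as smooth as the equation: each derivative gained for the
    solution is gained for the right-hand side adjoint_contraction it. *)
Lemma ode_smooth n Om (q dq : R -> R -> 'rV[R]_n) : netdom (titv t1 t2) Om ->
  (forall e t j, 0 < e <= 1 -> Om e (const_mx t) -> is_derive t 1 (fun s => q e s 0 j) (dq e t 0 j)) ->
  (forall t te, gitv t1 t2 t -> represents te t -> mod_net rho (fun e => `|q e (te e)|)) ->
  (forall k, (forall j, Cnet (titv t1 t2) Om k (fun e x => q e (x 0 0) 0 j)) ->
    forall j, Cnet (titv t1 t2) Om k (fun e x => dq e (x 0 0) 0 j)) ->
  exists f, curvenet t1 t2 f Om q dq.
Proof.
move=> dX qd qm qS; apply: Snet_curvenet => // j k.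
have dq' j' e x i : 0 < e <= 1 -> Om e x ->
    is_derive x (delta_mx 0 i) (fun x : 'rV[R]_1 => q e (x 0 0) 0 j') (dq e (x 0 0) 0 j').
  move=> e01; rewrite [x in Om e x]row1E [x in is_derive x]row1E => Ox.
  apply/is_derive_time; rewrite (_ : (fun _ => _) = fun s => q e s 0 j'); first exact: qd.
  by apply/funext => s; rewrite mxE.
have C0 j' : [/\ forall e x, 0 < e <= 1 -> Om e x -> {for x, continuous (fun x : 'rV[R]_1 => q e (x 0 0) 0 j')} &
    mod_on (titv t1 t2) (fun e x => q e (x 0 0) 0 j')].
  split=> [e x e01|x xe tx hx].
    rewrite [x in Om e x]row1E => Ox; apply: (@continuous_comp _ _ _ (fun x : 'rV[R]_1 => x 0 0) (fun s => q e s 0 j')).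
      exact: coord_continuous.
    exact: is_derive_cts (qd _ _ _ e01 Ox).
  apply: (mod_net_le (qm _ _ tx (hx 0))); near=> e; rewrite normr_id; exact: coord_le_norm.
elim: k j => [|k ih] j; apply/CnetP; split => //; try exact: (C0 j).1; try exact: (C0 j).2.
exists (fun _ e x => dq e (x 0 0) 0 j); split => [_|i e x e01 Ox]; first exact: qS.
exact: dq'.
Unshelve. all: by end_near. Qed.

Lemma net_primitive (f : 'rV[rc]_1 -> 'rV[rc]_1) Om fe : gsf_net (titv t1 t2) f Om fe ->
  exists F : R -> R -> R, exists N, \near0 e, forall t, a e - rho e ^+ N <= t <= b e + rho e ^+ N ->
    [/\ is_derive t 1 (F e) (fe e (const_mx t) 0 0),
        {for t, continuous (fun t => fe e (const_mx t) 0 0)} & `|fe e (const_mx t) 0 0| <= rho e ^- N].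
Proof.
move=> hf; have dX := gsf_net_dom hf; have S0 := gsf_net_Snet hf [::] 0 0%N.
have [N1 h1] := time_dom t12 ha hb dX; have [N2 h2] := time_bound t12 ha hb (Cnet_mod S0).
have cc (e t : R) : 0 < e <= 1 -> Om e (const_mx t) -> {for t, continuous (fun t => fe e (const_mx t) 0 0)}.
  move=> e01 Ot; apply: (@continuous_comp _ _ _ (fun t : R => const_mx t : 'rV[R]_1) (fun x => fe e x 0 0)).
    apply: row_continuous => i; rewrite (_ : (fun s : R => (const_mx s : 'rV[R]_1) 0 i) = id).
      exact: cvg_id.
    by apply/funext => s; rewrite mxE.
  exact: (Cnet_cts S0 e01 Ot).
pose N := (N1 + N2)%N.
have [F hF] : exists F : R -> R -> R, \near0 e, forall t, a e - rho e ^+ N <= t <= b e + rho e ^+ N ->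
    is_derive t 1 (F e) (fe e (const_mx t) 0 0).
  apply: (near0_choice (P := fun e F => forall t, a e - rho e ^+ N <= t <= b e + rho e ^+ N ->
    is_derive t 1 F (fe e (const_mx t) 0 0)) (fun=> 0)); near=> e.
  have re : 0 < rho e <= 1 by near: e; apply: gauge_near.
  have e01 : 0 < e <= 1 by near: e; apply: near0_itv.
  have ab : a e < b e by near: e; apply: near_time t12 ha hb.
  have rN := rho_exp_gt0 N re.
  have ab' : a e - rho e ^+ N <= b e + rho e ^+ N by lra.
  have rN1 : rho e ^+ N <= rho e ^+ N1 by apply: rho_expM => //; rewrite leq_addr.
  have k1 : forall t, a e - rho e ^+ N1 <= t <= b e + rho e ^+ N1 -> Om e (const_mx t) by near: e.
  pose g t := fe e (const_mx (clamp (a e - rho e ^+ N) (b e + rho e ^+ N) t)) 0 0.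
  have gc : continuous g.
    move=> t; apply: (@continuous_comp _ _ _ (clamp (a e - rho e ^+ N) (b e + rho e ^+ N))
      (fun t => fe e (const_mx t) 0 0)); first exact: clamp_continuous.
    apply: cc => //; apply: k1; have /andP[c1 c2] := clamp_itv t ab'; apply/andP; split; lra.
  have [G hG] := antiderivative (a e - rho e ^+ N) (b e + rho e ^+ N) gc.
  by exists G => t tab; have := hG t tab; rewrite /g clamp_id.
exists F, N; near=> e => t tab.
have re : 0 < rho e <= 1 by near: e; apply: gauge_near.
have e01 : 0 < e <= 1 by near: e; apply: near0_itv.
have rN1 : rho e ^+ N <= rho e ^+ N1 by apply: rho_expM => //; rewrite leq_addr.
have rN2 : rho e ^+ N <= rho e ^+ N2 by apply: rho_expM => //; rewrite leq_addl.
have rN3 : rho e ^- N2 <= rho e ^- N by apply: rho_expVM => //; rewrite leq_addl.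
have k1 : forall t, a e - rho e ^+ N1 <= t <= b e + rho e ^+ N1 -> Om e (const_mx t) by near: e.
have k2 : forall t, a e - rho e ^+ N2 <= t <= b e + rho e ^+ N2 -> `|fe e (const_mx t) 0 0| <= rho e ^- N2 by near: e.
have k3 : forall t, a e - rho e ^+ N <= t <= b e + rho e ^+ N ->
    is_derive t 1 (F e) (fe e (const_mx t) 0 0) by near: e.
have /andP[c1 c2] := tab; split; first exact: k3.
  by apply: cc => //; apply: k1; apply/andP; split; lra.
by apply: le_trans rN3; apply: k2; apply/andP; split; lra.
Unshelve. all: by end_near. Qed.

(** Two nets of f are uniformly close on [t1, t2] and representatives of the end
    points are close, so primitives change by negligible amounts only; this
    makes the integral independent of all choices. *)
Lemma gint_primitive (f : rc -> rc) Om fe (F : R -> R -> R) :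
  gsf_net (titv t1 t2) (oncurve (fun t => const_mx (f t) : 'rV_1)) Om fe ->
  (\near0 e, forall t, a e <= t <= b e -> is_derive t 1 (F e) (fe e (const_mx t) 0 0)) ->
  represents (fun e => F e (b e) - F e (a e)) (gint t1 t2 f).
Proof.
move=> hf FD.
have key Om' fe' a' b' : gsf_net (titv t1 t2) (oncurve (fun t => const_mx (f t) : 'rV_1)) Om' fe' ->
    represents a' t1 -> represents b' t2 ->
    negl rho (fun e => (\int[lebesgue_measure]_(t in `[a' e, b' e]) fe' e (const_mx t) 0 0)%R - (F e (b e) - F e (a e))).
  move=> hf' ha' hb' n.
  have [F' [N hN]] := net_primitive hf'.
  have nb := represents_negl hb' hb; have na := represents_negl ha' ha.
  have [m0 /(_ m0 (leqnn _)) hm] := mod_net_absorb n.+2 (mod_netB (represents_mod hb) (represents_mod ha)).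
  have hd : \near0 e, forall t, a e <= t <= b e ->
      `|fe' e (const_mx t) 0 0 - fe e (const_mx t) 0 0| <= rho e ^+ m0.
    apply: (curve_unif t12 ha hb) => t te tt ht _.
    have ttm : titv t1 t2 (const_mx t) by rewrite /titv /= mxE.
    have htm := vrepresents_const_mx ht.
    by apply: represents_negl (gsf_net_val hf' ttm htm 0) (gsf_net_val hf ttm htm 0) m0.
  near=> e.
  have re : 0 < rho e <= 1 by near: e; apply: gauge_near.
  have ab : a e < b e by near: e; apply: near_time t12 ha hb.
  have ab' : a' e < b' e by near: e; apply: near_time t12 ha' hb'.
  have T0 : 0 < b e - a e by rewrite subr_gt0.
  have kb : `|b' e - b e| <= rho e ^+ (N + n.+2) by near: e; apply: nb.
  have ka : `|a' e - a e| <= rho e ^+ (N + n.+2) by near: e; apply: na.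
  have kT : `|b e - a e| * rho e ^+ m0 <= rho e ^+ n.+2 by near: e.
  have rNn : rho e ^+ (N + n.+2) <= rho e ^+ N by apply: rho_expM => //; rewrite leq_addr.
  have k4 : 3 * rho e ^+ n.+2 <= rho e ^+ n.+1 by near: e; apply: near_rhoX.
  have k5 : rho e ^+ n.+1 <= rho e ^+ n by apply: rho_expM.
  have rN := rho_exp_gt0 N re.
  have kF' : forall t, a e - rho e ^+ N <= t <= b e + rho e ^+ N ->
    [/\ is_derive t 1 (F' e) (fe' e (const_mx t) 0 0),
        {for t, continuous (fun t => fe' e (const_mx t) 0 0)} & `|fe' e (const_mx t) 0 0| <= rho e ^- N] by near: e.
  have kF : forall t, a e <= t <= b e -> is_derive t 1 (F e) (fe e (const_mx t) 0 0) by near: e.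
  have kd : forall t, a e <= t <= b e ->
      `|fe' e (const_mx t) 0 0 - fe e (const_mx t) 0 0| <= rho e ^+ m0 by near: e.
  rewrite gtr0_norm// in kT.
  move: (kb); rewrite ler_norml => /andP[b1 b2].
  move: (ka); rewrite ler_norml => /andP[a1 a2].
  have inI t : a' e <= t <= b' e -> a e - rho e ^+ N <= t <= b e + rho e ^+ N.
    by move=> /andP[u1 u2]; apply/andP; split; lra.
  have inJ t : a e <= t <= b e -> a e - rho e ^+ N <= t <= b e + rho e ^+ N.
    by move=> /andP[u1 u2]; apply/andP; split; lra.
  rewrite [X in X - (F e _ - _)](@Rintegral_antiderivative R (fun t => fe' e (const_mx t) 0 0) (F' e) _ _ ab'); first last.
  - by move=> t /inI/kF'[].
  - by move=> t /inI/kF'[].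
  have small x y : a e - rho e ^+ N <= x <= b e + rho e ^+ N -> a e - rho e ^+ N <= y <= b e + rho e ^+ N ->
      `|y - x| <= rho e ^+ (N + n.+2) -> `|F' e y - F' e x| <= rho e ^+ n.+2.
    move=> hx hy xy.
    have mm t : Num.min x y <= t <= Num.max x y -> a e - rho e ^+ N <= t <= b e + rho e ^+ N.
      exact: minmax_itv.
    have [t tm ->] := @MVT_any R (F' e) (fun t => fe' e (const_mx t) 0 0) x y (fun t h => let: And3 k _ _ := kF' t (mm t h) in k).
    rewrite normrM; have [_ _ k] := kF' t (mm t tm).
    apply: (@le_trans _ _ (rho e ^- N * rho e ^+ (N + n.+2))); last by rewrite rho_expVMX.
    exact: ler_pM.
  have kA : `|F' e (a' e) - F' e (a e)| <= rho e ^+ n.+2.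
    by apply: small => //; [apply: inJ|apply: inI]; rewrite lexx ltW.
  have kB : `|F' e (b' e) - F' e (b e)| <= rho e ^+ n.+2.
    by apply: small => //; [apply: inJ|apply: inI]; rewrite lexx ltW.
  have kC : `|F' e (b e) - F e (b e) - (F' e (a e) - F e (a e))| <= rho e ^+ n.+2.
    have mm t : Num.min (a e) (b e) <= t <= Num.max (a e) (b e) -> a e <= t <= b e.
      by rewrite (min_idPl (ltW ab)) (max_idPr (ltW ab)).
    have [t|t tm] := @MVT_any R (fun t => F' e t - F e t) (fun t => fe' e (const_mx t) 0 0 - fe e (const_mx t) 0 0) (a e) (b e).
      move=> /mm tm; apply: is_deriveB (kF _ tm); by have [] := kF' t (inJ _ tm).
    move=> ->; rewrite normrM (gtr0_norm T0) mulrC.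
    by apply: le_trans kT; rewrite ler_pM2l//; apply: kd; apply: mm.
  have -> : F' e (b' e) - F' e (a' e) - (F e (b e) - F e (a e)) =
      (F' e (b' e) - F' e (b e)) - (F' e (a' e) - F' e (a e)) + (F' e (b e) - F e (b e) - (F' e (a e) - F e (a e))) by ring.
  apply: (le_trans (ler_normD _ _)).
  have := ler_normB (F' e (b' e) - F' e (b e)) (F' e (a' e) - F' e (a e)); lra.
rewrite /gint; set S := (X in xget _ X).
have mI : mod_net rho (fun e => (\int[lebesgue_measure]_(t in `[a e, b e]) fe e (const_mx t) 0 0)%R).
  have [F' [N hN]] := net_primitive hf.
  have mT := mod_netB (represents_mod hb) (represents_mod ha).
  apply: (mod_net_le (mod_netM mT (mod_net_rho rho N))); near=> e.
  have re : 0 < rho e <= 1 by near: e; apply: gauge_near.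
  have rN := rho_exp_gt0 N re.
  have ab : a e < b e by near: e; apply: near_time t12 ha hb.
  have kF' : forall t, a e - rho e ^+ N <= t <= b e + rho e ^+ N ->
    [/\ is_derive t 1 (F' e) (fe e (const_mx t) 0 0),
        {for t, continuous (fun t => fe e (const_mx t) 0 0)} & `|fe e (const_mx t) 0 0| <= rho e ^- N] by near: e.
  have inJ t : a e <= t <= b e -> a e - rho e ^+ N <= t <= b e + rho e ^+ N.
    by move=> /andP[u1 u2]; apply/andP; split; lra.
  rewrite [X in `|X| <= _](@Rintegral_antiderivative R (fun t => fe e (const_mx t) 0 0) (F' e) _ _ ab); first last.
  - by move=> t /inJ/kF'[].
  - by move=> t /inJ/kF'[].
  have mm t : Num.min (a e) (b e) <= t <= Num.max (a e) (b e) -> a e - rho e ^+ N <= t <= b e + rho e ^+ N.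
    by rewrite (min_idPl (ltW ab)) (max_idPr (ltW ab)) => /inJ.
  have [t tm ->] := @MVT_any R (F' e) (fun t => fe e (const_mx t) 0 0) (a e) (b e) (fun t h => let: And3 k _ _ := kF' t (mm t h) in k).
  have [_ _ k] := kF' t (mm t tm).
  rewrite mulrC !normrM ler_wpM2l//; apply: (le_trans k); exact: ler_norm.
have : S (xget 0 S).
  apply: xgetPex; exists (rcclass rho (fun e => (\int[lebesgue_measure]_(t in `[a e, b e]) fe e (const_mx t) 0 0)%R)).
  by exists Om, fe, a, b; split => //; apply: represents_rcclass.
move=> [Om' [fe' [a' [b' [hf' ha' hb' hI]]]]].
apply: (represents_congr hI) => n; have hk := key _ _ _ _ hf' ha' hb' n; near=> e.
by rewrite distrC; near: e.
Unshelve. all: by end_near. Qed.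

Lemma gint_ext (f g : rc -> rc) : (forall t, gitv t1 t2 t -> f t = g t) -> gint t1 t2 f = gint t1 t2 g.
Proof.
move=> fg; rewrite /gint; congr (xget _ _); apply/funext => y; apply/propext.
have ext (h k : rc -> rc) Om fn : (forall t, gitv t1 t2 t -> h t = k t) ->
    gsf_net (titv t1 t2) (oncurve (fun t => const_mx (h t) : 'rV[rc]_1)) Om fn ->
    gsf_net (titv t1 t2) (oncurve (fun t => const_mx (k t) : 'rV[rc]_1)) Om fn.
  move=> hk [h1 h2 h3 h4]; split => // x xe tx hx; rewrite /oncurve -hk; first exact: h3 _ _ tx hx.
  exact: tx.
by split=> -[Om [fn [x [z [h1 h2 h3 h4]]]]]; exists Om, fn, x, z; split => //; apply: ext h1 => t tt;
  rewrite fg.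
Qed.

End CurveSolutions.

(** * The domain of the control problem *)

Section Control.
Context {R : realType} (rho : gauge R) {d l : nat} (P : control_data rho d l).
Notation rc := (rcnum rho).
Notation t1 := (ct1 P).
Notation t2 := (ct2 P).
Variables (a b r : R -> R) (q1 : R -> 'rV[R]_d) (Kc : R -> set 'rV[R]_l).
Hypotheses (hP : standing P) (ha : represents a t1) (hb : represents b t2)
  (hr : represents r (cr P)) (hq1 : vrepresents q1 (cq1 P)).
Hypotheses (KKc : forall x, cK P x -> exists2 xe, vrepresents xe x & \near0 e, Kc e (xe e))
  (KcK : forall xe, (\near0 e, Kc e (xe e)) -> exists2 x, cK P x & vrepresents xe x)
  (K0 : cK P !=set0).

Let t12 : t1 <~ t2 := st_time hP.

Lemma fat_dom3 : fat (dom3 P).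
Proof.
have h : fat (setprod (setprod (titv t1 t2) (cH P)) (cK P)).
  apply: fat_setprod; first apply: fat_setprod.
  - exact: fat_titv t12 ha hb.
  - exact: fat_solid (st_H hP).2.
  - exact: fat_solid (st_K hP).2.
suff -> : dom3 P = setprod (setprod (titv t1 t2) (cH P)) (cK P) by [].
by apply/seteqP; split => x; rewrite /dom3 /unc3 /setprod /=; case=> // -[].
Qed.

Lemma fat_dom4 : fat (dom4 P).
Proof.
have -> : dom4 P = setprod (dom3 P) setT by apply/seteqP; split => x; rewrite /dom4 /setprod /= => // -[].
by apply: fat_setprod; [exact: fat_dom3|exact: fat_setT].
Qed.

Lemma dom3_pack3 t q k : gitv t1 t2 t -> cH P q -> cK P k -> dom3 P (pack3 t q k).
Proof. by move=> tt Hq Kk; rewrite /dom3 /= unc3_pack3. Qed.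

Lemma dom4_pack4 t q k p : gitv t1 t2 t -> cH P q -> cK P k -> dom4 P (pack4 t q k p).
Proof. by move=> tt Hq Kk; rewrite /dom4 /= /pack4 row_mxKl; apply: dom3_pack3. Qed.

(** The compact core [t1, t2] x ball x K of the domain, where the constants
    M_K and L_K control phi. *)
Definition core : set 'rV[rc]_(1 + d + l) :=
  [set x | unc3 (fun t q k => [/\ gitv t1 t2 t, gcball (cq1 P) (cr P) q & cK P k]) x].

Definition core_net e : set 'rV[R]_(1 + d + l) :=
  [set x | unc3 (fun t q k => [/\ a e <= t <= b e, enorm (q - q1 e) <= r e & Kc e k]) x].

Lemma core_dom3 : core `<=` dom3 P.
Proof.
move=> x; rewrite /core /dom3 /= /unc3 => -[h1 h2 h3]; split => //.
exact: (st_ball hP).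
Qed.

Lemma near_r : \near0 e, 0 < r e.
Proof.
have [N hN] := (gltP (represents0 rho) hr).1 (st_r hP); near=> e.
have re : 0 < rho e <= 1 by near: e; apply: gauge_near.
have : 0 + rho e ^+ N <= r e by near: e.
have := rho_exp_gt0 N re; lra.
Unshelve. all: by end_near. Qed.

Lemma gcball_net qe : (\near0 e, enorm (qe e - q1 e) <= r e) ->
  exists2 q, gcball (cq1 P) (cr P) q & vrepresents qe q.
Proof.
move=> hqe; have mq : mod_net rho (fun e => `|qe e|).
  apply: (mod_net_le (mod_netD (vrepresents_mod hq1) (represents_mod hr))); near=> e.
  rewrite normr_id -(subrK (q1 e) (qe e)) addrC; apply: (le_trans (ler_normD _ _)).
  apply: le_trans (ler_norm _); rewrite lerD2l; apply: (le_trans (norm_le_enorm _)).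
  by near: e.
have [q hq] := mod_vrepresents mq; exists q => //.
apply/(gleP (represents_gnorm (vrepresentsB hq hq1)) hr) => n; near=> e.
have re : 0 < rho e <= 1 by near: e; apply: gauge_near.
have h : enorm (qe e - q1 e) <= r e by near: e.
have := rho_exp_gt0 n re; lra.
Unshelve. all: by end_near. Qed.

Lemma gcball_rep q : gcball (cq1 P) (cr P) q ->
  exists2 qe, vrepresents qe q & \near0 e, enorm (qe e - q1 e) <= r e.
Proof.
move=> hq; have hv := vrepresents_vnet q.
have : \near0 e, exists q', enorm (q' - q1 e) <= r e /\
    enorm (vnet q e - q') <= Num.max 0 (enorm (vnet q e - q1 e) - r e).
  by near=> e; apply: retract_ball; apply: ltW; near: e; exact: near_r.
move=> /(near0_choice 0)[qe hqe]; exists qe; last first.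
  near=> e; have [] // : enorm (qe e - q1 e) <= r e /\
    enorm (vnet q e - qe e) <= Num.max 0 (enorm (vnet q e - q1 e) - r e) by near: e.
apply: (vrepresents_congr hv) => n; near=> e.
have re : 0 < rho e <= 1 by near: e; apply: gauge_near.
have [_ h] : enorm (qe e - q1 e) <= r e /\
    enorm (vnet q e - qe e) <= Num.max 0 (enorm (vnet q e - q1 e) - r e) by near: e.
have h1 : enorm (vnet q e - q1 e) <= r e + rho e ^+ n.
  by near: e; apply: ((gleP (represents_gnorm (vrepresentsB hv hq1)) hr).1 hq).
rewrite normr_id distrC; apply: (le_trans (norm_le_enorm _)); apply: (le_trans h).
by rewrite ge_max rho_exp_ge0//= lerBlDl.
Unshelve. all: by end_near. Qed.

Lemma core_nets_in : nets_in core_net core.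
Proof.
split.
  have [k0 Kk0] := K0; have [ke hk hKe] := KKc Kk0.
  near=> e; exists (pack3 (a e) (q1 e) (ke e)); rewrite /core_net /= unc3_pack3; split.
  - by rewrite lexx ltW//; near: e; exact: near_time t12 ha hb.
  - by rewrite subrr enorm0 ltW//; near: e; exact: near_r.
  - by near: e.
move=> xe hxe.
have h1 : \near0 e, a e <= lsubmx (lsubmx (xe e)) 0 0 <= b e by apply: filterS hxe => e [].
have h2 : \near0 e, enorm (rsubmx (lsubmx (xe e)) - q1 e) <= r e by apply: filterS hxe => e [].
have h3 : \near0 e, Kc e (rsubmx (xe e)) by apply: filterS hxe => e [].
have [t tt ht] := itv_rep ha hb h1.
have [q qb hq] := gcball_net h2.
have [k Kk hk] := KcK h3.
exists (pack3 t q k); first by rewrite /core /= unc3_pack3.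
have := vrepresents_pack3 ht hq hk.
by under eq_fun do rewrite -pack3_unc3.
Unshelve. all: by end_near. Qed.

Lemma core_rep x : core x -> exists2 xe, vrepresents xe x & \near0 e, core_net e (xe e).
Proof.
rewrite [x in core x]pack3_unc3 /core /= unc3_pack3 => -[tt qb Kk].
have ht := gitv_clamp t12 ha hb tt (represents_rcnet _).
have [qe hq hqe] := gcball_rep qb; have [ke hk hke] := KKc Kk.
exists (fun e => pack3 (clamp (a e) (b e) (rcnet (lsubmx (lsubmx x) 0 0) e)) (qe e) (ke e)).
  by rewrite [x]pack3_unc3; apply: vrepresents_pack3 hq hk; rewrite /pack3 !row_mxKl mxE.
near=> e; rewrite /core_net /= unc3_pack3; split; last by near: e.
  by near: e; apply: near_clamp t12 ha hb _.
by near: e.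
Unshelve. all: by end_near. Qed.

Lemma mod_T : mod_net rho (fun e => b e - a e).
Proof. exact: mod_netB (represents_mod hb) (represents_mod ha). Qed.

Variables (Omf : R -> set 'rV[R]_(1 + d + l)) (fe : R -> 'rV[R]_(1 + d + l) -> 'rV[R]_d).
Hypothesis hf : gsf_net (dom3 P) (unc3 (cphi P)) Omf fe.

Definition phi_q e x : 'M[R]_d := \matrix_(i, j) pderive [:: dir_q i] (vcomp (fe e) j) x.

Lemma dphi_dq_rep t q k xe : dom3 P (pack3 t q k) -> vrepresents xe (pack3 t q k) ->
  forall i j, represents (fun e => phi_q e (xe e) i j) (dphi_dq P t q k i j).
Proof.
move=> Dx hx i j; rewrite mxE; under eq_fun do rewrite mxE.
exact: gderivE fat_dom3 hf Dx hx.
Qed.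

Lemma phi_MK p : \near0 e, forall x, core_net e x ->
  (b e - a e) * enorm (fe e x) <= r e + rho e ^+ p.
Proof.
have hM := represents_rcnet (M_K P).
have hG x xe : core x -> vrepresents xe x ->
    represents (fun e => enorm (fe e (xe e))) (Defs.gnorm (unc3 (cphi P) x)).
  move=> cx hx; apply: represents_gnorm.
  by have := gsf_net_val hf (core_dom3 cx) hx.
have hA y : (exists t q k, [/\ gitv t1 t2 t, gcball (cq1 P) (cr P) q, cK P k &
    y = Defs.gnorm (cphi P t q k)]) <-> exists2 x, core x & y = Defs.gnorm (unc3 (cphi P) x).
  split=> [[t [q [k [tt qb Kk ->]]]]|[x cx ->]].
    by exists (pack3 t q k); rewrite /core /= unc3_pack3.
  by move: cx; rewrite /core /unc3 /= => -[]; do 3 eexists; split; eauto.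
have h := gmax_attained (g := fun e x => enorm (fe e x)) core_nets_in core_rep hG hA hM.
have hle := (gleP (representsM (representsB hb ha) hM) hr).1 (st_MK hP).
have [m0 /(_ m0 (leqnn _)) hm] := mod_net_absorb p.+1 mod_T.
near=> e => x cx.
have re : 0 < rho e <= 1 by near: e; apply: gauge_near.
have ab : a e < b e by near: e; apply: near_time t12 ha hb.
have k1 : forall x, core_net e x -> enorm (fe e x) <= rcnet (M_K P) e + rho e ^+ m0 by near: e; apply: h.
have k2 : (b e - a e) * rcnet (M_K P) e <= r e + rho e ^+ p.+1 by near: e; apply: hle.
have k3 : `|b e - a e| * rho e ^+ m0 <= rho e ^+ p.+1 by near: e.
have k4 : 2 * rho e ^+ p.+1 <= rho e ^+ p by near: e; apply: near_rhoX.
have T0 : 0 < b e - a e by rewrite subr_gt0.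
rewrite gtr0_norm// in k3.
have := ler_wpM2l (ltW T0) (k1 x cx); lra.
Unshelve. all: by end_near. Qed.

(** The powers of (t2 - t1) L_K tend sharply to 0, so one of them is below rho;
    hence (t2 - t1) L_K is below every positive real. *)
Lemma phi_LK (eta : R) : 0 < eta -> \near0 e, forall x, core_net e x ->
  (b e - a e) * opnorm (phi_q e x) <= eta.
Proof.
move=> eta0; have hL := represents_rcnet (L_K P).
pose G x := gopnorm (unc3 (dphi_dq P) x).
have hG x xe : core x -> vrepresents xe x ->
    represents (fun e => opnorm (phi_q e (xe e))) (G x).
  move=> cx hx; apply: represents_gopnorm; rewrite /unc3; apply: dphi_dq_rep; rewrite -pack3_unc3//.
  exact: core_dom3.
have hA y : (exists t q k, [/\ gitv t1 t2 t, gcball (cq1 P) (cr P) q, cK P k &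
    y = gopnorm (dphi_dq P t q k)]) <-> exists2 x, core x & y = G x.
  split=> [[t [q [k [tt qb Kk ->]]]]|[x cx ->]].
    by exists (pack3 t q k); rewrite /G /core /= unc3_pack3.
  by move: cx; rewrite /G /core /unc3 /= => -[]; do 3 eexists; split; eauto.
have h := gmax_attained (g := fun e x => opnorm (phi_q e x)) core_nets_in core_rep hG hA hL.
have h0 : vrepresents (fun=> 0 : 'rV[R]_1) (0 : 'rV[rc]_1).
  move=> i; rewrite !mxE; exact: represents0.
have [N _ hN] := st_LK hP (sharp_nbhs_net 1 h0).
have hLN : \near0 e, (b e - a e) ^+ N.+1 * rcnet (L_K P) e ^+ N.+1 <= rho e.
  have /= hNN := hN N.+1 (leqnSn _).
  have hrep := vrepresents_const_mx (representsM (representsX N.+1 (representsB hb ha)) (representsX N.+1 hL)).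
  have := hNN _ hrep; apply: filterS => e; rewrite subr0 expr1 => /(le_trans (coord_le_norm _ 0)).
  by rewrite mxE; apply: le_trans; apply: ler_norm.
have hLs : \near0 e, (b e - a e) * rcnet (L_K P) e <= eta / 2.
  near=> e; rewrite leNgt; apply/negP => hlt.
  have k1 : (b e - a e) ^+ N.+1 * rcnet (L_K P) e ^+ N.+1 <= rho e by near: e.
  have k2 : rho e < (eta / 2) ^+ N.+1 by near: e; apply: gauge_small; rewrite exprn_gt0 ?divr_gt0.
  have : (eta / 2) ^+ N.+1 < ((b e - a e) * rcnet (L_K P) e) ^+ N.+1.
    by apply: ltrXn2r => //; rewrite divr_ge0 ?ltW.
  by rewrite [X in _ < X]exprMn; lra.
have [m0 /(_ m0.+1 (leqnSn _)) hm] := mod_net_absorb 1 mod_T.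
near=> e => x cx.
have re : 0 < rho e <= 1 by near: e; apply: gauge_near.
have ab : a e < b e by near: e; apply: near_time t12 ha hb.
have k1 : forall x, core_net e x -> opnorm (phi_q e x) <= rcnet (L_K P) e + rho e ^+ m0.+1 by near: e; apply: h.
have k2 : (b e - a e) * rcnet (L_K P) e <= eta / 2 by near: e.
have k3 : `|b e - a e| * rho e ^+ m0.+1 <= rho e ^+ 1 by near: e.
have k4 : rho e < eta / 2 by near: e; apply: gauge_small; rewrite divr_gt0.
have T0 : 0 < b e - a e by rewrite subr_gt0.
rewrite gtr0_norm// expr1 in k3.
have := ler_wpM2l (ltW T0) (k1 x cx); lra.
Unshelve. all: by end_near. Qed.

(** The control stays near a single value k0, since K need not be convex; the
    tube is then convex, as the mean value theorem requires. *)
Definition tube (dl : R) e (k0 : 'rV[R]_l) : set 'rV[R]_(1 + d + l) :=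
  [set x | unc3 (fun t q k => [/\ a e - dl <= t <= b e + dl,
     enorm (q - q1 e) <= r e + dl & `|k - k0| <= dl]) x].

Lemma tube_pack3 dl e k0 t q k : tube dl e k0 (pack3 t q k) =
  [/\ a e - dl <= t <= b e + dl, enorm (q - q1 e) <= r e + dl & `|k - k0| <= dl].
Proof. by rewrite /tube /= unc3_pack3. Qed.

Lemma tube_convex dl e k0 x y (s : R) : 0 <= s <= 1 ->
  tube dl e k0 x -> tube dl e k0 y -> tube dl e k0 (x + s *: (y - x)).
Proof.
move=> s01; have /andP[s0 s1] := s01.
rewrite [x]pack3_unc3 [y]pack3_unc3; move: (lsubmx _ 0 0) (rsubmx _) (rsubmx _) (lsubmx _ 0 0) (rsubmx _) (rsubmx _).
move=> t k q t' k' q'; rewrite pack3B pack3Z pack3D !tube_pack3.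
move=> [/andP[h1 h2] h3 h4] [/andP[h1' h2'] h3' h4']; split.
- by apply/andP; split; nra.
- exact: convex_comb_enorm.
- exact: ball_segment.
Qed.

Lemma near_tube_core N : \near0 e, forall k0 x, Kc e k0 -> tube (rho e ^+ N) e k0 x ->
  exists2 y, core_net e y & `|x - y| <= rho e ^+ N.
Proof.
near=> e => k0 x Kk0.
have re : 0 < rho e <= 1 by near: e; apply: gauge_near.
have ab : a e < b e by near: e; apply: near_time t12 ha hb.
have r0 : 0 < r e by near: e; apply: near_r.
have rN := rho_exp_gt0 N re.
rewrite [x]pack3_unc3; move: (lsubmx _ 0 0) (rsubmx _) (rsubmx _) => t k q.
rewrite tube_pack3 => -[/andP[h1 h2] h3 h4].
have [q' [qb qq']] := retract_ball (q1 e) q (ltW r0).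
exists (pack3 (clamp (a e) (b e) t) q' k0).
  by rewrite /core_net /= unc3_pack3; split => //; apply: clamp_itv; apply: ltW.
rewrite pack3B; apply: norm_pack3 => //.
  by rewrite ler_norml; apply/andP; case: (clampP t (ltW ab)) => -[h ->]; split; lra.
apply: (le_trans (norm_le_enorm _)); apply: (le_trans qq').
by rewrite ge_max (ltW rN)/= lerBlDl.
Unshelve. all: by end_near. Qed.

(** A power of rho serves as width for the domain and for moderate bounds.  The
    matrix phi_q is Lipschitz there with a moderate constant, so a smaller
    power keeps (t2 - t1) |phi_q| below the bound valid on the core. *)
Lemma tube_dom : exists N, \near0 e, forall k0 x, Kc e k0 -> tube (rho e ^+ N) e k0 x ->
  [/\ Omf e x, forall i j, `|pderive [:: i] (vcomp (fe e) j) x| <= rho e ^- N &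
      (b e - a e) * opnorm (phi_q e x) <= 8^-1].
Proof.
have dX := gsf_net_dom hf.
have cX : nets_in core_net (dom3 P).
  split; first exact: core_nets_in.1.
  by move=> xe /core_nets_in.2[x /core_dom3 Dx hx]; exists x.
have [N0 h0] := unif_dom dX.2 cX.
have [N1 h1] : exists N, \near0 e, forall (ij : 'I_(1 + d + l) * 'I_d),
    forall x y z : 'rV[R]_(1 + d + l), core_net e x ->
    `|y - x| <= rho e ^+ N -> `|z - x| <= rho e ^+ N ->
    `|pderive [:: ij.1] (vcomp (fe e) ij.2) z - pderive [:: ij.1] (vcomp (fe e) ij.2) y| <=
      rho e ^- N * `|z - y|.
  apply: (@near0_forall_exp R rho) => [N M e ij re NM h x y z cx yx zx|ij].
    apply: (le_trans (h x y z cx _ _)); [apply: le_trans yx _|apply: le_trans zx _|];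
      rewrite ?rho_expM// ler_wpM2r//; exact: rho_expVM.
  exact: unif_lipschitz dX (gsf_net_Snet hf [:: ij.1] ij.2 1) cX.
have [N2 h2] : exists N, \near0 e, forall (ij : 'I_(1 + d + l) * 'I_d),
    forall x y : 'rV[R]_(1 + d + l), core_net e x -> `|y - x| <= rho e ^+ N ->
    `|pderive [:: ij.1] (vcomp (fe e) ij.2) y| <= rho e ^- N.
  apply: (@near0_forall_exp R rho) => [N M e ij re NM h x y cx yx|ij].
    by apply: (le_trans (h x y cx _)); [apply: le_trans yx _; apply: rho_expM|apply: rho_expVM].
  by apply: unif_bound cX; apply: Cnet_mod (gsf_net_Snet hf [:: ij.1] ij.2 0).
have [N3 h3] := mod_T.
pose N := (N0 + N1 + N2 + N3).+1.
have [l0 l1 l2 l3] : [/\ (N0 <= N)%N, (N1 <= N)%N, (N2 <= N)%N & (N3 + (N1 + 1) <= N)%N].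
  by rewrite /N; split; lia.
exists N; near=> e => k0 x Kk0 tx.
have re : 0 < rho e <= 1 by near: e; apply: gauge_near.
have ab : a e < b e by near: e; apply: near_time t12 ha hb.
have [y cy xy] : exists2 y, core_net e y & `|x - y| <= rho e ^+ N.
  have h : forall k0 x, Kc e k0 -> tube (rho e ^+ N) e k0 x ->
    exists2 y, core_net e y & `|x - y| <= rho e ^+ N by near: e; apply: near_tube_core.
  exact: h Kk0 tx.
have k1 : forall x y : 'rV[R]_(1 + d + l), core_net e x -> `|y - x| <= rho e ^+ N0 -> Omf e y by near: e.
have k2 : forall (ij : 'I_(1 + d + l) * 'I_d),
    forall x y z : 'rV[R]_(1 + d + l), core_net e x ->
    `|y - x| <= rho e ^+ N1 -> `|z - x| <= rho e ^+ N1 ->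
    `|pderive [:: ij.1] (vcomp (fe e) ij.2) z - pderive [:: ij.1] (vcomp (fe e) ij.2) y| <=
      rho e ^- N1 * `|z - y| by near: e.
have k3 : forall (ij : 'I_(1 + d + l) * 'I_d),
    forall x y : 'rV[R]_(1 + d + l), core_net e x -> `|y - x| <= rho e ^+ N2 ->
    `|pderive [:: ij.1] (vcomp (fe e) ij.2) y| <= rho e ^- N2 by near: e.
split.
- by apply: (k1 y) => //; apply: le_trans xy _; apply: rho_expM.
- move=> i j; apply: (le_trans (k3 (i, j) y x cy _)); last exact: rho_expVM.
  by apply: le_trans xy _; apply: rho_expM.
have k4 : (b e - a e) * opnorm (phi_q e y) <= 16^-1.
  have h : forall x, core_net e x -> (b e - a e) * opnorm (phi_q e x) <= 16^-1.
    by near: e; apply: phi_LK; rewrite invr_gt0.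
  exact: h.
have k5 : `|b e - a e| <= rho e ^- N3 by near: e.
have k6 : 16 * (d%:R * d%:R) * rho e <= 1 by near: e; apply: near_rhoM.
have T0 : 0 < b e - a e by rewrite subr_gt0.
rewrite gtr0_norm// in k5.
have k7 : msum (phi_q e x - phi_q e y) <= d%:R * d%:R * (rho e ^- N1 * rho e ^+ N).
  have -> : d%:R * d%:R * (rho e ^- N1 * rho e ^+ N) =
      \sum_(i < d) \sum_(j < d) rho e ^- N1 * rho e ^+ N.
    by rewrite !sumr_const !card_ord -mulrnA -[in RHS]mulr_natl natrM.
  rewrite /msum.
  apply: ler_sum => i _; apply: ler_sum => j _; rewrite !mxE.
  apply: (le_trans (k2 (dir_q i, j) y y x cy _ _)); rewrite ?subrr ?normr0 ?rho_exp_ge0//.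
    by apply: le_trans xy _; apply: rho_expM.
  by rewrite ler_wpM2l// invr_ge0 rho_exp_ge0.
have k8 : rho e ^- N3 * (rho e ^- N1 * rho e ^+ N) <= rho e.
  apply: (@le_trans _ _ (rho e ^- N3 * (rho e ^- N1 * rho e ^+ (N1 + (N3 + 1))))).
    by rewrite !ler_wpM2l ?invr_ge0 ?rho_exp_ge0//; apply: rho_expM => //; rewrite addnCA.
  by rewrite !rho_expVMX// expr1.
have k9 : 0 <= rho e ^- N1 * rho e ^+ N by rewrite mulr_ge0 ?invr_ge0 ?rho_exp_ge0.
have dd0 : (0 : R) <= d%:R * d%:R by rewrite mulr_ge0.
have := opnorm_dist (phi_q e x) (phi_q e y) => k10.
have k11 := ler_wpM2l (ltW T0) k10.
have k12 := ler_wpM2l (ltW T0) k7.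
have k13 := ler_wpM2r k9 k5.
have k14 := ler_wpM2l dd0 (le_trans k13 k8).
exact: (arith_tube k11 k12 k14 k4 k6).
Unshelve. all: by end_near. Qed.

(** The mean value theorem in a fixed direction w: the factor 1/8 in q comes
    from (t2 - t1) |phi_q|, the moderate factor in t and k from the other
    partials. *)
Lemma tube_lipschitz : exists N M, \near0 e, forall k0 t q k t' q' k', Kc e k0 ->
  tube (rho e ^+ N) e k0 (pack3 t q k) -> tube (rho e ^+ N) e k0 (pack3 t' q' k') ->
  (b e - a e) * enorm (fe e (pack3 t' q' k') - fe e (pack3 t q k)) <=
    enorm (q' - q) / 8 + rho e ^- M * (`|t' - t| + `|k' - k|).
Proof.
have dX := gsf_net_dom hf.
have [N hN] := tube_dom; have [N3 h3] := mod_T.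
exists N, (N3 + N).+1; near=> e => k0 t q k t' q' k' Kk0 tx tx'.
have re : 0 < rho e <= 1 by near: e; apply: gauge_near.
have e01 : 0 < e <= 1 by near: e; apply: near0_itv.
have ab : a e < b e by near: e; apply: near_time t12 ha hb.
have T0 : 0 < b e - a e by rewrite subr_gt0.
have k1 : forall k0 x, Kc e k0 -> tube (rho e ^+ N) e k0 x ->
  [/\ Omf e x, forall i j, `|pderive [:: i] (vcomp (fe e) j) x| <= rho e ^- N &
      (b e - a e) * opnorm (phi_q e x) <= 8^-1] by near: e.
have k5 : `|b e - a e| <= rho e ^- N3 by near: e.
rewrite gtr0_norm// in k5.
pose x := pack3 t q k; pose x' := pack3 t' q' k'.
pose C := rho e ^- (N3 + N).+1.
have C0 : 0 <= C by rewrite invr_ge0 rho_exp_ge0.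
rewrite -[X in X * enorm _]ger0_norm ?(ltW T0)// -enormZ.
apply: enorm_dual => [|w].
  by rewrite addr_ge0// ?divr_ge0 ?enorm_ge0// mulr_ge0// addr_ge0.
pose D i y := \sum_j w 0 j * pderive [:: i] (vcomp (fe e) j) y.
have hseg (s : R) : 0 <= s <= 1 -> tube (rho e ^+ N) e k0 (x + s *: (x' - x)).
  by move=> s01; apply: tube_convex.
have fD z i : Omf e z -> is_derive z (delta_mx 0 i) (fun y => \sum_j w 0 j * vcomp (fe e) j y) (D i z).
  move=> Oz; apply: is_derive_sumr => j.
  apply: is_deriveZ; exact: (Snet_D dX (gsf_net_Snet hf [::] j) i).2.
have Dc z i : Omf e z -> {for z, continuous (D i)}.
  move=> Oz; apply: (@cvg_sumr R _ (nbhs z) _ _ _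
    (fun j y => w 0 j * pderive [:: i] (vcomp (fe e) j) y)
    (fun j => w 0 j * pderive [:: i] (vcomp (fe e) j) z)) => j.
  apply: cvgM; first exact: cvg_cst.
  exact: (Cnet_cts (gsf_net_Snet hf [:: i] j 0%N) e01 Oz).
have oO : open (Omf e) := dX.1 e e01.
have hS := segment_increment oO (fun s s01 => let: And3 h _ _ := k1 _ _ Kk0 (hseg s s01) in h) fD Dc.
have [s|s] := @MVT_any R (fun s => (fun y => \sum_j w 0 j * vcomp (fe e) j y) (x + s *: (x' - x)))
    (fun s => \sum_i D i (x + s *: (x' - x)) * (x' - x) 0 i) 0 1.
  by rewrite (min_idPl ler01) (max_idPr ler01); apply: hS.
rewrite (min_idPl ler01) (max_idPr ler01) scale1r scale0r addr0 subrKC subr0 mulr1.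
move=> s01 sE; have [_ kD kq] := k1 _ _ Kk0 (hseg s s01).
set z := x + s *: (x' - x) in sE kD kq.
have -> : dotp ((b e - a e) *: (fe e x' - fe e x)) w =
    (b e - a e) * (\sum_j w 0 j * vcomp (fe e) j x' - \sum_j w 0 j * vcomp (fe e) j x).
  rewrite -sumrB mulr_sumr; apply: eq_bigr => j _; rewrite !mxE /vcomp; ring.
have Dle i : `|D i z| <= d%:R * rho e ^- N * enorm w.
  apply: (le_trans (ler_norm_sum _ _ _)); 
  have -> : d%:R * rho e ^- N * enorm w = \sum_(j < d) rho e ^- N * enorm w.
    by rewrite sumr_const card_ord -mulrA mulr_natl.
  apply: ler_sum => j _; rewrite normrM [leLHS]mulrC ler_pM//.
  exact: coord_le_enorm.
have w0 := enorm_ge0 w.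
rewrite sE sum_pack3 {1 2 3}/x' {1 2 3}/x pack3B pack3_t.
under [X in _ + X + _]eq_bigr do rewrite pack3_q.
have -> : \sum_i D (dir_u i) z * pack3 (t' - t) (q' - q) (k' - k) 0 (dir_u i) =
    \sum_i D (dir_u i) z * (k' - k) 0 i by apply: eq_bigr => i _; rewrite pack3_u.
have -> : \sum_i D (dir_q i) z * (q' - q) 0 i = dotp ((q' - q) *m phi_q e z) w.
  rewrite /dotp; under [RHS]eq_bigr do rewrite mxE mulr_suml.
  rewrite exchange_big/=; apply: eq_bigr => i _; rewrite /D mulr_suml.
  by apply: eq_bigr => j _; rewrite [phi_q _ _ _ _]mxE; ring.
have p1 : (b e - a e) * dotp ((q' - q) *m phi_q e z) w <= enorm (q' - q) / 8 * enorm w.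
  apply: (@le_trans _ _ ((b e - a e) * (opnorm (phi_q e z) * enorm (q' - q) * enorm w))).
    rewrite ler_pM2l//; apply: (le_trans (dotp_le _ _)).
    by rewrite ler_wpM2r//; apply: enorm_opnorm.
  rewrite !mulrA ler_wpM2r// [X in _ <= X]mulrC ler_wpM2r// enorm_ge0//.
have A0 : 0 <= d%:R * rho e ^- N * enorm w by rewrite !mulr_ge0// invr_ge0 rho_exp_ge0.
have p2 : D dir_t z * (t' - t) <= d%:R * rho e ^- N * enorm w * `|t' - t|.
  by apply: (le_trans (ler_norm _)); rewrite normrM ler_wpM2r.
have p3 : \sum_i D (dir_u i) z * (k' - k) 0 i <= d%:R * rho e ^- N * enorm w * (l%:R * `|k' - k|).
  apply: (@le_trans _ _ (\sum_i d%:R * rho e ^- N * enorm w * `|(k' - k) 0 i|)).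
    apply: ler_sum => i _; apply: (le_trans (ler_norm _)).
    by rewrite normrM ler_wpM2r.
  by rewrite -mulr_sumr ler_wpM2l// sum_le_norm.
have p4 : d%:R * (l%:R + 1) * rho e <= 1 by near: e; apply: near_rhoM.
have r0 : 0 < rho e by case/andP: re.
have p5 : (b e - a e) * (d%:R * rho e ^- N * (l%:R + 1)) <= C.
  apply: (@le_trans _ _ (rho e ^- N3 * (rho e ^- N * (d%:R * (l%:R + 1))))).
    rewrite [leLHS](_ : _ = (b e - a e) * (rho e ^- N * (d%:R * (l%:R + 1)))); last by ring.
    by rewrite ler_wpM2r// !mulr_ge0 ?addr_ge0// invr_ge0 rho_exp_ge0.
  rewrite /C exprS exprD !invfM mulrC -!mulrA [X in _ <= X]mulrC -!mulrA.
  rewrite [X in X <= _](_ : _ = rho e ^- N3 * (rho e ^- N * (d%:R * (l%:R + 1)))); last by ring.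
  rewrite !ler_wpM2l ?invr_ge0 ?rho_exp_ge0//.
  by rewrite -[leRHS]mul1r ler_pdivlMr.
have S0 : 0 <= `|t' - t| + `|k' - k| by rewrite addr_ge0.
have p6 := ler_wpM2r w0 (ler_wpM2r S0 p5).
have p7 : (b e - a e) * (D dir_t z * (t' - t) + \sum_i D (dir_u i) z * (k' - k) 0 i) <=
   (b e - a e) * (d%:R * rho e ^- N * (l%:R + 1)) * (`|t' - t| + `|k' - k|) * enorm w.
  rewrite -!mulrA ler_pM2l//.
  apply: (le_trans (lerD p2 p3)).
  have l0 : (0 : R) <= l%:R by [].
  have c0 : 0 <= d%:R * rho e ^- N * enorm w := A0.
  rewrite [leRHS](_ : _ = d%:R * rho e ^- N * enorm w * ((l%:R + 1) * (`|t' - t| + `|k' - k|))); last by ring.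
  rewrite -mulrDr ler_wpM2l//.
  have := normr_ge0 (t' - t); have := normr_ge0 (k' - k); nra.
rewrite [_ * enorm w in leRHS]mulrDl.
rewrite addrAC [leLHS]mulrDr [leRHS]addrC; apply: lerD; last exact: p1.
exact: le_trans p7 p6.
Unshelve. all: by end_near. Qed.

(** * Control nets and approximate solutions of the state equation *)

(** The values of a net of a control approach Kc e to every order but need not
    lie in it. *)
Definition near_K (ue : R -> R -> 'rV[R]_l) := forall n, \near0 e, forall t,
  a e <= t <= b e -> exists2 k0, Kc e k0 & `|ue e t - k0| <= rho e ^+ n.

Lemma control_near_K u Omu ue due : control P u -> curvenet t1 t2 u Omu ue due -> near_K ue.
Proof.
move=> [uK _] [_ _ _ uv _] n; apply: (curve_unif t12 ha hb) => t te tt ht tab.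
have ttm : titv t1 t2 (const_mx t) by rewrite /titv /= mxE.
have Kut : cK P (u t) by have := uK _ ttm; rewrite /oncurve mxE.
have [xe hx hxe] := KKc Kut.
have hd := vrepresents_negl (uv t te tt ht) hx.
near=> e; exists (xe e); first by near: e.
by rewrite -normr_id; near: e; apply: hd.
Unshelve. all: by end_near. Qed.

(** Solutions of the state equation up to negligible errors, which is all that
    representatives of a solution are. *)
Definition state_net (ue : R -> R -> 'rV[R]_l) (q dq : R -> R -> 'rV[R]_d) :=
  [/\ \near0 e, forall t, a e <= t <= b e -> forall j, is_derive t 1 (fun s => q e s 0 j) (dq e t 0 j),
      negl rho (fun e => enorm (q e (a e) - q1 e)) &
      forall n, \near0 e, forall t, a e <= t <= b e ->
        enorm (dq e t - fe e (pack3 t (q e t) (ue e t))) <= rho e ^+ n].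

(** The barrier of radius r: inside the tube (t2 - t1) times the speed is at
    most r, by the choice of M_K, plus half of the excess of q over the
    ball. *)
Lemma state_bound ue q dq : near_K ue -> state_net ue q dq ->
  forall n, \near0 e, forall t, a e <= t <= b e -> enorm (q e t - q1 e) <= r e + rho e ^+ n.
Proof.
move=> uK [qd q0 qf] n.
have [N [M hNM]] := tube_lipschitz.
pose m := (n + N).+2.
have [p4 /(_ p4 (leqnn _)) h4] := mod_net_absorb m.+1 mod_T.
pose p2 := (M + (m.+1 + N))%N.
near=> e => t tab.
have re : 0 < rho e <= 1 by near: e; apply: gauge_near.
have ab : a e < b e by near: e; apply: near_time t12 ha hb.
have T0 : 0 < b e - a e by rewrite subr_gt0.
have r0 : 0 < r e by near: e; apply: near_r.
have hL : forall k0 t q k t' q' k', Kc e k0 ->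
  tube (rho e ^+ N) e k0 (pack3 t q k) -> tube (rho e ^+ N) e k0 (pack3 t' q' k') ->
  (b e - a e) * enorm (fe e (pack3 t' q' k') - fe e (pack3 t q k)) <=
    enorm (q' - q) / 8 + rho e ^- M * (`|t' - t| + `|k' - k|) by near: e.
have hd : forall t, a e <= t <= b e -> forall j, is_derive t 1 (fun s => q e s 0 j) (dq e t 0 j) by near: e.
have h0 : `|enorm (q e (a e) - q1 e)| <= rho e ^+ m by near: e; apply: q0.
have hf' : forall t, a e <= t <= b e -> enorm (dq e t - fe e (pack3 t (q e t) (ue e t))) <= rho e ^+ p4.
  by near: e; apply: qf.
have hK : forall t, a e <= t <= b e -> exists2 k0, Kc e k0 & `|ue e t - k0| <= rho e ^+ p2.
  by near: e; apply: uK.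
have hM : forall x, core_net e x -> (b e - a e) * enorm (fe e x) <= r e + rho e ^+ m.+1.
  by near: e; apply: phi_MK.
have hT : `|b e - a e| * rho e ^+ p4 <= rho e ^+ m.+1 by near: e.
have h3m : 3 * rho e ^+ m.+1 <= rho e ^+ m by near: e; apply: near_rhoX.
have h5m : 5 * rho e ^+ m <= rho e ^+ (n + N).+1 by near: e; apply: near_rhoX.
have rN : rho e ^+ (n + N).+1 <= rho e ^+ N by apply: rho_expM => //; exact: leqW (leq_addl _ _).
have rn : rho e ^+ (n + N).+1 <= rho e ^+ n by apply: rho_expM => //; exact: leqW (leq_addr _ _).
have rm0 := rho_exp_gt0 m re.
rewrite gtr0_norm// in hT; rewrite ger0_norm ?enorm_ge0// in h0.
apply: (le_trans (@barrier R d (fun t => q e t - q1 e) (dq e) (a e) (b e) (r e) (rho e ^+ N)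
   (rho e ^+ m) (rho e ^+ m) ab _ h0 (ltW r0) (ltW rm0) _ _ t tab)).
- move=> s sab j; have := is_deriveB (hd s sab j) (is_derive_cst (q1 e 0 j) s 1).
  rewrite subr0; set f := _ - _; set g := fun _ => _; suff -> : f = g by [].
  by apply/funext => v; rewrite /f /g !mxE.
- move=> s sab hs.
  have [k0 Kk0 uk0] := hK s sab.
  have [q' [qb qq']] := retract_ball (q1 e) (q e s) (ltW r0).
  have rN0 := rho_exp_gt0 N re.
  have rp2 : rho e ^+ p2 <= rho e ^+ N by apply: rho_expM => //; rewrite /p2 addnA leq_addl.
  have tube1 : tube (rho e ^+ N) e k0 (pack3 s (q e s) (ue e s)).
    by rewrite tube_pack3; split => //; [exact: itv_widen|exact: le_trans uk0 rp2].
  have tube2 : tube (rho e ^+ N) e k0 (pack3 s q' k0).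
    rewrite tube_pack3; split => //; last by rewrite subrr normr0 ltW.
      exact: itv_widen.
    by apply: (le_trans qb); rewrite lerDl ltW.
  have c2 : core_net e (pack3 s q' k0) by rewrite /core_net /= unc3_pack3.
  have l1 := hL _ _ _ _ _ _ _ Kk0 tube2 tube1.
  have l2 := hM _ c2.
  rewrite subrr normr0 add0r in l1.
  have l3 : rho e ^- M * `|ue e s - k0| <= rho e ^+ m.+1.
    apply: (@le_trans _ _ (rho e ^- M * rho e ^+ (M + m.+1))); last by rewrite rho_expVMX.
    rewrite ler_wpM2l ?invr_ge0 ?rho_exp_ge0//; apply: (le_trans uk0).
    by apply: rho_expM => //; rewrite /p2 addnA leq_addr.
  have l4 := enormBD (dq e s) (fe e (pack3 s (q e s) (ue e s))) 0.
  have l5 := enormBD (fe e (pack3 s (q e s) (ue e s))) (fe e (pack3 s q' k0)) 0.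
  rewrite !subr0 in l4 l5.
  have l6 := ler_wpM2l (ltW T0) l4; have l7 := ler_wpM2l (ltW T0) l5.
  have l8 := ler_wpM2l (ltW T0) (hf' s sab).
  have l9 : 0 <= Num.max 0 (enorm (q e s - q1 e) - r e) by rewrite le_max lexx.
  exact: (arith_bound l1 l2 l3 l6 l7 l8 l9 qq' h3m hT).
- exact: (arith_lt h5m rN rm0).
exact: (arith_le _ h5m rn rm0).
Unshelve. all: by end_near. Qed.

(** The barrier of radius 0 for the difference of two solutions, with the
    difference of the controls as defect. *)
Lemma state_close : exists N M, forall ue q dq ue' q' dq' (c : R -> R),
  near_K ue -> near_K ue' -> state_net ue q dq -> state_net ue' q' dq' ->
  (\near0 e, 0 <= c e <= rho e ^+ N) ->
  (\near0 e, forall t, a e <= t <= b e -> `|ue' e t - ue e t| <= c e) ->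
  forall n, \near0 e, forall t, a e <= t <= b e ->
    enorm (q' e t - q e t) <= 2 * (rho e ^- M * c e) + rho e ^+ n.
Proof.
have [N [M hNM]] := tube_lipschitz; exists N.+1, M.
move=> ue q dq ue' q' dq' c uK uK' sq sq' cN uu' n.
have qb := state_bound uK sq N; have qb' := state_bound uK' sq' N.
have [qd q0 qf] := sq; have [qd' q0' qf'] := sq'.
pose m := n.+2.
have [p4 /(_ p4 (leqnn _)) h4] := mod_net_absorb m.+1 mod_T.
near=> e => t tab.
have re : 0 < rho e <= 1 by near: e; apply: gauge_near.
have ab : a e < b e by near: e; apply: near_time t12 ha hb.
have T0 : 0 < b e - a e by rewrite subr_gt0.
have hL : forall k0 t q k t' q' k', Kc e k0 ->
  tube (rho e ^+ N) e k0 (pack3 t q k) -> tube (rho e ^+ N) e k0 (pack3 t' q' k') ->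
  (b e - a e) * enorm (fe e (pack3 t' q' k') - fe e (pack3 t q k)) <=
    enorm (q' - q) / 8 + rho e ^- M * (`|t' - t| + `|k' - k|) by near: e.
have hd : forall t, a e <= t <= b e -> forall j, is_derive t 1 (fun s => q e s 0 j) (dq e t 0 j) by near: e.
have hd' : forall t, a e <= t <= b e -> forall j, is_derive t 1 (fun s => q' e s 0 j) (dq' e t 0 j) by near: e.
have h0 : `|enorm (q e (a e) - q1 e)| <= rho e ^+ m.+1 by near: e; apply: q0.
have h0' : `|enorm (q' e (a e) - q1 e)| <= rho e ^+ m.+1 by near: e; apply: q0'.
have hfe : forall t, a e <= t <= b e -> enorm (dq e t - fe e (pack3 t (q e t) (ue e t))) <= rho e ^+ p4.
  by near: e; apply: qf.
have hfe' : forall t, a e <= t <= b e -> enorm (dq' e t - fe e (pack3 t (q' e t) (ue' e t))) <= rho e ^+ p4.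
  by near: e; apply: qf'.
have hK : forall t, a e <= t <= b e -> exists2 k0, Kc e k0 & `|ue e t - k0| <= rho e ^+ N.+1.
  by near: e; apply: uK.
have hb1 : forall t, a e <= t <= b e -> enorm (q e t - q1 e) <= r e + rho e ^+ N by near: e.
have hb2 : forall t, a e <= t <= b e -> enorm (q' e t - q1 e) <= r e + rho e ^+ N by near: e.
have hT : `|b e - a e| * rho e ^+ p4 <= rho e ^+ m.+1 by near: e.
have /andP[hc0 hcN] : 0 <= c e <= rho e ^+ N.+1 by near: e.
have huu : forall t, a e <= t <= b e -> `|ue' e t - ue e t| <= c e by near: e.
have h2m : 2 * rho e ^+ m.+1 <= rho e ^+ m by near: e; apply: near_rhoX.
have h4m : 4 * rho e ^+ m <= rho e ^+ n.+1 by near: e; apply: near_rhoX.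
have h2N : 2 * rho e ^+ N.+1 <= rho e ^+ N by near: e; apply: near_rhoX.
have rn : rho e ^+ n.+1 <= rho e ^+ n by apply: rho_expM.
have rm0 := rho_exp_gt0 m re; have rN1 := rho_exp_gt0 N.+1 re; have rN0 := rho_exp_gt0 N re.
rewrite gtr0_norm// in hT; rewrite ger0_norm ?enorm_ge0// in h0; rewrite ger0_norm ?enorm_ge0// in h0'.
have hA : enorm (q' e (a e) - q e (a e)) <= rho e ^+ m.
  apply: (le_trans (enormBD _ (q1 e) _)); rewrite (enormB (q1 e)).
  exact: (arith_sum2 h0' h0 h2m).
have B0 : 0 <= rho e ^- M * c e + rho e ^+ m.
  by rewrite addr_ge0 ?(ltW rm0)// mulr_ge0// invr_ge0 rho_exp_ge0.
pose AB := 2 * (rho e ^+ m + (rho e ^- M * c e + rho e ^+ m)).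
apply: (le_trans (@barrier R d (fun t => q' e t - q e t) (fun t => dq' e t - dq e t) (a e) (b e) 0 (AB + 1)
   (rho e ^+ m) (rho e ^- M * c e + rho e ^+ m) ab _ hA (lexx 0) B0 _ _ t tab)).
- move=> s sab j; have := is_deriveB (hd' s sab j) (hd s sab j).
  rewrite !mxE; set f := _ - _; set g := fun _ => _; suff -> : f = g by [].
  by apply/funext => v; rewrite /f /g !mxE.
- move=> s sab _.
  have [k0 Kk0 uk0] := hK s sab.
  have uk0' : `|ue' e s - k0| <= rho e ^+ N.
    rewrite -(subrKA (ue e s)); apply: (le_trans (ler_normD _ _)).
    exact: (arith_sum2 (le_trans (huu s sab) hcN) uk0 h2N).
  have sab' : a e - rho e ^+ N <= s <= b e + rho e ^+ N.
    exact: itv_widen.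
  have tube1 : tube (rho e ^+ N) e k0 (pack3 s (q e s) (ue e s)).
    rewrite tube_pack3; split => //; first exact: hb1.
    by apply: (le_trans uk0); apply: rho_expM.
  have tube2 : tube (rho e ^+ N) e k0 (pack3 s (q' e s) (ue' e s)).
    by rewrite tube_pack3; split => //; exact: hb2.
  have l1 := hL _ _ _ _ _ _ _ Kk0 tube1 tube2.
  rewrite subrr normr0 add0r in l1.
  have l3 : rho e ^- M * `|ue' e s - ue e s| <= rho e ^- M * c e.
    by rewrite ler_wpM2l ?invr_ge0 ?rho_exp_ge0//; apply: huu.
  have l4 := enormBD (dq' e s) (fe e (pack3 s (q' e s) (ue' e s))) (dq e s).
  have l5 := enormBD (fe e (pack3 s (q' e s) (ue' e s))) (fe e (pack3 s (q e s) (ue e s))) (dq e s).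
  rewrite (enormB (fe e (pack3 s (q e s) (ue e s))) (dq e s)) in l5.
  have l6 := ler_wpM2l (ltW T0) l4; have l7 := ler_wpM2l (ltW T0) l5.
  have l8 := ler_wpM2l (ltW T0) (hfe s sab).
  have l8' := ler_wpM2l (ltW T0) (hfe' s sab).
  rewrite add0r subr0 (max_idPr (enorm_ge0 _)).
  have l9 := enorm_ge0 (q' e s - q e s).
  exact: (arith_close l1 l3 l6 l7 l8 l8' l9 h2m hT).
- by rewrite /AB ltrDl.
by rewrite add0r; exact: (arith_final _ h4m rn).
Unshelve. all: by end_near. Qed.

Lemma cphi_rep u Omu ue due q Omq qe dqe : control P u -> curvenet t1 t2 u Omu ue due ->
  curvenet t1 t2 q Omq qe dqe -> forall t te, gitv t1 t2 t -> represents te t -> cH P (q t) ->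
  vrepresents (fun e => fe e (pack3 (te e) (qe e (te e)) (ue e (te e)))) (cphi P t (q t) (u t)).
Proof.
move=> [uK _] hu hq t te tt ht Hq.
have ttm : titv t1 t2 (const_mx t) by rewrite /titv /= mxE.
have Kut : cK P (u t) by have := uK _ ttm; rewrite /oncurve mxE.
have [_ _ _ uv _] := hu; have [_ _ _ qv _] := hq.
have := gsf_net_val hf (dom3_pack3 tt Hq Kut) (vrepresents_pack3 ht (qv _ _ tt ht) (uv _ _ tt ht)).
by rewrite unc3_pack3.
Qed.

Lemma state_solution_net u Omu ue due q Omq qe dqe : control P u -> curvenet t1 t2 u Omu ue due ->
  state_solution P u q -> curvenet t1 t2 q Omq qe dqe -> state_net ue qe dqe.
Proof.
move=> uc hu [[[qH _] _] qd q0] hq; have [[_ XO] _ _ qv qdv] := hq.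
have tt1 : gitv t1 t2 t1.
  split; last exact: glt_gle.
  by apply/(gleP ha ha) => n; near=> e; rewrite lerDl rho_exp_ge0//; near: e; apply: gauge_near.
split.
- apply: (curve_unif t12 ha hb) => t te tt ht _; near=> e => j.
  apply: qdv; near: e; first exact: near0_itv.
  apply: XO (vrepresents_const_mx ht); by rewrite /titv /= mxE.
- have := vrepresents_negl (qv _ _ tt1 ha); rewrite q0 => /(_ _ hq1) h.
  apply: (negl_le (neglM (mod_net_cst rho d%:R) h)); near=> e.
  rewrite ger0_norm ?enorm_ge0//; apply: le_trans (ler_norm _); exact: enorm_le_norm.
- move=> n; apply: (curve_unif t12 ha hb) => t te tt ht _.
  have Hq : cH P (q t).
    by have := qH (const_mx t); rewrite /oncurve /titv /= mxE; apply.
  have h1 := curvenet_gdot t12 ha hb hq tt ht; rewrite qd// in h1.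
  have h2 := vrepresents_negl h1 (cphi_rep uc hu hq tt ht Hq).
  have h3 : negl rho (fun e => enorm (dqe e (te e) - fe e (pack3 (te e) (qe e (te e)) (ue e (te e))))).
    apply: (negl_le (neglM (mod_net_cst rho d%:R) h2)); near=> e.
    rewrite ger0_norm ?enorm_ge0//; apply: le_trans (ler_norm _); exact: enorm_le_norm.
  by near=> e; rewrite -[leLHS]ger0_norm ?enorm_ge0//; near: e; apply: h3.
Unshelve. all: by end_near. Qed.

(** Two solutions for the same control are close with c = 0. *)
Lemma state_solution_unique u q q' : control P u -> state_solution P u q -> state_solution P u q' ->
  forall t, gitv t1 t2 t -> q t = q' t.
Proof.
move=> uc sq sq' t tt.
have [Omu [ue [due hu]]] := gcurve_curvenet uc.
have [[qg _] _ _] := sq; have [[qg' _] _ _] := sq'.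
have [Omq [qe [dqe hq]]] := gcurve_curvenet qg.
have [Omq' [qe' [dqe' hq']]] := gcurve_curvenet qg'.
have uK := control_near_K uc hu.
have s1 := state_solution_net uc hu sq hq; have s2 := state_solution_net uc hu sq' hq'.
have [N [M /(_ _ _ _ _ _ _ (fun=> 0) uK uK s1 s2) h]] := state_close.
have [_ _ _ qv _] := hq; have [_ _ _ qv' _] := hq'.
have ht := gitv_clamp t12 ha hb tt (represents_rcnet t).
have tab := near_clamp t12 ha hb (rcnet t).
apply: (vrepresents_inj (qv _ _ tt ht)).
apply: (vrepresents_congr (qv' _ _ tt ht)) => n.
have hn := h _ _ n; near=> e.
rewrite normr_id distrC; apply: (le_trans (norm_le_enorm _)).
have k1 : forall t, a e <= t <= b e ->
    enorm (qe' e t - qe e t) <= 2 * (rho e ^- M * 0) + rho e ^+ n.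
  near: e; apply: hn; near=> e'.
    by rewrite lexx rho_exp_ge0//; near: e'; apply: gauge_near.
  by move=> s _; rewrite subrr normr0.
by rewrite -[leRHS]add0r -[X in _ <= X + _](mulr0 2) -[X in _ <= 2 * X + _](mulr0 (rho e ^- M)); apply: k1; near: e.
Unshelve. all: by end_near. Qed.

(** * Existence of the state *)

Definition wide p e t := a e - rho e ^+ p <= t <= b e + rho e ^+ p.

Lemma wide_le m n e t : 0 < rho e <= 1 -> (m <= n)%N -> wide n e t -> wide m e t.
Proof. by move=> re mn /andP[h1 h2]; have h := rho_expM re mn; apply/andP; split; lra. Qed.

Lemma near_K_wide u Omu ue due : control P u -> curvenet t1 t2 u Omu ue due ->
  forall n, exists p0, forall p, (p0 <= p)%N -> \near0 e, forall t, wide p e t ->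
    Omu e (const_mx t) /\ exists2 k0, Kc e k0 & `|ue e t - k0| <= rho e ^+ n.
Proof.
move=> uc hu n; have [N hN] := curvenet_lipschitz t12 ha hb hu.
have [N1 hN1] := curvenet_bound t12 ha hb hu.
have uK := control_near_K uc hu.
exists (N1 + (N + n.+1))%N => p pp; near=> e => t tb.
have re : 0 < rho e <= 1 by near: e; apply: gauge_near.
have ab : a e < b e by near: e; apply: near_time t12 ha hb.
have kO : forall t, wide N1 e t -> [/\ Omu e (const_mx t), `|ue e t| <= rho e ^- N1 & `|due e t| <= rho e ^- N1].
  by near: e.
have kL : forall s t, wide N e s -> wide N e t -> enorm (ue e t - ue e s) <= rho e ^- N * `|t - s| by near: e.
have kK : forall t, a e <= t <= b e -> exists2 k0, Kc e k0 & `|ue e t - k0| <= rho e ^+ n.+1.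
  by near: e; apply: uK.
have k2 : 2 * rho e ^+ n.+1 <= rho e ^+ n by near: e; apply: near_rhoX.
have l1 : (N1 <= p)%N := leq_trans (leq_addr _ _) pp.
have l2 : (N + n.+1 <= p)%N := leq_trans (leq_addl _ _) pp.
have l3 : (N <= p)%N := leq_trans (leq_addr _ _) l2.
split; first by have [] := kO t (wide_le re l1 tb).
have cab := clamp_itv t (ltW ab).
have cw : wide N e (clamp (a e) (b e) t) by apply: itv_widen => //; apply: rho_exp_gt0.
have tc : `|t - clamp (a e) (b e) t| <= rho e ^+ p.
  by apply: clamp_wide; rewrite ?(ltW ab) ?rho_exp_ge0.
have [k0 Kk0 hk0] := kK _ cab; exists k0 => //.
rewrite -(subrKA (ue e (clamp (a e) (b e) t))); apply: (le_trans (ler_normD _ _)).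
have h1 : `|ue e t - ue e (clamp (a e) (b e) t)| <= rho e ^+ n.+1.
  apply: (le_trans (norm_le_enorm _)); apply: (le_trans (kL _ _ cw (wide_le re l3 tb))).
  apply: (@le_trans _ _ (rho e ^- N * rho e ^+ (N + n.+1))); last by rewrite rho_expVMX.
  rewrite ler_wpM2l ?invr_ge0 ?rho_exp_ge0//; apply: (le_trans tc); exact: rho_expM.
exact: arith_sum2 h1 hk0 k2.
Unshelve. all: by end_near. Qed.

(** The hypotheses of Picard iteration on the ball of radius r + rho^N: since
    the ball is slightly larger than the one of M_K, there is room for a time
    interval that is slightly longer than [t1, t2]. *)
Lemma state_contraction u Omu ue due : control P u -> curvenet t1 t2 u Omu ue due ->
  exists p N, \near0 e, (forall t, wide p e t -> Omu e (const_mx t)) /\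
    [/\ forall t q, wide p e t -> enorm (q - q1 e) <= r e + rho e ^+ N -> Omf e (pack3 t q (ue e t)),
      forall t q, wide p e t -> enorm (q - q1 e) <= r e + rho e ^+ N ->
        (b e - a e + 2 * rho e ^+ p) * enorm (fe e (pack3 t q (ue e t))) <= r e + rho e ^+ N,
      forall t q q', wide p e t -> enorm (q - q1 e) <= r e + rho e ^+ N ->
        enorm (q' - q1 e) <= r e + rho e ^+ N ->
        (b e - a e + 2 * rho e ^+ p) * enorm (fe e (pack3 t q (ue e t)) - fe e (pack3 t q' (ue e t)))
          <= enorm (q - q') / 2 &
      forall t q, wide p e t -> enorm (q - q1 e) <= r e + rho e ^+ N ->
        (b e - a e + 2 * rho e ^+ p) * opnorm (phi_q e (pack3 t q (ue e t))) <= 2^-1].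
Proof.
move=> uc hu; have [N1 hN1] := tube_dom; have [N2 [M hN2]] := tube_lipschitz.
pose N := (N1 + N2)%N; pose m := N.+1.
have [p0 hp0] := near_K_wide uc hu (N + (M + m)).
have [G hG] := time_gap t12 ha hb.
have [M2 hM2] := mod_netD (represents_mod hr) (mod_net_cst rho 4).
(* the interval grows by 2 rho^p, which must be small against its length, at
   least rho^G, and against the inverse of the bound for phi *)
pose p := (p0 + (N + (M + m)) + (G + (M2 + m.+1)))%N.
have [l0 l1 l2] : [/\ (p0 <= p)%N, (N + (M + m) <= p)%N & (G + (M2 + m.+1) <= p)%N].
  by rewrite /p; split; lia.
have lN : (N <= p)%N := leq_trans (leq_addr _ _) l1.
have lM : (M + m <= p)%N := leq_trans (leq_addl _ _) l1.
have lM' : (M + m <= N + (M + m))%N by rewrite leq_addl.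
have lG : (G.+1 <= p)%N by apply: leq_trans l2; rewrite -addn1 leq_add2l addnS.
have hp := hp0 p l0.
exists p, N; near=> e.
have re : 0 < rho e <= 1 by near: e; apply: gauge_near.
have ab : a e < b e by near: e; apply: near_time t12 ha hb.
have T0 : 0 < b e - a e by rewrite subr_gt0.
have r0 : 0 < r e by near: e; apply: near_r.
have k1 : forall k0 x, Kc e k0 -> tube (rho e ^+ N1) e k0 x ->
  [/\ Omf e x, forall i j, `|pderive [:: i] (vcomp (fe e) j) x| <= rho e ^- N1 &
      (b e - a e) * opnorm (phi_q e x) <= 8^-1] by near: e.
have k2 : forall k0 t q k t' q' k', Kc e k0 ->
  tube (rho e ^+ N2) e k0 (pack3 t q k) -> tube (rho e ^+ N2) e k0 (pack3 t' q' k') ->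
  (b e - a e) * enorm (fe e (pack3 t' q' k') - fe e (pack3 t q k)) <=
    enorm (q' - q) / 8 + rho e ^- M * (`|t' - t| + `|k' - k|) by near: e.
have k3 : forall t, wide p e t ->
    Omu e (const_mx t) /\ exists2 k0, Kc e k0 & `|ue e t - k0| <= rho e ^+ (N + (M + m)) by near: e.
have kG : a e + rho e ^+ G <= b e by near: e.
have kM2 : `|r e + 4| <= rho e ^- M2 by near: e.
have kMK : forall x, core_net e x -> (b e - a e) * enorm (fe e x) <= r e + rho e ^+ m.
  by near: e; apply: phi_MK.
have h8 : 8 * rho e ^+ m <= rho e ^+ N by near: e; apply: near_rhoX.
have h2 : 2 * rho e ^+ m.+1 <= rho e ^+ m by near: e; apply: near_rhoX.
have h2G : 2 * rho e ^+ G.+1 <= rho e ^+ G by near: e; apply: near_rhoX.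
have rm0 := rho_exp_gt0 m re; have rN0 := rho_exp_gt0 N re.
have rNle : rho e ^+ N <= 1 by rewrite -(expr0 (rho e)); apply: rho_expM.
have pT : 2 * rho e ^+ p <= b e - a e.
  have := rho_expM re lG; lra.
have tb k0 t q k n : (n <= N)%N -> wide p e t -> enorm (q - q1 e) <= r e + rho e ^+ N ->
    `|k - k0| <= rho e ^+ (N + (M + m)) -> tube (rho e ^+ n) e k0 (pack3 t q k).
  move=> nN tw qb kk; have rn := rho_expM re nN; rewrite tube_pack3; split.
  - exact: wide_le re (leq_trans nN lN) tw.
  - by apply: (le_trans qb); rewrite lerD2l.
  - apply: (le_trans kk); apply: rho_expM => //; exact: leq_trans nN (leq_addr _ _).
have n1 : (N1 <= N)%N by rewrite leq_addr.
have n2 : (N2 <= N)%N by rewrite leq_addl.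
split; first by move=> t /k3[].
split.
- move=> t q tw qb; have [_ [k0 Kk0 hk0]] := k3 t tw.
  by have [] := k1 k0 _ Kk0 (tb _ _ _ _ _ n1 tw qb hk0).
- move=> t q tw qb; have [_ [k0 Kk0 hk0]] := k3 t tw.
  have [q' [q'b qq']] := retract_ball (q1 e) q (ltW r0).
  have cab := clamp_itv t (ltW ab).
  have q'b' : enorm (q' - q1 e) <= r e + rho e ^+ N by apply: (le_trans q'b); rewrite lerDl ltW.
  have cw : wide p e (clamp (a e) (b e) t) by apply: itv_widen => //; apply: rho_exp_gt0.
  have tube1 := tb _ _ _ _ _ n2 tw qb hk0.
  have tube2 : tube (rho e ^+ N2) e k0 (pack3 (clamp (a e) (b e) t) q' k0).
    by apply: tb => //; rewrite subrr normr0 rho_exp_ge0.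
  have c2 : core_net e (pack3 (clamp (a e) (b e) t) q' k0) by rewrite /core_net /= unc3_pack3.
  have j1 := k2 _ _ _ _ _ _ _ Kk0 tube2 tube1; have j2 := kMK _ c2.
  have tc : `|t - clamp (a e) (b e) t| <= rho e ^+ (M + m).
    exact: clamp_wide (ltW ab) (wide_le re lM tw) (rho_exp_ge0 _ re).
  have j3 : rho e ^- M * (`|t - clamp (a e) (b e) t| + `|ue e t - k0|) <= 2 * rho e ^+ m.
    apply: (@le_trans _ _ (rho e ^- M * (2 * rho e ^+ (M + m)))); last by rewrite mulrCA rho_expVMX.
    rewrite ler_wpM2l ?invr_ge0 ?rho_exp_ge0// mulr_natl mulr2n lerD//.
    by apply: (le_trans hk0); apply: rho_expM.
  have j4 : enorm (q - q') <= rho e ^+ N.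
    by apply: (le_trans qq'); rewrite ge_max (ltW rN0)/= lerBlDl.
  have j5 := ler_wpM2l (ltW T0) (enormBD (fe e (pack3 t q (ue e t))) (fe e (pack3 (clamp (a e) (b e) t) q' k0)) 0).
  rewrite !subr0 in j5.
  have j6 : (b e - a e) * enorm (fe e (pack3 t q (ue e t)) - fe e (pack3 (clamp (a e) (b e) t) q' k0)) <=
     rho e ^+ N / 8 + rho e ^- M * (`|t - clamp (a e) (b e) t| + `|ue e t - k0|).
    by apply: (le_trans j1); rewrite lerD2r ler_wpM2r// invr_ge0.
  have j7 := arith_rhs j5 j2 j6 j3.
  apply: (arith_rhs2 j7 _ h8 (ltW rm0)).
  set F := enorm _ in j7 *; have F0 : 0 <= F by apply: enorm_ge0.
  have j8 : rho e ^+ G * F <= rho e ^- M2.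
    apply: (@le_trans _ _ ((b e - a e) * F)); first by rewrite ler_wpM2r// lerBrDl.
    apply: (le_trans j7); apply: le_trans kM2; apply: le_trans (ler_norm _); exact: arith_r4 h8 rNle.
  apply: le_trans h2; rewrite -mulrA ler_wpM2l//.
  apply: (@le_trans _ _ (rho e ^+ (G + (M2 + m.+1)) * F)); first by rewrite ler_wpM2r// rho_expM.
  rewrite exprD mulrAC exprD; apply: (@le_trans _ _ (rho e ^- M2 * (rho e ^+ M2 * rho e ^+ m.+1))).
    by rewrite ler_wpM2r// mulr_ge0 ?rho_exp_ge0.
  by rewrite -exprD rho_expVMX.
- move=> t q q' tw qb qb'; have [_ [k0 Kk0 hk0]] := k3 t tw.
  have := k2 _ _ _ _ _ _ _ Kk0 (tb _ _ _ _ _ n2 tw qb' hk0) (tb _ _ _ _ _ n2 tw qb hk0).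
  rewrite !subrr !normr0 addr0 mulr0 addr0 => h.
  exact: arith_rhs3 h (enorm_ge0 _) pT (enorm_ge0 _).
- move=> t q tw qb; have [_ [k0 Kk0 hk0]] := k3 t tw.
  have [_ _ h] := k1 k0 _ Kk0 (tb _ _ _ _ _ n1 tw qb hk0).
  rewrite -[leRHS]mul1r; apply: arith_rhs3 (opnorm_ge0 _) pT _ => //.
  by rewrite mul1r.
Unshelve. all: by end_near. Qed.

Lemma gcball_limit qe : (forall n, \near0 e, enorm (qe e - q1 e) <= r e + rho e ^+ n) ->
  exists2 q, gcball (cq1 P) (cr P) q & vrepresents qe q.
Proof.
move=> h; have mq : mod_net rho (fun e => `|qe e|).
  apply: (mod_net_le (mod_netD (vrepresents_mod hq1) (mod_netD (represents_mod hr) (mod_net_cst rho 1)))).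
  near=> e; rewrite normr_id -(subrK (q1 e) (qe e)) addrC; apply: (le_trans (ler_normD _ _)).
  apply: le_trans (ler_norm _); rewrite lerD2l; apply: (le_trans (norm_le_enorm _)).
  by near: e; exact: (h 0%N).
have [q hq] := mod_vrepresents mq; exists q => //.
by apply/(gleP (represents_gnorm (vrepresentsB hq hq1)) hr).
Unshelve. all: by end_near. Qed.

(** A limit of nets within rho^n of the ball, for every n, lies in the ball and
    hence in H. *)
Lemma trajectory_net q Omq qe dqe : curvenet t1 t2 q Omq qe dqe ->
  (forall n, \near0 e, forall t, a e <= t <= b e -> enorm (qe e t - q1 e) <= r e + rho e ^+ n) ->
  trajectory P q.
Proof.
move=> hq hb'; have [_ _ _ qv _] := hq.
have qin t te : gitv t1 t2 t -> represents te t -> (\near0 e, a e <= te e <= b e) ->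
    forall n, \near0 e, enorm (qe e (te e) - q1 e) <= r e + rho e ^+ n.
  move=> tt ht tab n; near=> e.
  have h : forall t, a e <= t <= b e -> enorm (qe e t - q1 e) <= r e + rho e ^+ n by near: e.
  by apply: h; near: e.
split.
  apply: (curvenet_gcurve hq) => t tt; apply: (st_ball hP).
  have ht := gitv_clamp t12 ha hb tt (represents_rcnet t).
  have tab := near_clamp t12 ha hb (rcnet t).
  have [y yb hy] := gcball_limit (qin _ _ tt ht tab).
  by rewrite (vrepresents_inj (qv _ _ tt ht) hy).
apply: (gcnorm_le t12 hr); first by apply: filterS near_r => e /ltW.
move=> Om ge hg [|//] i t te _ tt ht p.
have hc := gitv_clamp t12 ha hb tt ht; have tab := near_clamp t12 ha hb te.
have h1 := qin _ _ tt hc tab p.+1.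
have ttm : titv t1 t2 (const_mx t) by rewrite /titv /= mxE.
have h2 := gsf_net_val hg ttm (vrepresents_const_mx ht).
have := vrepresents_negl h2; rewrite /oncurve mxE => /(_ _ (vrepresentsB (qv _ _ tt hc) hq1)) h3.
near=> e.
have k1 : enorm (qe e (clamp (a e) (b e) (te e)) - q1 e) <= r e + rho e ^+ p.+1 by near: e.
have k2 : `| `|ge e (const_mx (te e)) - (qe e (clamp (a e) (b e) (te e)) - q1 e)| | <= rho e ^+ p.+1.
  by near: e; apply: h3.
have k3 : 2 * rho e ^+ p.+1 <= rho e ^+ p by near: e; apply: near_rhoX.
rewrite normr_id in k2.
apply: (le_trans (coord_le_norm _ _)).
rewrite -(subrK (qe e (clamp (a e) (b e) (te e)) - q1 e) (ge e (const_mx (te e)))).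
apply: (le_trans (ler_normD _ _)).
have := norm_le_enorm (qe e (clamp (a e) (b e) (te e)) - q1 e); lra.
Unshelve. all: by end_near. Qed.

(** Picard iteration for each e yields a net of exact solutions; the estimate
    of approximate solutions then applies to it and puts its values into the
    ball, which is what smoothness of the composition with phi needs. *)
Lemma state_exists u : control P u -> exists q, state_solution P u q.
Proof.
move=> uc; have [Omu [ue [due hu]]] := gcurve_curvenet uc.
have [p [N hpN]] := state_contraction uc hu.
have [[oOu XOu] Su _ uv ud] := hu.
have dX3 := gsf_net_dom hf.
pose F e t q := fe e (pack3 t q (ue e t)).
have [|||| q hq] := @ode_solve R rho t1 t2 a b t12 ha hb d p F a (fun e => r e + rho e ^+ N) q1.
- near=> e; have re : 0 < rho e <= 1 by near: e; apply: gauge_near.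
  have ab : a e < b e by near: e; apply: near_time t12 ha hb.
  have r0 : 0 < r e by near: e; apply: near_r.
  by split; [apply: addr_ge0; [exact: ltW|exact: rho_exp_ge0]|rewrite lexx ltW].
- near=> e => x xc xb c cc cw j s.
  have e01 : 0 < e <= 1 by near: e; apply: near0_itv.
  have k1 : (forall t, wide p e t -> Omu e (const_mx t)) by near: e; apply: filterS hpN => e [].
  have k2 : forall t q, wide p e t -> enorm (q - q1 e) <= r e + rho e ^+ N -> Omf e (pack3 t q (ue e t)).
    by near: e; apply: filterS hpN => e [_ []].
  apply: (@continuous_comp _ _ _ (fun s => pack3 (c s) (x (c s)) (ue e (c s))) (fun y => fe e y 0 j)).
    apply: pack3_continuous => [|i|i]; first exact: cc.
      by apply: (@continuous_comp _ _ _ c (fun s => x s 0 i)); [exact: cc|exact: xc].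
    apply: (@continuous_comp _ _ _ c (fun s => ue e s 0 i)); first exact: cc.
    exact: is_derive_cts (ud _ _ i e01 (k1 _ (cw s))).
  exact: (Cnet_cts (gsf_net_Snet hf [::] j 0%N) e01 (k2 _ _ (cw s) (xb _))).
- by apply: filterS hpN => e [_ []].
- by apply: filterS hpN => e [_ []].
pose dq e t := F e t (q e t).
pose good e := [/\ forall t, enorm (q e t - q1 e) <= r e + rho e ^+ N,
    forall t, a e - rho e ^+ p < t < b e + rho e ^+ p ->
      forall j, is_derive t 1 (fun u => q e u 0 j) (dq e t 0 j) &
    (forall t, wide p e t -> Omu e (const_mx t)) /\
    forall t q, wide p e t -> enorm (q - q1 e) <= r e + rho e ^+ N -> Omf e (pack3 t q (ue e t))].
have gn : \near0 e, good e.
  by apply: filterS2 hq hpN => e [_ h1 _ h2] [h3 [h4 _ _ _]].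
have dX := @time_interval_dom R rho t1 t2 a b p good t12 ha hb gn.
set Om := (fun e => _) in dX.
have uK := control_near_K uc hu.
have qd e t j : 0 < e <= 1 -> Om e (const_mx t) -> is_derive t 1 (fun s => q e s 0 j) (dq e t 0 j).
  by move=> e01 [[_ h _]]; rewrite mxE => /h; apply.
have sn : state_net ue q dq.
  split.
  - near=> e => t tab j.
    have re : 0 < rho e <= 1 by near: e; apply: gauge_near.
    have rp := rho_exp_gt0 p re; have [_ h _] : good e by near: e.
    by apply: h; move/andP: tab => [? ?]; apply/andP; split; lra.
  - apply: (negl_le (negl0 rho)); near=> e.
    have -> : q e (a e) = q1 e by near: e; apply: filterS hq => e [].
    by rewrite subrr enorm0 normr0.
  - move=> n; near=> e => t _; rewrite subrr enorm0 rho_exp_ge0//; near: e; exact: gauge_near.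
have sb := state_bound uK sn.
have qrep t te : gitv t1 t2 t -> represents te t ->
    exists2 y, gcball (cq1 P) (cr P) y & vrepresents (fun e => q e (te e)) y.
  move=> tt ht; have hc := gitv_clamp t12 ha hb tt ht; have tab := near_clamp t12 ha hb te.
  have [n|y yb hy] := @gcball_limit (fun e => q e (clamp (a e) (b e) (te e))).
    near=> e; have h : forall t, a e <= t <= b e -> enorm (q e t - q1 e) <= r e + rho e ^+ n by near: e; apply: sb.
    by apply: h; near: e.
  exists y => //; apply: (vrepresents_congr hy).
  have [G hG] := time_gap t12 ha hb.
  have ms : mod_net rho (fun e => r e + rho e ^+ N) := mod_netD (represents_mod hr) (mod_net_rhoX rho N).
  apply: (negl_le (neglM (mod_netM (mod_net_rho rho G) ms) (represents_negl ht hc))).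
  near=> e; rewrite normr_id; apply: (le_trans (norm_le_enorm _)).
  have re : 0 < rho e <= 1 by near: e; apply: gauge_near.
  have h : forall t t', (b e - a e) * enorm (q e t - q e t') <= (r e + rho e ^+ N) * `|t - t'|.
    by near: e; apply: filterS hq => e [].
  have kG : a e + rho e ^+ G <= b e by near: e.
  rewrite -mulrA normrM ger0_norm ?invr_ge0 ?rho_exp_ge0// ler_pdivlMl ?rho_exp_gt0//.
  apply: (@le_trans _ _ ((b e - a e) * enorm (q e (te e) - q e (clamp (a e) (b e) (te e))))).
    by rewrite ler_wpM2r ?enorm_ge0// lerBrDl.
  by apply: (le_trans (h _ _)); rewrite normrM ler_wpM2r// ler_norm.
have [f hfc] : exists f, curvenet t1 t2 f Om q dq.
  apply: ode_smooth => // [t te tt ht|k Ck j].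
    by have [y _ hy] := qrep t te tt ht; apply: vrepresents_mod hy.
  apply: (@Cnet_comp R rho 1 _ (titv t1 t2) Om (dom3 P) Omf k (fun e x => vcomp (fe e) j x)
    (fun e x => pack3 (x 0 0) (q e (x 0 0)) (ue e (x 0 0))) dX3).
  - move=> e x e01 [[h1 _ [_ h2]] /andP[w1 w2]]; apply: h2 => //; apply/andP; split; exact: ltW.
  - move=> x xe tx hx; have [y yb hy] := qrep _ _ tx (hx 0).
    exists (pack3 (x 0 0) y (u (x 0 0))); last exact: vrepresents_pack3 (hx 0) hy (uv _ _ tx (hx 0)).
    apply: dom3_pack3 => //; first exact: (st_ball hP).
    by have [+ _] := uc; apply.
  - exact: gsf_net_Snet hf [::] j k.
  - apply: Cnet_pack3 => // [|i]; first exact: Cnet_coord.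
    apply: Snet_sub dX _ (Su i k) => e x [[_ _ [h _]] /andP[w1 w2]].
    by rewrite [x]row1E; apply: h; apply/andP; split; exact: ltW.
exists f; have [_ _ _ fv _] := hfc.
have ft := trajectory_net hfc sb; split => //.
- move=> t tt; have ht := represents_rcnet t.
  apply: (vrepresents_inj (curvenet_gdot t12 ha hb hfc tt ht)).
  apply: (cphi_rep uc hu hfc) => //.
  have := ft.1.1 (const_mx t); rewrite /oncurve mxE; apply; by rewrite /titv /= mxE.
- have tt1 : gitv t1 t2 t1.
    split; last exact: glt_gle.
    by apply/(gleP ha ha) => n; near=> e; rewrite lerDl rho_exp_ge0//; near: e; apply: gauge_near.
  apply: (vrepresents_inj (fv _ _ tt1 ha)); apply: (vrepresents_congr hq1).
  apply: (negl_le (negl0 rho)); near=> e.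
  have -> : q e (a e) = q1 e by near: e; apply: filterS hq => e [].
  by rewrite subrr !normr0.
Unshelve. all: by end_near. Qed.

(** * The Hamiltonian *)

Variables (OmL : R -> set 'rV[R]_(1 + d + l)) (Le : R -> 'rV[R]_(1 + d + l) -> 'rV[R]_1).
Hypothesis hL : gsf_net (dom3 P) (fun x => const_mx (unc3 (cL P) x) : 'rV_1) OmL Le.

Definition Om4 e : set 'rV[R]_(1 + d + l + d) :=
  [set x | setT x /\ (OmL e `&` Omf e) (lsubmx x)].

Definition ham e (x : 'rV[R]_(1 + d + l + d)) : R :=
  vcomp (Le e) 0 (lsubmx x) + \sum_j x 0 (rshift (1 + d + l) j) * vcomp (fe e) j (lsubmx x).

Definition dham e i x := 'D_(delta_mx 0 i) (ham e) x.

Lemma netdom3 : netdom (dom3 P) (fun e => OmL e `&` Omf e).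
Proof. exact: netdomI (gsf_net_dom hL) (gsf_net_dom hf). Qed.

Lemma netdom4 : netdom (dom4 P) Om4.
Proof.
apply: (@netdom_preimage R rho _ _ (dom4 P) (fun=> setT) (dom3 P) (fun e => OmL e `&` Omf e)
  (fun _ x => lsubmx x) _ netdom3).
- by split => // [e _|x _ xe _]; [exact: openT|near=> e].
- move=> i; have -> : (fun (_ : R) (x : 'rV[R]_(1 + d + l + d)) => lsubmx x 0 i) =
      fun _ x => x 0 (lshift d i) by apply/funext => e; apply/funext => x; rewrite mxE.
  exact: Cnet_coord.
- by move=> x xe xX hx; exists (lsubmx x) => //; exact: vrepresents_lsubmx.
Unshelve. all: by end_near. Qed.

Lemma Snet_lsub g : Snet (dom3 P) (fun e => OmL e `&` Omf e) g ->
  Snet (dom4 P) Om4 (fun e x => g e (lsubmx x)).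
Proof.
move=> Sg k; apply: (@Cnet_comp R rho _ _ (dom4 P) Om4 (dom3 P) (fun e => OmL e `&` Omf e)
  k g (fun _ x => lsubmx x) netdom3) => //.
- by move=> e x _ [].
- by move=> x xe xX hx; exists (lsubmx x) => //; exact: vrepresents_lsubmx.
- by move=> i; under eq_fun do under eq_fun do rewrite mxE; exact: Cnet_coord.
Qed.

Lemma Snet_L s : Snet (dom3 P) (fun e => OmL e `&` Omf e) (fun e => pderive s (vcomp (Le e) 0)).
Proof. by move=> k; apply: Snet_sub netdom3 _ (gsf_net_Snet hL s 0 k) => e x []. Qed.

Lemma Snet_phi s j : Snet (dom3 P) (fun e => OmL e `&` Omf e) (fun e => pderive s (vcomp (fe e) j)).
Proof. by move=> k; apply: Snet_sub netdom3 _ (gsf_net_Snet hf s j k) => e x []. Qed.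

Lemma ham_Snet : Snet (dom4 P) Om4 ham.
Proof.
move=> k; apply: CnetD; first exact: Snet_lsub (Snet_L [::]) k.
apply: Cnet_sum => j; apply: CnetM; first exact: Cnet_coord.
exact: Snet_lsub (Snet_phi [::] j) k.
Qed.

Lemma dham_Snet i : Snet (dom4 P) Om4 (fun e => dham e i).
Proof. exact: (Snet_D netdom4 ham_Snet i).1. Qed.

Lemma ham_derive e x i : 0 < e <= 1 -> Om4 e x -> is_derive x (delta_mx 0 i) (ham e) (dham e i x).
Proof. exact: (Snet_D netdom4 ham_Snet i).2. Qed.

Lemma ham_gsf_net : gsf_net (dom4 P) (fun x => const_mx (unc4 (hamiltonian P) x) : 'rV_1) Om4
  (fun e x => const_mx (ham e x)).
Proof.
apply: Snet_gsf_net => [||x xe xX hx]; first exact: netdom4.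
  by move=> j k; rewrite /vcomp; under eq_fun do under eq_fun do rewrite mxE; exact: ham_Snet.
apply: vrepresents_const_mx; rewrite /unc4 /hamiltonian /unc3.
have hx3 := vrepresents_lsubmx hx.
apply: representsD.
  by have := gsf_net_val hL xX hx3 0; rewrite mxE.
rewrite mxE; apply: represents_sum => j; apply: representsM.
  by rewrite mxE; exact: hx.
by rewrite mxE; exact: (gsf_net_val hf xX hx3 j).
Qed.

Lemma dham_lshift e i x : 0 < e <= 1 -> Om4 e x -> dham e (lshift d i) x =
  pderive [:: i] (vcomp (Le e) 0) (lsubmx x) +
  \sum_j x 0 (rshift (1 + d + l) j) * pderive [:: i] (vcomp (fe e) j) (lsubmx x).
Proof.
move=> e01 Ox; have [_ Olf] := Ox; rewrite /dham; apply/derive_val.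
apply: is_deriveD.
  by apply: is_derive_lsub; apply: (Snet_D netdom3 (Snet_L [::]) i).2.
apply: is_derive_sumr => j.
have h1 := is_derive_coord x (delta_mx 0 (lshift d i)) (rshift (1 + d + l) j).
have h2 := is_derive_lsub ((Snet_D netdom3 (Snet_phi [::] j) i).2 e (lsubmx x) e01 Olf).
have := is_deriveM h1 h2; rewrite mxE /= eq_rlshift scaler0 addr0.
exact.
Qed.

Lemma dham_rshift e j x : 0 < e <= 1 -> Om4 e x -> dham e (rshift (1 + d + l) j) x = fe e (lsubmx x) 0 j.
Proof.
move=> e01 Ox; rewrite /dham; apply/derive_val.
rewrite -[fe e _ 0 j]add0r; apply: is_deriveD; first exact: is_derive_lsub0.
have -> : fe e (lsubmx x) 0 j = \sum_k (if k == j then vcomp (fe e) k (lsubmx x) else 0).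
  by rewrite -big_mkcond big_pred1_eq.
apply: is_derive_sumr => k.
have h1 := is_derive_coord x (delta_mx 0 (rshift (1 + d + l) j)) (rshift (1 + d + l) k).
have := is_deriveM h1 (is_derive_lsub0 (vcomp (fe e) k) x j).
rewrite scaler0 add0r mxE /= eq_rshift.
by case: (k == j); rewrite ?scaler1 ?scaler0.
Qed.

Lemma dham_rep t q k p i xe : dom4 P (pack4 t q k p) -> vrepresents xe (pack4 t q k p) ->
  represents (fun e => dham e i (xe e)) (spderiv (dom4 P) (unc4 (hamiltonian P)) i (pack4 t q k p)).
Proof.
move=> D4 hx; have := gderivE [:: i] 0 fat_dom4 ham_gsf_net D4 hx.
have -> : (fun e => pderive [:: i] (vcomp (fun x => const_mx (ham e x) : 'rV[R]_1) 0) (xe e)) =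
    fun e => dham e i (xe e); last by [].
apply/funext => e; rewrite /= /dham; congr ('D__ _ _).
by apply/funext => x; rewrite /vcomp mxE.
Qed.

Lemma dH_dp_phi t q k p : gitv t1 t2 t -> cH P q -> cK P k -> dH_dp P t q k p = cphi P t q k.
Proof.
move=> tt Hq Kk; have D4 := dom4_pack4 p tt Hq Kk; have D3 := dom3_pack3 tt Hq Kk.
apply/rowP => j; rewrite mxE.
have hx := vrepresents_vnet (pack4 t q k p).
have hx3 : vrepresents (fun e => lsubmx (vnet (pack4 t q k p) e)) (pack3 t q k).
  by have := vrepresents_lsubmx hx; rewrite row_mxKl.
apply: (represents_inj (dham_rep _ D4 hx)).
have := gsf_net_val hf D3 hx3 j; rewrite unc3_pack3 => h.
apply: (represents_congr h); apply: (negl_le (negl0 rho)); near=> e.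
rewrite dham_rshift ?subrr ?normr0//; first by near: e; apply: near0_itv.
by near: e; apply: (netdom4.2 _ D4 _ hx).
Unshelve. all: by end_near. Qed.

(** * The adjoint equation *)

Definition dir4_q i : 'I_(1 + d + l + d) := lshift d (dir_q i).
Definition dir4_u i : 'I_(1 + d + l + d) := lshift d (dir_u i).

Lemma dham_q e t q k p i : 0 < e <= 1 -> (OmL e `&` Omf e) (pack3 t q k) ->
  dham e (dir4_q i) (pack4 t q k p) =
  pderive [:: dir_q i] (vcomp (Le e) 0) (pack3 t q k) + (p *m (phi_q e (pack3 t q k))^T) 0 i.
Proof.
move=> e01 O3; rewrite dham_lshift//; last by split; rewrite // row_mxKl.
rewrite row_mxKl; congr (_ + _); rewrite mxE; apply: eq_bigr => j _.
by rewrite /pack4 row_mxEr !mxE.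
Qed.

Section Along.
Variables (u : rc -> 'rV[rc]_l) (q : rc -> 'rV[rc]_d).
Variables (Omu Omq : R -> set 'rV[R]_1) (ue due : R -> R -> 'rV[R]_l) (qe dqe : R -> R -> 'rV[R]_d).
Hypotheses (uc : control P u) (hu : curvenet t1 t2 u Omu ue due).
Hypotheses (sq : state_solution P u q) (hq : curvenet t1 t2 q Omq qe dqe).

Let x3 e t := pack3 t (qe e t) (ue e t).

Lemma solution_bound n : \near0 e, forall t, a e <= t <= b e -> enorm (qe e t - q1 e) <= r e + rho e ^+ n.
Proof. exact: state_bound (control_near_K uc hu) (state_solution_net uc hu sq hq) n. Qed.

Lemma curve_dom3 t te : gitv t1 t2 t -> represents te t ->
  dom3 P (pack3 t (q t) (u t)) /\ vrepresents (fun e => x3 e (te e)) (pack3 t (q t) (u t)).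
Proof.
move=> tt ht; have [uK _] := uc; have [[[qH _] _] _ _] := sq.
have ttm : titv t1 t2 (const_mx t) by rewrite /titv /= mxE.
have := uK _ ttm; have := qH _ ttm; rewrite /oncurve mxE => qt ut.
have [_ _ _ uv _] := hu; have [_ _ _ qv _] := hq.
by split; [exact: dom3_pack3|exact: vrepresents_pack3 ht (qv _ _ tt ht) (uv _ _ tt ht)].
Qed.

Lemma Cnet_curve Om k : netdom (titv t1 t2) Om -> (forall e, Om e `<=` Omq e `&` Omu e) ->
  forall i, Cnet (titv t1 t2) Om k (fun e x => x3 e (x 0 0) 0 i).
Proof.
move=> dX OO; have [_ Su _ _ _] := hu; have [_ Sq _ _ _] := hq.
apply: Cnet_pack3 => [|i|i]; first exact: Cnet_coord.
  by apply: Snet_sub dX _ (Sq i k) => e x /OO[].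
by apply: Snet_sub dX _ (Su i k) => e x /OO[].
Qed.

Definition Om_along e : set 'rV[R]_1 :=
  [set x | (Omq e `&` Omu e) x /\ (OmL e `&` Omf e) (x3 e (x 0 0))].

Lemma netdom_along : netdom (titv t1 t2) Om_along.
Proof.
have dX : netdom (titv t1 t2) (fun e => Omq e `&` Omu e).
  by have [h1 _ _ _ _] := hu; have [h2 _ _ _ _] := hq; exact: netdomI.
apply: (netdom_preimage (G := fun e x => x3 e (x 0 0)) dX netdom3) => [i|x xe tx hx].
  exact: (Cnet_curve 0 dX (fun e x h => h)).
have [h1 h2] := curve_dom3 tx (hx 0).
by exists (pack3 (x 0 0) (q (x 0 0)) (u (x 0 0))).
Qed.

Lemma Snet_along g : Snet (dom3 P) (fun e => OmL e `&` Omf e) g ->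
  Snet (titv t1 t2) Om_along (fun e x => g e (x3 e (x 0 0))).
Proof.
move=> Sg k; apply: (@Cnet_comp R rho _ _ (titv t1 t2) Om_along (dom3 P) (fun e => OmL e `&` Omf e)
  k g (fun e x => x3 e (x 0 0)) netdom3) => //.
- by move=> e x _ [].
- move=> x xe tx hx; have [h1 h2] := curve_dom3 tx (hx 0).
  by exists (pack3 (x 0 0) (q (x 0 0)) (u (x 0 0))).
- by apply: Cnet_curve => [|e x []]; first exact: netdom_along.
Qed.

Lemma solution_wide N : exists p0, \near0 e, forall t, wide p0 e t -> enorm (qe e t - q1 e) <= r e + rho e ^+ N.
Proof.
have [M hM] := curvenet_lipschitz t12 ha hb hq; have qb := solution_bound N.+1.
exists (M + N.+1)%N; near=> e => t tw.
have re : 0 < rho e <= 1 by near: e; apply: gauge_near.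
have ab : a e < b e by near: e; apply: near_time t12 ha hb.
have k1 : forall s t, wide M e s -> wide M e t -> enorm (qe e t - qe e s) <= rho e ^- M * `|t - s| by near: e.
have k2 : forall t, a e <= t <= b e -> enorm (qe e t - q1 e) <= r e + rho e ^+ N.+1 by near: e.
have k3 : 2 * rho e ^+ N.+1 <= rho e ^+ N by near: e; apply: near_rhoX.
have cab := clamp_itv t (ltW ab).
have cw : wide M e (clamp (a e) (b e) t) by apply: itv_widen => //; apply: rho_exp_gt0.
have tM : wide M e t := wide_le re (leq_addr _ _) tw.
have tc := clamp_wide (ltW ab) tw (rho_exp_ge0 _ re).
have h1 : enorm (qe e t - qe e (clamp (a e) (b e) t)) <= rho e ^+ N.+1.
  apply: (le_trans (k1 _ _ cw tM)).
  by rewrite -(rho_expVMX M N.+1 re) ler_wpM2l// invr_ge0 rho_exp_ge0.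
have := enormBD (qe e t) (qe e (clamp (a e) (b e) t)) (q1 e); have := k2 _ cab.
by move=> h2 h3; exact: arith_wide h2 h3 h1 k3.
Unshelve. all: by end_near. Qed.

Definition contracting p S e := forall t, wide p e t ->
  [/\ Om_along e (const_mx t),
    (b e - a e + 2 * rho e ^+ p) * enorm (\row_i pderive [:: dir_q i] (vcomp (Le e) 0) (x3 e t)) <= rho e ^- S &
    (b e - a e + 2 * rho e ^+ p) * opnorm (phi_q e (x3 e t)) <= 2^-1].

(** On a slightly larger interval the adjoint equation is defined, has a
    moderate inhomogeneity, and is a contraction. *)
Lemma adjoint_contraction : exists p S, \near0 e, contracting p S e.
Proof.
have [N1 h1] := time_dom t12 ha hb netdom_along.
have [p2 [N h2]] := state_contraction uc hu.
have [p3 h3] := solution_wide N.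
have [S h4] : exists N, \near0 e, forall (i : 'I_d), forall t, wide N e t ->
    `|pderive [:: dir_q i] (vcomp (Le e) 0) (x3 e t)| <= rho e ^- N.
  apply: (@near0_forall_exp R rho) => [M M' e i re MM h t tw|i].
    apply: (le_trans (h t (wide_le re MM tw))); exact: rho_expVM.
  have [M hM] := time_bound t12 ha hb (Cnet_mod (Snet_along (Snet_L [:: dir_q i]) 0)).
  exists M; near=> e => t tw.
  have k : forall t, wide M e t -> `|pderive [:: dir_q i] (vcomp (Le e) 0) (x3 e ((const_mx t : 'rV[R]_1) 0 0))| <= rho e ^- M by near: e.
  by have := k t tw; rewrite mxE.
pose p := (N1 + p2 + p3 + S)%N.
have [l1 l2 l3 l4] : [/\ (N1 <= p)%N, (p2 <= p)%N, (p3 <= p)%N & (S <= p)%N] by rewrite /p; split; lia.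
have [S' hS'] := mod_netM (mod_netD mod_T (mod_net_cst rho 2)) (mod_netM (mod_net_cst rho d%:R) (mod_net_rho rho S)).
exists p, S'; near=> e => t tw.
have re : 0 < rho e <= 1 by near: e; apply: gauge_near.
have ab : a e < b e by near: e; apply: near_time t12 ha hb.
have T0 : 0 < b e - a e by rewrite subr_gt0.
have k1 : forall t, wide N1 e t -> Om_along e (const_mx t) by near: e.
have k2 : forall t q, wide p2 e t -> enorm (q - q1 e) <= r e + rho e ^+ N ->
        (b e - a e + 2 * rho e ^+ p2) * opnorm (phi_q e (pack3 t q (ue e t))) <= 2^-1.
  by near: e; apply: filterS h2 => e [_ []].
have k3 : forall t, wide p3 e t -> enorm (qe e t - q1 e) <= r e + rho e ^+ N by near: e.
have k4 : forall (i : 'I_d), forall t, wide S e t ->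
    `|pderive [:: dir_q i] (vcomp (Le e) 0) (x3 e t)| <= rho e ^- S by near: e.
have k5 : `|(b e - a e + 2) * (d%:R * rho e ^- S)| <= rho e ^- S' by near: e.
have rp1 : rho e ^+ p <= 1 by rewrite -(expr0 (rho e)); apply: rho_expM.
have rp2 := rho_expM re l2.
have rp0 := rho_exp_gt0 p re.
split; first exact: k1 (wide_le re l1 tw).
  apply: le_trans k5; apply: le_trans (ler_norm _).
  have T0' : 0 <= b e - a e + 2 * rho e ^+ p by apply: addr_ge0; [exact: ltW|apply: mulr_ge0 => //; exact: ltW].
  apply: ler_pM; rewrite ?enorm_ge0//.
    by rewrite lerD2l ler_piMr.
  apply: (le_trans (enorm_le_norm _)); rewrite ler_wpM2l//.
  apply: norm_le_coord => [|i]; first by rewrite invr_ge0 rho_exp_ge0.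
  by rewrite mxE; apply: k4; apply: wide_le re l4 tw.
have := k2 t (qe e t) (wide_le re l2 tw) (k3 t (wide_le re l3 tw)).
apply: le_trans; rewrite ler_wpM2r ?opnorm_ge0//.
by rewrite lerD2l ler_wpM2l.
Unshelve. all: by end_near. Qed.

Definition adjoint_rhs e t p : 'rV[R]_d := - \row_i dham e (dir4_q i) (pack4 t (qe e t) (ue e t) p).

(** The adjoint equation is affine in p and its linear part is the transpose of
    phi_q. *)
Lemma adjoint_rhsE e t p : 0 < e <= 1 -> Om_along e (const_mx t) ->
  adjoint_rhs e t p = - (\row_i pderive [:: dir_q i] (vcomp (Le e) 0) (x3 e t)) - p *m (phi_q e (x3 e t))^T.
Proof.
move=> e01 [_]; rewrite mxE => O3; apply/rowP => i; rewrite !mxE dham_q//.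
by rewrite opprD; congr (_ - _); rewrite mxE.
Qed.

Definition adjoint_at p := [/\ gcurve t1 t2 setT p,
  forall t, gitv t1 t2 t -> gdot t1 t2 p t = - dH_dq P t (q t) (u t) (p t) & p t2 = 0].

Lemma gitv_t2 : gitv t1 t2 t2.
Proof.
split; first exact: glt_gle.
by apply/(gleP hb hb) => n; near=> e; rewrite lerDl rho_exp_ge0//; near: e; apply: gauge_near.
Unshelve. all: by end_near. Qed.

Lemma dH_dq_rep t te p pe : gitv t1 t2 t -> represents te t -> vrepresents pe p ->
  vrepresents (fun e => adjoint_rhs e (te e) (pe e)) (- dH_dq P t (q t) (u t) p).
Proof.
move=> tt ht hp i; have [h1 h2] := curve_dom3 tt ht.
rewrite !mxE; under eq_fun do rewrite !mxE; apply: representsN.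
apply: dham_rep; first by rewrite /dom4 /= row_mxKl.
exact: vrepresents_row_mx.
Qed.

Lemma adjoint_exists : exists p, adjoint_at p.
Proof.
have [p [S hpS]] := adjoint_contraction.
(* half of the ball of radius s absorbs the inhomogeneity, the other half the
   linear part *)
pose S' := S.+1; pose s e := rho e ^- S'.
have [|||| pe hpe] := @ode_solve R rho t1 t2 a b t12 ha hb d p adjoint_rhs b s (fun=> 0).
- near=> e; have re : 0 < rho e <= 1 by near: e; apply: gauge_near.
  have ab : a e < b e by near: e; apply: near_time t12 ha hb.
  by split; [rewrite invr_ge0 rho_exp_ge0|rewrite lexx ltW].
- near=> e => x xc xb c cc cw j t.
  have e01 : 0 < e <= 1 by near: e; apply: near0_itv.
  have [[qc' ucc] O3] : Om_along e (const_mx (c t)).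
    have h : forall t, wide p e t -> Om_along e (const_mx t) by near: e; apply: filterS hpS => e h t /h[].
    exact: (h _ (cw t)).
  rewrite mxE in O3.
  have [_ _ _ _ qd] := hq; have [_ _ _ _ ud] := hu.
  rewrite (_ : (fun t => _) = fun t => - dham e (dir4_q j) (pack4 (c t) (qe e (c t)) (ue e (c t)) (x (c t)))); last first.
    by apply/funext => t'; rewrite !mxE.
  apply: cvgN.
  apply: (@continuous_comp _ _ _ (fun t => pack4 (c t) (qe e (c t)) (ue e (c t)) (x (c t))) (fun y => dham e (dir4_q j) y)).
    apply: row_continuous => i; rewrite /pack4; case: (split_ordP i) => i' ->.
      rewrite (_ : (fun s => _) = fun s => pack3 (c s) (qe e (c s)) (ue e (c s)) 0 i'); last first.
        by apply/funext => t'; rewrite row_mxEl.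
      apply: (@continuous_comp _ _ _ (fun s => pack3 (c s) (qe e (c s)) (ue e (c s))) (fun y : 'rV[R]_(1 + d + l) => y 0 i')).
        apply: pack3_continuous => [|k|k]; first exact: cc.
          apply: (@continuous_comp _ _ _ c (fun s => qe e s 0 k)); first exact: cc.
          exact: is_derive_cts (qd _ _ k e01 qc').
        apply: (@continuous_comp _ _ _ c (fun s => ue e s 0 k)); first exact: cc.
        exact: is_derive_cts (ud _ _ k e01 ucc).
      exact: coord_continuous.
    rewrite (_ : (fun s => _) = fun s => x (c s) 0 i'); last first.
      by apply/funext => t'; rewrite row_mxEr.
    by apply: (@continuous_comp _ _ _ c (fun s => x s 0 i')); [exact: cc|exact: xc].
  apply: (Cnet_cts (dham_Snet (dir4_q j) 0%N) e01); split => //.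
  by rewrite /pack4 row_mxKl.
- near=> e => t y tw; rewrite subr0 => ys.
  have e01 : 0 < e <= 1 by near: e; apply: near0_itv.
  have re : 0 < rho e <= 1 by near: e; apply: gauge_near.
  have ab : a e < b e by near: e; apply: near_time t12 ha hb.
  have T0 : 0 < b e - a e by rewrite subr_gt0.
  have rp0 := rho_exp_gt0 p re.
  have h : contracting p S e by near: e.
  have [h1 h2 h3] := h t tw.
  have T0' : 0 <= b e - a e + 2 * rho e ^+ p by apply: addr_ge0; [exact: ltW|apply: mulr_ge0 => //; exact: ltW].
  rewrite adjoint_rhsE//.
  apply: (le_trans (ler_wpM2l T0' (enormD _ _))); rewrite !enormN.
  have h4 := ler_wpM2l T0' (enorm_opnorm_tr y (phi_q e (x3 e t))).
  have h5 := ler_pM (mulr_ge0 T0' (opnorm_ge0 _)) (enorm_ge0 _) h3 ys.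
  have h6 : 2 * rho e ^- S <= s e.
    rewrite /s /S' exprS invfM; have r0 : 0 < rho e by case/andP: re.
    rewrite ler_wpM2r ?invr_ge0 ?rho_exp_ge0// -[leRHS]mul1r ler_pdivlMr//.
    by near: e; apply: near_rhoM.
  exact: arith_adj h2 h4 h5 (mulrA _ _ _) h6.
- near=> e => t y y' tw _ _.
  have e01 : 0 < e <= 1 by near: e; apply: near0_itv.
  have re : 0 < rho e <= 1 by near: e; apply: gauge_near.
  have ab : a e < b e by near: e; apply: near_time t12 ha hb.
  have T0 : 0 < b e - a e by rewrite subr_gt0.
  have rp0 := rho_exp_gt0 p re.
  have h : contracting p S e by near: e.
  have [h1 h2 h3] := h t tw.
  have T0' : 0 <= b e - a e + 2 * rho e ^+ p by apply: addr_ge0; [exact: ltW|apply: mulr_ge0 => //; exact: ltW].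
  have -> : adjoint_rhs e t y - adjoint_rhs e t y' = - ((y - y') *m (phi_q e (x3 e t))^T).
    rewrite !adjoint_rhsE// mulmxBl; move: (y *m _) (y' *m _) (\row_i _) => A B C.
    by apply/rowP => i; rewrite !mxE; ring.
  rewrite enormN.
  apply: (le_trans (ler_wpM2l T0' (enorm_opnorm_tr _ _))).
  by rewrite mulrA mulrC; apply: ler_wpM2l; rewrite ?enorm_ge0.
pose dp e t := adjoint_rhs e t (pe e t).
pose good e := [/\ forall t, enorm (pe e t) <= s e,
    forall t, a e - rho e ^+ p < t < b e + rho e ^+ p ->
      forall j, is_derive t 1 (fun u => pe e u 0 j) (dp e t 0 j) &
    (forall t, wide p e t -> Om_along e (const_mx t))].
have gn : \near0 e, good e.
  apply: filterS2 hpe hpS => e [_ h1 _ h2] h3; split => // [t|t /h3[]//].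
  by have := h1 t; rewrite subr0.
have dX := @time_interval_dom R rho t1 t2 a b p good t12 ha hb gn.
set Om := (fun e => _) in dX.
have OmA e : Om e `<=` Om_along e.
  by move=> x [[_ _ h] /andP[w1 w2]]; rewrite [x]row1E; apply: h; apply/andP; split; exact: ltW.
have prep t te : gitv t1 t2 t -> represents te t -> mod_net rho (fun e => `|pe e (te e)|).
  move=> tt ht; apply: (mod_net_le (mod_net_rho rho S')); near=> e.
  rewrite normr_id; apply: (le_trans (norm_le_enorm _)); apply: le_trans (ler_norm _).
  by have [h _ _] : good e by near: e.
have [f hfc] : exists f, curvenet t1 t2 f Om pe dp.
  apply: ode_smooth => // [e t j e01|k Ck j].
    by move=> [[_ h _]]; rewrite mxE => /h; apply.
  have -> : (fun e (x : 'rV[R]_1) => dp e (x 0 0) 0 j) =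
      fun e x => (-1) * dham e (dir4_q j) (pack4 (x 0 0) (qe e (x 0 0)) (ue e (x 0 0)) (pe e (x 0 0))).
    by apply/funext => e; apply/funext => x; rewrite !mxE mulN1r.
  apply: CnetM; first by apply: (@Cnet_cst R rho 1 _ Om k (fun=> -1)); exact: mod_net_cst.
  apply: (@Cnet_comp R rho 1 _ (titv t1 t2) Om (dom4 P) Om4 k (fun e x => dham e (dir4_q j) x)
    (fun e x => pack4 (x 0 0) (qe e (x 0 0)) (ue e (x 0 0)) (pe e (x 0 0))) netdom4).
  - by move=> e x e01 /OmA[_ h]; split => //; rewrite /pack4 row_mxKl.
  - move=> x xe tx hx; have [h1 h2] := curve_dom3 tx (hx 0).
    have [y hy] := mod_vrepresents (prep _ _ tx (hx 0)).
    exists (pack4 (x 0 0) (q (x 0 0)) (u (x 0 0)) y); first by rewrite /dom4 /= row_mxKl.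
    exact: vrepresents_row_mx.
  - exact: dham_Snet.
  - apply: Cnet_row_mx => // i; apply: Cnet_curve => // e x /OmA[]//.
exists f; have [_ _ _ fv _] := hfc; split.
- exact: curvenet_gcurve hfc _.
- move=> t tt; have ht := represents_rcnet t.
  apply: (vrepresents_inj (curvenet_gdot t12 ha hb hfc tt ht)).
  exact: dH_dq_rep tt ht (fv _ _ tt ht).
- apply: (vrepresents_inj (fv _ _ gitv_t2 hb)).
  have h0 : vrepresents (fun=> 0 : 'rV[R]_d) (0 : 'rV[rc]_d).
    by move=> i; rewrite !mxE; exact: represents0.
  apply: (vrepresents_congr h0); apply: (negl_le (negl0 rho)); near=> e.
  have -> : pe e (b e) = 0 by near: e; apply: filterS hpe => e [].
  by rewrite subrr !normr0.
Unshelve. all: by end_near. Qed.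

(** Time reversal turns the final value problem into an initial value problem,
    to which the barrier applies. *)
Lemma adjoint_unique p p' : adjoint_at p -> adjoint_at p' -> forall t, gitv t1 t2 t -> p t = p' t.
Proof.
move=> [pg pd p0] [pg' pd' p0'] t tt.
have [Omp [pe [dpe hp]]] := gcurve_curvenet pg.
have [Omp' [pe' [dpe' hp']]] := gcurve_curvenet pg'.
have [m [S hm]] := adjoint_contraction.
have [_ _ _ pv pdv] := hp; have [_ _ _ pv' pdv'] := hp'.
have [M hM] := curvenet_bound t12 ha hb hp; have [M' hM'] := curvenet_bound t12 ha hb hp'.
have pe_dh pp Omp0 pp0 dpp0 (hpp : curvenet t1 t2 pp Omp0 pp0 dpp0) :
    (forall t, gitv t1 t2 t -> gdot t1 t2 pp t = - dH_dq P t (q t) (u t) (pp t)) ->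
    forall n, \near0 e, forall t, a e <= t <= b e -> `|dpp0 e t - adjoint_rhs e t (pp0 e t)| <= rho e ^+ n.
  move=> hd n; apply: (curve_unif t12 ha hb) => s se ss hs _.
  have [_ _ _ ppv _] := hpp.
  have h1 := curvenet_gdot t12 ha hb hpp ss hs; rewrite hd// in h1.
  have h2 := vrepresents_negl h1 (dH_dq_rep ss hs (ppv _ _ ss hs)).
  by near=> e; rewrite -normr_id; near: e; apply: h2.
have key n : \near0 e, forall t, a e <= t <= b e -> enorm (pe e t - pe' e t) <= rho e ^+ n.
  pose n1 := n.+2.
  have [m0 /(_ m0 (leqnn _)) hT] := mod_net_absorb n1.+1 (mod_netM (mod_net_cst rho d%:R) mod_T).
  have n2 := vrepresents_negl (pv _ _ gitv_t2 hb); rewrite p0 -p0' in n2.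
  have {}n2 := n2 _ (pv' _ _ gitv_t2 hb).
  have K3 := pe_dh _ _ _ _ hp pd m0; have K3' := pe_dh _ _ _ _ hp' pd' m0.
  near=> e => s0 s0ab.
  have re : 0 < rho e <= 1 by near: e; apply: gauge_near.
  have e01 : 0 < e <= 1 by near: e; apply: near0_itv.
  have ab : a e < b e by near: e; apply: near_time t12 ha hb.
  have T0 : 0 < b e - a e by rewrite subr_gt0.
  have k1 : contracting m S e by near: e.
  have k2 : forall t, wide M e t -> [/\ Omp e (const_mx t), `|pe e t| <= rho e ^- M & `|dpe e t| <= rho e ^- M] by near: e.
  have k2' : forall t, wide M' e t -> [/\ Omp' e (const_mx t), `|pe' e t| <= rho e ^- M' & `|dpe' e t| <= rho e ^- M'] by near: e.
  have [k3 k3'] : (forall t, a e <= t <= b e -> `|dpe e t - adjoint_rhs e t (pe e t)| <= rho e ^+ m0) /\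
      (forall t, a e <= t <= b e -> `|dpe' e t - adjoint_rhs e t (pe' e t)| <= rho e ^+ m0).
    by near: e; exact: filterI K3 K3'.
  have k4 : `|d%:R * (b e - a e)| * rho e ^+ m0 <= rho e ^+ n1.+1 by near: e.
  have k5 : `| `|pe e (b e) - pe' e (b e)| | <= rho e ^+ n1.+1 by near: e; apply: n2.
  have k6 : d%:R * rho e ^+ n1.+1 <= rho e ^+ n1 by near: e; apply: near_rhoX.
  have k7 : 2 * rho e ^+ n1.+1 <= rho e ^+ n1 by near: e; apply: near_rhoX.
  have k8 : 4 * rho e ^+ n1 <= rho e ^+ n.+1 by near: e; apply: near_rhoX.
  have rn : rho e ^+ n.+1 <= rho e ^+ n by apply: rho_expM.
  have rn1 := rho_exp_gt0 n1 re.
  have rev w : a e <= w <= b e -> a e <= a e + b e - w <= b e.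
    by move=> /andP[u1 u2]; apply/andP; split; lra.
  have wd n' w : a e <= w <= b e -> wide n' e w.
    by move=> h; apply: itv_widen => //; apply: rho_exp_gt0.
  rewrite normr_id in k5.
  have hA : enorm (pe e (a e + b e - a e) - pe' e (a e + b e - a e)) <= rho e ^+ n1.
    have -> : a e + b e - a e = b e by ring.
    apply: (le_trans (enorm_le_norm _)); apply: le_trans k6; exact: ler_wpM2l.
  pose AB := 2 * (rho e ^+ n1 + rho e ^+ n1).
  have -> : s0 = a e + b e - (a e + b e - s0) by ring.
  apply: (le_trans (@barrier R d (fun t => pe e (a e + b e - t) - pe' e (a e + b e - t))
    (fun t => - (dpe e (a e + b e - t) - dpe' e (a e + b e - t))) (a e) (b e) 0 (AB + 1)
    (rho e ^+ n1) (rho e ^+ n1) ab _ hA (lexx 0) (ltW rn1) _ _ _ (rev _ s0ab))).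
  - move=> s sab j; have rs := rev _ sab.
    have [hO1 _ _] := k2 _ (wd M _ rs); have [hO2 _ _] := k2' _ (wd M' _ rs).
    have h := is_deriveB (pdv e _ j e01 hO1) (pdv' e _ j e01 hO2).
    have := is_derive_reflect h; rewrite !mxE.
    set f := fun _ => _; set g := fun _ => _; suff -> : f = g by [].
    by apply/funext => v; rewrite /f /g !mxE.
  - move=> s sab _; have rs := rev _ sab; set s' := a e + b e - s in rs *.
    have [hO1 _ op] := k1 _ (wd m _ rs).
    rewrite add0r subr0 (max_idPr (enorm_ge0 _)) enormN.
    set w := pe e s' - pe' e s'.
    have -> : dpe e s' - dpe' e s' = (dpe e s' - adjoint_rhs e s' (pe e s')) -
        (dpe' e s' - adjoint_rhs e s' (pe' e s')) - w *m (phi_q e (x3 e s'))^T.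
      rewrite !adjoint_rhsE// mulmxBl; move: (_ *m _) (_ *m _) (\row_i _) => A B C.
      by apply/rowP => i; rewrite !mxE; ring.
    have h1 := enormD ((dpe e s' - adjoint_rhs e s' (pe e s')) -
        (dpe' e s' - adjoint_rhs e s' (pe' e s'))) (- (w *m (phi_q e (x3 e s'))^T)).
    have h2 := enormD (dpe e s' - adjoint_rhs e s' (pe e s')) (- (dpe' e s' - adjoint_rhs e s' (pe' e s'))).
    rewrite !enormN in h1 h2.
    have h3 := ler_wpM2l (ltW T0) (enorm_opnorm_tr w (phi_q e (x3 e s'))).
    have Td : 0 <= d%:R * (b e - a e) := mulr_ge0 (ler0n _ _) (ltW T0).
    rewrite (ger0_norm Td) in k4.
    have small z : `|z| <= rho e ^+ m0 -> (b e - a e) * enorm (z : 'rV[R]_d) <= rho e ^+ n1.+1.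
      move=> hz; apply: le_trans k4; rewrite [X in _ <= X * _]mulrC -mulrA ler_pM2l//.
      by apply: (le_trans (enorm_le_norm _)); rewrite ler_wpM2l.
    have h4 := small _ (k3 _ rs); have h5 := small _ (k3' _ rs).
    have op' : (b e - a e) * opnorm (phi_q e (x3 e s')) <= 2^-1.
      apply: le_trans op; rewrite ler_wpM2r ?opnorm_ge0// lerDl mulr_ge0// rho_exp_ge0//.
    have h6 := ler_wpM2r (enorm_ge0 w) op'.
    have h7 := ler_wpM2l (ltW T0) (le_trans h1 (lerD h2 (lexx _))).
    exact: arith_uniq h7 h3 h4 h5 h6 k7.
  - by rewrite /AB ltrDl.
  by rewrite add0r; exact: arith_fin2 k8 rn.
have ht := gitv_clamp t12 ha hb tt (represents_rcnet t).
have tab := near_clamp t12 ha hb (rcnet t).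
apply: (vrepresents_inj (pv _ _ tt ht)); apply: (vrepresents_congr (pv' _ _ tt ht)) => n.
have hn := key n; near=> e; rewrite normr_id; apply: (le_trans (norm_le_enorm _)).
have h : forall t, a e <= t <= b e -> enorm (pe e t - pe' e t) <= rho e ^+ n by near: e.
by apply: h; near: e.
Unshelve. all: by end_near. Qed.

(** * The cost along the curves *)

Lemma cost_net : gsf_net (titv t1 t2) (oncurve (fun t => const_mx (cL P t (q t) (u t)) : 'rV_1)) Om_along
  (fun e x => const_mx (vcomp (Le e) 0 (x3 e (x 0 0)))).
Proof.
apply: Snet_gsf_net => [||x xe tx hx]; first exact: netdom_along.
  move=> j; rewrite /vcomp; under eq_fun do under eq_fun do rewrite mxE.
  exact: Snet_along (Snet_L [::]).
have [h1 h2] := curve_dom3 tx (hx 0); rewrite /oncurve; apply: vrepresents_const_mx.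
by have := gsf_net_val hL h1 h2 0; rewrite mxE unc3_pack3.
Qed.

Lemma cost_primitive : exists Lam : R -> R -> R,
  (\near0 e, forall t, a e <= t <= b e -> is_derive t 1 (Lam e) (vcomp (Le e) 0 (x3 e t))) /\
  represents (fun e => Lam e (b e) - Lam e (a e)) (gint t1 t2 (fun t => cL P t (q t) (u t))).
Proof.
have [Lam [N hN]] := net_primitive t12 ha hb cost_net.
have h : \near0 e, forall t, a e <= t <= b e ->
    is_derive t 1 (Lam e) ((const_mx (vcomp (Le e) 0 (x3 e ((const_mx t : 'rV[R]_1) 0 0))) : 'rV[R]_1) 0 0).
  near=> e => t tab.
  have re : 0 < rho e <= 1 by near: e; apply: gauge_near.
  have k : forall t, wide N e t -> [/\
    is_derive t 1 (Lam e) ((const_mx (vcomp (Le e) 0 (x3 e ((const_mx t : 'rV[R]_1) 0 0))) : 'rV[R]_1) 0 0),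
    {for t, continuous (fun t => (const_mx (vcomp (Le e) 0 (x3 e ((const_mx t : 'rV[R]_1) 0 0))) : 'rV[R]_1) 0 0)} &
    `|(const_mx (vcomp (Le e) 0 (x3 e ((const_mx t : 'rV[R]_1) 0 0))) : 'rV[R]_1) 0 0| <= rho e ^- N] by near: e.
  by have [] // := k t (itv_widen tab (rho_exp_gt0 N re)).
exists Lam; split; last first.
  exact: (@gint_primitive R rho t1 t2 a b t12 ha hb (fun t => cL P t (q t) (u t)) Om_along
    (fun e x => const_mx (vcomp (Le e) 0 (x3 e (x 0 0)))) Lam cost_net h).
by apply: filterS h => e h t tab; have := h t tab; rewrite !mxE.
Unshelve. all: by end_near. Qed.

(** * The Hamiltonian near a solution of the adjoint equation *)

Section Variation.
Variables (p : rc -> 'rV[rc]_d) (Omp : R -> set 'rV[R]_1) (pe dpe : R -> R -> 'rV[R]_d).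
Hypothesis hp : curvenet t1 t2 p Omp pe dpe.

Let x4 e t := pack4 t (qe e t) (ue e t) (pe e t).

Lemma curve_dom4 t te : gitv t1 t2 t -> represents te t ->
  dom4 P (pack4 t (q t) (u t) (p t)) /\ vrepresents (fun e => x4 e (te e)) (pack4 t (q t) (u t) (p t)).
Proof.
move=> tt ht; have [h1 h2] := curve_dom3 tt ht; have [_ _ _ pv _] := hp.
by split; [rewrite /dom4 /= row_mxKl|exact: vrepresents_row_mx h2 (pv _ _ tt ht)].
Qed.

Definition curve4 e : set 'rV[R]_(1 + d + l + d) := [set x4 e t | t in [set t | a e <= t <= b e]].

Lemma curve4_nets_in : nets_in curve4 (dom4 P).
Proof.
split.
  near=> e; exists (x4 e (a e)), (a e) => //=; rewrite lexx ltW//.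
  near: e; exact: near_time t12 ha hb.
move=> xe hxe.
have : \near0 e, exists t, a e <= t <= b e /\ x4 e t = xe e.
  by apply: filterS hxe => e [t tab tx]; exists t.
move=> /(near0_choice 0)[te hte].
have tab : \near0 e, a e <= te e <= b e by apply: filterS hte => e [].
have [t tt ht] := itv_rep ha hb tab; have [h1 h2] := curve_dom4 tt ht.
exists (pack4 t (q t) (u t) (p t)) => //; apply: (vrepresents_congr h2).
apply: (negl_le (negl0 rho)); near=> e.
have [_ <-] : a e <= te e <= b e /\ x4 e (te e) = xe e by near: e.
by rewrite subrr !normr0.
Unshelve. all: by end_near. Qed.

(** The second partials of the Hamiltonian are bounded by a power of rho near the
    curve, by uniformity. *)
Lemma ham_taylor : exists N C, \near0 e, forall t y, a e <= t <= b e -> `|y - x4 e t| <= rho e ^+ N ->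
  Om4 e y /\ `|ham e y - ham e (x4 e t) - \sum_i dham e i (x4 e t) * (y - x4 e t) 0 i| <=
    rho e ^- C * `|y - x4 e t| ^+ 2.
Proof.
have [N0 h0] := unif_dom netdom4.2 curve4_nets_in.
pose DD (i j : 'I_(1 + d + l + d)) e x := 'D_(delta_mx 0 j) (dham e i) x.
have SDD i j : Snet (dom4 P) Om4 (DD i j) := (Snet_D netdom4 (dham_Snet i) j).1.
have [N1 h1] : exists N, \near0 e, forall (ij : 'I_(1 + d + l + d) * 'I_(1 + d + l + d)),
    forall x y : 'rV[R]_(1 + d + l + d), curve4 e x -> `|y - x| <= rho e ^+ N ->
    `|DD ij.1 ij.2 e y| <= rho e ^- N.
  apply: (@near0_forall_exp R rho) => [N M e ij re NM h x y cx yx|ij].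
    by apply: (le_trans (h x y cx _)); [apply: le_trans yx _; apply: rho_expM|apply: rho_expVM].
  by apply: unif_bound curve4_nets_in; apply: Cnet_mod (SDD ij.1 ij.2 0%N).
pose n := (1 + d + l + d)%N.
exists (N0 + N1)%N, N1.+1; near=> e => t y tab yx.
have re : 0 < rho e <= 1 by near: e; apply: gauge_near.
have e01 : 0 < e <= 1 by near: e; apply: near0_itv.
have k0 : forall x y : 'rV[R]_(1 + d + l + d), curve4 e x -> `|y - x| <= rho e ^+ N0 -> Om4 e y by near: e.
have k1 : forall (ij : 'I_(1 + d + l + d) * 'I_(1 + d + l + d)),
    forall x y : 'rV[R]_(1 + d + l + d), curve4 e x -> `|y - x| <= rho e ^+ N1 ->
    `|DD ij.1 ij.2 e y| <= rho e ^- N1 by near: e.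
have k2 : (n%:R ^+ 2) * rho e <= 1 by near: e; apply: near_rhoM.
have cx : curve4 e (x4 e t) by exists t.
have yx0 : `|y - x4 e t| <= rho e ^+ N0 by apply: (le_trans yx); apply: rho_expM => //; rewrite leq_addr.
have yx1 : `|y - x4 e t| <= rho e ^+ N1 by apply: (le_trans yx); apply: rho_expM => //; rewrite leq_addl.
have xx m : `|x4 e t - x4 e t| <= rho e ^+ m by rewrite subrr normr0 rho_exp_ge0.
split; first exact: k0 cx yx0.
have hO (s : R) : 0 <= s <= 1 -> Om4 e (x4 e t + s *: (y - x4 e t)).
  by move=> s01; apply: (k0 (x4 e t)) => //; apply: ball_segment.
have := @segment_taylor2 R _ (ham e) (fun i => dham e i) (fun i j => DD i j e) (Om4 e) (x4 e t) y (rho e ^- N1).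
move=> /(_ (netdom4.1 e e01) hO) h; apply: (le_trans (h _ _ _ _ _)).
- by move=> z i Oz; apply: ham_derive.
- by move=> z i j Oz; apply: (Snet_D netdom4 (dham_Snet i) j).2.
- by move=> z i Oz; apply: (Cnet_cts (dham_Snet i 0%N)).
- by move=> z i j Oz; apply: (Cnet_cts (SDD i j 0%N)).
- move=> s i j s01; apply: (k1 (i, j) (x4 e t)) => //; exact: ball_segment.
rewrite exprMn mulrA ler_wpM2r ?sqr_ge0//.
have r0 : 0 < rho e by case/andP: re.
by rewrite [in leRHS]exprS invfM mulrC ler_wpM2r ?invr_ge0 ?rho_exp_ge0// -[leRHS]mul1r ler_pdivlMr.
Unshelve. all: by end_near. Qed.

(** Minus the derivative of the Hamiltonian in the control: the direction in
    which the cost decreases at first order. *)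
Definition descent e t : 'rV[R]_l := - \row_i dham e (dir4_u i) (x4 e t).

Lemma ham_gradient e t (dq' : 'rV[R]_d) (du : 'rV[R]_l) :
  \sum_i dham e i (x4 e t) * (pack4 0 dq' du 0 : 'rV[R]__) 0 i =
  - dotp (adjoint_rhs e t (pe e t)) dq' - dotp (descent e t) du.
Proof.
rewrite big_split_ord /= [X in _ + X]big1 ?addr0; last first.
  by move=> i _; rewrite /pack4 row_mxEr mxE mulr0.
rewrite sum_pack3; congr (_ + _).
  rewrite /pack4 row_mxEl pack3_t mulr0 add0r /dotp -sumrN; apply: eq_bigr => i _.
  by rewrite row_mxEl pack3_q !mxE mulNr opprK.
rewrite /dotp -sumrN; apply: eq_bigr => i _.
by rewrite /pack4 row_mxEl pack3_u !mxE mulNr opprK.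
Qed.

Definition Om_var e := Om_along e `&` Omp e.

Lemma netdom_var : netdom (titv t1 t2) Om_var.
Proof. by have [h _ _ _ _] := hp; exact: netdomI netdom_along h. Qed.

Lemma descent_Snet j : Snet (titv t1 t2) Om_var (fun e x => descent e (x 0 0) 0 j).
Proof.
move=> k.
have -> : (fun e (x : 'rV[R]_1) => descent e (x 0 0) 0 j) =
    fun e x => (-1) * dham e (dir4_u j) (x4 e (x 0 0)).
  by apply/funext => e; apply/funext => x; rewrite !mxE mulN1r.
apply: CnetM; first by apply: (@Cnet_cst R rho 1 _ Om_var k (fun=> -1)); exact: mod_net_cst.
apply: (@Cnet_comp R rho 1 _ (titv t1 t2) Om_var (dom4 P) Om4 k (fun e x => dham e (dir4_u j) x)
  (fun e x => x4 e (x 0 0)) netdom4).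
- by move=> e x e01 [[_ h] _]; split => //; rewrite /x4 /pack4 row_mxKl.
- by move=> x xe tx hx; have [h1 h2] := curve_dom4 tx (hx 0);
    exists (pack4 (x 0 0) (q (x 0 0)) (u (x 0 0)) (p (x 0 0))).
- exact: dham_Snet.
- apply: Cnet_row_mx => i.
    by apply: Cnet_curve => [|e x [[]]]; first exact: netdom_var.
  have [_ Sp _ _ _] := hp.
  by apply: Snet_sub netdom_var _ (Sp i k) => e x [].
Qed.

Lemma descent_rep t te : gitv t1 t2 t -> represents te t ->
  vrepresents (fun e => descent e (te e)) (- dH_du P t (q t) (u t) (p t)).
Proof.
move=> tt ht i; have [h1 h2] := curve_dom4 tt ht.
rewrite !mxE; under eq_fun do rewrite !mxE; apply: representsN.
exact: dham_rep.
Qed.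

Lemma variation k : exists w dw,
  curvenet t1 t2 w Om_var (fun e t => ue e t + rho e ^+ k *: descent e t) dw.
Proof.
apply: (Snet_curve netdom_var) => j n.
have -> : (fun e (x : 'rV[R]_1) => (ue e (x 0 0) + rho e ^+ k *: descent e (x 0 0)) 0 j) =
    fun e x => ue e (x 0 0) 0 j + rho e ^+ k * descent e (x 0 0) 0 j.
  by apply/funext => e; apply/funext => x; rewrite !mxE.
apply: CnetD.
  by have [_ Su _ _ _] := hu; apply: Snet_sub netdom_var _ (Su j n) => e x [[[]]].
by apply: CnetM (descent_Snet j n); apply: (@Cnet_cst R rho 1 _ Om_var n (fun e => rho e ^+ k)); exact: mod_net_rhoX.
Qed.

Lemma descent_bound : exists N, \near0 e, forall t, wide N e t -> `|descent e t| <= rho e ^- N /\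
  forall s, wide N e s -> enorm (descent e t - descent e s) <= rho e ^- N * `|t - s|.
Proof.
have [f [dc hc]] := Snet_curve netdom_var descent_Snet.
have [N1 h1] := curvenet_bound t12 ha hb hc; have [N2 h2] := curvenet_lipschitz t12 ha hb hc.
exists (N1 + N2)%N; near=> e => t tw.
have re : 0 < rho e <= 1 by near: e; apply: gauge_near.
have k1 : forall t, wide N1 e t ->
  [/\ Om_var e (const_mx t), `|descent e t| <= rho e ^- N1 & `|dc e t| <= rho e ^- N1] by near: e.
have k2 : forall s t, wide N2 e s -> wide N2 e t -> enorm (descent e t - descent e s) <= rho e ^- N2 * `|t - s| by near: e.
split.
  have [_ h _] := k1 t (wide_le re (leq_addr _ _) tw); apply: (le_trans h).
  by apply: rho_expVM => //; rewrite leq_addr.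
move=> s sw; apply: (le_trans (k2 _ _ (wide_le re (leq_addl _ _) sw) (wide_le re (leq_addl _ _) tw))).
by rewrite ler_wpM2r//; apply: rho_expVM => //; rewrite leq_addl.
Unshelve. all: by end_near. Qed.

End Variation.

End Along.

(** * Variations of an optimal control *)

Lemma ham_pack4 e t q k p : ham e (pack4 t q k p) =
  vcomp (Le e) 0 (pack3 t q k) + dotp p (fe e (pack3 t q k)).
Proof.
rewrite /ham /pack4 row_mxKl; congr (_ + _); apply: eq_bigr => j _.
by rewrite row_mxEr.
Qed.

Section Optimality.
Variables (v : rc -> 'rV[rc]_l) (q p : rc -> 'rV[rc]_d).
Variables (Omv Omq Omp : R -> set 'rV[R]_1) (ve dve : R -> R -> 'rV[R]_l) (qe dqe pe dpe : R -> R -> 'rV[R]_d).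
Hypotheses (vc : control P v) (hv : curvenet t1 t2 v Omv ve dve).
Hypotheses (sq : state_solution P v q) (hq : curvenet t1 t2 q Omq qe dqe).
Hypotheses (ap : adjoint_at v q p) (hp : curvenet t1 t2 p Omp pe dpe).

Let D := descent ve qe pe.
Let Om := Om_var Omv Omq ve qe Omp.
Let varied k e t := ve e t + rho e ^+ k *: D e t.

Let dX : netdom (titv t1 t2) Om := netdom_var vc hv sq hq hp.

Lemma varied_diff k w dw : curvenet t1 t2 w Om (varied k) dw ->
  forall t te, gitv t1 t2 t -> represents te t ->
  vrepresents (fun e => rho e ^+ k *: D e (te e)) (w t - v t).
Proof.
move=> hw t te tt ht; have [_ _ _ wv _] := hw; have [_ _ _ vv _] := hv.
have := vrepresentsB (wv _ _ tt ht) (vv _ _ tt ht).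
set f := fun _ => _; set g := fun _ => _; suff -> : f = g by [].
by apply/funext => e; rewrite /f /g /varied addrAC subrr add0r.
Qed.

(** Each derivative of the variation is rho^k times a net bounded by rho^-N on
    the interval, with one N for the finitely many orders up to n. *)
Lemma gcnorm_variation n M : exists k0, forall k, (k0 <= k)%N -> forall w dw,
  curvenet t1 t2 w Om (varied k) dw ->
  gcnorm t1 t2 n (fun t => w t - v t) <=~ rcclass rho (fun e => rho e ^+ M).
Proof.
have SD j : Snet (titv t1 t2) Om (fun e x => D e (x 0 0) 0 j) := descent_Snet vc hv sq hq hp j.
have [N hN] : exists N, \near0 e, forall (ji : 'I_n.+1 * 'I_l), forall t, wide N e t ->
    `|pderive (nseq ji.1 ord0) (fun x : 'rV[R]_1 => D e (x 0 0) 0 ji.2) (const_mx t)| <= rho e ^- N.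
  apply: (@near0_forall_exp R rho) => [N N' e ji re NN h t tw|ji].
    by apply: (le_trans (h t (wide_le re NN tw))); apply: rho_expVM.
  exact: (time_bound t12 ha hb (Cnet_mod (Snet_pderive (nseq ji.1 ord0) dX (SD ji.2) 0%N))).
exists (N + M)%N => k kk w dw hw.
have hwv : gsf_net (titv t1 t2) (oncurve (fun t => w t - v t)) Om (fun e x => rho e ^+ k *: D e (x 0 0)).
  apply: Snet_gsf_net => // [j n'|x xe tx hx]; last exact: varied_diff hw _ _ tx (hx 0).
  have -> : (fun e => vcomp (fun x : 'rV[R]_1 => rho e ^+ k *: D e (x 0 0)) j) =
    fun e x => rho e ^+ k * D e (x 0 0) 0 j.
    by apply/funext => e; apply/funext => x; rewrite /vcomp mxE.
  by apply: CnetM (SD j n'); apply: (@Cnet_cst R rho 1 _ Om n' (fun e => rho e ^+ k)); exact: mod_net_rhoX.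
apply: (gcnorm_le t12 (represents_rhoX rho M)).
  by near=> e; rewrite rho_exp_ge0//; near: e; apply: gauge_near.
move=> Om' ge hg j i t te jn tt ht m.
have ttm : titv t1 t2 (const_mx t) by rewrite /titv /= mxE.
have htm := vrepresents_const_mx ht.
have hd := pderive_unique (fat_titv t12 ha hb) hg hwv (nseq j ord0) i ttm htm.
have [h1 h2] := tt.
near=> e.
have re : 0 < rho e <= 1 by near: e; apply: gauge_near.
have e01 : 0 < e <= 1 by near: e; apply: near0_itv.
have kw : wide N e (te e).
  have k1 : a e <= te e + rho e ^+ N by near: e; apply: ((gleP ha ht).1 h1).
  have k2 : te e <= b e + rho e ^+ N by near: e; apply: ((gleP ht hb).1 h2).
  by rewrite /wide lerBlDr k1.
have kO : Om e (const_mx (te e)) by near: e; apply: dX.2 ttm _ htm.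
have kN : forall (ji : 'I_n.+1 * 'I_l), forall t, wide N e t ->
    `|pderive (nseq ji.1 ord0) (fun x : 'rV[R]_1 => D e (x 0 0) 0 ji.2) (const_mx t)| <= rho e ^- N by near: e.
have kd : `|pderive (nseq j ord0) (vcomp (ge e) i) (const_mx (te e)) -
   pderive (nseq j ord0) (vcomp (fun x : 'rV[R]_1 => rho e ^+ k *: D e (x 0 0)) i) (const_mx (te e))| <= rho e ^+ m.
  by near: e; apply: hd.
have vE : vcomp (fun x : 'rV[R]_1 => rho e ^+ k *: D e (x 0 0)) i = fun x => rho e ^+ k * D e (x 0 0) 0 i.
  by apply/funext => x; rewrite /vcomp mxE.
rewrite vE (pderiveZ (fun e => rho e ^+ k) dX (SD i) _ e01 kO) in kd.
have jn' : (j < n.+1)%N by rewrite ltnS.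
have kb := kN (Ordinal jn', i) _ kw; rewrite /= in kb.
set A := pderive _ _ _ in kd *; set B := pderive _ _ _ in kd kb.
have kB : `|rho e ^+ k * B| <= rho e ^+ M.
  rewrite normrM ger0_norm ?rho_exp_ge0//.
  rewrite -(rho_expVMX N M re) mulrC; apply: ler_pM => //; rewrite ?rho_exp_ge0//.
  exact: rho_expM.
rewrite -(subrK (rho e ^+ k * B) A) addrC; apply: (le_trans (ler_normD _ _)).
exact: lerD.
Unshelve. all: by end_near. Qed.

Lemma gmax_variation M : exists k0, forall k, (k0 <= k)%N -> forall w dw,
  curvenet t1 t2 w Om (varied k) dw ->
  gmax [set Defs.gnorm (w t - v t) | t in gitv t1 t2] <=~ rcclass rho (fun e => rho e ^+ M).
Proof.
have [N hN] := descent_bound vc hv sq hq hp.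
exists (N + M.+1)%N => k kk w dw hw; rewrite /gmax; set S := (X in xget _ X).
have [[y Sy]|nS] := pselect (exists y, S y); last first.
  rewrite xgetPN; last by move=> y Sy; apply: nS; exists y.
  apply/(gleP (represents0 rho) (represents_rhoX rho M)) => n; near=> e.
  have re : 0 < rho e <= 1 by near: e; apply: gauge_near.
  by rewrite addr_ge0 ?rho_exp_ge0.
have [[t tt <-] _] : S (xget 0 S) by apply: xgetPex; exists y.
have ht := gitv_clamp t12 ha hb tt (represents_rcnet t).
have tab := near_clamp t12 ha hb (rcnet t).
apply/(gleP (represents_gnorm (varied_diff hw tt ht)) (represents_rhoX rho M)) => n; near=> e.
have re : 0 < rho e <= 1 by near: e; apply: gauge_near.
have kN : forall t, wide N e t -> `|D e t| <= rho e ^- N /\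
  forall s, wide N e s -> enorm (D e t - D e s) <= rho e ^- N * `|t - s| by near: e.
have kab : a e <= clamp (a e) (b e) (rcnet t e) <= b e by near: e.
have [kD _] := kN _ (itv_widen kab (rho_exp_gt0 N re)).
have kl : l%:R * rho e ^+ M.+1 <= rho e ^+ M by near: e; apply: near_rhoX.
apply: (@le_trans _ _ (rho e ^+ M)); last by rewrite lerDl rho_exp_ge0.
rewrite enormZ ger0_norm ?rho_exp_ge0//.
apply: le_trans kl.
apply: (@le_trans _ _ (rho e ^+ (N + M.+1) * (l%:R * rho e ^- N))).
  apply: ler_pM; rewrite ?rho_exp_ge0 ?enorm_ge0//; first exact: rho_expM.
  by apply: (le_trans (enorm_le_norm _)); rewrite ler_wpM2l.
by rewrite mulrC -mulrA rho_expVMX.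
Unshelve. all: by end_near. Qed.

Lemma variation_admissible : inner_control P v -> optimal P v -> exists k0, forall k, (k0 <= k)%N ->
  forall w dw, curvenet t1 t2 w Om (varied k) dw -> control P w /\ cost P v <=~ cost P w.
Proof.
move=> [_ [r1 r10 hr1]] [r2 [n [r20 hr2]]].
have [M1 hM1] := rho_small r10; have [M2 hM2] := rho_small r20.
have [k1 hk1] := gmax_variation M1; have [k2 hk2] := gcnorm_variation n M2.
exists (k1 + k2)%N => k kk w dw hw.
have wc : control P w.
  apply: hr1; first exact: curvenet_gcurve hw _.
  apply: gle_glt_trans hM1; apply: hk1 hw; exact: leq_trans (leq_addr _ _) kk.
split => //; apply: hr2 => //; apply: gle_glt_trans hM2; apply: hk2 hw.
exact: leq_trans (leq_addl _ _) kk.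
Qed.

(** Along the variation of order rho^(A+K) the integrand of the cost, corrected
    by the pairing of the adjoint state with the deviation of the state, drops
    by rho^(A+K) |D|^2 up to an error of order rho^(2K). *)
Lemma cost_descent : exists A C k1, forall K, (k1 <= K)%N -> forall w dw,
  curvenet t1 t2 w Om (varied (A + K)) dw -> control P w -> cost P v <=~ cost P w ->
  (forall t, gitv t1 t2 t -> state P v t = q t) ->
  exists G dG : R -> R -> R, \near0 e,
    [/\ forall t, a e <= t <= b e -> is_derive t 1 (G e) (dG e t),
      forall t, a e <= t <= b e -> dG e t <= - (rho e ^+ (A + K) * dotp (D e t) (D e t)) + rho e ^- C * rho e ^+ (2 * K) &
      - rho e ^+ (2 * K) <= G e (b e) - G e (a e)].
Proof.
have [N0 [C0 hT]] := ham_taylor vc hv sq hq hp.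
have [Nh hD] := descent_bound vc hv sq hq hp.
have [Np hpb] := curvenet_bound t12 ha hb hp.
have [N [M hcl]] := state_close.
(* rho^A compensates the bound for D and the factor in state_close, so that
   control and state move by at most rho^K *)
pose A := (Nh + (M + 2))%N.
exists A, C0.+1, (N + N0)%N => K kK w dw hw wc cvw sv.
have [q' sq'] := state_exists wc.
have [[q'g _] _ _] := sq'; have [Omq' [qe' [dqe' hq']]] := gcurve_curvenet q'g.
have nv := state_solution_net vc hv sq hq; have nw := state_solution_net wc hw sq' hq'.
have vK := control_near_K vc hv; have wK := control_near_K wc hw.
have [Lam [Ld Lr]] := cost_primitive vc hv sq hq.
have [Lam' [Ld' Lr']] := cost_primitive wc hw sq' hq'.
have [pg pd p0] := ap.
have [_ _ _ pv pdv] := hp.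
pose m1 := (Np + (2 * K).+2)%N.
have pe_dh n : \near0 e, forall t, a e <= t <= b e -> `|dpe e t - adjoint_rhs ve qe e t (pe e t)| <= rho e ^+ n.
  apply: (curve_unif t12 ha hb) => s se ss hs _.
  have h1 := curvenet_gdot t12 ha hb hp ss hs; rewrite pd// in h1.
  have h2 := vrepresents_negl h1 (dH_dq_rep vc hv sq hq ss hs (pv _ _ ss hs)).
  by near=> e; rewrite -normr_id; near: e; apply: h2.
have Kpd := pe_dh (2 * K).+2.
have hpb0 : negl rho (fun e => `|pe e (b e)|).
  have h0 : vrepresents (fun=> 0 : 'rV[R]_d) (0 : 'rV[rc]_d).
    by move=> i; rewrite !mxE; exact: represents0.
  have := vrepresents_negl (pv _ _ gitv_t2 hb); rewrite p0 => /(_ _ h0) h.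
  by apply: (negl_le h); near=> e; rewrite subr0.
have Kcl : \near0 e, forall t, a e <= t <= b e -> enorm (qe' e t - qe e t) <= rho e ^+ K.+1.
  have h := hcl _ _ _ _ _ _ (fun e => rho e ^+ (M + K.+2)) vK wK nv nw _ _ K.+2.
  have {}h : \near0 e, forall t, a e <= t <= b e ->
      enorm (qe' e t - qe e t) <= 2 * (rho e ^- M * rho e ^+ (M + K.+2)) + rho e ^+ K.+2.
    apply: h; near=> e.
      have re : 0 < rho e <= 1 by near: e; apply: gauge_near.
      rewrite rho_exp_ge0//=; apply: rho_expM => //; apply: leq_trans (leq_addl _ _).
      by apply: leq_trans (leqW (leqnSn _)); apply: leq_trans kK; rewrite leq_addr.
    move=> t tab; have re : 0 < rho e <= 1 by near: e; apply: gauge_near.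
    have kD : forall t, wide Nh e t -> `|D e t| <= rho e ^- Nh /\
      forall s, wide Nh e s -> enorm (D e t - D e s) <= rho e ^- Nh * `|t - s| by near: e.
    have [k1 _] := kD _ (itv_widen tab (rho_exp_gt0 Nh re)).
    rewrite /varied addrAC subrr add0r mx_normZ ger0_norm ?rho_exp_ge0//.
    rewrite /A -addnA -[leRHS](rho_expVMX Nh _ re) mulrC; apply: ler_pM => //; rewrite ?rho_exp_ge0//.
    by apply: rho_expM => //; rewrite -addnA add2n.
  near=> e => t tab; have re : 0 < rho e <= 1 by near: e; apply: gauge_near.
  have k1 : forall t, a e <= t <= b e ->
      enorm (qe' e t - qe e t) <= 2 * (rho e ^- M * rho e ^+ (M + K.+2)) + rho e ^+ K.+2 by near: e.
  have k3 : 3 * rho e ^+ K.+2 <= rho e ^+ K.+1 by near: e; apply: near_rhoX.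
  by apply: (le_trans (k1 t tab)); rewrite rho_expVMX//; lra.
have sv' : gint t1 t2 (fun t => cL P t (q t) (v t)) <=~ gint t1 t2 (fun t => cL P t (q' t) (w t)).
  have hs : state_solution P w (state P w) by apply: xgetPex; exists q'.
  have e1 : gint t1 t2 (fun t => cL P t (q t) (v t)) = cost P v.
    by apply: gint_ext => t tt; rewrite sv.
  have e2 : gint t1 t2 (fun t => cL P t (q' t) (w t)) = cost P w.
    by apply: gint_ext => t tt; rewrite (state_solution_unique wc sq' hs).
  by rewrite e1 e2.
have {}sv' := (gleP Lr Lr').1 sv'.
exists (fun e t => Lam' e t - Lam e t + dotp (pe e t) (qe' e t - qe e t)).
exists (fun e t => vcomp (Le e) 0 (pack3 t (qe' e t) (varied (A + K) e t)) - vcomp (Le e) 0 (pack3 t (qe e t) (ve e t)) +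
  (dotp (dpe e t) (qe' e t - qe e t) + dotp (pe e t) (dqe' e t - dqe e t))).
have [nqd nq0 nqf] := nv; have [nqd' nq0' nqf'] := nw.
near=> e.
have re : 0 < rho e <= 1 by near: e; apply: gauge_near.
have e01 : 0 < e <= 1 by near: e; apply: near0_itv.
have ab : a e < b e by near: e; apply: near_time t12 ha hb.
have kp : forall t, wide Np e t -> [/\ Omp e (const_mx t), `|pe e t| <= rho e ^- Np & `|dpe e t| <= rho e ^- Np] by near: e.
have kLd : forall t, a e <= t <= b e -> is_derive t 1 (Lam e) (vcomp (Le e) 0 (pack3 t (qe e t) (ve e t))) by near: e.
have kLd' : forall t, a e <= t <= b e -> is_derive t 1 (Lam' e) (vcomp (Le e) 0 (pack3 t (qe' e t) (varied (A + K) e t))) by near: e.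
have kq : forall t, a e <= t <= b e -> forall j, is_derive t 1 (fun s => qe e s 0 j) (dqe e t 0 j) by near: e.
have kq' : forall t, a e <= t <= b e -> forall j, is_derive t 1 (fun s => qe' e s 0 j) (dqe' e t 0 j) by near: e.
have kf : forall t, a e <= t <= b e -> enorm (dqe e t - fe e (pack3 t (qe e t) (ve e t))) <= rho e ^+ m1.
  by near: e; exact: nqf m1.
have kf' : forall t, a e <= t <= b e -> enorm (dqe' e t - fe e (pack3 t (qe' e t) (varied (A + K) e t))) <= rho e ^+ m1.
  by near: e; exact: nqf' m1.
have kD : forall t, wide Nh e t -> `|D e t| <= rho e ^- Nh /\
      forall s, wide Nh e s -> enorm (D e t - D e s) <= rho e ^- Nh * `|t - s| by near: e.
have kcl : forall t, a e <= t <= b e -> enorm (qe' e t - qe e t) <= rho e ^+ K.+1 by near: e.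
have kT : forall t y, a e <= t <= b e -> `|y - pack4 t (qe e t) (ve e t) (pe e t)| <= rho e ^+ N0 ->
  Om4 e y /\ `|ham e y - ham e (pack4 t (qe e t) (ve e t) (pe e t)) -
      \sum_i dham e i (pack4 t (qe e t) (ve e t) (pe e t)) * (y - pack4 t (qe e t) (ve e t) (pe e t)) 0 i| <=
    rho e ^- C0 * `|y - pack4 t (qe e t) (ve e t) (pe e t)| ^+ 2 by near: e.
have kpd : forall t, a e <= t <= b e -> `|dpe e t - adjoint_rhs ve qe e t (pe e t)| <= rho e ^+ (2 * K).+2.
  by near: e; exact: Kpd.
have kpb : `| `|pe e (b e)| | <= rho e ^+ (2 * K).+2 by near: e; exact: hpb0.
have ksv : Lam e (b e) - Lam e (a e) <= Lam' e (b e) - Lam' e (a e) + rho e ^+ (2 * K).+1 by near: e; exact: sv'.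
have kq0 : `|enorm (qe e (a e) - q1 e)| <= rho e ^+ m1.+1 by near: e; exact: nq0.
have kq0' : `|enorm (qe' e (a e) - q1 e)| <= rho e ^+ m1.+1 by near: e; exact: nq0'.
have kd : d%:R * rho e ^+ (2 * K).+2 <= rho e ^+ (2 * K).+1 by near: e; apply: near_rhoX.
have k2 : 2 * rho e ^+ m1.+1 <= rho e ^+ m1 by near: e; apply: near_rhoX.
have k3 : 3 * rho e ^+ (2 * K).+1 <= rho e ^+ (2 * K) by near: e; apply: near_rhoX.
have k4 : 4 * rho e <= 1 by near: e; apply: near_rhoM.
rewrite normr_id in kpb; rewrite ger0_norm ?enorm_ge0// in kq0; rewrite ger0_norm ?enorm_ge0// in kq0'.
have aab : a e <= a e <= b e by rewrite lexx ltW.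
have bab : a e <= b e <= b e by rewrite lexx ltW.
have dq1 t : a e <= t <= b e -> enorm (qe' e t - qe e t) <= 1.
  by move=> tab; apply: (le_trans (kcl t tab)); rewrite -(expr0 (rho e)); apply: rho_expM.
have pe1 t (z : 'rV[R]_d) : a e <= t <= b e -> enorm z <= rho e ^+ m1 -> `|dotp (pe e t) z| <= rho e ^+ (2 * K).+1.
  move=> tab hz; have [_ hpt _] := kp t (itv_widen tab (rho_exp_gt0 Np re)).
  apply: (le_trans (dotp_norm _ _)); apply: le_trans kd.
  apply: (@le_trans _ _ (d%:R * rho e ^- Np * rho e ^+ m1)).
    apply: ler_pM; rewrite ?enorm_ge0//; apply: (le_trans (enorm_le_norm _)).
    by rewrite ler_wpM2l.
  by rewrite -mulrA rho_expVMX.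
have pe2 (z y : 'rV[R]_d) : `|z| <= rho e ^+ (2 * K).+2 -> enorm y <= 1 -> `|dotp z y| <= rho e ^+ (2 * K).+1.
  move=> hz hy; apply: (le_trans (dotp_norm _ _)); apply: le_trans kd; rewrite -[leRHS]mulr1.
  apply: ler_pM; rewrite ?enorm_ge0//; apply: (le_trans (enorm_le_norm _)).
  by rewrite ler_wpM2l.
split.
- move=> t tab; apply: is_deriveD.
    exact: is_deriveB (kLd' t tab) (kLd t tab).
  have [hOp _ _] := kp t (itv_widen tab (rho_exp_gt0 Np re)).
  apply: (@is_derive_dotp R d (pe e) (fun s => qe' e s - qe e s) (dpe e) (fun s => dqe' e s - dqe e s)) => j.
    exact: pdv.
  have := is_deriveB (kq' t tab j) (kq t tab j); rewrite !mxE.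
  set f := _ - _; set h := fun _ => _; suff -> : f = h by [].
  by apply/funext => s; rewrite /f /h !mxE.
- move=> t tab.
  set x := pack4 t (qe e t) (ve e t) (pe e t) in kT *.
  pose y := pack4 t (qe' e t) (varied (A + K) e t) (pe e t).
  have [kDt _] := kD t (itv_widen tab (rho_exp_gt0 Nh re)).
  have yx : y - x = pack4 0 (qe' e t - qe e t) (rho e ^+ (A + K) *: D e t) 0.
    by rewrite pack4B !subrr /varied [ve e t + _ - _]addrAC subrr add0r.
  have kv : `|rho e ^+ (A + K) *: D e t| <= rho e ^+ K.
    rewrite mx_normZ ger0_norm ?rho_exp_ge0// /A -addnA -[leRHS](rho_expVMX Nh _ re) mulrC.
    apply: ler_pM => //; rewrite ?rho_exp_ge0//; apply: rho_expM => //.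
    by rewrite leq_add2l leq_addl.
  have yxK : `|y - x| <= rho e ^+ K.
    rewrite yx; apply: norm_row_mx; last by rewrite normr0 rho_exp_ge0.
    apply: norm_pack3 => //; first by rewrite normr0 rho_exp_ge0.
    by apply: (le_trans (norm_le_enorm _)); apply: (le_trans (kcl t tab)); apply: rho_expM.
  have [_] : Om4 e y /\ `|ham e y - ham e x - \sum_i dham e i x * (y - x) 0 i| <= rho e ^- C0 * `|y - x| ^+ 2.
    apply: kT => //; apply: (le_trans yxK); apply: rho_expM => //; apply: leq_trans kK; rewrite leq_addl//.
  rewrite yx ham_gradient -yx; set Rem := _ - _ - _ => hRem.
  have h1 : Rem <= rho e ^- C0 * rho e ^+ (2 * K).
    apply: (le_trans (ler_norm _)); apply: (le_trans hRem).
    rewrite ler_wpM2l ?invr_ge0 ?rho_exp_ge0// mulnC exprM.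
    by rewrite lerXn2r ?nnegrE ?rho_exp_ge0.
  have h2 := pe2 _ _ (kpd t tab) (dq1 t tab).
  have h3 := pe1 t _ tab (kf' t tab); have h4 := pe1 t _ tab (kf t tab).
  rewrite ler_norml in h4; have /andP[h4' _] := h4.
  have dE : dotp (D e t) (rho e ^+ (A + K) *: D e t) = rho e ^+ (A + K) * dotp (D e t) (D e t).
    move: (D e t) (rho e ^+ _) => z z0.
    by rewrite /dotp mulr_sumr; apply: eq_bigr => i _; rewrite mxE mulrCA.
  apply: (arith_slope _ h1 (le_trans (ler_norm _) h2) (le_trans (ler_norm _) h3) h4').
    rewrite /Rem /x /y !ham_pack4 -dE.
    exact: slope_identity.
  apply: (@le_trans _ _ (rho e ^- C0 * (rho e ^+ (2 * K)) * 4)).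
    have g1 : 1 <= rho e ^- C0 by rewrite -invr1 lef_pV2 ?posrE ?rho_exp_gt0// -(expr0 (rho e)) rho_expM.
    have g2 := ler_wpM2r (rho_exp_ge0 (2 * K) re) g1; rewrite mul1r in g2.
    have g3 := rho_expM re (leqnSn (2 * K)).
    lra.
  have r0 : 0 < rho e by case/andP: re.
  have -> : rho e ^- C0.+1 = (rho e)^-1 * rho e ^- C0 by rewrite exprS invfM.
  rewrite -[leRHS]mulrA [leLHS]mulrC; apply: ler_wpM2r; first by rewrite mulr_ge0 ?invr_ge0 ?rho_exp_ge0.
  by rewrite -[leRHS]mul1r ler_pdivlMr.
have j1 : `|dotp (pe e (b e)) (qe' e (b e) - qe e (b e))| <= rho e ^+ (2 * K).+1 := pe2 _ _ kpb (dq1 _ bab).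
have j2 : `|dotp (pe e (a e)) (qe' e (a e) - qe e (a e))| <= rho e ^+ (2 * K).+1.
  apply: pe1 => //; apply: (le_trans (enormBD _ (q1 e) _)); rewrite (enormB (q1 e)).
  exact: arith_sum2 kq0' kq0 k2.
move: j1 j2; rewrite !ler_norml => /andP[j1 _] /andP[_ j2].
exact: (arith_ends ksv j1 j2 k3).
Unshelve. all: by end_near. Qed.

(** A direction that does not vanish at some point has norm at least rho^m / 2 on an
    interval of polynomial length, and the decrease there beats the error
    terms. *)
Lemma stationary : inner_control P v -> optimal P v ->
  (forall t, gitv t1 t2 t -> state P v t = q t) ->
  forall t, gitv t1 t2 t -> dH_du P t (q t) (v t) (p t) = 0.
Proof.
move=> iv ov sv.
have [A [C [k1 hG]]] := cost_descent.
have [k0 hk0] := variation_admissible iv ov.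
have [Nh hD] := descent_bound vc hv sq hq hp.
have [Gp hGp] := time_gap t12 ha hb.
have [T hT] := mod_T.
have key m0 : \near0 e, forall t, a e <= t <= b e -> enorm (D e t) <= rho e ^+ m0.
  (* |D| > rho^m at one point gives |D| >= rho^m / 2 on an interval of length
     rho^dl, hence a gain of order rho^(dl + A + K + 2 m); the error is of order
     rho^(2 K) up to moderate factors, so K exceeds the remaining exponents *)
  pose m := (m0 + Gp)%N.
  pose dl := (Nh + m.+1)%N.
  pose K := (k0 + k1 + (C + T) + (dl + A + 2 * m) + 4)%N.
  have [lk0 lk1] : (k0 <= A + K)%N /\ (k1 <= K)%N by rewrite /K; split; lia.
  have KE : (C + T + (dl + (A + K) + 2 * m + 3) <= 2 * K)%N by rewrite /K; lia.
  have KE' : (dl + (A + K) + 2 * m + 3 <= 2 * K)%N by rewrite /K; lia.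
  have dlG : (Gp.+1 <= dl)%N by rewrite /dl /m; lia.
  have mm0 : (m0 <= m)%N by rewrite /m leq_addr.
  have [w [dw hw]] := variation vc hv sq hq hp (A + K).
  have [wc cw] := hk0 _ lk0 w dw hw.
  have [G [dG hGK]] := hG K lk1 w dw hw wc cw sv.
  near=> e => t tab; rewrite leNgt; apply/negP => hlt0.
  have re : 0 < rho e <= 1 by near: e; apply: gauge_near.
  have ab : a e < b e by near: e; apply: near_time t12 ha hb.
  have T0 : 0 < b e - a e by rewrite subr_gt0.
  have [g1 g2 g3] : [/\ forall t, a e <= t <= b e -> is_derive t 1 (G e) (dG e t),
      forall t, a e <= t <= b e -> dG e t <= - (rho e ^+ (A + K) * dotp (D e t) (D e t)) + rho e ^- C * rho e ^+ (2 * K) &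
      - rho e ^+ (2 * K) <= G e (b e) - G e (a e)] by near: e.
  have kD : forall t, wide Nh e t -> `|D e t| <= rho e ^- Nh /\
      forall s, wide Nh e s -> enorm (D e t - D e s) <= rho e ^- Nh * `|t - s| by near: e.
  have kG : a e + rho e ^+ Gp <= b e by near: e.
  have kT : `|b e - a e| <= rho e ^- T by near: e.
  have kG2 : 2 * rho e ^+ Gp.+1 <= rho e ^+ Gp by near: e; apply: near_rhoX.
  have km2 : 2 * rho e ^+ m.+1 <= rho e ^+ m by near: e; apply: near_rhoX.
  have kr : 16 * rho e <= 1 by near: e; apply: near_rhoM.
  rewrite gtr0_norm// in kT.
  have hlt : rho e ^+ m < enorm (D e t) by apply: le_lt_trans hlt0; apply: rho_expM.
  pose del := rho e ^+ dl.
  have del0 : 0 < del := rho_exp_gt0 dl re.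
  have delG : 2 * del <= b e - a e.
    by have := rho_expM re dlG; rewrite -/del; lra.
  have [s1 [s1a s1b s1t]] : exists s1, [/\ a e <= s1, s1 + del <= b e & s1 <= t <= s1 + del].
    exact: subinterval tab delG del0.
  have s12 : s1 <= s1 + del by rewrite lerDl ltW.
  have big s : s1 <= s <= s1 + del -> rho e ^+ (2 * m) / 4 <= dotp (D e s) (D e s).
    move=> ss; have sab : a e <= s <= b e.
      by move/andP: ss => [u1 u2]; rewrite (le_trans s1a u1) (le_trans u2 s1b).
    have [_ h] := kD t (itv_widen tab (rho_exp_gt0 Nh re)).
    have {}h := h s (itv_widen sab (rho_exp_gt0 Nh re)).
    have ts : `|t - s| <= del by exact: dist_le_itv s1t ss.
    have h1 : enorm (D e t - D e s) <= rho e ^+ m.+1.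
      apply: (le_trans h); rewrite -(rho_expVMX Nh m.+1 re) ler_wpM2l// invr_ge0 rho_exp_ge0//.
    have h2 := enormBD (D e t) (D e s) 0; rewrite !subr0 in h2.
    have h3 : rho e ^+ m / 2 <= enorm (D e s) by exact: arith_half hlt h1 h2 km2.
    rewrite -enorm_sqr mulnC exprM.
    have -> : (rho e ^+ m) ^+ 2 / 4 = (rho e ^+ m / 2) ^+ 2 by field.
    by rewrite lerXn2r ?nnegrE ?enorm_ge0// divr_ge0 ?rho_exp_ge0.
  pose eta := rho e ^- C * rho e ^+ (2 * K).
  have eta0 : 0 <= eta by rewrite mulr_ge0 ?invr_ge0 ?rho_exp_ge0.
  pose c := rho e ^+ (A + K) * (rho e ^+ (2 * m) / 4).
  have rAK := rho_exp_ge0 (A + K) re.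
  have := mean_descent s1a s12 s1b g1 (eta := eta) (c := c) _ _.
  have d1 : forall t, a e <= t <= b e -> dG e t <= eta.
    move=> s sab; apply: (le_trans (g2 s sab)); rewrite -/eta gerDr oppr_le0 mulr_ge0//.
    by rewrite -enorm_sqr sqr_ge0.
  have d2 : forall t, s1 <= t <= s1 + del -> dG e t <= eta - c.
    move=> s ss; have sab : a e <= s <= b e.
      by move/andP: ss => [u1 u2]; rewrite (le_trans s1a u1) (le_trans u2 s1b).
    apply: (le_trans (g2 s sab)); rewrite -/eta addrC lerD2l lerN2.
    by rewrite ler_wpM2l//; apply: big.
  move=> /(_ d1 d2); apply/negP; rewrite -ltNge.
  have -> : s1 + del - s1 = del by ring.
  pose E := (dl + (A + K) + 2 * m)%N.
  have cE : del * c = rho e ^+ E / 4 by rewrite /E /c /del !mulrA -!exprD.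
  have e1 : (b e - a e) * eta <= rho e ^+ (E + 3).
    apply: (@le_trans _ _ (rho e ^- T * (rho e ^- C * rho e ^+ (C + (T + (E + 3)))))); last first.
      by rewrite !rho_expVMX.
    apply: ler_pM => //; [exact: ltW|].
    rewrite ler_wpM2l ?invr_ge0 ?rho_exp_ge0//; apply: rho_expM => //.
    by rewrite addnA /E.
  have e2 : rho e ^+ (2 * K) <= rho e ^+ (E + 3) by apply: rho_expM.
  have e3 : 16 * rho e ^+ (E + 3) <= rho e ^+ E.
    have -> : rho e ^+ (E + 3) = rho e * rho e ^+ (E + 2) by rewrite -exprS addnS.
    rewrite mulrA; apply: (@le_trans _ _ (rho e ^+ (E + 2))).
      by rewrite ler_piMl ?rho_exp_ge0.
    by apply: rho_expM => //; rewrite leq_addr.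
  have e4 := rho_exp_gt0 E re.
  rewrite cE; exact: arith_contra g3 e1 e2 e3 e4.
move=> t tt.
have ht := gitv_clamp t12 ha hb tt (represents_rcnet t).
have tab := near_clamp t12 ha hb (rcnet t).
have hDr := descent_rep vc hv sq hq hp tt ht.
apply: oppr_inj; rewrite oppr0; apply: (vrepresents_inj hDr).
have h0 : vrepresents (fun=> 0 : 'rV[R]_l) (0 : 'rV[rc]_l).
  by move=> i; rewrite !mxE; exact: represents0.
apply: (vrepresents_congr h0) => n; have hn := key n; near=> e.
rewrite subr0 normr_id; apply: (le_trans (norm_le_enorm _)).
have h : forall t, a e <= t <= b e -> enorm (D e t) <= rho e ^+ n by near: e.
by apply: h; near: e.
Unshelve. all: by end_near. Qed.

End Optimality.

End Control.

(** * The weak maximum principle *)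

Section MaximumPrinciple.
Context {R : realType} (rho : gauge R) {d l : nat} (P : control_data rho d l).
Notation rc := (rcnum rho).
Hypothesis hP : standing P.

Lemma control_values u t : control P u -> gitv (ct1 P) (ct2 P) t -> cK P (u t).
Proof.
by move=> [uK _] tt; have := uK (const_mx t); rewrite /oncurve /titv /= mxE; apply.
Qed.

Lemma trajectory_values q t : trajectory P q -> gitv (ct1 P) (ct2 P) t -> cH P (q t).
Proof.
by move=> [[qH _] _] tt; have := qH (const_mx t); rewrite /oncurve /titv /= mxE; apply.
Qed.

(** Both halves of the theorem refer to the same choice of representatives of the
    data, made here once. *)
Lemma control_facts u : control P u ->
  [/\ state_solution P u (state P u),
    forall q, state_solution P u q -> forall t, gitv (ct1 P) (ct2 P) t -> q t = state P u t,
    adjoint_solution P u (costate P u),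
    forall p, adjoint_solution P u p -> forall t, gitv (ct1 P) (ct2 P) t -> p t = costate P u t &
    (forall t q k p, gitv (ct1 P) (ct2 P) t -> cH P q -> cK P k -> dH_dp P t q k p = cphi P t q k) /\
    (inner_control P u -> optimal P u -> forall t, gitv (ct1 P) (ct2 P) t ->
      dH_du P t (state P u t) (u t) (costate P u t) = 0)].
Proof.
move=> uc.
have ha := represents_rcnet (ct1 P); have hb := represents_rcnet (ct2 P).
have hr := represents_rcnet (cr P); have hq1 := vrepresents_vnet (cq1 P).
have [Kc [KKc KcK]] := functionally_compact_nets (st_K hP).1.
have t12 := st_time hP.
have K0 : cK P !=set0.
  by exists (u (ct2 P)); apply: control_values uc (gitv_t2 hP hb).
have [_ [Omf [fe hf]]] := st_phi hP.
have [_ [OmL [Le hL]]] := st_L hP.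
have ss : state_solution P u (state P u).
  have [q sq] := state_exists hP ha hb hr hq1 KKc KcK K0 hf uc.
  by apply: xgetPex; exists q.
have su q : state_solution P u q -> forall t, gitv (ct1 P) (ct2 P) t -> q t = state P u t.
  by move=> sq t tt; exact: (state_solution_unique hP ha hb hr hq1 KKc KcK K0 hf uc sq ss tt).
have [Omu [ue [due hu]]] := gcurve_curvenet uc.
have [[qg _] _ _] := ss; have [Omq [qe [dqe hq]]] := gcurve_curvenet qg.
have as_ : adjoint_solution P u (costate P u).
  have [p hp] := adjoint_exists hP ha hb hr hq1 KKc KcK K0 hf hL uc hu ss hq.
  by apply: xgetPex; exists p.
have au p : adjoint_solution P u p -> forall t, gitv (ct1 P) (ct2 P) t -> p t = costate P u t.
  by move=> hp t tt; exact: (adjoint_unique hP ha hb hr hq1 KKc KcK K0 hf hL uc hu ss hq hp as_ tt).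
split => //; split => [t q k p|iu ou t tt].
  exact: (dH_dp_phi hP ha hb hf hL).
have [pg _ _] := as_; have [Omp [pe [dpe hp]]] := gcurve_curvenet pg.
exact: (stationary hP ha hb hr hq1 KKc KcK K0 hf hL uc hu ss hq as_ hp iu ou (fun _ _ => erefl) tt).
Qed.

End MaximumPrinciple.

Theorem corollary64 (R : realType) (rho : gauge R) (d l : nat)
    (P : control_data rho d l) (hP : standing P)
    (hlog : exists N : nat,
      L_K P * (ct2 P - ct1 P) <=~ N%:R * log_drhoV rho) :
  (forall v : rcnum rho -> 'rV[rcnum rho]_l,
     inner_control P v -> optimal P v ->
     trajectory P (state P v) /\
     gcurve (ct1 P) (ct2 P) setT (costate P v) /\
     solves_WPS P (state P v) v (costate P v)) /\
  (forall (q : rcnum rho -> 'rV[rcnum rho]_d)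
          (u : rcnum rho -> 'rV[rcnum rho]_l)
          (p : rcnum rho -> 'rV[rcnum rho]_d),
     trajectory P q -> control P u -> gcurve (ct1 P) (ct2 P) setT p ->
     solves_WPS P q u p ->
     forall t, gitv (ct1 P) (ct2 P) t ->
       q t = state P u t /\ p t = costate P u t).
Proof.
split=> [v iv ov|q u p tq uc pg [WPS [q0 p0]]].
  have vc := iv.1; have [ss _ av _ [hdp hdu]] := control_facts hP vc.
  have [tq qd q0] := ss; have [pg pd p0] := av.
  split=> //; split=> //; split=> // t tt; split; [|exact: pd|exact: hdu].
  by rewrite qd// hdp//; [exact: trajectory_values tq tt|exact: control_values vc tt].
have [ss su av au [hdp _]] := control_facts hP uc.
have qE : forall t, gitv (ct1 P) (ct2 P) t -> q t = state P u t.
  apply: su; split=> // t tt; have [-> _ _] := WPS t tt.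
  by rewrite hdp//; [exact: trajectory_values tq tt|exact: control_values uc tt].
move=> t tt; split; first exact: qE.
apply: au tt; split=> // s hs; have [_ -> _] := WPS s hs.
by rewrite qE.
Qed.
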